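(* Let $X$ be a Banach space, let $A:D(A)\subset X\to X$ be a positive operator, and let $$\Lambda_{(3,\frac12)}=\begin{pmatrix}0&-I&0\\ A&2A^{\frac12}&0\\ 0&0&2A^{\frac12}\end{pmatrix},$$ regarded as an operator in $X^{\frac12}\times X\times X$ with domain $D(\Lambda_{(3,\frac12)})=X^{1}\times X^{\frac12}\times X^{\frac12}$. Then for all $\alpha\in(0,1)$, $$\Lambda_{(3,\frac12)}^{-\alpha}=\begin{pmatrix}(1+\alpha)A^{-\frac{\alpha}{2}}&\alpha A^{-\frac{1+\alpha}{2}}&0\\ -\alpha A^{\frac{1-\alpha}{2}}&(1-\alpha)A^{-\frac{\alpha}{2}}&0\\ 0&0&2^{-\alpha}A^{-\frac{\alpha}{2}}\end{pmatrix}\in\mathcal L(X^{\frac12}\times X\times X),$$ and $$\Lambda_{(3,\frac12)}^{\alpha}=\begin{pmatrix}(1-\alpha)A^{\frac{\alpha}{2}}&-\alpha A^{\frac{\alpha-1}{2}}&0\\ \alpha A^{\frac{1+\alpha}{2}}&(1+\alpha)A^{\frac{\alpha}{2}}&0\\ 0&0&2^{\alpha}A^{\frac{\alpha}{2}}\end{pmatrix},\qquad D(\Lambda_{(3,\frac12)}^{\alpha})=X^{\frac{1+\alpha}{2}}\times X^{\frac{\alpha}{2}}\times X^{\frac{\alpha}{2}}.$$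
   Context: A closed densely defined operator $A:D(A)\subset X\to X$ on a Banach space $X$ is called positive if there is $M\ge 1$ such that $[0,\infty)\subset\rho(-A)$ and $(1+s)\|(s+A)^{-1}\|_{\mathcal L(X)}\le M$ for all real $s>0$. Fractional powers of a positive operator $A$: for $\alpha>0$, $A^{-\alpha}:=\frac{1}{2\pi i}\int_\Gamma(-\lambda)^{-\alpha}(\lambda+A)^{-1}\,d\lambda\in\mathcal L(X)$ (principal branch), where $\Gamma$ is a contour from $\infty e^{-i\psi}$ to $\infty e^{i\psi}$ lying in $(\{|\arg z|\le\psi\}\cup B(0,r_0))\setminus[0,\infty)$, with $0<\psi<\arcsin(\frac1{2M})$ and $0<r_0<\frac1{2M}$. For $\alpha\in(0,1)$ this equals $\frac{\sin(\pi\alpha)}{\pi}\int_0^\infty s^{-\alpha}(s+A)^{-1}ds$. The operator $A^{-\alpha}$ is injective, and $A^{\alpha}:=(A^{-\alpha})^{-1}$ with domain $D(A^\alpha)=R(A^{-\alpha})$ (the range). $X^{\alpha}$ denotes $D(A^\alpha)$ equipped with the graph norm. The operator $\Lambda_{(3,\frac12)}$ is a positive operator on the Banach space $X^{\frac12}\times X\times X$, and its fractional powers are those of a positive operator on that space. Entries of the matrices are understood as operators between the corresponding components (restricted to the relevant subspaces). *)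

(* Defs.v *)
From Stdlib Require Import Reals Lra ProofIrrelevance.
From Coquelicot Require Export Coquelicot.

Open Scope R_scope.

(* Banach spaces are complex, since the fractional powers below are contour
   integrals.  [scal], [plus], [norm], ... are Coquelicot's. *)
Notation cspace := (NormedModule C_AbsRing).

(* Coquelicot integrates functions with values in a real normed module; this is
   the same space with the same topology, scalars being restricted to R. *)
Section Realify.
Variable V : cspace.

Definition realify_scal (r : R) (x : V) : V := scal (RtoC r : C_AbsRing) x.

Lemma realify_scal_assoc (r s : R) (u : V) :
  realify_scal r (realify_scal s u) = realify_scal (mult r s) u.
Proof.
  unfold realify_scal. rewrite scal_assoc. f_equal.
  symmetry; apply RtoC_mult.
Qed.

Lemma realify_scal_one (u : V) : realify_scal one u = u.
Proof. exact (scal_one u). Qed.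

Lemma realify_scal_distr_l (r : R) (u v : V) :
  realify_scal r (plus u v) = plus (realify_scal r u) (realify_scal r v).
Proof. exact (scal_distr_l _ u v). Qed.

Lemma realify_scal_distr_r (r s : R) (u : V) :
  realify_scal (plus r s) u = plus (realify_scal r u) (realify_scal s u).
Proof.
  refine (eq_trans _ (scal_distr_r (RtoC r : C_AbsRing) (RtoC s) u)).
  unfold realify_scal. f_equal. apply RtoC_plus.
Qed.

Definition realify_ModuleSpace_mixin :=
  ModuleSpace.Mixin R_Ring (NormedModule.AbelianGroup _ V) realify_scal
    realify_scal_assoc realify_scal_one realify_scal_distr_l
    realify_scal_distr_r.

Definition realify_aux : NormedModuleAux R_AbsRing :=
  NormedModuleAux.Pack R_AbsRing V
    (NormedModuleAux.Class R_AbsRing V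
       (ModuleSpace.Class R_Ring V
          (AbelianGroup.class (NormedModule.AbelianGroup _ V))
          realify_ModuleSpace_mixin)
       (UniformSpace.class (NormedModule.UniformSpace _ V))) V.

Lemma realify_norm_scal (r : R) (x : V) :
  norm (realify_scal r x) <= Rabs r * norm x.
Proof.
  rewrite <- Cmod_R.
  exact (norm_scal (RtoC r : C_AbsRing) x).
Qed.

Definition realify_mixin : NormedModule.mixin_of R_AbsRing realify_aux :=
  NormedModule.Mixin R_AbsRing realify_aux (@norm C_AbsRing V)
    (@norm_factor C_AbsRing V) norm_triangle realify_norm_scal
    norm_compat1 norm_compat2 norm_eq_zero.

Definition realify : NormedModule R_AbsRing :=
  NormedModule.Pack R_AbsRing V
    (NormedModule.Class R_AbsRing V (NormedModuleAux.class _ realify_aux)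
       realify_mixin) V.

End Realify.

(* Instances of the generic module lemmas, for which unification does not find
   the module structure underlying a normed module. *)
Lemma Cscal_zero_r {V : cspace} (c : C_AbsRing) :
  scal c (zero : V) = zero.
Proof. exact (scal_zero_r (V := NormedModule.ModuleSpace _ V) c). Qed.

Lemma Cscal_distr_l {V : cspace} (c : C_AbsRing) (x y : V) :
  scal c (plus x y) = plus (scal c x) (scal c y).
Proof. exact (scal_distr_l (V := NormedModule.ModuleSpace _ V) c x y). Qed.

Lemma Cscal_assoc {V : cspace} (a b : C_AbsRing) (x : V) :
  scal a (scal b x) = scal (mult a b) x.
Proof. exact (scal_assoc (V := NormedModule.ModuleSpace _ V) a b x). Qed.

(* An unbounded operator is represented by its graph, a linear subspace of
   [X * Y].  Single-valuedness is a separate predicate, so that inverses of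
   operators are always available. *)
Record linrel (X Y : cspace) := LinRel {
  graph :> X -> Y -> Prop;
  graph_zero : graph zero zero;
  graph_plus : forall x x' y y', graph x y -> graph x' y' ->
    graph (plus x x') (plus y y');
  graph_scal : forall (c : C_AbsRing) x y, graph x y ->
    graph (scal c x) (scal c y)
}.
Arguments LinRel {X Y} _ _ _ _.
Arguments graph {X Y} _ _ _.
Arguments graph_zero {X Y} _.
Arguments graph_plus {X Y} _ _ _ _ _ _ _.
Arguments graph_scal {X Y} _ _ _ _ _.

Definition single_valued {X Y : cspace} (T : linrel X Y) : Prop :=
  forall x y y', T x y -> T x y' -> y = y'.

Definition dom {X Y : cspace} (T : linrel X Y) (x : X) : Prop :=
  exists y, T x y.

Definition eq_op {X Y : cspace} (T S : linrel X Y) : Prop :=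
  forall x y, T x y <-> S x y.

Definition lr_id (X : cspace) : linrel X X.
Proof.
  refine (LinRel (fun x y => y = x) _ _ _); simpl; intros; subst; reflexivity.
Defined.

Definition lr_zero (X Y : cspace) : linrel X Y.
Proof.
  refine (LinRel (fun x y => y = zero) _ _ _); simpl; intros; subst.
  - reflexivity.
  - apply plus_zero_r.
  - apply Cscal_zero_r.
Defined.

Definition lr_inv {X Y : cspace} (T : linrel X Y) : linrel Y X.
Proof.
  refine (LinRel (fun y x => T x y) _ _ _); intros.
  - apply graph_zero.
  - now apply graph_plus.
  - now apply graph_scal.
Defined.

Lemma plus_plus {G : AbelianMonoid} (a b c d : G) :
  plus (plus a b) (plus c d) = plus (plus a c) (plus b d).
Proof.
  rewrite <- !plus_assoc. f_equal. rewrite !plus_assoc. f_equal.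
  apply plus_comm.
Qed.

Lemma scal_scal_comm {V : cspace} (a b : C_AbsRing) (x : V) :
  scal a (scal b x) = scal b (scal a x).
Proof.
  rewrite !Cscal_assoc. f_equal. exact (Cmult_comm a b).
Qed.

(* As usual, the domain of a sum is the intersection of the domains. *)
Definition lr_plus {X Y : cspace} (T S : linrel X Y) : linrel X Y.
Proof.
  refine (LinRel (fun x y => exists a b, T x a /\ S x b /\ y = plus a b)
            _ _ _).
  - exists zero, zero. repeat split; try apply graph_zero.
    symmetry; apply plus_zero_r.
  - intros x x' y y' (a & b & Ha & Hb & ->) (a' & b' & Ha' & Hb' & ->).
    exists (plus a a'), (plus b b').
    split; [now apply graph_plus | split; [now apply graph_plus|]].
    apply plus_plus.
  - intros c x y (a & b & Ha & Hb & ->).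
    exists (scal c a), (scal c b).
    split; [now apply graph_scal | split; [now apply graph_scal|]].
    apply Cscal_distr_l.
Defined.

Definition lr_scal {X Y : cspace} (k : C) (T : linrel X Y) : linrel X Y.
Proof.
  refine (LinRel (fun x y => exists a, T x a /\ y = scal (k : C_AbsRing) a)
            _ _ _).
  - exists zero. split; [apply graph_zero | symmetry; apply Cscal_zero_r].
  - intros x x' y y' (a & Ha & ->) (a' & Ha' & ->).
    exists (plus a a'). split; [now apply graph_plus|].
    symmetry; apply Cscal_distr_l.
  - intros c x y (a & Ha & ->).
    exists (scal c a). split; [now apply graph_scal | apply scal_scal_comm].
Defined.

Declare Scope linrel_scope.
Delimit Scope linrel_scope with lr.
Bind Scope linrel_scope with linrel.
Infix "+" := lr_plus : linrel_scope.
Notation "k '*:' T" := (lr_scal k%C T)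
  (at level 40, no associativity) : linrel_scope.
Notation "T '^-1'" := (lr_inv T)
  (at level 3, left associativity, format "T '^-1'") : linrel_scope.

(* T belongs to L(X, Y) *)
Definition bounded_op {X Y : cspace} (T : linrel X Y) : Prop :=
  single_valued T /\ (forall x, dom T x) /\
  exists K : R, forall x y, T x y -> norm y <= K * norm x.

Definition op_norm {X Y : cspace} (T : linrel X Y) : Rbar :=
  Lub_Rbar (fun r => exists x y, norm x <= 1 /\ T x y /\ r = norm y).

Definition resolvent_set {X : cspace} (B : linrel X X) (lam : C) : Prop :=
  bounded_op ((lam *: lr_id X + (-1) *: B)^-1)%lr.

(* (lam + A)^{-1} *)
Definition shift_inv {X : cspace} (A : linrel X X) (lam : C) : linrel X X :=
  ((lam *: lr_id X + A)^-1)%lr.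

Definition densely_defined {X Y : cspace} (T : linrel X Y) : Prop :=
  forall (x : X) (eps : posreal), exists x', dom T x' /\ ball x eps x'.

Definition closed_op {X Y : cspace} (T : linrel X Y) : Prop :=
  closed (fun p : prod_UniformSpace X Y => T (fst p) (snd p)).

Definition positive_with {X : cspace} (A : linrel X X) (M : R) : Prop :=
  1 <= M /\
  (forall s : R, 0 <= s -> resolvent_set ((-1) *: A)%lr s) /\
  (forall s : R, 0 < s ->
     Rbar_le (Rbar_mult (Finite (1 + s)) (op_norm (shift_inv A s))) (Finite M)).

Definition positive_op {X : cspace} (A : linrel X X) : Prop :=
  single_valued A /\ closed_op A /\ densely_defined A /\
  exists M : R, positive_with A M.

Definition cis (t : R) : C := (cos t, sin t).

(* principal argument, in (-PI, PI], of a nonzero complex number *)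
Definition Carg (z : C) : R :=
  if Rle_dec 0 (Im z) then acos (Re z / Cmod z) else - acos (Re z / Cmod z).

(* principal branch of z^a, for z <> 0 *)
Definition Cpower (z : C) (a : R) : C :=
  (RtoC (Rpower (Cmod z) a) * cis (a * Carg z))%C.

(* integral of f along the path g with derivative g', the parameter running
   from the end Fa to the end Fb *)
Definition is_path_int {V : cspace} (f : C -> V) (g g' : R -> C)
    (Fa Fb : (R -> Prop) -> Prop) (l : V) : Prop :=
  is_RInt_gen (V := realify V) (fun t => scal (g' t : C_AbsRing) (f (g t)))
    Fa Fb l.

(* The contour Gamma: the ray of argument -psi from infinity to radius r, the
   arc of radius r crossing the negative half-line, and the ray of argument psi
   from radius r to infinity. *)
Definition on_contour (psi r : R) (lam : C) : Prop :=
  (exists s : R, r <= s /\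
     (lam = (s * cis (- psi))%C \/ lam = (s * cis psi)%C)) \/
  (exists th : R, psi <= th <= 2 * PI - psi /\ lam = (r * cis th)%C).

Definition is_contour_int {V : cspace} (f : C -> V) (psi r : R) (l : V)
    : Prop :=
  exists l1 l2 l3 : V,
    is_path_int f (fun s => (s * cis (- psi))%C) (fun _ => cis (- psi))
      (Rbar_locally p_infty) (at_point r) l1 /\
    is_path_int f (fun th => (r * cis th)%C) (fun th => (Ci * (r * cis th))%C)
      (at_point (2 * PI - psi)) (at_point psi) l2 /\
    is_path_int f (fun s => (s * cis psi)%C) (fun _ => cis psi)
      (at_point r) (Rbar_locally p_infty) l3 /\
    l = plus (plus l1 l2) l3.

Lemma is_RInt_zero {V : NormedModule R_AbsRing} (a b : R) :
  is_RInt (V := V) (fun _ => zero) a b zero.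
Proof.
  exact (eq_rect _ (is_RInt (fun _ => zero) a b)
    (is_RInt_const (V := V) a b zero) _
    (scal_zero_r (V := NormedModule.ModuleSpace _ V) (b - a))).
Qed.

Lemma is_RInt_gen_zero {V : NormedModule R_AbsRing} Fa Fb :
  Filter Fa -> Filter Fb -> is_RInt_gen (V := V) (fun _ => zero) Fa Fb zero.
Proof.
  intros FFa FFb P HP.
  apply (Filter_prod _ _ _ (fun _ => True) (fun _ => True)).
  - apply filter_true.
  - apply filter_true.
  - intros x y _ _. exists zero. split.
    + apply is_RInt_zero.
    + now apply locally_singleton.
Qed.

Lemma is_RInt_Cscal {V : cspace} (c : C_AbsRing) (f : R -> V) a b l :
  is_RInt (V := realify V) f a b l ->
  is_RInt (V := realify V) (fun t => scal c (f t)) a b (scal c l).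
Proof.
  unfold is_RInt. intros H.
  apply filterlim_ext with
    (fun ptd => scal c (scal (V := realify V) (sign (b - a))
                 (Riemann_sum (V := realify V) f ptd) : V)).
  - intros ptd. unfold Riemann_sum.
    transitivity (scal (V := realify V) (sign (b - a))
      (scal c (seq.foldr plus zero (seq.pairmap (fun x y : R * R =>
         scal (V := realify V) (fst y - fst x) (f (snd y)))
         ((SF_h ptd, zero) : R * R) (SF_t ptd)) : V) : realify V)).
    { exact (scal_scal_comm (V := V) _ _ _). }
    f_equal.
    match goal with |- context [seq.pairmap _ ?q _] => generalize q end.
    induction (SF_t ptd) as [|q t IH]; intros p.
    + exact (Cscal_zero_r (V := V) c).
    + etransitivity; [exact (Cscal_distr_l (V := V) c _ _)|].
      apply (f_equal2 (@plus (NormedModule.AbelianMonoid _ V)));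
        [exact (scal_scal_comm (V := V) _ _ _) | exact (IH q)].
  - eapply filterlim_comp; [exact H|].
    exact (filterlim_scal_r (V := V) c l).
Qed.

Lemma is_RInt_gen_Cscal {V : cspace} (c : C_AbsRing) (f : R -> V) Fa Fb l :
  Filter Fa -> Filter Fb ->
  is_RInt_gen (V := realify V) f Fa Fb l ->
  is_RInt_gen (V := realify V) (fun t => scal c (f t)) Fa Fb (scal c l).
Proof.
  intros FFa FFb H P HP.
  specialize (H (fun y => P (scal c (y : V) : realify V))).
  unfold filtermapi in *.
  eapply filter_imp; [|apply H].
  - intros ab (y & Hy & HPy). exists (scal c (y : V)). split; [|exact HPy].
    now apply is_RInt_Cscal.
  - exact (filterlim_scal_r (V := V) c l P HP).
Qed.

Section PathInt.
Context {V : cspace}.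
Implicit Types f : C -> V.

Lemma is_path_int_ext f1 f2 g g' Fa Fb l :
  Filter Fa -> Filter Fb -> (forall z, f1 z = f2 z) ->
  is_path_int f1 g g' Fa Fb l -> is_path_int f2 g g' Fa Fb l.
Proof.
  intros FFa FFb E. apply is_RInt_gen_ext.
  apply (Filter_prod _ _ _ (fun _ => True) (fun _ => True));
    try apply filter_true.
  intros; now rewrite E.
Qed.

Lemma is_path_int_zero g g' Fa Fb : Filter Fa -> Filter Fb ->
  is_path_int (fun _ => zero : V) g g' Fa Fb zero.
Proof.
  intros FFa FFb.
  eapply is_RInt_gen_ext; [|apply (is_RInt_gen_zero (V := realify V))];
    try assumption.
  apply (Filter_prod _ _ _ (fun _ => True) (fun _ => True));
    try apply filter_true.
  intros; simpl. symmetry; exact (Cscal_zero_r (V := V) _).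
Qed.

Lemma is_path_int_plus f1 f2 g g' Fa Fb l1 l2 : Filter Fa -> Filter Fb ->
  is_path_int f1 g g' Fa Fb l1 -> is_path_int f2 g g' Fa Fb l2 ->
  is_path_int (fun z => plus (f1 z) (f2 z)) g g' Fa Fb (plus l1 l2).
Proof.
  intros FFa FFb H1 H2.
  eapply is_RInt_gen_ext;
    [|exact (is_RInt_gen_plus (V := realify V) _ _ _ _ H1 H2)].
  apply (Filter_prod _ _ _ (fun _ => True) (fun _ => True));
    try apply filter_true.
  intros; simpl. symmetry; exact (Cscal_distr_l (V := V) _ _ _).
Qed.

Lemma is_path_int_scal c f g g' Fa Fb l : Filter Fa -> Filter Fb ->
  is_path_int f g g' Fa Fb l ->
  is_path_int (fun z => scal (c : C_AbsRing) (f z)) g g' Fa Fb (scal c l).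
Proof.
  intros FFa FFb H.
  eapply is_RInt_gen_ext; [|exact (is_RInt_gen_Cscal c _ _ _ _ FFa FFb H)].
  apply (Filter_prod _ _ _ (fun _ => True) (fun _ => True));
    try apply filter_true.
  intros; simpl. exact (scal_scal_comm (V := V) _ _ _).
Qed.

Lemma is_contour_int_ext f1 f2 psi r l :
  (forall z, f1 z = f2 z) ->
  is_contour_int f1 psi r l -> is_contour_int f2 psi r l.
Proof.
  intros E (l1 & l2 & l3 & H1 & H2 & H3 & ->).
  exists l1, l2, l3.
  repeat split; (eapply is_path_int_ext; [| | exact E | eassumption];
    apply filter_filter).
Qed.

Lemma is_contour_int_zero psi r : is_contour_int (fun _ => zero : V) psi r zero.
Proof.
  exists zero, zero, zero.
  repeat split; try (apply is_path_int_zero; apply filter_filter).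
  now rewrite !plus_zero_r.
Qed.

Lemma is_contour_int_plus f1 f2 psi r l1 l2 :
  is_contour_int f1 psi r l1 -> is_contour_int f2 psi r l2 ->
  is_contour_int (fun z => plus (f1 z) (f2 z)) psi r (plus l1 l2).
Proof.
  intros (a1 & a2 & a3 & H1 & H2 & H3 & ->) (b1 & b2 & b3 & K1 & K2 & K3 & ->).
  exists (plus a1 b1), (plus a2 b2), (plus a3 b3).
  repeat split;
    try (apply is_path_int_plus; [apply filter_filter ..| |]; assumption).
  now rewrite (plus_plus (plus a1 a2)), (plus_plus a1).
Qed.

Lemma is_contour_int_scal (c : C_AbsRing) f psi r l :
  is_contour_int f psi r l ->
  is_contour_int (fun z => scal c (f z)) psi r (scal c l).
Proof.
  intros (a1 & a2 & a3 & H1 & H2 & H3 & ->).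
  exists (scal c a1), (scal c a2), (scal c a3).
  repeat split;
    try (apply is_path_int_scal; [apply filter_filter ..|]; assumption).
  now rewrite !Cscal_distr_l.
Qed.

End PathInt.

Definition admissible {X : cspace} (A : linrel X X) (psi r : R) : Prop :=
  exists M : R, positive_with A M /\
    0 < psi < asin (1 / (2 * M)) /\ 0 < r < 1 / (2 * M).

(* x = 1/(2 i PI) int_Gamma (-lam)^{-a} (lam + A)^{-1} y dlam, where [Rs lam]
   is (lam + A)^{-1} y. *)
Definition is_power_int {X : cspace} (A : linrel X X) (a psi r : R) (y x : X)
    : Prop :=
  exists (Rs : C -> X) (l : X),
    (forall lam, on_contour psi r lam -> shift_inv A lam y (Rs lam)) /\
    is_contour_int
      (fun lam => scal (Cpower (- lam) (- a) : C_AbsRing) (Rs lam)) psi r l /\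
    x = scal (/ (2 * PI * Ci) : C)%C l.

(* A^{-a} for a > 0; by Cauchy's theorem the integral does not depend on the
   admissible contour, and all of them are required to give the same value. *)
Definition neg_power {X : cspace} (A : linrel X X) (a : R) : linrel X X.
Proof.
  refine (LinRel (fun y x => forall psi r, admissible A psi r ->
            is_power_int A a psi r y x) _ _ _).
  - intros psi r _. exists (fun _ => zero), zero. split; [|split].
    + intros; apply graph_zero.
    + eapply is_contour_int_ext; [|apply is_contour_int_zero].
      intros; simpl. now rewrite Cscal_zero_r.
    + now rewrite Cscal_zero_r.
  - intros y y' x x' H H' psi r Hc.
    destruct (H psi r Hc) as (R1 & l1 & E1 & I1 & ->).
    destruct (H' psi r Hc) as (R2 & l2 & E2 & I2 & ->).
    exists (fun z => plus (R1 z) (R2 z)), (plus l1 l2). split; [|split].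
    + intros; apply graph_plus; auto.
    + eapply is_contour_int_ext; [|exact (is_contour_int_plus _ _ _ _ _ _ I1 I2)].
      intros; simpl. now rewrite Cscal_distr_l.
    + now rewrite Cscal_distr_l.
  - intros c y x H psi r Hc.
    destruct (H psi r Hc) as (R1 & l1 & E1 & I1 & ->).
    exists (fun z => scal c (R1 z)), (scal c l1). split; [|split].
    + intros; apply graph_scal; auto.
    + eapply is_contour_int_ext; [|exact (is_contour_int_scal c _ _ _ _ I1)].
      intros; simpl. apply scal_scal_comm.
    + apply scal_scal_comm.
Defined.

(* [neg_power] and [frac_power] are meant for positive A and a > 0 only. *)
Definition frac_power {X : cspace} (A : linrel X X) (a : R) : linrel X X :=
  ((neg_power A a)^-1)%lr.

(* D(T) with the graph norm: an element x of D(T) is carried together with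
   T x, as a point of the graph of T, and the norm is the norm
   sqrt (|x|^2 + |T x|^2) of [X * Y]. *)
Section GraphSpace.
Context {X Y : cspace}.
Variable T : linrel X Y.

Definition gs : Type := {p : X * Y | T (fst p) (snd p)}.

Lemma gs_eq (u v : gs) : proj1_sig u = proj1_sig v -> u = v.
Proof.
  destruct u as [p Hp], v as [q Hq]; simpl. intros <-. f_equal.
  apply proof_irrelevance.
Qed.

Definition gs_zero : gs :=
  exist (fun p : X * Y => T (fst p) (snd p)) (zero, zero) (graph_zero T).
Definition gs_plus (u v : gs) : gs :=
  exist (fun p : X * Y => T (fst p) (snd p))
    (plus (proj1_sig u) (proj1_sig v))
    (graph_plus T _ _ _ _ (proj2_sig u) (proj2_sig v)).
Definition gs_scal (c : C_AbsRing) (u : gs) : gs :=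
  exist (fun p : X * Y => T (fst p) (snd p))
    (scal c (proj1_sig u : prod_NormedModule _ X Y))
    (graph_scal T c _ _ (proj2_sig u)).
Definition gs_opp (u : gs) : gs := gs_scal (opp one) u.

Lemma gs_plus_comm u v : gs_plus u v = gs_plus v u.
Proof. apply gs_eq; simpl. apply plus_comm. Qed.
Lemma gs_plus_assoc u v w : gs_plus u (gs_plus v w) = gs_plus (gs_plus u v) w.
Proof. apply gs_eq; simpl. apply plus_assoc. Qed.
Lemma gs_plus_zero u : gs_plus u gs_zero = u.
Proof. apply gs_eq; simpl. exact (plus_zero_r (proj1_sig u)). Qed.

Definition gs_AbelianMonoid_mixin :=
  AbelianMonoid.Mixin gs gs_plus gs_zero gs_plus_comm gs_plus_assoc
    gs_plus_zero.
Definition gs_AbelianMonoid := AbelianMonoid.Pack gs gs_AbelianMonoid_mixin gs.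

Lemma gs_plus_opp (u : gs_AbelianMonoid) : plus u (gs_opp u) = zero.
Proof.
  apply gs_eq.
  pose (E := NormedModule.ModuleSpace _ (prod_NormedModule _ X Y)).
  exact (eq_trans
    (f_equal (@plus E (proj1_sig u)) (scal_opp_one (V := E) (proj1_sig u)))
    (plus_opp_r (G := E) (proj1_sig u))).
Qed.

Definition gs_AbelianGroup_mixin :=
  AbelianGroup.Mixin gs_AbelianMonoid gs_opp gs_plus_opp.
Definition gs_AbelianGroup :=
  AbelianGroup.Pack gs
    (AbelianGroup.Class gs gs_AbelianMonoid_mixin gs_AbelianGroup_mixin) gs.

Lemma gs_scal_assoc (x y : C_AbsRing) (u : gs) :
  gs_scal x (gs_scal y u) = gs_scal (mult x y) u.
Proof.
  apply gs_eq. exact (scal_assoc x y (proj1_sig u : prod_NormedModule _ X Y)).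
Qed.
Lemma gs_scal_one (u : gs) : gs_scal one u = u.
Proof.
  apply gs_eq. exact (scal_one (proj1_sig u : prod_NormedModule _ X Y)).
Qed.
Lemma gs_scal_distr_l (x : C_AbsRing) (u v : gs_AbelianGroup) :
  gs_scal x (plus u v) = plus (gs_scal x u : gs_AbelianGroup) (gs_scal x v).
Proof.
  apply gs_eq.
  exact (scal_distr_l x (proj1_sig u : prod_NormedModule _ X Y) (proj1_sig v)).
Qed.
Lemma gs_scal_distr_r (x y : C_AbsRing) (u : gs_AbelianGroup) :
  gs_scal (plus x y) u = plus (gs_scal x u : gs_AbelianGroup) (gs_scal y u).
Proof.
  apply gs_eq.
  exact (scal_distr_r x y (proj1_sig u : prod_NormedModule _ X Y)).
Qed.

Definition gs_ModuleSpace_mixin :=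
  ModuleSpace.Mixin C_AbsRing gs_AbelianGroup gs_scal gs_scal_assoc
    gs_scal_one gs_scal_distr_l gs_scal_distr_r.

Definition gs_ball (u : gs) (e : R) (v : gs) : Prop :=
  ball (proj1_sig u : prod_NormedModule _ X Y) e (proj1_sig v).

Lemma gs_ball_center (u : gs) (e : posreal) : gs_ball u e u.
Proof. apply ball_center. Qed.
Lemma gs_ball_sym (u v : gs) (e : R) : gs_ball u e v -> gs_ball v e u.
Proof. apply ball_sym. Qed.
Lemma gs_ball_triangle (u v w : gs) (e1 e2 : R) :
  gs_ball u e1 v -> gs_ball v e2 w -> gs_ball u (e1 + e2) w.
Proof. apply ball_triangle. Qed.

Definition gs_UniformSpace_mixin :=
  UniformSpace.Mixin gs gs_zero gs_ball gs_ball_center gs_ball_sym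
    gs_ball_triangle.

Definition gs_NormedModuleAux : NormedModuleAux C_AbsRing :=
  NormedModuleAux.Pack C_AbsRing gs
    (NormedModuleAux.Class C_AbsRing gs
       (ModuleSpace.Class C_AbsRing gs (AbelianGroup.class gs_AbelianGroup)
          gs_ModuleSpace_mixin)
       gs_UniformSpace_mixin) gs.

Definition gs_norm (u : gs_NormedModuleAux) : R :=
  norm (proj1_sig u : prod_NormedModule _ X Y).

Lemma gs_minus (u v : gs_NormedModuleAux) :
  proj1_sig (minus u v) =
  minus (proj1_sig u : prod_NormedModule _ X Y) (proj1_sig v).
Proof.
  pose (E := NormedModule.ModuleSpace _ (prod_NormedModule _ X Y)).
  exact (f_equal (@plus E (proj1_sig u)) (scal_opp_one (V := E) (proj1_sig v))).
Qed.

Lemma gs_norm_triangle (u v : gs_NormedModuleAux) :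
  gs_norm (plus u v) <= gs_norm u + gs_norm v.
Proof. exact (norm_triangle (V := prod_NormedModule _ X Y) _ _). Qed.
Lemma gs_norm_scal (c : C_AbsRing) (u : gs_NormedModuleAux) :
  gs_norm (scal c u) <= abs c * gs_norm u.
Proof. exact (norm_scal (V := prod_NormedModule _ X Y) c _). Qed.
Lemma gs_norm_compat1 (u v : gs_NormedModuleAux) (e : R) :
  gs_norm (minus v u) < e -> ball u e v.
Proof.
  unfold gs_norm. rewrite gs_minus.
  exact (norm_compat1 (V := prod_NormedModule _ X Y) _ _ e).
Qed.
Lemma gs_norm_compat2 (u v : gs_NormedModuleAux) (e : posreal) :
  ball u e v ->
  gs_norm (minus v u) < @norm_factor _ (prod_NormedModule _ X Y) * e.
Proof.
  unfold gs_norm. rewrite gs_minus.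
  exact (norm_compat2 (V := prod_NormedModule _ X Y) _ _ e).
Qed.
Lemma gs_norm_eq_zero (u : gs_NormedModuleAux) : gs_norm u = 0 -> u = zero.
Proof.
  intros H. apply gs_eq.
  exact (norm_eq_zero (V := prod_NormedModule _ X Y) _ H).
Qed.

Definition gs_NormedModule_mixin :=
  NormedModule.Mixin C_AbsRing gs_NormedModuleAux gs_norm _ gs_norm_triangle
    gs_norm_scal gs_norm_compat1 gs_norm_compat2 gs_norm_eq_zero.

Definition graph_space : cspace :=
  NormedModule.Pack C_AbsRing gs
    (NormedModule.Class C_AbsRing gs
       (NormedModuleAux.class _ gs_NormedModuleAux) gs_NormedModule_mixin) gs.

Definition incl (u : graph_space) : X := fst (proj1_sig u).

Lemma is_linear_incl : is_linear incl.
Proof.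
  split.
  - reflexivity.
  - reflexivity.
  - destruct (is_linear_fst (U := X) (V := Y)) as [_ _ (M & HM & H)].
    exists M. split; [exact HM|]. intros u. apply H.
Qed.

End GraphSpace.

(* An operator T of X regarded as an operator from E to F, two spaces included
   in X: its domain consists of the x in E such that T x is defined and lies
   in F. *)
Definition lr_between {X E F : cspace} {i : E -> X} {j : F -> X}
  (Hi : is_linear i) (Hj : is_linear j) (T : linrel X X) : linrel E F.
Proof.
  refine (LinRel (fun e f => T (i e) (j f)) _ _ _).
  - rewrite (linear_zero i Hi), (linear_zero j Hj). apply graph_zero.
  - intros. rewrite (linear_plus i Hi), (linear_plus j Hj).
    now apply graph_plus.
  - intros. rewrite (linear_scal i Hi), (linear_scal j Hj).
    now apply graph_scal.
Defined.

Notation prod3 E1 E2 E3 :=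
  (prod_NormedModule C_AbsRing E1 (prod_NormedModule C_AbsRing E2 E3)).

Definition lr_row {E1 E2 E3 F : cspace} (T1 : linrel E1 F) (T2 : linrel E2 F)
  (T3 : linrel E3 F) : linrel (prod3 E1 E2 E3) F.
Proof.
  refine (LinRel (fun p y => exists y1 y2 y3, T1 (fst p) y1 /\
    T2 (fst (snd p)) y2 /\ T3 (snd (snd p)) y3 /\
    y = plus (plus y1 y2) y3) _ _ _).
  - exists zero, zero, zero. repeat split; try apply graph_zero.
    now rewrite !plus_zero_r.
  - intros p p' y y' (a1 & a2 & a3 & H1 & H2 & H3 & ->)
      (b1 & b2 & b3 & K1 & K2 & K3 & ->).
    exists (plus a1 b1), (plus a2 b2), (plus a3 b3).
    split; [exact (graph_plus T1 _ _ _ _ H1 K1)|].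
    split; [exact (graph_plus T2 _ _ _ _ H2 K2)|].
    split; [exact (graph_plus T3 _ _ _ _ H3 K3)|].
    now rewrite (plus_plus (plus a1 a2)), (plus_plus a1).
  - intros c p y (a1 & a2 & a3 & H1 & H2 & H3 & ->).
    exists (scal c a1), (scal c a2), (scal c a3).
    split; [exact (graph_scal T1 c _ _ H1)|].
    split; [exact (graph_scal T2 c _ _ H2)|].
    split; [exact (graph_scal T3 c _ _ H3)|].
    now rewrite !Cscal_distr_l.
Defined.

Definition lr_col {E F1 F2 F3 : cspace} (T1 : linrel E F1) (T2 : linrel E F2)
  (T3 : linrel E F3) : linrel E (prod3 F1 F2 F3).
Proof.
  refine (LinRel (fun x q => T1 x (fst q) /\ T2 x (fst (snd q)) /\
    T3 x (snd (snd q))) _ _ _).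
  - repeat split; apply graph_zero.
  - intros x x' y y' (H1 & H2 & H3) (K1 & K2 & K3).
    repeat split; now apply graph_plus.
  - intros c x y (H1 & H2 & H3). repeat split; now apply graph_scal.
Defined.

Section OperatorMatrix.
Context {X : cspace}.
Variable A : linrel X X.

Definition Xhalf : cspace := graph_space (frac_power A (1 / 2)).

Definition phase_space : cspace := prod3 Xhalf X X.

(* The operator matrix (T_ij), acting in X^{1/2} x X x X; its domain is the set
   of (u1, u2, u3) such that each T_ij u_j is defined and lies in the i-th
   component. *)
Definition op_matrix
  (T11 T12 T13
   T21 T22 T23
   T31 T32 T33 : linrel X X) : linrel phase_space phase_space :=
  let h := is_linear_incl (frac_power A (1 / 2)) in
  let x := is_linear_id (V := X) in
  lr_col
    (lr_row (lr_between h h T11) (lr_between x h T12) (lr_between x h T13))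
    (lr_row (lr_between h x T21) (lr_between x x T22) (lr_between x x T23))
    (lr_row (lr_between h x T31) (lr_between x x T32) (lr_between x x T33)).

Local Notation "0" := (lr_zero X X) : linrel_scope.

Definition Lambda : linrel phase_space phase_space :=
  op_matrix
    0      ((-1) *: lr_id X)            0
    A      (2 *: frac_power A (1 / 2))  0
    0      0                            (2 *: frac_power A (1 / 2)).

End OperatorMatrix.

(* The domain of Lambda is X^1 x X^{1/2} x X^{1/2}, where X^1 = D(A). *)
Lemma dom_Lambda {X : cspace} (A : linrel X X) (p : phase_space A) :
  dom (Lambda A) p <->
  dom A (incl _ (fst p)) /\ dom (frac_power A (1 / 2)) (fst (snd p)) /\
  dom (frac_power A (1 / 2)) (snd (snd p)).
Proof.
  split.
  - intros (q & _ & (y1 & y2 & _ & H1 & (z & H2 & _) & _) &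
      (_ & _ & y3 & _ & _ & (w & H3 & _) & _)).
    split; [exists y1; exact H1 | split; [exists z; exact H2|]].
    exists w; exact H3.
  - destruct p as (u & v & w). intros ((a & Ha) & (b & Hb) & (d & Hd)).
    simpl in Ha, Hb, Hd.
    set (k := scal (RtoC (-1) : C_AbsRing) (exist
      (fun p : X * X => frac_power A (1 / 2) (fst p) (snd p)) (v, b) Hb
      : Xhalf A)).
    set (s := scal ((RtoC 2) : C_AbsRing) b).
    set (t := scal ((RtoC 2) : C_AbsRing) d).
    exists (k, (plus a s, t)). split; [|split].
    + exists zero, k, zero. repeat split.
      * exists v; split; reflexivity.
      * simpl. now rewrite plus_zero_r, plus_zero_l.
    + exists a, s, zero. repeat split; try exact Ha.
      * exists b; split; [exact Hb | reflexivity].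
      * simpl. now rewrite plus_zero_r.
    + exists zero, zero, t. repeat split.
      * exists d; split; [exact Hd | reflexivity].
      * simpl. now rewrite !plus_zero_l.
Qed.

(* Main.v *)
From Stdlib Require Import Reals Lra Lia List Classical.
From Stdlib Require Import ClassicalEpsilon FunctionalExtensionality PropExtensionality.
Require Import Defs.
From Coquelicot Require Import Coquelicot.
Open Scope R_scope.

(* On the half-line the resolvent R(t) = (t + A)^(-1) satisfies only the resolvent
   identity and |R(t)| <= M / (1 + t), and almost everything is derived from these
   two facts ([resfam]).  In logarithmic coordinates lam = exp (x + i th) the
   integrals over rays are differentiable in the angle, so the contour integral
   collapses to P_a = sin (pi a) / pi * int t^(-a) R(t) dt without a theory of
   holomorphic functions.  The function F(t) = (t + A)^(-a) solves
   F' = - a R(t) F and t^a F(t) y -> y on the domain; products of such functions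
   whose exponents sum to 1 equal (t + A)^(-1), whence injectivity and
   P_a P_b = P_(a+b).

   For B = A^(1/2) one has (s + B)^(-1) = S(s) with
   S(s) = 1 / pi * int t^(1/2) / (s^2 + t) R(t) dt.  The defect in this identity
   vanishes for small s and is a Cauchy transform on the right half-plane, hence
   vanishes for all s.  A change of variables then gives
   P_a(B) = P_(a/2)(A) =: Q.

   In the coordinates (B u, v, w) of X^(1/2) x X x X the resolvent of Lambda is
   polynomial in S: with K = S - s S^2 and L = s S^2 it maps (f, g, h) to
   ((K + S) f + K g, L g - K f, S(s/2) h / 2).  Integrating S against
   sin (pi a) / pi * s^(-a) gives Q, and integrating s S^2 = - s S' by parts gives
   (1 - a) Q; these are the entries of Lambda^(-a), and inverting the 2 x 2 matrix
   of coefficients of Q gives Lambda^a. *)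

(** * Vector identities *)

(** In the coordinates of the overview, [Lambda] acts on the first two components as B (I + N),
    where N has rows (-1, -1) and (1, 1) and N^2 = 0. All the formulas come from this nilpotency: (s
    + B + B N)^(-1) = S - B S^2 N with B S^2 = S - s S^2 = K, and the binomial series of I + N stops
    after its linear term, so that the powers are B^(-alpha) (I - alpha N) and B^alpha (I + alpha
    N). The main obstacle is to identify (s + B)^(-1). Algebra with the resolvent identity gives
    only A D = s^2 D for the defect D; positivity excludes nonpositive eigenvalues of A, but not
    s^2. Hence a real-variable substitute for the identity theorem: a Cauchy transform that vanishes
    on (0, s1) can be divided by s1 - s again and again, its densities shrink by 1 / s1 each time,
    and so it vanishes on (0, 2 s1). Exchanges of integrals are avoided as well: convolving an
    antiderivative takes their place. *)

Notation "c *v x" := (@scal (AbsRing.Ring C_AbsRing) (NormedModule.ModuleSpace C_AbsRing _) c x)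
  (at level 40, x at next level, left associativity).
Notation "x +v y" := (@plus (NormedModule.AbelianMonoid C_AbsRing _) x y)
  (at level 50, left associativity).
Notation "-v x" := (@opp (NormedModule.AbelianGroup C_AbsRing _) x)
  (at level 35, right associativity).
Notation "x -v y" := (@minus (NormedModule.AbelianGroup C_AbsRing _) x y)
  (at level 50, left associativity).
Notation "0v" := (@zero (NormedModule.AbelianMonoid C_AbsRing _)).
Notation nrm := (@norm C_AbsRing _).

(** Syntax for reflection: linear identities between vectors are reduced to their scalar
    coefficients, so that the rearrangements below are settled by [ring] or [field] in C. An atom
    outside the environment denotes zero. *)
Inductive vexp :=
  | VZ | VA (n : nat) | VP (a b : vexp) | VO (a : vexp) | VS (c : C) (a : vexp).

Fixpoint vden {V : cspace} (env : list V) (e : vexp) : V :=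
  match e with
  | VZ => 0v
  | VA n => nth n env 0v
  | VP a b => vden env a +v vden env b
  | VO a => -v vden env a
  | VS c a => c *v vden env a
  end.

Fixpoint vcoef (e : vexp) (n : nat) : C :=
  match e with
  | VZ => RtoC 0
  | VA m => if Nat.eqb m n then RtoC 1 else RtoC 0
  | VP a b => (vcoef a n + vcoef b n)%C
  | VO a => (- vcoef a n)%C
  | VS c a => (c * vcoef a n)%C
  end.

Fixpoint vlin {V : cspace} (env : list V) (f : nat -> C) : V :=
  match env with
  | nil => 0v
  | cons x l => f O *v x +v vlin l (fun n => f (S n))
  end.

Section VecNormal.
Context {V : cspace}.
Implicit Types x y : V.

Lemma Cscal_distr_r (a b : C) x : (a + b)%C *v x = a *v x +v b *v x.
Proof. exact (scal_distr_r (V := NormedModule.ModuleSpace _ V) a b x). Qed.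
Lemma Cscal_one x : RtoC 1 *v x = x.
Proof. exact (scal_one (V := NormedModule.ModuleSpace _ V) x). Qed.
Lemma Cscal_zero_l x : RtoC 0 *v x = 0v.
Proof. exact (scal_zero_l (V := NormedModule.ModuleSpace _ V) x). Qed.
Lemma Copp_scal x : -v x = (- RtoC 1)%C *v x.
Proof. symmetry; exact (scal_opp_one (V := NormedModule.ModuleSpace _ V) x). Qed.

Lemma vlin_ext env f g : (forall n, f n = g n) -> @vlin V env f = vlin env g.
Proof.
  revert f g; induction env as [|x l IH]; intros f g H; simpl; [reflexivity|].
  rewrite H. f_equal. apply IH. auto.
Qed.
Lemma vlin_plus env f g :
  @vlin V env (fun n => f n + g n)%C = vlin env f +v vlin env g.
Proof.
  revert f g; induction env as [|x l IH]; intros f g; simpl.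
  - symmetry; apply plus_zero_r.
  - rewrite IH, Cscal_distr_r. apply plus_plus.
Qed.
Lemma vlin_scal env c f :
  @vlin V env (fun n => c * f n)%C = c *v vlin env f.
Proof.
  revert f; induction env as [|x l IH]; intros f; simpl.
  - symmetry; apply Cscal_zero_r.
  - rewrite IH, Cscal_distr_l, Cscal_assoc. reflexivity.
Qed.
Lemma vlin_zero env : @vlin V env (fun _ => RtoC 0) = 0v.
Proof.
  induction env as [|x l IH]; simpl; [reflexivity|].
  rewrite IH, Cscal_zero_l. apply plus_zero_r.
Qed.
Lemma vlin_atom env m :
  @vlin V env (fun n => if Nat.eqb m n then RtoC 1 else RtoC 0) = nth m env 0v.
Proof.
  revert m; induction env as [|x l IH]; intros m; simpl.
  - destruct m; reflexivity.
  - destruct m as [|m]; simpl.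
    + rewrite vlin_zero, Cscal_one. apply plus_zero_r.
    + rewrite Cscal_zero_l, IH. apply plus_zero_l.
Qed.
Lemma vden_vlin env e : @vden V env e = vlin env (vcoef e).
Proof.
  induction e; simpl.
  - symmetry; apply vlin_zero.
  - symmetry; apply vlin_atom.
  - rewrite IHe1, IHe2. symmetry; apply vlin_plus.
  - rewrite IHe, Copp_scal, <- vlin_scal. apply vlin_ext; intros; ring.
  - rewrite IHe. symmetry; apply vlin_scal.
Qed.

(** Comparison up to the length of the environment unfolds to a finite conjunction of identities in
    C, which [vec_coefs] leaves as goals. *)
Fixpoint coefs_agree (k : nat) (f g : nat -> C) : Prop :=
  match k with
  | O => True
  | S k => f O = g O /\ coefs_agree k (fun n => f (S n)) (fun n => g (S n))
  end.

Lemma vlin_agree (env : list V) f g :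
  coefs_agree (length env) f g -> vlin env f = vlin env g.
Proof.
  revert f g; induction env as [|x l IH]; intros f g; simpl; [reflexivity|].
  intros [E H]. now rewrite E, (IH _ _ H).
Qed.
Lemma vec_decide (env : list V) e1 e2 :
  coefs_agree (length env) (vcoef e1) (vcoef e2) -> vden env e1 = vden env e2.
Proof. intros H. rewrite !vden_vlin. now apply vlin_agree. Qed.
End VecNormal.

Ltac vec_index x l :=
  lazymatch l with
  | cons x _ => constr:(O)
  | cons _ ?l' => let n := vec_index x l' in constr:(S n)
  end.
Ltac vec_atoms t l :=
  lazymatch t with
  | @plus _ ?a ?b => let l1 := vec_atoms a l in vec_atoms b l1
  | @minus _ ?a ?b => let l1 := vec_atoms a l in vec_atoms b l1
  | @opp _ ?a => vec_atoms a l
  | @scal _ _ _ ?a => vec_atoms a l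
  | @zero _ => l
  | ?x => match l with
          | _ => let n := vec_index x l in l
          | _ => constr:(cons x l)
          end
  end.
Ltac vec_reify t l :=
  lazymatch t with
  | @plus _ ?a ?b =>
      let e1 := vec_reify a l in let e2 := vec_reify b l in constr:(VP e1 e2)
  | @minus _ ?a ?b =>
      let e1 := vec_reify a l in let e2 := vec_reify b l in
      constr:(VP e1 (VO e2))
  | @opp _ ?a => let e := vec_reify a l in constr:(VO e)
  | @scal _ _ ?c ?a => let e := vec_reify a l in constr:(VS c e)
  | @zero _ => constr:(VZ)
  | ?x => let n := vec_index x l in constr:(VA n)
  end.
(* Reduces an equation between vectors to the equality of the coefficients of
   the atoms. *)
Ltac vec_coefs :=
  lazymatch goal with
  | |- @eq ?T ?a ?b =>
      let l0 := vec_atoms a (@nil T) in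
      let l := vec_atoms b l0 in
      let e1 := vec_reify a l in
      let e2 := vec_reify b l in
      refine (@vec_decide _ l e1 e2 _);
      cbn [length coefs_agree vcoef Nat.eqb]; repeat split
  end.
Lemma RtoC_m1 : RtoC (-1) = (- RtoC 1)%C.
Proof. exact (RtoC_opp 1). Qed.
Ltac Creal := repeat progress rewrite ?RtoC_m1, ?RtoC_plus, ?RtoC_minus, ?RtoC_opp, ?RtoC_mult.
Ltac vec := vec_coefs; try (Creal; ring).

(** * Norms, bounded maps and completeness *)

Section Norms.
Context {V : cspace}.
Implicit Types x y z : V.

Lemma nrm_ge0 x : 0 <= nrm x.
Proof. apply norm_ge_0. Qed.
Lemma nrm_zero : nrm (0v : V) = 0.
Proof. exact (norm_zero (V := V)). Qed.
Lemma nrm_tri x y : nrm (x +v y) <= nrm x + nrm y.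
Proof. exact (norm_triangle x y). Qed.
Lemma nrm_scal (c : C) x : nrm (c *v x) <= Cmod c * nrm x.
Proof. exact (norm_scal c x). Qed.
Lemma nrm_opp x : nrm (-v x) = nrm x.
Proof. exact (norm_opp x). Qed.
Lemma nrm_tri_minus x y : nrm (x -v y) <= nrm x + nrm y.
Proof.
  unfold minus. eapply Rle_trans; [apply nrm_tri|]. rewrite nrm_opp. lra.
Qed.
Lemma nrm_minus_sym x y : nrm (x -v y) = nrm (y -v x).
Proof. rewrite <- nrm_opp. f_equal. vec. Qed.
Lemma nrm_eq0 x : nrm x = 0 -> x = 0v.
Proof. exact (norm_eq_zero x). Qed.
Lemma nrm_sub_eq0 x y : nrm (x -v y) = 0 -> x = y.
Proof.
  intros H. apply nrm_eq0 in H.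
  transitivity (y +v (x -v y)); [vec | rewrite H; vec].
Qed.
Lemma nrm_tri3 x y z : nrm (x -v z) <= nrm (x -v y) + nrm (y -v z).
Proof.
  replace (x -v z) with ((x -v y) +v (y -v z)) by vec. apply nrm_tri.
Qed.
Lemma nrm_scal_eq (c : C) x : nrm (c *v x) = Cmod c * nrm x.
Proof.
  apply Rle_antisym; [apply nrm_scal|].
  destruct (Req_dec (Cmod c) 0) as [E|E].
  - rewrite E, Rmult_0_l. apply nrm_ge0.
  - assert (c <> RtoC 0) by (intros ->; apply E; apply Cmod_0).
    assert (H0 : nrm x <= Cmod (/ c) * nrm (c *v x)).
    { eapply Rle_trans; [|apply nrm_scal]. apply Req_le. f_equal. vec_coefs.
      field; assumption. }
    rewrite Cmod_inv in H0 by assumption.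
    apply Rmult_le_compat_l with (r := Cmod c) in H0; [|apply Cmod_ge_0].
    eapply Rle_trans; [exact H0|]. right. field. assumption.
Qed.
Lemma nrm_le_eps_eq0 x : (forall eps, 0 < eps -> nrm x <= eps) -> x = 0v.
Proof.
  intros H. apply nrm_eq0. apply Rle_antisym; [|apply nrm_ge0].
  apply le_epsilon. intros eps Heps. rewrite Rplus_0_l. auto.
Qed.
Lemma nrm_le_eps_eq x y : (forall eps, 0 < eps -> nrm (x -v y) <= eps) -> x = y.
Proof.
  intros H. apply nrm_sub_eq0. rewrite (nrm_le_eps_eq0 _ H). apply nrm_zero.
Qed.
Lemma nrm_minus_ge x y : nrm x - nrm y <= nrm (x -v y).
Proof.
  assert (nrm x <= nrm (x -v y) + nrm y); [|lra].
  replace x with ((x -v y) +v y) at 1 by vec. apply nrm_tri.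
Qed.
End Norms.

(** The sign of [K] is left free, which spares side conditions in statements such as [Rv_blin];
    [blin_pos] supplies a positive bound where a division by it occurs. *)
Record blin {V W : cspace} (L : V -> W) (K : R) : Prop := Blin {
  blin_plus : forall x y, L (x +v y) = L x +v L y;
  blin_scal : forall c x, L (c *v x) = c *v L x;
  blin_nrm : forall x, nrm (L x) <= K * nrm x
}.
Arguments blin_plus {V W L K} _ _ _.
Arguments blin_scal {V W L K} _ _ _.
Arguments blin_nrm {V W L K} _ _.

Section Blin.
Context {V W : cspace} {L : V -> W} {K : R}.
Hypothesis HL : blin L K.
Lemma blin_opp x : L (-v x) = -v L x.
Proof. rewrite !Copp_scal. apply HL. Qed.
Lemma blin_minus x y : L (x -v y) = L x -v L y.
Proof. unfold minus. rewrite (blin_plus HL), blin_opp. reflexivity. Qed.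
Lemma blin_zero : L 0v = 0v.
Proof. rewrite <- (Cscal_zero_l 0v), (blin_scal HL). apply Cscal_zero_l. Qed.
Lemma blin_weaken K' : K <= K' -> blin L K'.
Proof.
  intros H; split; try apply HL. intros x.
  eapply Rle_trans; [apply HL|]. apply Rmult_le_compat_r; [apply nrm_ge0|exact H].
Qed.
End Blin.

Lemma blin_comp {U V W : cspace} (L : V -> W) (L' : U -> V) K K' :
  0 <= K -> blin L K -> blin L' K' -> blin (fun x => L (L' x)) (K * K').
Proof.
  intros HK H H'. split; intros.
  - now rewrite (blin_plus H'), (blin_plus H).
  - now rewrite (blin_scal H'), (blin_scal H).
  - eapply Rle_trans; [apply H|]. rewrite Rmult_assoc.
    apply Rmult_le_compat_l; [exact HK | apply H'].
Qed.

Definition seq_lim {V : cspace} (u : nat -> V) (l : V) : Prop :=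
  forall eps, 0 < eps -> exists N, forall n, (N <= n)%nat -> nrm (u n -v l) < eps.
Definition seq_cauchy {V : cspace} (u : nat -> V) : Prop :=
  forall eps, 0 < eps -> exists N, forall n m, (N <= n)%nat -> (N <= m)%nat ->
    nrm (u n -v u m) < eps.
(** Sequential completeness can be checked coordinate by coordinate, as [banach_phase_space] does
    for the graph norm; [rcomplete] recovers from it the filter-based structure used for
    integration. *)
Definition banach (V : cspace) : Prop :=
  forall u : nat -> V, seq_cauchy u -> exists l, seq_lim u l.

Lemma ball_nrm {V : cspace} (x y : V) (eps : R) : nrm (y -v x) < eps -> ball x eps y.
Proof. apply norm_compat1. Qed.

Lemma nrm_ball {V : cspace} (x : V) (eps : R) : 0 < eps ->
  exists d : posreal, forall y, ball x d y -> nrm (y -v x) < eps.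
Proof.
  intros He.
  assert (Hd : 0 < eps / @norm_factor _ V)
    by (apply Rdiv_lt_0_compat; [exact He | apply norm_factor_gt_0]).
  exists (mkposreal _ Hd). intros y Hy.
  eapply Rlt_le_trans; [exact (norm_compat2 x y _ Hy)|].
  simpl. right. field. apply Rgt_not_eq, norm_factor_gt_0.
Qed.

Lemma banach_complete (X : CompleteNormedModule C_AbsRing) : banach X.
Proof.
  intros u Hu.
  pose (F := fun P : X -> Prop => exists N, forall n, (N <= n)%nat -> P (u n)).
  assert (FF : ProperFilter F).
  { split.
    - intros P [N HN]. exists (u N). auto.
    - split.
      + exists 0%nat. auto.
      + intros P Q [N HN] [M HM]. exists (max N M). intros n Hn.
        split; [apply HN | apply HM]; lia.
      + intros P Q H [N HN]. exists N. auto. }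
  assert (HF : cauchy F).
  { intros eps. destruct (Hu eps (cond_pos eps)) as [N HN].
    exists (u N). exists N. intros n Hn.
    exact (ball_nrm (V := CompleteNormedModule.NormedModule _ X) _ _ _ (HN n N Hn (le_n N))). }
  exists (lim F). intros eps Heps.
  destruct (nrm_ball (V := X) (lim F) eps Heps) as [d Hd].
  destruct (complete_cauchy F FF HF d) as [N HN].
  exists N. intros n Hn. apply Hd. auto.
Qed.

(* Coquelicot's integrability and derivation theorems are stated for complete
   normed modules over R. *)
Section RealComplete.
Context {V : cspace}.
Hypothesis HV : banach V.

(** Points [u n] whose balls of radius 1 / (n + 1) belong to the filter form a Cauchy sequence,
    because two members of a proper filter meet. The constant [norm_factor] converts balls into norm
    estimates. *)
Lemma banach_filter (F : (V -> Prop) -> Prop) : ProperFilter F -> cauchy F ->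
  exists l, forall eps : posreal, F (ball l eps).
Proof.
  intros FF HF.
  assert (H : forall n : nat, exists x, F (ball x (/ (INR n + 1)))).
  { intros n. assert (H : 0 < / (INR n + 1)) by apply RinvN_pos.
    destruct (HF (mkposreal _ H)) as [x Hx]. exists x. exact Hx. }
  apply choice in H as [u Hu].
  assert (C : seq_cauchy u).
  { intros eps Heps.
    assert (Hf := @norm_factor_gt_0 _ V).
    destruct (archimed_cor1 (eps / (2 * @norm_factor _ V))) as (N & HN & HN0).
    { apply Rdiv_lt_0_compat; lra. }
    exists N. intros n m Hn Hm.
    destruct (filter_ex _ (filter_and _ _ (Hu n) (Hu m))) as (z & Hz1 & Hz2).
    assert (Hz : forall k, (N <= k)%nat -> ball (u k) (/ (INR k + 1)) z ->
       nrm (z -v u k) < eps / 2).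
    { intros k Hk Hb. pose proof (RinvN_pos k) as Hp.
      eapply Rlt_le_trans; [exact (norm_compat2 (u k) z (mkposreal _ Hp) Hb)|].
      simpl. apply Rle_trans with (@norm_factor _ V * (eps / (2 * @norm_factor _ V))).
      - apply Rmult_le_compat_l; [lra|].
        apply Rle_trans with (/ INR N); [|lra].
        apply Rinv_le_contravar; [apply lt_0_INR; lia|].
        apply le_INR in Hk. lra.
      - right. field. lra. }
    eapply Rle_lt_trans; [apply (nrm_tri3 _ z)|].
    rewrite nrm_minus_sym. pose proof (Hz n Hn Hz1). pose proof (Hz m Hm Hz2). lra. }
  destruct (HV u C) as [l Hl]. exists l. intros eps.
  pose proof (cond_pos eps) as Heps.
  destruct (Hl (eps / 2)) as [N1 HN1]; [lra|].
  destruct (archimed_cor1 (eps / 2)) as (N2 & HN2 & HN20); [lra|].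
  set (n := max N1 N2).
  eapply filter_imp; [|exact (Hu n)]. intros z Hz.
  assert (Hlt : / (INR n + 1) <= / INR N2).
  { apply Rinv_le_contravar; [apply lt_0_INR; lia|].
    assert (INR N2 <= INR n) by (apply le_INR; lia). lra. }
  apply ball_le with (eps / 2 + / (INR n + 1)); [lra|].
  apply ball_triangle with (u n); [|exact Hz].
  apply ball_nrm. apply HN1. lia.
Qed.

Definition filter_limit (F : (V -> Prop) -> Prop) : V :=
  epsilon (inhabits (0v : V)) (fun l => forall eps : posreal, F (ball l eps)).

Lemma filter_limit_ax1 (F : (V -> Prop) -> Prop) : ProperFilter F -> cauchy F ->
  forall eps : posreal, F (ball (filter_limit F) eps).
Proof.
  intros FF HF. unfold filter_limit. apply epsilon_spec. now apply banach_filter.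
Qed.
Lemma filter_limit_ax2 (F1 F2 : (V -> Prop) -> Prop) :
  filter_le F1 F2 -> filter_le F2 F1 -> close (filter_limit F1) (filter_limit F2).
Proof.
  intros H1 H2.
  (* Filters that refine each other are equal as predicates, so the choice operator returns the same
     limit for both. *)
  replace F2 with F1; [apply close_refl|].
  apply functional_extensionality. intros P. apply propositional_extensionality.
  split; auto.
Qed.

Definition rcomplete : CompleteNormedModule R_AbsRing :=
  CompleteNormedModule.Pack R_AbsRing V
    (CompleteNormedModule.Class R_AbsRing V (NormedModule.class _ (realify V))
       (CompleteSpace.Mixin _ filter_limit filter_limit_ax1 filter_limit_ax2)) V.
End RealComplete.

(** * Calculus of vector-valued functions *)

(** The supremum of the points up to which [Q] holds satisfies [Q] by the left-hand step, and the
    right-hand step moves past it unless it equals [b]. This replaces the intermediate point of the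
    scalar mean value theorem, which vector-valued functions do not have. *)
Lemma real_induction (a b : R) (Q : R -> Prop) : a <= b -> Q a ->
  (forall x, a <= x < b -> (forall y, a <= y <= x -> Q y) ->
     exists d, 0 < d /\ forall y, x < y < x + d -> y <= b -> Q y) ->
  (forall x, a < x <= b -> (forall y, a <= y < x -> Q y) -> Q x) ->
  forall x, a <= x <= b -> Q x.
Proof.
  intros Hab Ha Hr Hl.
  pose (E := fun x => a <= x <= b /\ forall y, a <= y <= x -> Q y).
  assert (HEa : E a). { split; [lra|]. intros y Hy. now replace y with a by lra. }
  destruct (completeness E) as [c [Hub Hlub]].
  { exists b. intros x [Hx _]. lra. }
  { exists a. exact HEa. }
  assert (Hac : a <= c) by (apply Hub; exact HEa).
  assert (Hcb : c <= b) by (apply Hlub; intros x [Hx _]; lra).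
  assert (Hlt : forall y, a <= y < c -> Q y).
  { intros y Hy. apply NNPP. intros Hn.
    assert (c <= y); [|lra]. apply Hlub. intros x [Hx Hx'].
    apply Rnot_lt_le. intros Hxy. apply Hn, Hx'. lra. }
  assert (Hc : Q c).
  { destruct (Req_dec a c) as [<-|Hne]; [exact Ha|]. apply Hl; [lra|exact Hlt]. }
  assert (HEc : forall y, a <= y <= c -> Q y).
  { intros y Hy. destruct (Req_dec y c) as [->|]; [exact Hc|]. apply Hlt; lra. }
  destruct (Rle_lt_or_eq_dec _ _ Hcb) as [Hlt'|<-].
  - destruct (Hr c) as (d & Hd & Hq); [lra|exact HEc|].
    set (x := Rmin b (c + d / 2)).
    assert (x <= b /\ x <= c + d/2 /\ c < x) as (H1 & H2 & H3).
    { unfold x. split; [apply Rmin_l|]. split; [apply Rmin_r|].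
      apply Rmin_glb_lt; lra. }
    assert (x <= c); [|lra]. apply Hub. split; [lra|].
    intros y Hy. destruct (Rle_lt_dec y c) as [|Hyc]; [apply HEc; lra|].
    apply Hq; lra.
  - exact HEc.
Qed.

Definition has_deriv {V : cspace} (F : R -> V) (x : R) (d : V) : Prop :=
  forall eps, 0 < eps -> exists del, 0 < del /\ forall h, Rabs h < del ->
    nrm (F (x + h) -v F x -v RtoC h *v d) <= eps * Rabs h.

Definition cont_at {V : cspace} (F : R -> V) (x : R) : Prop :=
  forall eps, 0 < eps -> exists del, 0 < del /\ forall h, Rabs h < del ->
    nrm (F (x + h) -v F x) <= eps.

Definition lim_p {V : cspace} (F : R -> V) (l : V) : Prop :=
  forall eps, 0 < eps -> exists N, forall x, N < x -> nrm (F x -v l) <= eps.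
Definition lim_m {V : cspace} (F : R -> V) (l : V) : Prop :=
  forall eps, 0 < eps -> exists N, forall x, x < N -> nrm (F x -v l) <= eps.

Section Calculus.
Context {V : cspace}.
Implicit Types F G : R -> V.

Lemma deriv_cont F x d : has_deriv F x d -> cont_at F x.
Proof.
  intros H eps Heps. destruct (H 1) as (del & Hd & Hh); [lra|].
  pose proof (nrm_ge0 d).
  assert (H0' : 0 < eps / (1 + nrm d)) by (apply Rdiv_lt_0_compat; lra).
  exists (Rmin del (eps / (1 + nrm d))). split; [now apply Rmin_glb_lt|].
  intros h Hlt.
  assert (H1 := Rlt_le_trans _ _ _ Hlt (Rmin_l _ _)).
  assert (H2 := Rlt_le_trans _ _ _ Hlt (Rmin_r _ _)).
  specialize (Hh h H1).
  replace (F (x + h) -v F x) with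
    ((F (x + h) -v F x -v RtoC h *v d) +v RtoC h *v d) by vec.
  eapply Rle_trans; [apply nrm_tri|]. rewrite nrm_scal_eq, Cmod_R.
  apply Rle_trans with (Rabs h * (1 + nrm d)); [lra|].
  apply Rlt_le in H2. apply Rmult_le_compat_r with (r := 1 + nrm d) in H2; [|lra].
  eapply Rle_trans; [exact H2|]. right. field. lra.
Qed.

Lemma deriv_ext_loc F G x d (r : R) : 0 < r ->
  (forall h, Rabs h < r -> F (x + h) = G (x + h)) ->
  has_deriv F x d -> has_deriv G x d.
Proof.
  intros Hr E H eps Heps. destruct (H eps Heps) as (del & Hd & Hh).
  exists (Rmin del r). split; [now apply Rmin_glb_lt|].
  intros h Hlt.
  assert (H1 := Rlt_le_trans _ _ _ Hlt (Rmin_l _ _)).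
  assert (H2 := Rlt_le_trans _ _ _ Hlt (Rmin_r _ _)).
  specialize (Hh h H1). rewrite (E h H2) in Hh.
  pose proof (E 0) as E0. rewrite Rplus_0_r in E0.
  rewrite E0 in Hh; [exact Hh|]. rewrite Rabs_R0. exact Hr.
Qed.
Lemma deriv_ext F G x d : (forall x, F x = G x) ->
  has_deriv F x d -> has_deriv G x d.
Proof. intros E. apply (deriv_ext_loc _ _ _ _ 1); [lra|auto]. Qed.

Lemma deriv_const (c : V) x : has_deriv (fun _ => c) x 0v.
Proof.
  intros eps Heps. exists 1. split; [lra|]. intros h _.
  replace (c -v c -v RtoC h *v 0v) with (0v : V) by vec.
  rewrite nrm_zero. pose proof (Rabs_pos h). nra.
Qed.
Lemma deriv_plus F G x d e : has_deriv F x d -> has_deriv G x e ->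
  has_deriv (fun x => F x +v G x) x (d +v e).
Proof.
  intros H1 H2 eps Heps.
  destruct (H1 (eps/2)) as (d1 & Hd1 & Hh1); [lra|].
  destruct (H2 (eps/2)) as (d2 & Hd2 & Hh2); [lra|].
  exists (Rmin d1 d2). split; [now apply Rmin_glb_lt|]. intros h Hlt.
  specialize (Hh1 h (Rlt_le_trans _ _ _ Hlt (Rmin_l _ _))).
  specialize (Hh2 h (Rlt_le_trans _ _ _ Hlt (Rmin_r _ _))).
  replace (F (x + h) +v G (x + h) -v (F x +v G x) -v RtoC h *v (d +v e)) with
    ((F (x + h) -v F x -v RtoC h *v d) +v (G (x + h) -v G x -v RtoC h *v e)) by vec.
  eapply Rle_trans; [apply nrm_tri|]. lra.
Qed.
Lemma deriv_shift F x c d : has_deriv F (x + c) d ->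
  has_deriv (fun x => F (x + c)) x d.
Proof.
  intros H eps Heps. destruct (H eps Heps) as (del & Hd & Hh).
  exists del. split; [exact Hd|]. intros h Hlt.
  replace (x + h + c) with (x + c + h) by ring. auto.
Qed.

Lemma lim_p_plus F G l l' : lim_p F l -> lim_p G l' ->
  lim_p (fun x => F x +v G x) (l +v l').
Proof.
  intros H H' eps Heps.
  destruct (H (eps/2)) as [N HN]; [lra|]. destruct (H' (eps/2)) as [N' HN']; [lra|].
  exists (Rmax N N'). intros x Hx.
  assert (N <= Rmax N N') by apply Rmax_l. assert (N' <= Rmax N N') by apply Rmax_r.
  replace (F x +v G x -v (l +v l')) with ((F x -v l) +v (G x -v l')) by vec.
  eapply Rle_trans; [apply nrm_tri|].
  assert (A := HN x ltac:(lra)). assert (B := HN' x ltac:(lra)). lra.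
Qed.
Lemma lim_m_plus F G l l' : lim_m F l -> lim_m G l' ->
  lim_m (fun x => F x +v G x) (l +v l').
Proof.
  intros H H' eps Heps.
  destruct (H (eps/2)) as [N HN]; [lra|]. destruct (H' (eps/2)) as [N' HN']; [lra|].
  exists (Rmin N N'). intros x Hx.
  assert (Rmin N N' <= N) by apply Rmin_l. assert (Rmin N N' <= N') by apply Rmin_r.
  replace (F x +v G x -v (l +v l')) with ((F x -v l) +v (G x -v l')) by vec.
  eapply Rle_trans; [apply nrm_tri|].
  assert (A := HN x ltac:(lra)). assert (B := HN' x ltac:(lra)). lra.
Qed.
Lemma lim_p_const (c : V) : lim_p (fun _ => c) c.
Proof.
  intros eps Heps. exists 0. intros x _. replace (c -v c) with (0v : V) by vec.
  rewrite nrm_zero. lra.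
Qed.
Lemma lim_m_const (c : V) : lim_m (fun _ => c) c.
Proof.
  intros eps Heps. exists 0. intros x _. replace (c -v c) with (0v : V) by vec.
  rewrite nrm_zero. lra.
Qed.
Lemma lim_p_shift F l c : lim_p F l -> lim_p (fun x => F (x + c)) l.
Proof.
  intros H eps Heps. destruct (H eps Heps) as [N HN]. exists (N - c).
  intros x Hx. apply HN. lra.
Qed.
Lemma lim_m_shift F l c : lim_m F l -> lim_m (fun x => F (x + c)) l.
Proof.
  intros H eps Heps. destruct (H eps Heps) as [N HN]. exists (N - c).
  intros x Hx. apply HN. lra.
Qed.
Lemma lim_p_zero_dom F (g : R -> R) N0 : (forall x, N0 < x -> nrm (F x) <= g x) ->
  is_lim g p_infty 0 -> lim_p F 0v.
Proof.
  intros Hg Hl eps Heps.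
  apply is_lim_spec in Hl. destruct (Hl (mkposreal _ Heps)) as [N HN].
  exists (Rmax N N0). intros x Hx.
  pose proof (Rmax_l N N0). pose proof (Rmax_r N N0).
  specialize (HN x ltac:(lra)). simpl in HN.
  replace (F x -v 0v) with (F x) by vec.
  apply Rle_trans with (g x); [apply Hg; lra|].
  rewrite Rminus_0_r in HN. pose proof (Rle_abs (g x)). lra.
Qed.
Lemma lim_m_zero_dom F (g : R -> R) N0 : (forall x, x < N0 -> nrm (F x) <= g x) ->
  is_lim g m_infty 0 -> lim_m F 0v.
Proof.
  intros Hg Hl eps Heps.
  apply is_lim_spec in Hl. destruct (Hl (mkposreal _ Heps)) as [N HN].
  exists (Rmin N N0). intros x Hx.
  pose proof (Rmin_l N N0). pose proof (Rmin_r N N0).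
  specialize (HN x ltac:(lra)). simpl in HN.
  replace (F x -v 0v) with (F x) by vec.
  apply Rle_trans with (g x); [apply Hg; lra|].
  rewrite Rminus_0_r in HN. pose proof (Rle_abs (g x)). lra.
Qed.

(** Real induction on the estimate with an extra slope e: differentiability of [F] and [G] with
    tolerance e / 2 each extends it to the right, and continuity passes to limits from the left. *)
Lemma mean_value_ineq F (f : R -> V) (G g : R -> R) a b : a <= b ->
  (forall x, a <= x <= b -> has_deriv F x (f x)) ->
  (forall x, a <= x <= b -> is_derive G x (g x)) ->
  (forall x, a <= x <= b -> nrm (f x) <= g x) ->
  nrm (F b -v F a) <= G b - G a.
Proof.
  intros Hab HF HG Hfg.
  apply le_epsilon. intros eps Heps.
  (* The summand 1 covers the case a = b; over the whole interval the extra slope costs at most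
     eps. *)
  set (e := eps / (b - a + 1)).
  assert (He : 0 < e) by (apply Rdiv_lt_0_compat; lra).
  assert (H : forall x, a <= x <= b ->
    nrm (F x -v F a) <= G x - G a + e * (x - a)).
  { apply real_induction; [exact Hab| | |].
    - replace (F a -v F a) with (0v : V) by vec. rewrite nrm_zero. lra.
    - intros x Hx IH. specialize (IH x ltac:(lra)).
      destruct (HF x ltac:(lra) (e / 2)) as (d1 & Hd1 & Hh1); [lra|].
      pose proof (HG x ltac:(lra)) as HGx. apply is_derive_Reals in HGx.
      destruct (HGx (e / 2)) as [d2 Hd2]; [lra|].
      exists (Rmin d1 d2). split.
      { apply Rmin_glb_lt; [exact Hd1 | apply cond_pos]. }
      intros y Hy Hyb. set (h := y - x).
      assert (Hh : 0 < h) by (unfold h; lra).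
      assert (Hh1' : h < d1).
      { apply Rlt_le_trans with (Rmin d1 d2); [unfold h; lra|apply Rmin_l]. }
      assert (Hh2' : h < d2).
      { apply Rlt_le_trans with (Rmin d1 d2); [unfold h; lra|apply Rmin_r]. }
      specialize (Hh1 h ltac:(rewrite Rabs_pos_eq; lra)).
      specialize (Hd2 h ltac:(lra) ltac:(rewrite Rabs_pos_eq; lra)).
      replace (x + h) with y in * by (unfold h; ring).
      rewrite (Rabs_pos_eq h) in Hh1 by lra.
      assert (HG2 : g x * h - e / 2 * h <= G y - G x).
      { apply Rabs_def2 in Hd2. destruct Hd2 as [_ Hd2].
        apply Rmult_lt_compat_r with (r := h) in Hd2; [|exact Hh].
        replace (((G y - G x) / h - g x) * h) with (G y - G x - g x * h) in Hd2
          by (field; lra). lra. }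
      replace (F y -v F a) with
        ((F y -v F x -v RtoC h *v f x) +v (RtoC h *v f x) +v (F x -v F a)) by vec.
      eapply Rle_trans; [apply nrm_tri|].
      eapply Rle_trans; [apply Rplus_le_compat_r, nrm_tri|].
      rewrite nrm_scal_eq, Cmod_R, (Rabs_pos_eq h) by lra.
      pose proof (Hfg x ltac:(lra)). unfold h in *. nra.
    - intros x Hx IH. apply le_epsilon. intros eta Heta.
      destruct (deriv_cont _ _ _ (HF x ltac:(lra)) (eta/2)) as (d1 & Hd1 & Hh1); [lra|].
      assert (HGc : continuity_pt G x).
      { apply derivable_continuous_pt. exists (g x). apply is_derive_Reals.
        apply HG; lra. }
      destruct (HGc (eta / 2)) as (d2 & Hd2 & Hh2); [lra|].
      set (h := Rmin (Rmin d1 d2) (x - a) / 2).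
      assert (0 < Rmin (Rmin d1 d2) (x - a)).
      { repeat apply Rmin_glb_lt; lra. }
      assert (h < d1 /\ h < d2 /\ h < x - a /\ 0 < h) as (A1 & A2 & A3 & A4).
      { pose proof (Rmin_l (Rmin d1 d2) (x - a)). pose proof (Rmin_r (Rmin d1 d2) (x - a)).
        pose proof (Rmin_l d1 d2). pose proof (Rmin_r d1 d2). unfold h. lra. }
      specialize (Hh1 (-h) ltac:(rewrite Rabs_Ropp, Rabs_pos_eq; lra)).
      assert (Hh2' : Rabs (G (x + - h) - G x) < eta / 2).
      { apply (Hh2 (x + - h)). split; [split; [exact I|lra]|].
        simpl. unfold Rdist. replace (x + - h - x) with (- h) by ring.
        rewrite Rabs_Ropp, Rabs_pos_eq; lra. }
      apply Rabs_def2 in Hh2'.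
      specialize (IH (x + - h) ltac:(lra)).
      eapply Rle_trans; [apply (nrm_tri3 _ (F (x + - h)))|].
      rewrite nrm_minus_sym. nra. }
  specialize (H b ltac:(lra)).
  assert (e * (b - a) <= eps); [|lra].
  unfold e. apply Rmult_le_reg_r with (b - a + 1); [lra|].
  field_simplify; [|lra]. nra.
Qed.

Lemma deriv_zero_const F a b : a <= b ->
  (forall x, a <= x <= b -> has_deriv F x 0v) -> F b = F a.
Proof.
  intros Hab HF. apply nrm_le_eps_eq. intros eps Heps.
  apply Rle_trans with 0; [|lra].
  replace 0 with ((fun _ : R => 0) b - (fun _ : R => 0) a) by ring.
  apply (mean_value_ineq F (fun _ => 0v) (fun _ => 0) (fun _ => 0)); auto.
  - intros. apply (is_derive_const (V := R_NormedModule) 0).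
  - intros. rewrite nrm_zero. lra.
Qed.
End Calculus.

Section LinearImage.
Context {V W : cspace} {L : V -> W} {K : R} (HL : blin L K).
Implicit Types F : R -> V.

Lemma blin_pos : exists K', 0 < K' /\ blin L K'.
Proof.
  exists (Rmax 1 K). split; [|apply (blin_weaken HL), Rmax_r].
  pose proof (Rmax_l 1 K). lra.
Qed.
Lemma deriv_blin F x d : has_deriv F x d -> has_deriv (fun x => L (F x)) x (L d).
Proof.
  destruct blin_pos as (K' & HK & HL'). intros H eps Heps.
  destruct (H (eps / K')) as (del & Hd & Hh); [now apply Rdiv_lt_0_compat|].
  exists del. split; [exact Hd|]. intros h Hlt. specialize (Hh h Hlt).
  rewrite <- (blin_scal HL), <- !(blin_minus HL).
  eapply Rle_trans; [apply HL'|].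
  apply Rmult_le_compat_l with (r := K') in Hh; [|lra].
  eapply Rle_trans; [exact Hh|]. right. field. lra.
Qed.
Lemma cont_blin F x : cont_at F x -> cont_at (fun x => L (F x)) x.
Proof.
  destruct blin_pos as (K' & HK & HL'). intros H eps Heps.
  destruct (H (eps / K')) as (del & Hd & Hh); [now apply Rdiv_lt_0_compat|].
  exists del. split; [exact Hd|]. intros h Hlt. specialize (Hh h Hlt).
  rewrite <- !(blin_minus HL). eapply Rle_trans; [apply HL'|].
  apply Rmult_le_compat_l with (r := K') in Hh; [|lra].
  eapply Rle_trans; [exact Hh|]. right. field. lra.
Qed.
Lemma lim_p_blin F l : lim_p F l -> lim_p (fun x => L (F x)) (L l).
Proof.
  destruct blin_pos as (K' & HK & HL'). intros H eps Heps.
  destruct (H (eps / K')) as (N & Hh); [now apply Rdiv_lt_0_compat|].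
  exists N. intros h Hlt. specialize (Hh h Hlt).
  rewrite <- !(blin_minus HL). eapply Rle_trans; [apply HL'|].
  apply Rmult_le_compat_l with (r := K') in Hh; [|lra].
  eapply Rle_trans; [exact Hh|]. right. field. lra.
Qed.
Lemma lim_m_blin F l : lim_m F l -> lim_m (fun x => L (F x)) (L l).
Proof.
  destruct blin_pos as (K' & HK & HL'). intros H eps Heps.
  destruct (H (eps / K')) as (N & Hh); [now apply Rdiv_lt_0_compat|].
  exists N. intros h Hlt. specialize (Hh h Hlt).
  rewrite <- !(blin_minus HL). eapply Rle_trans; [apply HL'|].
  apply Rmult_le_compat_l with (r := K') in Hh; [|lra].
  eapply Rle_trans; [exact Hh|]. right. field. lra.
Qed.
End LinearImage.

Lemma blin_scalar {V : cspace} (c : C) : blin (fun x : V => c *v x) (Cmod c).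
Proof.
  split; intros.
  - vec.
  - vec.
  - apply nrm_scal.
Qed.

(** The limit 0 at minus infinity makes the antiderivative unique. A finite [b] serves near the
    origin, where the half-line x < b is the part of a ray inside a disc. *)
Definition anti {V : cspace} (b : Rbar) (f F : R -> V) : Prop :=
  (forall x : R, Rbar_lt x b -> has_deriv F x (f x)) /\ lim_m F 0v.

(** Integrals over the line are limits of antiderivatives, so that linearity, bounded maps and
    translations reduce to derivatives and limits. Riemann integrals enter only in [anti_exists] and
    in the comparison with the contour integral. *)
Definition is_int {V : cspace} (f : R -> V) (l : V) : Prop :=
  exists F, anti p_infty f F /\ lim_p F l.

(** Domination with an explicit antiderivative: dominated estimates become instances of
    [mean_value_ineq]. *)
Record is_majorant (g G : R -> R) (L : R) : Prop := Majorant {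
  maj_deriv : forall x, is_derive G x (g x);
  maj_m : is_lim G m_infty 0;
  maj_p : is_lim G p_infty L
}.
Arguments maj_deriv {g G L} _ _.
Arguments maj_m {g G L} _.
Arguments maj_p {g G L} _.

Section Integral.
Context {V : cspace}.
Implicit Types f F : R -> V.

Lemma anti_bound (b : Rbar) f F g G L : is_majorant g G L ->
  anti b f F -> (forall x : R, Rbar_lt x b -> nrm (f x) <= g x) ->
  forall x : R, Rbar_lt x b -> nrm (F x) <= G x.
Proof.
  intros HG [HF HF0] Hfg x Hx.
  apply le_epsilon. intros eps Heps.
  destruct (HF0 (eps / 2)) as [N1 HN1]; [lra|].
  pose proof (maj_m HG) as Hm. apply is_lim_spec in Hm.
  assert (H2 : 0 < eps / 2) by lra.
  destruct (Hm (mkposreal _ H2)) as [N2 HN2]. simpl in HN2.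
  set (y := Rmin x (Rmin N1 N2) - 1).
  assert (y < x /\ y < N1 /\ y < N2) as (A1 & A2 & A3).
  { pose proof (Rmin_l x (Rmin N1 N2)). pose proof (Rmin_r x (Rmin N1 N2)).
    pose proof (Rmin_l N1 N2). pose proof (Rmin_r N1 N2). unfold y. lra. }
  specialize (HN1 y A2). specialize (HN2 y A3).
  replace (F y -v 0v) with (F y) in HN1 by vec.
  apply Rabs_def2 in HN2.
  assert (H : nrm (F x -v F y) <= G x - G y).
  { apply mean_value_ineq with (f := f) (g := g); [lra| | |].
    - intros z Hz. apply HF. eapply Rbar_le_lt_trans; [|exact Hx]. simpl; lra.
    - intros z Hz. apply HG.
    - intros z Hz. apply Hfg. eapply Rbar_le_lt_trans; [|exact Hx]. simpl; lra. }
  pose proof (nrm_minus_ge (F x) (F y)). lra.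
Qed.

Lemma lim_le_nrm F (G : R -> R) l (L : R) : lim_p F l -> is_lim G p_infty L ->
  (forall x, nrm (F x) <= G x) -> nrm l <= L.
Proof.
  intros HF HG H. apply le_epsilon. intros eps Heps.
  destruct (HF (eps / 2)) as [N1 HN1]; [lra|].
  apply is_lim_spec in HG.
  assert (H2 : 0 < eps / 2) by lra.
  destruct (HG (mkposreal _ H2)) as [N2 HN2]. simpl in HN2.
  set (x := Rmax N1 N2 + 1).
  pose proof (Rmax_l N1 N2). pose proof (Rmax_r N1 N2).
  specialize (HN1 x ltac:(unfold x; lra)). specialize (HN2 x ltac:(unfold x; lra)).
  apply Rabs_def2 in HN2. specialize (H x). rewrite nrm_minus_sym in HN1.
  pose proof (nrm_minus_ge l (F x)). lra.
Qed.

Lemma int_bound f l g G L : is_majorant g G L -> is_int f l ->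
  (forall x, nrm (f x) <= g x) -> nrm l <= L.
Proof.
  intros HG (F & HF & Hl) Hfg.
  apply (lim_le_nrm F G); [exact Hl | apply HG|].
  intros x. apply (anti_bound p_infty f F g G L); simpl; auto.
Qed.

(** The Riemann integral from a base point [c] is an antiderivative; [G] makes it Cauchy at minus
    infinity, and subtracting its limit normalises it. *)
Lemma anti_exists (b : Rbar) f g G L : banach V -> b <> m_infty ->
  is_majorant g G L ->
  (forall x : R, Rbar_lt x b -> cont_at f x) ->
  (forall x : R, Rbar_lt x b -> nrm (f x) <= g x) ->
  exists F, anti b f F.
Proof.
  intros HV Hb HG Hc Hfg.
  assert (exists c : R, Rbar_lt c b) as [c Hcb].
  { destruct b as [b| |]; [exists (b - 1); simpl; lra | exists 0; exact I|congruence]. }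
  pose (W := rcomplete HV : CompleteNormedModule R_AbsRing).
  assert (Hcont : forall x : R, Rbar_lt x b -> continuous (U := W) f x).
  { intros x Hx. apply filterlim_locally. intros eps.
    destruct (Hc x Hx (eps / 2)) as (d & Hd & Hh); [pose proof (cond_pos eps); lra|].
    exists (mkposreal d Hd). intros y Hy.
    apply (ball_nrm (V := V)). specialize (Hh (y - x)).
    rewrite (Rplus_minus x y) in Hh.
    eapply Rle_lt_trans; [apply Hh; exact Hy|]. pose proof (cond_pos eps). lra. }
  pose (F0 := fun x => RInt (V := W) f c x).
  assert (HI : forall x : R, Rbar_lt x b -> is_RInt (V := W) f c x (F0 x)).
  { intros x Hx. apply RInt_correct, ex_RInt_continuous.
    intros z Hz. apply Hcont. eapply Rbar_le_lt_trans with (Rmax c x); [apply Hz|].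
    unfold Rmax; destruct Rle_dec; assumption. }
  assert (HF0 : forall x : R, Rbar_lt x b -> has_deriv (V := V) F0 x (f x)).
  { intros x Hx.
    assert (Hd : is_derive (K := R_AbsRing) (V := W) F0 x (f x)).
    { apply is_derive_RInt with c; [|now apply Hcont].
      assert (exists d : posreal, forall y : R, ball x d y -> Rbar_lt y b) as [d Hd].
      { destruct b as [b| |]; [|exists (mkposreal 1 Rlt_0_1); intros; exact I|congruence].
        simpl in Hx. assert (H : 0 < b - x) by lra.
        exists (mkposreal _ H). intros y Hy. apply Rabs_def2 in Hy. simpl in *.
        unfold minus, plus, opp in Hy; simpl in Hy. lra. }
      exists d. intros y Hy. apply HI. auto. }
    destruct Hd as [_ Hd]. specialize (Hd x (fun P H => H)).
    intros eps Heps. destruct (Hd (mkposreal _ Heps)) as [d Hy].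
    exists d. split; [apply cond_pos|]. intros h Hh.
    specialize (Hy (x + h)).
    assert (Hb' : ball x d (x + h)).
    { change (Rabs (x + h - x) < d). replace (x + h - x) with h by ring. exact Hh. }
    specialize (Hy Hb').
    change (nrm ((F0 (x + h) -v F0 x) -v RtoC (x + h - x) *v f x)
      <= eps * Rabs (x + h - x)) in Hy.
    replace (x + h - x) with h in Hy by ring. exact Hy. }
  assert (Hdiff : forall x y : R, y <= x -> Rbar_lt x b ->
     nrm (F0 x -v F0 y : V) <= G x - G y).
  { intros x y Hyx Hx. apply (mean_value_ineq (V := V)) with (f := f) (g := g); [lra| | |].
    - intros z Hz. apply HF0. eapply Rbar_le_lt_trans; [|exact Hx]. simpl; lra.
    - intros z Hz. apply HG.
    - intros z Hz. apply Hfg. eapply Rbar_le_lt_trans; [|exact Hx]. simpl; lra. }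
  pose proof (maj_m HG) as Hm. apply is_lim_spec in Hm.
  assert (Hcau : forall eps, 0 < eps -> exists N, forall x y : R, x < N -> y < N ->
    nrm (F0 x -v F0 y : V) <= eps).
  { intros eps Heps. assert (H2 : 0 < eps / 2) by lra.
    destruct (Hm (mkposreal _ H2)) as [N HN]. simpl in HN.
    exists (Rmin N c). intros x y Hx Hy.
    pose proof (Rmin_l N c). pose proof (Rmin_r N c).
    assert (A := HN x ltac:(lra)). assert (B := HN y ltac:(lra)).
    apply Rabs_def2 in A. apply Rabs_def2 in B.
    assert (Rbar_lt x b /\ Rbar_lt y b) as [Hxb Hyb].
    { split; (eapply Rbar_lt_trans; [|exact Hcb]); simpl; lra. }
    destruct (Rle_lt_dec y x) as [Hle|Hlt].
    - pose proof (Hdiff x y Hle Hxb). lra.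
    - rewrite nrm_minus_sym. pose proof (Hdiff y x ltac:(lra) Hyb). lra. }
  destruct (HV (fun n => F0 (- INR n))) as [l Hl].
  { intros eps Heps. destruct (Hcau (eps / 2)) as [N HN]; [lra|].
    destruct (nfloor_ex (Rabs N)) as [n Hn]; [apply Rabs_pos|].
    exists (S (S n)). intros p q Hp Hq.
    assert (forall k, (S (S n) <= k)%nat -> - INR k < N).
    { intros k Hk. apply le_INR in Hk. rewrite !S_INR in Hk.
      pose proof (Rle_abs (- N)). rewrite Rabs_Ropp in H. lra. }
    eapply Rle_lt_trans; [apply HN; auto|lra]. }
  exists (fun x => (F0 x : V) -v l). split.
  - intros x Hx. unfold minus.
    replace (f x) with (f x +v 0v) by vec.
    apply deriv_plus; [now apply HF0 | apply deriv_const].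
  - intros eps Heps. destruct (Hcau (eps / 2)) as [N HN]; [lra|].
    exists N. intros x Hx.
    destruct (Hl (eps / 2)) as [k Hk]; [lra|].
    destruct (nfloor_ex (Rabs N)) as [n Hn]; [apply Rabs_pos|].
    set (p := max k (S (S n))).
    assert (Hp : - INR p < N).
    { assert (Hp : INR (S (S n)) <= INR p) by (apply le_INR; unfold p; lia).
      rewrite !S_INR in Hp. pose proof (Rle_abs (- N)). rewrite Rabs_Ropp in H. lra. }
    specialize (Hk p ltac:(unfold p; lia)). specialize (HN x (- INR p) Hx Hp).
    replace ((F0 x : V) -v l -v 0v) with ((F0 x -v F0 (- INR p) : V) +v (F0 (- INR p) -v l)) by vec.
    eapply Rle_trans; [apply nrm_tri|]. lra.
Qed.

Lemma int_exists f g G L : banach V -> is_majorant g G L ->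
  (forall x, cont_at f x) -> (forall x, nrm (f x) <= g x) ->
  exists l, is_int f l.
Proof.
  intros HV HG Hc Hfg.
  destruct (anti_exists p_infty f g G L) as [F HF]; auto; [discriminate|].
  pose proof (maj_p HG) as Hp. apply is_lim_spec in Hp.
  assert (Hdiff : forall x y : R, y <= x -> nrm (F x -v F y) <= G x - G y).
  { intros x y Hyx. apply mean_value_ineq with (f := f) (g := g); auto.
    - intros z _. now apply HF.
    - intros z _. apply HG. }
  assert (Hcau : forall eps, 0 < eps -> exists N, forall x y : R, N < x -> N < y ->
    nrm (F x -v F y : V) <= eps).
  { intros eps Heps. assert (H2 : 0 < eps / 2) by lra.
    destruct (Hp (mkposreal _ H2)) as [N HN]. simpl in HN.
    exists N. intros x y Hx Hy.
    assert (A := HN x Hx). assert (B := HN y Hy).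
    apply Rabs_def2 in A. apply Rabs_def2 in B.
    destruct (Rle_lt_dec y x) as [Hle|Hlt].
    - pose proof (Hdiff x y Hle). lra.
    - rewrite nrm_minus_sym. pose proof (Hdiff y x ltac:(lra)). lra. }
  destruct (HV (fun n => F (INR n))) as [l Hl].
  { intros eps Heps. destruct (Hcau (eps / 2)) as [N HN]; [lra|].
    destruct (nfloor_ex (Rabs N)) as [n Hn]; [apply Rabs_pos|].
    exists (S (S n)). intros p q Hp' Hq.
    assert (forall k, (S (S n) <= k)%nat -> N < INR k).
    { intros k Hk. apply le_INR in Hk. rewrite !S_INR in Hk.
      pose proof (Rle_abs N). lra. }
    eapply Rle_lt_trans; [apply HN; auto|lra]. }
  exists l, F. split; [exact HF|].
  intros eps Heps. destruct (Hcau (eps / 2)) as [N HN]; [lra|].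
  exists N. intros x Hx.
  destruct (Hl (eps / 2)) as [k Hk]; [lra|].
  destruct (nfloor_ex (Rabs N)) as [n Hn]; [apply Rabs_pos|].
  set (p := max k (S (S n))).
  assert (Hp' : N < INR p).
  { assert (Hp' : INR (S (S n)) <= INR p) by (apply le_INR; unfold p; lia).
    rewrite !S_INR in Hp'. pose proof (Rle_abs N). lra. }
  specialize (Hk p ltac:(unfold p; lia)). specialize (HN x (INR p) Hx Hp').
  eapply Rle_trans; [apply (nrm_tri3 _ (F (INR p)))|]. lra.
Qed.

Lemma anti_ext (b : Rbar) f f' F : (forall x : R, Rbar_lt x b -> f x = f' x) ->
  anti b f F -> anti b f' F.
Proof. intros E [H H0]. split; [|exact H0]. intros x Hx. rewrite <- E; auto. Qed.
Lemma anti_plus b f f' F F' : anti b f F -> anti b f' F' ->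
  anti b (fun x => f x +v f' x) (fun x => F x +v F' x).
Proof.
  intros [H H0] [H' H0']. split.
  - intros x Hx. apply deriv_plus; auto.
  - replace (0v : V) with (0v +v 0v : V) by vec. now apply lim_m_plus.
Qed.
Lemma anti_scal b f F (c : C) : anti b f F ->
  anti b (fun x => c *v f x) (fun x => c *v F x).
Proof.
  intros [H H0]. split.
  - intros x Hx. apply (deriv_blin (blin_scalar c)). auto.
  - replace (0v : V) with (c *v 0v : V) by vec. now apply (lim_m_blin (blin_scalar c)).
Qed.
Lemma anti_minus b f f' F F' : anti b f F -> anti b f' F' ->
  anti b (fun x => f x -v f' x) (fun x => F x -v F' x).
Proof.
  intros H H'.
  assert (H2 := anti_plus _ _ _ _ _ H (anti_scal _ _ _ (- RtoC 1)%C H')).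
  destruct H2 as [A B]. split.
  - intros x Hx. replace (f x -v f' x) with (f x +v (- RtoC 1)%C *v f' x) by vec.
    eapply deriv_ext; [|apply A; exact Hx]. intros z; simpl. vec.
  - intros eps Heps. destruct (B eps Heps) as [N HN]. exists N. intros x Hx.
    eapply Rle_trans; [|apply (HN x Hx)]. right. f_equal. vec.
Qed.
Lemma majorant_zero : is_majorant (fun _ => 0) (fun _ => 0) 0.
Proof.
  split.
  - intros. apply (is_derive_const (V := R_NormedModule) 0).
  - apply is_lim_const.
  - apply is_lim_const.
Qed.
Lemma anti_unique b f F F' : anti b f F -> anti b f F' ->
  forall x : R, Rbar_lt x b -> F x = F' x.
Proof.
  intros H H' x Hx.
  pose proof (anti_minus _ _ _ _ _ H H') as H2.
  apply nrm_le_eps_eq. intros eps Heps. apply Rle_trans with 0; [|lra].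
  apply (anti_bound b (fun x => f x -v f x) (fun x => F x -v F' x)
    _ _ _ majorant_zero H2); [|exact Hx].
  intros y _. replace (f y -v f y) with (0v : V) by vec. rewrite nrm_zero. lra.
Qed.
Lemma anti_shift f F c : anti p_infty f F ->
  anti p_infty (fun x => f (x + c)) (fun x => F (x + c)).
Proof.
  intros [H H0]. split.
  - intros x _. apply deriv_shift. now apply H.
  - now apply lim_m_shift.
Qed.

Lemma int_ext f f' l : (forall x, f x = f' x) -> is_int f l -> is_int f' l.
Proof.
  intros E (F & H & Hl). exists F. split; [|exact Hl].
  eapply anti_ext; [|exact H]. auto.
Qed.
Lemma int_plus f f' l l' : is_int f l -> is_int f' l' ->
  is_int (fun x => f x +v f' x) (l +v l').
Proof.
  intros (F & H & Hl) (F' & H' & Hl'). exists (fun x => F x +v F' x).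
  split; [now apply anti_plus | now apply lim_p_plus].
Qed.
Lemma int_scal f l (c : C) : is_int f l -> is_int (fun x => c *v f x) (c *v l).
Proof.
  intros (F & H & Hl). exists (fun x => c *v F x).
  split; [now apply anti_scal | now apply (lim_p_blin (blin_scalar c))].
Qed.
Lemma int_minus f f' l l' : is_int f l -> is_int f' l' ->
  is_int (fun x => f x -v f' x) (l -v l').
Proof.
  intros H H'. replace (l -v l') with (l +v (- RtoC 1)%C *v l') by vec.
  eapply int_ext; [|exact (int_plus _ _ _ _ H (int_scal _ _ (- RtoC 1)%C H'))].
  intros x; simpl. vec.
Qed.
Lemma int_unique f l l' : is_int f l -> is_int f l' -> l = l'.
Proof.
  intros H H'. pose proof (int_minus _ _ _ _ H H') as H2.
  apply nrm_le_eps_eq. intros eps Heps. apply Rle_trans with 0; [|lra].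
  eapply int_bound; [exact majorant_zero | exact H2|].
  intros x. simpl. replace (f x -v f x) with (0v : V) by vec. rewrite nrm_zero. lra.
Qed.
Lemma int_shift f l c : is_int f l -> is_int (fun x => f (x + c)) l.
Proof.
  intros (F & H & Hl). exists (fun x => F (x + c)).
  split; [now apply anti_shift | now apply lim_p_shift].
Qed.
Lemma int_deriv f F : (forall x, has_deriv F x (f x)) -> lim_m F 0v ->
  forall l, lim_p F l -> is_int f l.
Proof. intros H H0 l Hl. exists F. split; [split|]; auto. Qed.
End Integral.

Lemma anti_blin {V W : cspace} {L : V -> W} {K} (HL : blin L K) b f F :
  anti b f F -> anti b (fun x => L (f x)) (fun x => L (F x)).
Proof.
  intros [H H0]. split.
  - intros x Hx. apply (deriv_blin HL). auto.
  - rewrite <- (blin_zero HL). now apply (lim_m_blin HL).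
Qed.
Lemma int_blin {V W : cspace} {L : V -> W} {K} (HL : blin L K) f l :
  is_int f l -> is_int (fun x => L (f x)) (L l).
Proof.
  intros (F & H & Hl). exists (fun x => L (F x)).
  split; [now apply (anti_blin HL) | now apply (lim_p_blin HL)].
Qed.

Section Scalars.
Context {V : cspace}.
Implicit Types f : R -> V.

Lemma deriv_prod (p : R -> C) f x (p' : C) (f' : V) :
  has_deriv p x p' -> has_deriv f x f' ->
  has_deriv (fun x => p x *v f x) x (p' *v f x +v p x *v f').
Proof.
  intros Hp Hf eps Heps.
  pose proof (deriv_cont _ _ _ Hf) as Hc.
  pose proof (Cmod_ge_0 p') as B1. pose proof (Cmod_ge_0 (p x)) as B2.
  pose proof (nrm_ge0 (f x)) as B3.
  set (M := 1 + Cmod p' + Cmod (p x) + nrm (f x)).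
  assert (HM : 1 <= M) by (unfold M; lra).
  assert (He : 0 < eps / (3 * M)) by (apply Rdiv_lt_0_compat; lra).
  destruct (Hp _ He) as (d1 & Hd1 & H1). destruct (Hf _ He) as (d2 & Hd2 & H2).
  destruct (Hc (Rmin 1 (eps / (3 * M)))) as (d3 & Hd3 & H3).
  { apply Rmin_glb_lt; lra. }
  exists (Rmin d1 (Rmin d2 d3)). split; [repeat apply Rmin_glb_lt; assumption|].
  intros h Hh.
  assert (A1 : Rabs h < d1) by (eapply Rlt_le_trans; [exact Hh|apply Rmin_l]).
  assert (A23 : Rabs h < Rmin d2 d3) by (eapply Rlt_le_trans; [exact Hh|apply Rmin_r]).
  assert (A2 : Rabs h < d2) by (eapply Rlt_le_trans; [exact A23|apply Rmin_l]).
  assert (A3 : Rabs h < d3) by (eapply Rlt_le_trans; [exact A23|apply Rmin_r]).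
  specialize (H1 h A1). specialize (H2 h A2). specialize (H3 h A3).
  assert (H3a := Rle_trans _ _ _ H3 (Rmin_l _ _)).
  assert (H3b := Rle_trans _ _ _ H3 (Rmin_r _ _)).
  set (e := eps / (3 * M)) in *.
  change (Cmod (p (x + h)%R - p x - h * p')%C <= e * Rabs h) in H1.
  replace (p (x + h) *v f (x + h) -v p x *v f x -v RtoC h *v (p' *v f x +v p x *v f'))
    with ((p (x + h)%R - p x - h * p')%C *v f (x + h)
      +v (RtoC h * p')%C *v (f (x + h) -v f x)
      +v p x *v (f (x + h) -v f x -v RtoC h *v f')) by vec.
  eapply Rle_trans; [apply nrm_tri|].
  eapply Rle_trans; [apply Rplus_le_compat_r, nrm_tri|].
  rewrite !nrm_scal_eq, Cmod_mult, Cmod_R.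
  assert (Hf1 : nrm (f (x + h)) <= M).
  { replace (f (x + h)) with ((f (x + h) -v f x) +v f x) by vec.
    eapply Rle_trans; [apply nrm_tri|]. unfold M. lra. }
  pose proof (Rabs_pos h) as B4.
  assert (T1 : Cmod (p (x + h)%R - p x - h * p')%C * nrm (f (x + h)) <= e * Rabs h * M).
  { apply Rmult_le_compat; auto; [apply Cmod_ge_0|apply nrm_ge0]. }
  assert (T2 : Rabs h * Cmod p' * nrm (f (x + h) -v f x) <= Rabs h * M * e).
  { apply Rmult_le_compat; auto; [nra|apply nrm_ge0|].
    apply Rmult_le_compat_l; [lra|unfold M; lra]. }
  assert (T3 : Cmod (p x) * nrm (f (x + h) -v f x -v RtoC h *v f') <= M * (e * Rabs h)).
  { apply Rmult_le_compat; auto; [apply nrm_ge0|unfold M; lra]. }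
  assert (E : e * M = eps / 3) by (unfold e; field; lra).
  nra.
Qed.

Lemma cont_prod (p : R -> C) f x : cont_at p x -> cont_at f x ->
  cont_at (fun x => p x *v f x) x.
Proof.
  intros Hp Hf eps Heps.
  pose proof (Cmod_ge_0 (p x)) as B2. pose proof (nrm_ge0 (f x)) as B3.
  set (M := 2 + Cmod (p x) + nrm (f x)).
  assert (HM : 2 <= M) by (unfold M; lra).
  assert (He : 0 < Rmin 1 (eps / (2 * M))).
  { apply Rmin_glb_lt; [lra|apply Rdiv_lt_0_compat; lra]. }
  destruct (Hp _ He) as (d1 & Hd1 & H1). destruct (Hf _ He) as (d2 & Hd2 & H2).
  exists (Rmin d1 d2). split; [repeat apply Rmin_glb_lt; assumption|].
  intros h Hh.
  specialize (H1 h (Rlt_le_trans _ _ _ Hh (Rmin_l _ _))).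
  specialize (H2 h (Rlt_le_trans _ _ _ Hh (Rmin_r _ _))).
  assert (H1b := Rle_trans _ _ _ H1 (Rmin_r _ _)).
  assert (H2a := Rle_trans _ _ _ H2 (Rmin_l _ _)).
  assert (H2b := Rle_trans _ _ _ H2 (Rmin_r _ _)).
  set (e := eps / (2 * M)) in *.
  change (Cmod (p (x + h)%R - p x)%C <= e) in H1b.
  replace (p (x + h) *v f (x + h) -v p x *v f x)
    with ((p (x + h)%R - p x)%C *v f (x + h) +v p x *v (f (x + h) -v f x)) by vec.
  eapply Rle_trans; [apply nrm_tri|]. rewrite !nrm_scal_eq.
  assert (Hf1 : nrm (f (x + h)) <= M).
  { replace (f (x + h)) with ((f (x + h) -v f x) +v f x) by vec.
    eapply Rle_trans; [apply nrm_tri|]. unfold M. lra. }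
  assert (T1 : Cmod (p (x + h)%R - p x)%C * nrm (f (x + h)) <= e * M).
  { apply Rmult_le_compat; auto; [apply Cmod_ge_0|apply nrm_ge0]. }
  assert (T2 : Cmod (p x) * nrm (f (x + h) -v f x) <= M * e).
  { apply Rmult_le_compat; auto; [apply nrm_ge0|unfold M; lra]. }
  assert (E : e * M = eps / 2) by (unfold e; field; lra).
  lra.
Qed.

Lemma deriv_RtoC (g : R -> R) x g' : is_derive g x g' ->
  has_deriv (fun x => RtoC (g x)) x (RtoC g').
Proof.
  intros H eps Heps. apply is_derive_Reals in H.
  destruct (H eps Heps) as [d Hd]. exists d. split; [apply cond_pos|].
  intros h Hh.
  change (Cmod (g (x + h)%R - g x - h * g')%C <= eps * Rabs h).
  rewrite <- !RtoC_minus, <- RtoC_mult, <- RtoC_minus, Cmod_R.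
  destruct (Req_dec h 0) as [->|Hne].
  - rewrite Rplus_0_r, Rabs_R0. replace (g x - g x - 0 * g') with 0 by ring.
    rewrite Rabs_R0. lra.
  - specialize (Hd h Hne Hh).
    replace (g (x + h) - g x - h * g') with (((g (x + h) - g x) / h - g') * h)
      by (field; exact Hne).
    rewrite Rabs_mult. apply Rmult_le_compat_r; [apply Rabs_pos|lra].
Qed.

Lemma cont_RtoC (g : R -> R) x : continuous g x -> cont_at (fun x => RtoC (g x)) x.
Proof.
  intros H eps Heps.
  apply continuity_pt_filterlim in H.
  destruct (H eps Heps) as (d & Hd & Hh). exists d. split; [exact Hd|].
  intros h Hlt.
  change (Cmod (g (x + h)%R - g x)%C <= eps). rewrite <- RtoC_minus, Cmod_R.
  destruct (Req_dec h 0) as [->|Hne].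
  - rewrite Rplus_0_r. replace (g x - g x) with 0 by ring. rewrite Rabs_R0. lra.
  - apply Rlt_le, (Hh (x + h)). split; [split; [exact I|lra]|].
    simpl. unfold Rdist. replace (x + h - x) with h by ring. exact Hlt.
Qed.

Lemma quad_deriv f (d : V) x B r : 0 < r ->
  (forall h, Rabs h < r -> nrm (f (x + h) -v f x -v RtoC h *v d) <= B * h^2) ->
  has_deriv f x d.
Proof.
  intros Hr H eps Heps. pose proof (Rabs_pos B).
  exists (Rmin r (eps / (1 + Rabs B))).
  split; [apply Rmin_glb_lt; [lra|apply Rdiv_lt_0_compat; lra]|].
  intros h Hh. eapply Rle_trans; [apply H; eapply Rlt_le_trans; [exact Hh|apply Rmin_l]|].
  assert (A : Rabs h <= eps / (1 + Rabs B))
    by (apply Rlt_le; eapply Rlt_le_trans; [exact Hh|apply Rmin_r]).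
  apply Rmult_le_compat_l with (r := 1 + Rabs B) in A; [|lra].
  replace ((1 + Rabs B) * (eps / (1 + Rabs B))) with eps in A by (field; lra).
  replace (h^2) with (Rabs h * Rabs h) by (rewrite <- Rabs_mult, Rabs_pos_eq; nra).
  pose proof (Rle_abs B). pose proof (Rabs_pos h). nra.
Qed.

(** Quadratic increments force a zero derivative. Independence of an angle ([mel_int_rot]) and of a
    shift ([power_family_one]) is proved in this way. *)
Lemma quad_const f K a b : a <= b ->
  (forall x y, a <= x <= b -> a <= y <= b -> Rabs (y - x) <= 1 ->
     nrm (f y -v f x) <= K * (y - x)^2) ->
  f b = f a.
Proof.
  intros Hab H.
  (* Clamping to [a, b] extends [f] to the line with the same estimate, so that the derivative is
     two-sided also at the end points. *)
  set (cl := fun x => Rmax a (Rmin b x)).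
  assert (Hcl : forall x, a <= cl x <= b).
  { intros x. unfold cl. split; [apply Rmax_l|]. apply Rmax_lub; [lra|apply Rmin_l]. }
  assert (Hcla : forall x, a <= x <= b -> cl x = x).
  { intros x Hx. unfold cl. rewrite Rmin_right by lra. apply Rmax_right. lra. }
  assert (Hcll : forall x, x < a -> cl x = a).
  { intros x Hx. unfold cl. rewrite Rmin_right by lra. apply Rmax_left. lra. }
  assert (Hclr : forall x, b < x -> cl x = b).
  { intros x Hx. unfold cl. rewrite Rmin_left by lra. apply Rmax_right. lra. }
  assert (Hcl1 : forall x y, Rabs (cl y - cl x) <= Rabs (y - x)).
  { intros x y.
    destruct (Rlt_le_dec x a), (Rlt_le_dec b x), (Rlt_le_dec y a), (Rlt_le_dec b y);
      try lra; rewrite ?(Hcll x), ?(Hcll y), ?(Hclr x), ?(Hclr y), ?(Hcla x), ?(Hcla y) by lra;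
      unfold Rabs; repeat match goal with |- context [Rcase_abs ?u] =>
        destruct (Rcase_abs u) end; lra. }
  rewrite <- (Hcla b), <- (Hcla a) by lra.
  apply (deriv_zero_const (fun x => f (cl x)) a b Hab).
  intros x _. apply (quad_deriv _ _ _ (Rabs K) 1); [lra|]. intros h Hh.
  replace (f (cl (x + h)) -v f (cl x) -v RtoC h *v 0v) with (f (cl (x + h)) -v f (cl x)) by vec.
  specialize (Hcl1 x (x + h)). replace (x + h - x) with h in Hcl1 by ring.
  eapply Rle_trans; [apply H; try apply Hcl; lra|].
  assert (Hp : (cl (x + h) - cl x)^2 <= h^2).
  { rewrite <- (pow2_abs (cl _ - _)), <- (pow2_abs h). apply pow_incr. split; [apply Rabs_pos|exact Hcl1]. }
  pose proof (Rle_abs K). pose proof (Rabs_pos K). pose proof (pow2_ge_0 (cl (x + h) - cl x)). nra.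
Qed.
End Scalars.

Lemma banach_C : banach C_NormedModule.
Proof. exact (banach_complete C_CompleteNormedModule). Qed.

Lemma exp_le_mono x y : x <= y -> exp x <= exp y.
Proof.
  intros [H| ->]; [left; now apply exp_increasing | right; reflexivity].
Qed.

Lemma lim_atan_p (f : R -> R) : is_lim f p_infty p_infty ->
  is_lim (fun x => atan (f x)) p_infty (PI / 2).
Proof.
  intros Hf. apply is_lim_spec. intros eps. apply is_lim_spec in Hf.
  pose proof PI_RGT_0 as HPI.
  set (e := Rmin (eps / 2) (PI / 4)).
  assert (He : 0 < e) by (apply Rmin_glb_lt; [pose proof (cond_pos eps); lra|lra]).
  assert (He1 : e <= eps / 2) by apply Rmin_l.
  assert (He2 : e <= PI / 4) by apply Rmin_r.
  destruct (Hf (tan (PI / 2 - e))) as [N HN]. exists N. intros x Hx.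
  specialize (HN x Hx). apply atan_increasing in HN.
  rewrite atan_tan in HN by lra. pose proof (atan_bound (f x)).
  pose proof (cond_pos eps). apply Rabs_def1; lra.
Qed.

Lemma lim_exp_p (c : R) : 0 < c -> is_lim (fun x => exp (c * x)) p_infty p_infty.
Proof.
  intros Hc. apply is_lim_spec. intros M. exists (M / c). intros x Hx.
  apply Rmult_lt_compat_l with (r := c) in Hx; [|lra].
  replace (c * (M / c)) with M in Hx by (field; lra).
  pose proof (exp_ineq1_le (c * x)). lra.
Qed.
Lemma lim_exp_m (c : R) : 0 < c -> is_lim (fun x => exp (c * x)) m_infty 0.
Proof.
  intros Hc. apply is_lim_spec. intros eps. pose proof (cond_pos eps) as He.
  exists (- / (eps * c)). intros x Hx.
  rewrite Rminus_0_r, Rabs_pos_eq by (left; apply exp_pos).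
  replace (c * x) with (- (c * - x)) by ring. rewrite exp_Ropp.
  assert (Hy : / eps < c * - x).
  { apply Rmult_lt_compat_l with (r := c) in Hx; [|lra].
    replace (c * - / (eps * c)) with (- / eps) in Hx by (field; lra). lra. }
  assert (Hi : 0 < / eps) by now apply Rinv_0_lt_compat.
  pose proof (exp_ineq1_le (c * - x)).
  rewrite <- (Rinv_inv eps). apply Rinv_lt_contravar; [|lra].
  apply Rmult_lt_0_compat; [exact Hi | apply exp_pos].
Qed.

Lemma majorant_scal g G L c : is_majorant g G L ->
  is_majorant (fun x => c * g x) (fun x => c * G x) (c * L).
Proof.
  intros [H1 H2 H3]. split.
  - intros x. apply (is_derive_scal G x c (g x)), H1.
  - replace (Finite 0) with (Rbar_mult c 0) by (simpl; f_equal; ring).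
    now apply (is_lim_scal_l G c m_infty 0).
  - exact (is_lim_scal_l G c p_infty L H3).
Qed.


(** The weight is at most exp (- d |x|) with d = min (c, 1 - c), and the derivative of the logistic
    function exp (d x) / (1 + exp (d x)) decays at the same rate; the factor 4 makes up for its
    squared denominator. *)
Lemma mel_majorant c : 0 < c < 1 -> exists g G L, is_majorant g G L /\
  forall x, exp (c * x) / (1 + exp x) <= g x.
Proof.
  intros Hc. set (d := Rmin c (1 - c)).
  assert (Hd : 0 < d) by (apply Rmin_glb_lt; lra).
  assert (Hd1 : d <= c) by apply Rmin_l. assert (Hd2 : d <= 1 - c) by apply Rmin_r.
  exists (fun x => 4 / d * (d * exp (d * x) / (1 + exp (d * x))^2)),
    (fun x => 4 / d * (exp (d * x) / (1 + exp (d * x)))), (4 / d * 1).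
  split.
  - apply majorant_scal. split.
    + intros x. pose proof (exp_pos (d * x)). auto_derive; [lra|]. field. lra.
    + apply is_lim_ext with (fun x => 1 - / (1 + exp (d * x))).
      { intros x. pose proof (exp_pos (d * x)). field. lra. }
      replace (Finite 0) with (Finite (1 - / (1 + 0))) by (f_equal; field).
      apply (is_lim_minus' (fun _ => 1)); [apply is_lim_const|].
      apply (is_lim_inv _ _ (1 + 0)).
      * apply (is_lim_plus' (fun _ => 1)); [apply is_lim_const|now apply lim_exp_m].
      * intros H; injection H; lra.
    + apply is_lim_ext with (fun x => 1 - / (1 + exp (d * x))).
      { intros x. pose proof (exp_pos (d * x)). field. lra. }
      replace (Finite 1) with (Finite (1 - 0)) by (f_equal; field).
      apply (is_lim_minus' (fun _ => 1)); [apply is_lim_const|].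
      replace (Finite 0) with (Rbar_inv p_infty) by reflexivity.
      apply is_lim_inv; [|discriminate].
      eapply is_lim_plus; [apply is_lim_const|now apply lim_exp_p|reflexivity].
  - intros x.
    pose proof (exp_pos (d * x)) as E1. pose proof (exp_pos (c * x)) as E2.
    pose proof (exp_pos x) as E3.
    replace (4 / d * (d * exp (d * x) / (1 + exp (d * x))^2)) with
      (4 * exp (d * x) / (1 + exp (d * x))^2) by (field; lra).
    assert (Hdiv : exp (c * x) * (1 + exp (d * x))^2 <= 4 * exp (d * x) * (1 + exp x)).
    { destruct (Rle_lt_dec 0 x) as [Hx|Hx].
      - assert (F1 : exp (c * x) * exp (d * x) <= exp x).
        { rewrite <- exp_plus. apply exp_le_mono. nra. }
        assert (F2 : 1 <= exp (d * x)).
        { rewrite <- exp_0. apply exp_le_mono. nra. }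
        nra.
      - assert (F1 : exp (c * x) <= exp (d * x)) by (apply exp_le_mono; nra).
        assert (F2 : exp (d * x) <= 1).
        { rewrite <- exp_0. apply exp_le_mono. nra. }
        nra. }
    apply Rmult_le_reg_r with ((1 + exp x) * (1 + exp (d * x))^2); [nra|].
    replace (exp (c * x) / (1 + exp x) * ((1 + exp x) * (1 + exp (d * x))^2)) with
      (exp (c * x) * (1 + exp (d * x))^2) by (field; lra).
    replace (4 * exp (d * x) / (1 + exp (d * x))^2 * ((1 + exp x) * (1 + exp (d * x))^2))
      with (4 * exp (d * x) * (1 + exp x)) by (field; lra).
    exact Hdiv.
Qed.

(* From the substitution t = exp x in the integral of t^(-1/2) s / (s^2 + t). *)
Lemma atan_majorant s : 0 < s ->
  is_majorant (fun x => s * exp (/ 2 * x) / (s^2 + exp x))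
    (fun x => 2 * atan (exp (/ 2 * x) / s)) PI.
Proof.
  intros Hs.
  assert (Hp : is_lim (fun x => exp (/ 2 * x) / s) p_infty p_infty).
  { replace p_infty with (Rbar_mult p_infty (/ s)) at 2.
    - apply (is_lim_scal_r (fun x => exp (/ 2 * x)) (/ s) p_infty p_infty).
      apply lim_exp_p. lra.
    - simpl. assert (0 < / s) by now apply Rinv_0_lt_compat.
      destruct (Rle_dec 0 (/ s)) as [r|]; [|lra].
      destruct (Rle_lt_or_eq_dec 0 (/ s) r); [reflexivity|lra]. }
  split.
  - intros x. pose proof (exp_pos x) as E.
    assert (E2 : exp x = exp (/ 2 * x) * exp (/ 2 * x)).
    { rewrite <- exp_plus. f_equal. lra. }
    pose proof (exp_pos (/ 2 * x)) as E1.
    auto_derive; [lra|]. rewrite E2. field. split; nra.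
  - replace (Finite 0) with (Rbar_mult 2 (atan 0)) by (rewrite atan_0; simpl; f_equal; ring).
    apply (is_lim_scal_l (fun x => atan (exp (/ 2 * x) / s)) 2 m_infty (atan 0)).
    apply is_lim_comp_continuous.
    + replace (Finite 0) with (Finite (0 * / s)) by (f_equal; ring).
      apply (is_lim_scal_r (fun x => exp (/ 2 * x)) (/ s) m_infty 0).
      apply lim_exp_m. lra.
    + apply continuity_pt_filterlim, derivable_continuous_pt, derivable_pt_atan.
  - replace (Finite PI) with (Rbar_mult 2 (PI / 2)) by (simpl; f_equal; field).
    apply (is_lim_scal_l (fun x => atan (exp (/ 2 * x) / s)) 2 p_infty (PI / 2)).
    now apply lim_atan_p.
Qed.

(** * Mellin-type integrals of a resolvent *)

(** The two properties of a resolvent (lam + A)^(-1) on which the Mellin integrals rest, stated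
    without an operator. They are applied to the scalar 1 / (1 + lam), to A, to its shifts, to its
    square root and to [Lambda]. *)
Record resfam {V : cspace} (D : C -> Prop) (K : R) (Psi : C -> V -> V) : Prop := Resfam {
  rf_K : 0 <= K;
  rf_lin : forall lam, D lam -> blin (Psi lam) (K / (1 + Cmod lam));
  rf_id : forall lam mu, D lam -> D mu -> forall y,
    Psi lam y -v Psi mu y = (mu - lam)%C *v Psi lam (Psi mu y)
}.
Arguments rf_K {V D K Psi} _.
Arguments rf_lin {V D K Psi} _ _ _.
Arguments rf_id {V D K Psi} _ _ _ _ _ _.

Lemma rf_comm {V : cspace} {D K} {Psi : C -> V -> V} (HR : resfam D K Psi) lam mu y :
  D lam -> D mu -> Psi lam (Psi mu y) = Psi mu (Psi lam y).
Proof.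
  intros Hl Hm. destruct (classic (lam = mu)) as [->|Hne]; [reflexivity|].
  assert (H : (mu - lam)%C *v Psi lam (Psi mu y) = (mu - lam)%C *v Psi mu (Psi lam y)).
  { rewrite <- (rf_id HR) by assumption.
    transitivity ((- RtoC 1)%C *v (Psi mu y -v Psi lam y)); [vec|].
    rewrite (rf_id HR) by assumption. vec. }
  assert (H0 : (mu - lam)%C <> RtoC 0).
  { intros E. apply Hne. replace mu with ((mu - lam) + lam)%C by ring. rewrite E. ring. }
  apply (f_equal (fun z => (/ (mu - lam))%C *v z)) in H.
  rewrite !Cscal_assoc in H.
  change (mult (/ (mu - lam))%C (mu - lam)%C) with ((/ (mu - lam)) * (mu - lam))%C in H.
  rewrite (Cinv_l _ H0), !Cscal_one in H. exact H.
Qed.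

(** * Logarithmic polar coordinates *)

Definition pol (x th : R) : C := (RtoC (exp x) * cis th)%C.
(** The power [c] of [pol x th] on the branch continuous in [th]; the angle is not reduced modulo 2
    PI, so that a full turn shows as a factor ([mel_2PI]). *)
Definition ep (c x th : R) : C := (RtoC (exp (c * x)) * cis (c * th))%C.

Lemma Cmod_cis th : Cmod (cis th) = 1.
Proof.
  unfold Cmod, cis; simpl. transitivity (sqrt 1); [f_equal|apply sqrt_1].
  pose proof (sin2_cos2 th). unfold Rsqr in H. lra.
Qed.
Lemma cis_plus a b : cis (a + b) = (cis a * cis b)%C.
Proof.
  unfold cis, Cmult; simpl. rewrite cos_plus, sin_plus. f_equal; ring.
Qed.
Lemma cis_0 : cis 0 = RtoC 1.
Proof. unfold cis. now rewrite cos_0, sin_0. Qed.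
Lemma Cmod_pol x th : Cmod (pol x th) = exp x.
Proof.
  unfold pol. rewrite Cmod_mult, Cmod_cis, Cmod_R, Rabs_pos_eq; [ring|].
  left; apply exp_pos.
Qed.
Lemma Cmod_ep c x th : Cmod (ep c x th) = exp (c * x).
Proof.
  unfold ep. rewrite Cmod_mult, Cmod_cis, Cmod_R, Rabs_pos_eq; [ring|].
  left; apply exp_pos.
Qed.
Lemma pol_0 x : pol x 0 = RtoC (exp x).
Proof. unfold pol. rewrite cis_0. ring. Qed.
Lemma ep_0 c x : ep c x 0 = RtoC (exp (c * x)).
Proof. unfold ep. rewrite Rmult_0_r, cis_0. ring. Qed.

Lemma cis_deriv (k x : R) : has_deriv (fun t => cis (k * t)) x (Ci * RtoC k * cis (k * x))%C.
Proof.
  assert (H : has_deriv (fun t => RtoC (cos (k * t)) +v Ci *v RtoC (sin (k * t))) x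
     (RtoC (- k * sin (k * x)) +v Ci *v RtoC (k * cos (k * x)))).
  { apply deriv_plus.
    - apply (deriv_RtoC (fun t => cos (k * t))). auto_derive; [exact I|]. ring.
    - apply (deriv_blin (blin_scalar (V := C_NormedModule) Ci)).
      apply (deriv_RtoC (fun t => sin (k * t))). auto_derive; [exact I|]. ring. }
  replace (Ci * RtoC k * cis (k * x))%C with
    (RtoC (- k * sin (k * x)) +v Ci *v RtoC (k * cos (k * x))).
  - eapply deriv_ext; [|exact H]. intros t.
    change (RtoC (cos (k * t)) + Ci * RtoC (sin (k * t)) = cis (k * t))%C.
    unfold cis, RtoC, Ci, Cplus, Cmult; simpl. f_equal; ring.
  - change (RtoC (- k * sin (k * x)) + Ci * RtoC (k * cos (k * x)) = Ci * RtoC k * cis (k * x))%C.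
    unfold cis, RtoC, Ci, Cplus, Cmult; simpl. f_equal; ring.
Qed.

Lemma Cmod_Ci : Cmod Ci = 1.
Proof. unfold Cmod, Ci; simpl. transitivity (sqrt 1); [f_equal; ring|apply sqrt_1]. Qed.

Lemma cis_incr1_pos h : 0 <= h -> Cmod (cis h - RtoC 1) <= h.
Proof.
  intros Hh.
  assert (H := mean_value_ineq (V := C_NormedModule) (fun t => cis (1 * t))
      (fun x => (Ci * RtoC 1 * cis (1 * x))%C) (fun x => x) (fun _ => 1) 0 h Hh).
  assert (H' : Cmod (cis (1 * h) - cis (1 * 0))%C <= h - 0).
  { apply H; clear H.
    - intros x _. apply cis_deriv.
    - intros x _. apply (is_derive_id (K := R_AbsRing)).
    - intros x _. change (Cmod (Ci * RtoC 1 * cis (1 * x))%C <= 1).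
      rewrite !Cmod_mult, Cmod_Ci, Cmod_cis, Cmod_1. lra. }
  rewrite Rmult_1_l, Rmult_0_r, cis_0 in H'. lra.
Qed.
Lemma cis_incr2_pos h : 0 <= h -> Cmod (cis h - RtoC 1 - Ci * h) <= h^2.
Proof.
  intros Hh.
  assert (H := mean_value_ineq (V := C_NormedModule)
      (fun t => cis (1 * t) +v (RtoC t *v (- Ci)%C))
      (fun x => (Ci * RtoC 1 * cis (1 * x))%C +v (RtoC 1 *v (- Ci)%C +v RtoC x *v RtoC 0))
      (fun x => x^2/2) (fun x => x) 0 h Hh).
  assert (H' : Cmod ((cis (1 * h) + (RtoC h * - Ci)) - (cis (1 * 0) + (RtoC 0 * - Ci)))%C
    <= h^2/2 - 0^2/2).
  { apply H; clear H.
    - intros x _. apply (deriv_plus (V := C_NormedModule)); [apply cis_deriv|].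
      apply (deriv_prod (V := C_NormedModule) (fun t => RtoC t) (fun _ => (- Ci)%C)).
      + apply (deriv_RtoC (fun t => t)). apply (is_derive_id (K := R_AbsRing)).
      + apply (deriv_const (V := C_NormedModule)).
    - intros x _. auto_derive; [exact I|]. field.
    - intros x Hx.
      change (Cmod (Ci * RtoC 1 * cis (1 * x) + (RtoC 1 * - Ci + RtoC x * RtoC 0))%C <= x).
      replace (Ci * RtoC 1 * cis (1 * x) + (RtoC 1 * - Ci + RtoC x * RtoC 0))%C
        with (Ci * (cis x - RtoC 1))%C by (rewrite (Rmult_1_l x); ring).
      rewrite Cmod_mult, Cmod_Ci, Rmult_1_l. apply cis_incr1_pos. lra. }
  rewrite Rmult_1_l, Rmult_0_r, cis_0 in H'.
  replace (cis h - RtoC 1 - Ci * h)%C with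
    (cis h + (RtoC h * - Ci) - (RtoC 1 + RtoC 0 * - Ci))%C by ring.
  nra.
Qed.
Lemma cis_incr1 h : Cmod (cis h - RtoC 1) <= Rabs h.
Proof.
  unfold Rabs. destruct (Rcase_abs h) as [Hh|Hh]; [|apply cis_incr1_pos; lra].
  replace (Cmod (cis h - RtoC 1)) with (Cmod (cis (- h) - RtoC 1)); [apply cis_incr1_pos; lra|].
  unfold Cmod, cis; simpl. rewrite cos_neg, sin_neg. f_equal. ring.
Qed.
Lemma cis_incr2 h : Cmod (cis h - RtoC 1 - Ci * h) <= h^2.
Proof.
  destruct (Rle_lt_dec 0 h) as [Hh|Hh]; [apply cis_incr2_pos; lra|].
  replace (Cmod (cis h - RtoC 1 - Ci * h)) with (Cmod (cis (- h) - RtoC 1 - Ci * (- h)%R)).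
  - replace (h^2) with ((- h)^2) by ring. apply cis_incr2_pos; lra.
  - unfold Cmod, cis; simpl. rewrite cos_neg, sin_neg. f_equal. ring.
Qed.
Lemma exp_incr2 h : Rabs h <= / 2 -> Rabs (exp h - 1 - h) <= 2 * h^2.
Proof.
  intros Hh. apply Rabs_le_between in Hh.
  pose proof (exp_ineq1_le h) as H1. pose proof (exp_ineq1_le (- h)) as H2.
  rewrite exp_Ropp in H2. pose proof (exp_pos h) as E.
  assert (H3 : exp h * (1 - h) <= 1).
  { apply Rmult_le_compat_l with (r := exp h) in H2; [|lra].
    rewrite Rinv_r in H2; lra. }
  rewrite Rabs_pos_eq by lra.
  assert (exp h <= 2) by nra. nra.
Qed.
Lemma exp_incr1 h : Rabs h <= / 2 -> Rabs (exp h - 1) <= 2 * Rabs h.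
Proof.
  intros Hh. pose proof (exp_incr2 h Hh).
  replace (exp h - 1) with ((exp h - 1 - h) + h) by ring.
  eapply Rle_trans; [apply Rabs_triang|].
  assert (h^2 = Rabs h * Rabs h) by (rewrite <- Rabs_mult, Rabs_pos_eq; nra).
  pose proof (Rabs_pos h). nra.
Qed.

Section Mellin.
Context {V : cspace} {D : C -> Prop} {K : R} {Psi : C -> V -> V}.
Hypothesis HR : resfam D K Psi.

(** With lam = exp (x + i th) and d lam = lam dx, the integral of lam^(c - 1) Psi(lam) y along a ray
    becomes an integral over the line with this integrand. The power A^(-a) uses c = 1 - a. *)
Definition mel (c : R) (y : V) (th x : R) : V := ep c x th *v Psi (pol x th) y.
(** The derivative of [mel] in [x], from d Psi / d lam = - Psi^2. The derivative in [th] is [Ci]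
    times it: the Cauchy-Riemann equation in the variable x + i th. *)
Definition melD (c : R) (y : V) (th x : R) : V :=
  RtoC c *v mel c y th x -v (ep c x th * pol x th)%C *v Psi (pol x th) (Psi (pol x th) y).

(** One summand for each of the terms T1 to T4 in the estimate that follows. *)
Let incr_const (c k : R) := 3 * k * K + 3 * Rabs c * k * K^2 + 3 * k^2 * K^3 + k * K^2.


(* Second-order Taylor estimate of [q Psi(lam) y] when [lam] is multiplied by
   [exp zeta] and [q] by [exp (c zeta)]. *)
Lemma incr_estimate (c k : R) (y : V) (lam lam' q q' zeta : C) :
  0 <= k -> D lam -> D lam' -> 1 + Cmod lam <= 3 * (1 + Cmod lam') ->
  Cmod (q' - q - zeta * RtoC c * q) <= k * Cmod zeta^2 * Cmod q ->
  Cmod (lam' - lam - zeta * lam) <= k * Cmod zeta^2 * Cmod lam ->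
  Cmod (lam' - lam) <= k * Cmod zeta * Cmod lam ->
  nrm (q' *v Psi lam' y -v q *v Psi lam y
       -v zeta *v (RtoC c *v (q *v Psi lam y) -v (q * lam)%C *v Psi lam (Psi lam y)))
  <= incr_const c k * (Cmod zeta^2 * (Cmod q / (1 + Cmod lam)) * nrm y).
Proof.
  intros Hk Hl Hl' Hm Hq Hd2 Hd1.
  pose proof (rf_K HR) as HK.
  set (m := 1 + Cmod lam) in *.
  pose proof (Cmod_ge_0 lam) as L0. pose proof (Cmod_ge_0 lam') as L1.
  pose proof (Cmod_ge_0 zeta) as Z0. pose proof (Cmod_ge_0 q) as Q0.
  pose proof (nrm_ge0 y) as Y0. pose proof (Rabs_pos c) as C0.
  assert (Hm1 : 1 <= m) by (unfold m; lra).
  assert (Lm : Cmod lam <= m) by (unfold m; lra).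
  set (u := / m). assert (U0 : 0 < u) by (apply Rinv_0_lt_compat; lra).
  assert (Um : u * m = 1) by (unfold u; field; lra).
  assert (P1 : forall z, nrm (Psi lam z) <= K * u * nrm z) by (intros; apply (rf_lin HR); auto).
  assert (P2 : forall z, nrm (Psi lam' z) <= 3 * K * u * nrm z).
  { intros z. eapply Rle_trans; [apply (rf_lin HR); auto|].
    apply Rmult_le_compat_r; [apply nrm_ge0|].
    apply Rmult_le_reg_r with ((1 + Cmod lam') * m); [nra|].
    replace (K / (1 + Cmod lam') * ((1 + Cmod lam') * m)) with (K * m) by (field; lra).
    replace (3 * K * u * ((1 + Cmod lam') * m)) with (K * (3 * (1 + Cmod lam')) * (u * m)) by ring.
    rewrite Um. nra. }
  assert (E1 : Psi lam' y -v Psi lam y = (lam - lam')%C *v Psi lam' (Psi lam y))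
    by (apply (rf_id HR); auto).
  assert (E2 : Psi lam' (Psi lam y) -v Psi lam (Psi lam y)
     = (lam - lam')%C *v Psi lam' (Psi lam (Psi lam y)))
    by (apply (rf_id HR); auto).
  (* Two applications of the resolvent identity separate the second-order errors of [q] and of [lam]
     from two products of first-order increments. *)
  replace (q' *v Psi lam' y -v q *v Psi lam y
       -v zeta *v (RtoC c *v (q *v Psi lam y) -v (q * lam)%C *v Psi lam (Psi lam y)))
  with ((q' - q - zeta * RtoC c * q)%C *v Psi lam' y
     +v (zeta * RtoC c * q * (lam - lam'))%C *v Psi lam' (Psi lam y)
     +v ((q * (lam - lam') * (lam - lam'))%C *v Psi lam' (Psi lam (Psi lam y))
       +v (- q * (lam' - lam - zeta * lam))%C *v Psi lam (Psi lam y))).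
  2:{ transitivity ((q' - q - zeta * RtoC c * q)%C *v Psi lam' y
       +v (zeta * RtoC c * q)%C *v ((lam - lam')%C *v Psi lam' (Psi lam y))
       +v ((q * (lam - lam'))%C *v ((lam - lam')%C *v Psi lam' (Psi lam (Psi lam y)))
       +v (- q * (lam' - lam - zeta * lam))%C *v Psi lam (Psi lam y))); [vec|].
      rewrite <- E2, <- E1.
      transitivity ((q' - q)%C *v Psi lam' y -v (zeta * RtoC c * q)%C *v Psi lam y
        +v (q *v ((lam - lam')%C *v Psi lam' (Psi lam y)) +v (q * zeta * lam)%C *v Psi lam (Psi lam y))); [vec|].
      rewrite <- E1. vec. }
  eapply Rle_trans; [apply nrm_tri|].
  eapply Rle_trans; [apply Rplus_le_compat; apply nrm_tri|].
  rewrite !nrm_scal_eq, !Cmod_mult, Cmod_opp, Cmod_R.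
  replace (Cmod (lam - lam')) with (Cmod (lam' - lam))
    by (rewrite <- Cmod_opp; f_equal; ring).
  set (Z := Cmod zeta) in *. set (Q := Cmod q) in *. set (Y := nrm y) in *.
  set (d := Cmod (lam' - lam)%C) in *. set (l := Cmod lam) in *.
  assert (D0 : 0 <= d) by apply Cmod_ge_0.
  assert (Hd1' : d <= k * Z * m).
  { eapply Rle_trans; [exact Hd1|]. apply Rmult_le_compat_l; [nra|lra]. }
  assert (Hd2' : Cmod (lam' - lam - zeta * lam) <= k * Z^2 * m).
  { eapply Rle_trans; [exact Hd2|]. apply Rmult_le_compat_l; [|lra].
    apply Rmult_le_pos; [lra|apply pow_le; lra]. }
  assert (N1 : nrm (Psi lam y) <= K * u * Y) by apply P1.
  assert (KU : 0 <= K * u) by nra.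
  assert (N2 : nrm (Psi lam (Psi lam y)) <= K * u * (K * u * Y)).
  { eapply Rle_trans; [apply P1|]. apply Rmult_le_compat_l; auto. }
  assert (N3 : nrm (Psi lam' y) <= 3 * K * u * Y) by apply P2.
  assert (N4 : nrm (Psi lam' (Psi lam y)) <= 3 * K * u * (K * u * Y)).
  { eapply Rle_trans; [apply P2|]. apply Rmult_le_compat_l; [nra|auto]. }
  assert (N5 : nrm (Psi lam' (Psi lam (Psi lam y))) <= 3 * K * u * (K * u * (K * u * Y))).
  { eapply Rle_trans; [apply P2|]. apply Rmult_le_compat_l; [nra|auto]. }
  assert (ZZ : 0 <= Z^2) by (apply pow_le; lra).
  assert (T1 : Cmod (q' - q - zeta * RtoC c * q) * nrm (Psi lam' y)
    <= k * Z^2 * Q * (3 * K * u * Y)).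
  { apply Rmult_le_compat; auto; [apply Cmod_ge_0|apply nrm_ge0]. }
  assert (T2 : Z * Rabs c * Q * d * nrm (Psi lam' (Psi lam y))
    <= Z * Rabs c * Q * (k * Z * m) * (3 * K * u * (K * u * Y))).
  { apply Rmult_le_compat; auto; [|apply nrm_ge0|].
    - repeat apply Rmult_le_pos; auto.
    - apply Rmult_le_compat_l; auto. repeat apply Rmult_le_pos; auto. }
  assert (T3 : Q * d * d * nrm (Psi lam' (Psi lam (Psi lam y)))
    <= Q * (k * Z * m) * (k * Z * m) * (3 * K * u * (K * u * (K * u * Y)))).
  { apply Rmult_le_compat; auto; [|apply nrm_ge0|].
    - repeat apply Rmult_le_pos; auto.
    - apply Rmult_le_compat; auto; [nra|]. apply Rmult_le_compat_l; auto. }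
  assert (T4 : Q * Cmod (lam' - lam - zeta * lam) * nrm (Psi lam (Psi lam y))
    <= Q * (k * Z^2 * m) * (K * u * (K * u * Y))).
  { apply Rmult_le_compat; auto; [|apply nrm_ge0|].
    - apply Rmult_le_pos; auto. apply Cmod_ge_0.
    - apply Rmult_le_compat_l; auto. }
  replace (Q / m) with (Q * u) by reflexivity.
  replace (Z * Rabs c * Q * (k * Z * m) * (3 * K * u * (K * u * Y))) with
    (3 * Rabs c * k * K^2 * (Z^2 * (Q * u) * Y) * (u * m)) in T2 by ring.
  replace (Q * (k * Z * m) * (k * Z * m) * (3 * K * u * (K * u * (K * u * Y)))) with
    (3 * k^2 * K^3 * (Z^2 * (Q * u) * Y) * (u * m) * (u * m)) in T3 by ring.
  replace (Q * (k * Z^2 * m) * (K * u * (K * u * Y))) with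
    (k * K^2 * (Z^2 * (Q * u) * Y) * (u * m)) in T4 by ring.
  rewrite Um, !Rmult_1_r in T2, T3, T4.
  unfold incr_const.
  replace (k * Z^2 * Q * (3 * K * u * Y)) with (3 * k * K * (Z^2 * (Q * u) * Y)) in T1 by ring.
  lra.
Qed.

Lemma mel_nrm c y th x : D (pol x th) ->
  nrm (mel c y th x) <= K * nrm y * (exp (c * x) / (1 + exp x)).
Proof.
  intros H. unfold mel. rewrite nrm_scal_eq, Cmod_ep.
  pose proof (blin_nrm (rf_lin HR _ H) y) as H1. rewrite Cmod_pol in H1.
  pose proof (exp_pos (c * x)). pose proof (exp_pos x).
  apply Rmult_le_compat_l with (r := exp (c * x)) in H1; [|lra].
  eapply Rle_trans; [exact H1|]. right. field. lra.
Qed.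

Lemma mel_incr_th c y th th' x : 0 <= c <= 1 -> D (pol x th) -> D (pol x th') ->
  nrm (mel c y th' x -v mel c y th x -v (Ci * RtoC (th' - th))%C *v melD c y th x)
  <= incr_const c 1 * nrm y * (th' - th)^2 * (exp (c * x) / (1 + exp x)).
Proof.
  intros Hc Hl Hl'. set (h := th' - th).
  assert (HZ : Cmod (Ci * RtoC h) = Rabs h) by now rewrite Cmod_mult, Cmod_Ci, Cmod_R, Rmult_1_l.
  assert (HZ2 : Rabs h^2 = h^2) by now rewrite pow2_abs.
  pose proof (incr_estimate c 1 y (pol x th) (pol x th') (ep c x th) (ep c x th')
    (Ci * RtoC h)%C) as H.
  rewrite HZ, HZ2, !Cmod_pol, Cmod_ep in H.
  eapply Rle_trans; [apply H|right; ring]; clear H; auto; [lra|pose proof (exp_pos x); lra| | |].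
  - replace (ep c x th') with (ep c x th * cis (c * h))%C.
    2:{ unfold ep. rewrite <- Cmult_assoc, <- cis_plus. do 2 f_equal. unfold h. ring. }
    replace (ep c x th * cis (c * h) - ep c x th - Ci * RtoC h * RtoC c * ep c x th)%C with
      (ep c x th * (cis (c * h) - RtoC 1 - Ci * RtoC (c * h)))%C by (rewrite RtoC_mult; ring).
    rewrite Cmod_mult, Cmod_ep. rewrite Rmult_comm, Rmult_1_l.
    apply Rmult_le_compat_r; [left; apply exp_pos|].
    eapply Rle_trans; [apply cis_incr2|]. rewrite Rpow_mult_distr.
    pose proof (pow2_ge_0 h). assert (c^2 <= 1) by nra. nra.
  - replace (pol x th') with (pol x th * cis h)%C.
    2:{ unfold pol. rewrite <- Cmult_assoc, <- cis_plus. do 2 f_equal. unfold h. ring. }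
    replace (pol x th * cis h - pol x th - Ci * RtoC h * pol x th)%C with
      (pol x th * (cis h - RtoC 1 - Ci * RtoC h))%C by ring.
    rewrite Cmod_mult, Cmod_pol. rewrite Rmult_comm, Rmult_1_l.
    apply Rmult_le_compat_r; [left; apply exp_pos|]. apply cis_incr2.
  - replace (pol x th') with (pol x th * cis h)%C.
    2:{ unfold pol. rewrite <- Cmult_assoc, <- cis_plus. do 2 f_equal. unfold h. ring. }
    replace (pol x th * cis h - pol x th)%C with
      (pol x th * (cis h - RtoC 1))%C by ring.
    rewrite Cmod_mult, Cmod_pol. rewrite Rmult_comm, Rmult_1_l.
    apply Rmult_le_compat_r; [left; apply exp_pos|]. apply cis_incr1.
Qed.

(** The case c = 0 is included because it gives the continuity of the resolvent itself in
    [res_cont]. *)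
Lemma mel_deriv c y th x r : 0 <= c <= 1 -> 0 < r ->
  (forall h, Rabs h < r -> D (pol (x + h) th)) ->
  has_deriv (mel c y th) x (melD c y th x).
Proof.
  intros Hc Hr HD.
  assert (Hl : D (pol x th)).
  { rewrite <- (Rplus_0_r x). apply HD. rewrite Rabs_R0. exact Hr. }
  apply (quad_deriv _ _ _ (incr_const c 2 * ((exp (c * x) / (1 + exp x)) * nrm y)) (Rmin r (/ 2))).
  { apply Rmin_glb_lt; lra. }
  intros h Hh.
  assert (A1 : Rabs h < r) by (eapply Rlt_le_trans; [exact Hh|apply Rmin_l]).
  assert (A2 : Rabs h <= / 2) by (apply Rlt_le; eapply Rlt_le_trans; [exact Hh|apply Rmin_r]).
  pose proof (exp_pos x) as E. pose proof (exp_pos h) as Eh. pose proof (exp_pos (c * x)) as Ec.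
  assert (Hch : Rabs (c * h) <= / 2).
  { rewrite Rabs_mult, (Rabs_pos_eq c) by lra. pose proof (Rabs_pos h). nra. }
  assert (HZ2 : Rabs h^2 = h^2) by now rewrite pow2_abs.
  pose proof (incr_estimate c 2 y (pol x th) (pol (x + h) th) (ep c x th) (ep c (x + h) th)
    (RtoC h)) as H.
  rewrite Cmod_R, HZ2, !Cmod_pol, Cmod_ep in H.
  eapply Rle_trans; [apply H|]; clear H; auto; [lra| | | | |].
  (* As |h| <= 1/2, exp h is at least 1/3: this comparison of moduli is covered by the factor 3 in
     [incr_estimate]. *)
  - pose proof (exp_incr1 h A2). apply Rabs_le_between in A2.
    apply Rabs_le_between in H. rewrite exp_plus.
    assert (H3 : / 3 <= exp h); [|nra].
    pose proof (exp_ineq1_le h). lra.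
  - replace (ep c (x + h) th) with (RtoC (exp (c * h)) * ep c x th)%C.
    2:{ unfold ep. rewrite Rmult_plus_distr_l, exp_plus, RtoC_mult. ring. }
    replace (RtoC (exp (c * h)) * ep c x th - ep c x th - RtoC h * RtoC c * ep c x th)%C with
      (RtoC (exp (c * h) - 1 - c * h) * ep c x th)%C.
    2:{ rewrite !RtoC_minus, RtoC_mult. ring. }
    rewrite Cmod_mult, Cmod_ep, Cmod_R. apply Rmult_le_compat_r; [lra|].
    eapply Rle_trans; [apply exp_incr2, Hch|]. rewrite Rpow_mult_distr.
    pose proof (pow2_ge_0 h). assert (c^2 <= 1) by nra. nra.
  - replace (pol (x + h) th) with (RtoC (exp h) * pol x th)%C.
    2:{ unfold pol. rewrite exp_plus, RtoC_mult. ring. }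
    replace (RtoC (exp h) * pol x th - pol x th - RtoC h * pol x th)%C with
      (RtoC (exp h - 1 - h) * pol x th)%C.
    2:{ rewrite !RtoC_minus. ring. }
    rewrite Cmod_mult, Cmod_pol, Cmod_R. apply Rmult_le_compat_r; [lra|].
    now apply exp_incr2.
  - replace (pol (x + h) th) with (RtoC (exp h) * pol x th)%C.
    2:{ unfold pol. rewrite exp_plus, RtoC_mult. ring. }
    replace (RtoC (exp h) * pol x th - pol x th)%C with
      (RtoC (exp h - 1) * pol x th)%C.
    2:{ rewrite !RtoC_minus. ring. }
    rewrite Cmod_mult, Cmod_pol, Cmod_R. apply Rmult_le_compat_r; [lra|].
    now apply exp_incr1.
  - right. ring.
Qed.

Lemma mel_deriv_th c y th x r : 0 <= c <= 1 -> 0 < r ->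
  (forall h, Rabs h < r -> D (pol x (th + h))) ->
  has_deriv (fun th => mel c y th x) th (Ci *v melD c y th x).
Proof.
  intros Hc Hr HD.
  apply (quad_deriv _ _ _ (incr_const c 1 * nrm y * (exp (c * x) / (1 + exp x))) r Hr).
  intros h Hh.
  assert (Hl : D (pol x th)).
  { rewrite <- (Rplus_0_r th). apply HD. rewrite Rabs_R0. exact Hr. }
  pose proof (mel_incr_th c y th (th + h) x Hc Hl (HD h Hh)) as H.
  replace (th + h - th) with h in H by ring.
  replace (RtoC h *v (Ci *v melD c y th x)) with ((Ci * RtoC h)%C *v melD c y th x) by vec.
  lra.
Qed.
End Mellin.
Arguments mel {V} Psi c y th x.
Arguments melD {V} Psi c y th x.

Lemma lim_exp_neg_p (c : R) : 0 < c -> is_lim (fun x => exp (- c * x)) p_infty 0.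
Proof.
  intros Hc. apply is_lim_spec. intros eps.
  pose proof (lim_exp_m c Hc) as H. apply is_lim_spec in H.
  destruct (H eps) as [N HN]. exists (- N). intros x Hx.
  specialize (HN (- x) ltac:(lra)). now replace (- c * x) with (c * - x) by ring.
Qed.

Lemma mel_weight_m c x : exp (c * x) / (1 + exp x) <= exp (c * x).
Proof.
  pose proof (exp_pos x). pose proof (exp_pos (c * x)).
  apply Rmult_le_reg_r with (1 + exp x); [lra|].
  replace (exp (c * x) / (1 + exp x) * (1 + exp x)) with (exp (c * x)) by (field; lra).
  nra.
Qed.
Lemma mel_weight_p c x : exp (c * x) / (1 + exp x) <= exp (- (1 - c) * x).
Proof.
  pose proof (exp_pos x). pose proof (exp_pos (- (1 - c) * x)).
  assert (E : exp (c * x) = exp (- (1 - c) * x) * exp x).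
  { rewrite <- exp_plus. f_equal. ring. }
  apply Rmult_le_reg_r with (1 + exp x); [lra|].
  replace (exp (c * x) / (1 + exp x) * (1 + exp x)) with (exp (c * x)) by (field; lra).
  nra.
Qed.

Lemma lim_scal_zero (k : R) f (x : Rbar) : is_lim f x 0 -> is_lim (fun t => k * f t) x 0.
Proof.
  intros H. replace (Finite 0) with (Rbar_mult k 0) by (simpl; f_equal; ring).
  exact (is_lim_scal_l f k x 0 H).
Qed.

Section MellinInt.
Context {V : cspace} {D : C -> Prop} {K : R} {Psi : C -> V -> V}.
Hypothesis HV : banach V.
Hypothesis HR : resfam D K Psi.
Variable c : R.
Hypothesis Hc : 0 < c < 1.

Let ok (b : Rbar) (th : R) := forall x : R, Rbar_lt x b -> D (pol x th).

Lemma Rbar_lt_nbhd (x : R) (b : Rbar) : Rbar_lt x b ->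
  exists r, 0 < r /\ forall h, Rabs h < r -> Rbar_lt (x + h) b.
Proof.
  intros H. destruct b as [b| |].
  - exists (b - x). simpl in *. split; [lra|]. intros h Hh. apply Rabs_def2 in Hh. lra.
  - exists 1. split; [lra|]. intros; exact I.
  - destruct H.
Qed.

Lemma mel_deriv_ok b th y : ok b th ->
  forall x : R, Rbar_lt x b -> has_deriv (mel Psi c y th) x (melD Psi c y th x).
Proof.
  intros Hb x Hx. destruct (Rbar_lt_nbhd x b Hx) as (r & Hr & Hh).
  apply (mel_deriv HR) with r; [lra|exact Hr|]. intros h Hlt. apply Hb. auto.
Qed.

(** Positivity of [g] makes [G] increase from 0 to [L]; both inequalities are comparisons with the
    zero function. *)
Lemma mel_majorant_ok : exists g G L, is_majorant g G L /\ 0 <= L /\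
  (forall x, 0 <= G x <= L) /\ (forall x, exp (c * x) / (1 + exp x) <= g x).
Proof.
  destruct (mel_majorant c Hc) as (g & G & L & HG & Hg).
  assert (P : forall x, 0 <= exp (c * x) / (1 + exp x)).
  { intros x. pose proof (exp_pos x). apply Rmult_le_pos; [left; apply exp_pos|].
    left. apply Rinv_0_lt_compat. lra. }
  assert (HG0 : forall x, 0 <= G x).
  { intros x. rewrite <- (nrm_zero (V := C_NormedModule)).
    apply (anti_bound (V := C_NormedModule) p_infty (fun _ => 0v) (fun _ => 0v) g G L HG); [|
      |exact I].
    - split; [|apply lim_m_const]. intros; apply deriv_const.
    - intros z _. rewrite nrm_zero. eapply Rle_trans; [apply P|apply Hg]. }
  assert (HGL : forall x, G x <= L).
  { intros x. pose proof (maj_p HG) as Hp. apply is_lim_spec in Hp.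
    apply le_epsilon. intros eps Heps.
    destruct (Hp (mkposreal _ Heps)) as [N HN]. simpl in HN.
    set (z := Rmax N x + 1). pose proof (Rmax_l N x). pose proof (Rmax_r N x).
    specialize (HN z ltac:(unfold z; lra)). apply Rabs_def2 in HN.
    assert (H2 := mean_value_ineq (V := C_NormedModule) (fun _ => 0v) (fun _ => 0v) G g x z
      ltac:(unfold z; lra)).
    assert (H3 : 0 <= G z - G x); [|lra].
    eapply Rle_trans; [|apply H2].
    - apply nrm_ge0.
    - intros; apply deriv_const.
    - intros; apply HG.
    - intros u _. rewrite nrm_zero. eapply Rle_trans; [apply P|apply Hg]. }
  exists g, G, L. split; [exact HG|]. split; [|split; auto].
  eapply Rle_trans; [apply (HG0 0)|apply HGL].
Qed.

Lemma mel_anti_exists b th y : b <> m_infty -> ok b th ->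
  exists F, anti b (mel Psi c y th) F.
Proof.
  intros Hb Hok. destruct mel_majorant_ok as (g & G & L & HG & HL & HGL & Hg).
  apply (anti_exists b _ (fun x => K * nrm y * g x) (fun x => K * nrm y * G x) (K * nrm y * L));
    auto.
  - now apply majorant_scal.
  - intros x Hx. eapply deriv_cont, mel_deriv_ok; eassumption.
  - intros x Hx. eapply Rle_trans; [apply (mel_nrm HR); auto|].
    apply Rmult_le_compat_l; [|apply Hg].
    apply Rmult_le_pos; [apply (rf_K HR)|apply nrm_ge0].
Qed.

Lemma mel_lim_m b th y : b <> m_infty -> ok b th -> lim_m (mel Psi c y th) 0v.
Proof.
  intros Hb Hok.
  assert (exists N0, forall x : R, x < N0 -> Rbar_lt x b) as [N0 HN0].
  { destruct b as [b| |]; [exists b; auto|exists 0; intros; exact I|congruence]. }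
  apply (lim_m_zero_dom _ (fun x => K * nrm y * exp (c * x)) N0).
  - intros x Hx. eapply Rle_trans; [apply (mel_nrm HR); auto|].
    apply Rmult_le_compat_l; [|apply mel_weight_m].
    apply Rmult_le_pos; [apply (rf_K HR)|apply nrm_ge0].
  - apply lim_scal_zero, lim_exp_m. lra.
Qed.
Lemma mel_lim_p th y : ok p_infty th -> lim_p (mel Psi c y th) 0v.
Proof.
  intros Hok.
  apply (lim_p_zero_dom _ (fun x => K * nrm y * exp (- (1 - c) * x)) 0).
  - intros x Hx. eapply Rle_trans; [apply (mel_nrm HR), Hok; exact I|].
    apply Rmult_le_compat_l; [|apply mel_weight_p].
    apply Rmult_le_pos; [apply (rf_K HR)|apply nrm_ge0].
  - apply lim_scal_zero, lim_exp_neg_p. lra.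
Qed.
Lemma melD_anti b th y : b <> m_infty -> ok b th ->
  anti b (melD Psi c y th) (mel Psi c y th).
Proof.
  intros Hb Hok. split; [apply mel_deriv_ok; assumption|now apply mel_lim_m with b].
Qed.

Lemma mel_int_exists th y : ok p_infty th -> exists l, is_int (mel Psi c y th) l.
Proof.
  intros Hok. destruct mel_majorant_ok as (g & G & L & HG & HL & HGL & Hg).
  apply (int_exists _ (fun x => K * nrm y * g x) (fun x => K * nrm y * G x) (K * nrm y * L));
    auto.
  - now apply majorant_scal.
  - intros x. eapply deriv_cont. apply (mel_deriv_ok p_infty); [exact Hok|exact I].
  - intros x. eapply Rle_trans; [apply (mel_nrm HR), Hok; exact I|].
    apply Rmult_le_compat_l; [|apply Hg].
    apply Rmult_le_pos; [apply (rf_K HR)|apply nrm_ge0].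
Qed.

(** The integrand is the derivative of [mel], whose boundary values vanish at both ends because 0 <
    c < 1. *)
Lemma mel_byparts y : ok p_infty 0 -> is_int (melD Psi c y 0) 0v.
Proof.
  intros Hok. exists (mel Psi c y 0). split.
  - now apply melD_anti.
  - now apply mel_lim_p.
Qed.

(* Cauchy's theorem in logarithmic coordinates: the antiderivative along the
   radius is differentiable in the angle, with derivative [Ci * mel]. *)
Lemma anti_incr_th y : exists B, 0 <= B /\ forall b th th' F F',
  b <> m_infty -> ok b th -> ok b th' ->
  anti b (mel Psi c y th) F -> anti b (mel Psi c y th') F' ->
  forall x : R, Rbar_lt x b ->
  nrm (F' x -v F x -v (Ci * RtoC (th' - th))%C *v mel Psi c y th x) <= B * (th' - th)^2.
Proof.
  destruct mel_majorant_ok as (g & G & L & HG & HL & HGL & Hg).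
  assert (exists B, 0 <= B /\ forall th th' x, D (pol x th) -> D (pol x th') ->
    nrm (mel Psi c y th' x -v mel Psi c y th x -v (Ci * RtoC (th' - th))%C *v melD Psi c y th x)
    <= B * (th' - th)^2 * (exp (c * x) / (1 + exp x))) as (B & HB & H).
  { eexists (Rabs _). split; [apply Rabs_pos|]. intros th th' x H1 H2.
    eapply Rle_trans; [apply (mel_incr_th HR c y th th' x); [lra|exact H1|exact H2]|].
    apply Rmult_le_compat_r.
    - apply Rmult_le_pos; [left; apply exp_pos|]. left. apply Rinv_0_lt_compat.
      pose proof (exp_pos x). lra.
    - apply Rmult_le_compat_r; [apply pow2_ge_0|]. apply Rle_abs. }
  exists (B * L). split; [now apply Rmult_le_pos|].
  intros b th th' F F' Hb Hok Hok' HF HF' x Hx.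
  pose proof (anti_minus b _ _ _ _ (anti_minus b _ _ _ _ HF' HF)
    (anti_scal b _ _ (Ci * RtoC (th' - th))%C (melD_anti b th y Hb Hok))) as HA.
  pose proof (anti_bound b _ _ _ _ _ (majorant_scal g G L (B * (th' - th)^2) HG) HA) as H2.
  eapply Rle_trans; [apply H2; [|exact Hx]|].
  - intros z Hz. eapply Rle_trans; [apply H; auto|].
    apply Rmult_le_compat_l; [|apply Hg]. apply Rmult_le_pos; [exact HB|apply pow2_ge_0].
  - replace (B * L * (th' - th)^2) with (B * (th' - th)^2 * L) by ring.
    apply Rmult_le_compat_l; [|apply HGL]. apply Rmult_le_pos; [exact HB|apply pow2_ge_0].
Qed.

(** Letting x tend to infinity in [anti_incr_th] removes the first-order term, since [mel] tends to
    0 there. The integral then has quadratic increments in the angle, and [quad_const] applies. *)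
Lemma mel_int_rot y th0 th1 l : th0 <= th1 ->
  (forall th, th0 <= th <= th1 -> ok p_infty th) ->
  is_int (mel Psi c y th0) l -> is_int (mel Psi c y th1) l.
Proof.
  intros Hth Hok Hl.
  pose (J := fun th => epsilon (inhabits (0v : V)) (fun l => is_int (mel Psi c y th) l)).
  assert (HJ : forall th, th0 <= th <= th1 -> is_int (mel Psi c y th) (J th)).
  { intros th H. unfold J. apply epsilon_spec. apply mel_int_exists. auto. }
  destruct (anti_incr_th y) as (B & HB & H).
  assert (E : J th1 = J th0).
  { apply (quad_const J B th0 th1 Hth). intros th th' H1 H2 _.
    destruct (HJ th H1) as (F & HF & HlF). destruct (HJ th' H2) as (F' & HF' & HlF').
    apply (lim_le_nrm (fun x => F' x -v F x -v (Ci * RtoC (th' - th))%C *v mel Psi c y th x)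
      (fun _ => B * (th' - th)^2)).
    - replace (J th' -v J th) with (J th' +v (- RtoC 1)%C *v J th
        +v (- (Ci * RtoC (th' - th)))%C *v 0v) by vec.
      intros eps Heps.
      destruct (lim_p_plus _ _ _ _ (lim_p_plus _ _ _ _ HlF'
        (lim_p_blin (blin_scalar (- RtoC 1)%C) _ _ HlF))
        (lim_p_blin (blin_scalar (- (Ci * RtoC (th' - th)))%C) _ _ (mel_lim_p th y (Hok th H1)))
        eps Heps) as [N HN].
      exists N. intros x Hx. eapply Rle_trans; [|apply (HN x Hx)]. right. f_equal. vec.
    - apply is_lim_const.
    - intros x. apply (H p_infty); auto; [discriminate|exact I]. }
  assert (El : l = J th0) by (eapply int_unique; [exact Hl|apply HJ; lra]).
  rewrite El, <- E. apply HJ. lra.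
Qed.

(** At finite x the same estimate says that the antiderivatives along the rays, read at a fixed
    radius, form an antiderivative along the circular arc. This evaluates the arc of the contour. *)
Lemma anti_deriv_th b (Phi : R -> R -> V) y th0 th1 : b <> m_infty ->
  (forall th, th0 < th < th1 -> ok b th /\ anti b (mel Psi c y th) (Phi th)) ->
  forall th (x : R), th0 < th < th1 -> Rbar_lt x b ->
  has_deriv (fun th => Phi th x) th (Ci *v mel Psi c y th x).
Proof.
  intros Hb HPhi th x Hth Hx.
  destruct (anti_incr_th y) as (B & HB & H).
  apply (quad_deriv _ _ _ B (Rmin (th - th0) (th1 - th))); [apply Rmin_glb_lt; lra|].
  intros h Hh.
  assert (A1 : Rabs h < th - th0) by (eapply Rlt_le_trans; [exact Hh|apply Rmin_l]).
  assert (A2 : Rabs h < th1 - th) by (eapply Rlt_le_trans; [exact Hh|apply Rmin_r]).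
  apply Rabs_def2 in A1. apply Rabs_def2 in A2.
  destruct (HPhi th Hth) as [O1 N1]. destruct (HPhi (th + h) ltac:(lra)) as [O2 N2].
  specialize (H b th (th + h) _ _ Hb O1 O2 N1 N2 x Hx).
  replace (th + h - th) with h in H by ring.
  replace (RtoC h *v (Ci *v mel Psi c y th x)) with
    ((Ci * RtoC h)%C *v mel Psi c y th x) by vec.
  exact H.
Qed.
End MellinInt.

(** * Euler reflection integral *)

Lemma anti_flip {V : cspace} (f : R -> V) l : is_int f l -> is_int (fun x => f (- x)) l.
Proof.
  intros (F & [HF HF0] & Hl).
  exists (fun x => l -v F (- x)). split; [split|].
  - intros x _ eps Heps. destruct (HF (- x) I eps Heps) as (d & Hd & Hh).
    exists d. split; [exact Hd|]. intros h Hlt.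
    specialize (Hh (- h) ltac:(now rewrite Rabs_Ropp)). rewrite Rabs_Ropp in Hh.
    replace (- (x + h)) with (- x + - h) by ring.
    rewrite <- nrm_opp. eapply Rle_trans; [|exact Hh]. right. f_equal. vec.
  - intros eps Heps. destruct (Hl eps Heps) as [N HN]. exists (- N). intros x Hx.
    specialize (HN (- x) ltac:(lra)). rewrite <- nrm_opp.
    eapply Rle_trans; [|exact HN]. right. f_equal. vec.
  - intros eps Heps. destruct (HF0 eps Heps) as [N HN]. exists (- N). intros x Hx.
    specialize (HN (- x) ltac:(lra)). rewrite <- nrm_opp.
    eapply Rle_trans; [|exact HN]. right. f_equal. vec.
Qed.

Definition sector (th1 : R) (lam : C) : Prop :=
  exists x th, - th1 <= th <= th1 /\ lam = pol x th.

Lemma den_ge (u th th1 : R) : 0 <= u -> 0 <= th1 < PI -> - th1 <= th <= th1 ->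
  (1 + cos th1) / 2 * (1 + u)^2 <= 1 + 2 * u * cos th + u^2.
Proof.
  intros Hu H1 Hth.
  assert (Hc : cos th1 <= cos th).
  { destruct (Rle_lt_dec 0 th).
    - apply cos_decr_1; lra.
    - rewrite <- (cos_neg th). apply cos_decr_1; lra. }
  pose proof (COS_bound th1). pose proof (pow2_ge_0 (1 - u)). nra.
Qed.
Lemma cos_gt_m1 th : 0 <= th < PI -> -1 < cos th.
Proof. intros H. rewrite <- cos_PI. apply cos_decreasing_1; lra. Qed.

Lemma Cmod_1_pol x th :
  Cmod (RtoC 1 + pol x th)%C ^ 2 = 1 + 2 * exp x * cos th + exp x ^ 2.
Proof.
  unfold Cmod. rewrite pow2_sqrt.
  - unfold pol, cis, Cplus, Cmult, RtoC; simpl. pose proof (sin2_cos2 th). unfold Rsqr in H. nra.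
  - apply Rplus_le_le_0_compat; apply pow2_ge_0.
Qed.

(** The resolvent of multiplication by 1 on C, which brings Euler's integral under the rotation
    theorem. Its constant in [inv1_resfam] blows up as the sector opens to the angle PI. *)
Definition inv1 (lam z : C) : C := (z / (RtoC 1 + lam))%C.

Lemma inv1_resfam th1 : 0 <= th1 < PI ->
  resfam (V := C_NormedModule) (sector th1) (sqrt (2 / (1 + cos th1))) inv1.
Proof.
  intros H1. pose proof (cos_gt_m1 th1 H1) as Hc.
  set (K := sqrt (2 / (1 + cos th1))).
  assert (HK2 : K^2 = 2 / (1 + cos th1)).
  { apply pow2_sqrt. left. apply Rdiv_lt_0_compat; lra. }
  assert (Hge : forall lam, sector th1 lam -> 1 + Cmod lam <= K * Cmod (RtoC 1 + lam)).
  { intros lam (x & th & Hth & ->). rewrite Cmod_pol.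
    pose proof (den_ge (exp x) th th1 ltac:(left; apply exp_pos) H1 Hth) as H.
    rewrite <- Cmod_1_pol in H.
    apply Rsqr_incr_0_var; [|apply Rmult_le_pos; [apply sqrt_pos|apply Cmod_ge_0]].
    rewrite !Rsqr_pow2, Rpow_mult_distr, HK2.
    apply Rmult_le_compat_l with (r := 2 / (1 + cos th1)) in H.
    2:{ left; apply Rdiv_lt_0_compat; lra. }
    replace (2 / (1 + cos th1) * ((1 + cos th1) / 2 * (1 + exp x)^2))
      with ((1 + exp x)^2) in H by (field; lra). exact H. }
  assert (HK0 : 0 < K) by (apply sqrt_lt_R0, Rdiv_lt_0_compat; lra).
  assert (Hnz : forall lam, sector th1 lam -> (RtoC 1 + lam)%C <> RtoC 0).
  { intros lam Hl E. specialize (Hge lam Hl). rewrite E, Cmod_0 in Hge.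
    pose proof (Cmod_ge_0 lam). lra. }
  split; [lra| |].
  - intros lam Hl. specialize (Hge lam Hl). specialize (Hnz lam Hl).
    assert (Hp : 0 < Cmod (RtoC 1 + lam)) by now apply Cmod_gt_0.
    split; intros; unfold inv1.
    + change ((x + y) / (RtoC 1 + lam) = x / (RtoC 1 + lam) + y / (RtoC 1 + lam))%C.
      field. exact Hnz.
    + change ((c * x) / (RtoC 1 + lam) = c * (x / (RtoC 1 + lam)))%C. field. exact Hnz.
    + change (Cmod (x / (RtoC 1 + lam)) <= K / (1 + Cmod lam) * Cmod x).
      rewrite Cmod_div by exact Hnz.
      pose proof (Cmod_ge_0 x). pose proof (Cmod_ge_0 lam).
      apply Rmult_le_reg_r with (Cmod (RtoC 1 + lam) * (1 + Cmod lam)); [nra|].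
      replace (Cmod x / Cmod (RtoC 1 + lam) * (Cmod (RtoC 1 + lam) * (1 + Cmod lam)))
        with (Cmod x * (1 + Cmod lam)) by (field; lra).
      replace (K / (1 + Cmod lam) * Cmod x * (Cmod (RtoC 1 + lam) * (1 + Cmod lam)))
        with (Cmod x * (K * Cmod (RtoC 1 + lam))) by (field; lra).
      apply Rmult_le_compat_l; auto.
  - intros lam mu Hl Hm y. unfold inv1.
    change (y / (RtoC 1 + lam) - y / (RtoC 1 + mu) =
      (mu - lam) * (y / (RtoC 1 + mu) / (RtoC 1 + lam)))%C.
    field. split; auto.
Qed.

(** Equal to sin th / (2 (cosh x + cos th)); by [poisson_C] it is a combination of the scalar
    resolvent at two conjugate points. *)
Definition poisson (th x : R) : R := exp x * sin th / (1 + 2 * exp x * cos th + exp x ^ 2).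

Lemma poisson_C th x : 0 < th < PI ->
  (Ci / RtoC 2 * (inv1 (pol x th) (RtoC 1) - inv1 (pol x (- th)) (RtoC 1)) = RtoC (poisson th x))%C.
Proof.
  intros Hth. unfold inv1.
  set (z := (RtoC 1 + pol x th)%C). set (w := (RtoC 1 + pol x (- th))%C).
  pose proof (den_ge (exp x) th th ltac:(left; apply exp_pos) ltac:(lra) ltac:(lra)) as Hd.
  pose proof (cos_gt_m1 th ltac:(lra)) as Hc. pose proof (exp_pos x) as E.
  set (d := 1 + 2 * exp x * cos th + exp x ^ 2) in *.
  assert (Hd0 : 0 < d) by nra.
  assert (Hzw : (z * w)%C = RtoC d).
  { unfold z, w, d, pol, cis, Cplus, Cmult, RtoC; simpl. rewrite cos_neg, sin_neg.
    pose proof (sin2_cos2 th) as H. unfold Rsqr in H. f_equal; nra. }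
  assert (Hwz : (w - z)%C = (- RtoC 2 * Ci * RtoC (exp x * sin th))%C).
  { unfold z, w, pol, cis, Cplus, Cminus, Cmult, RtoC, Ci; simpl. rewrite cos_neg, sin_neg.
    unfold Cplus, Cmult, Copp; simpl. f_equal; ring. }
  assert (Hdc : RtoC d <> RtoC 0) by (intros H; apply RtoC_inj in H; lra).
  assert (Hz : z <> RtoC 0) by (intros H; rewrite H, Cmult_0_l in Hzw; congruence).
  assert (Hw : w <> RtoC 0) by (intros H; rewrite H, Cmult_0_r in Hzw; congruence).
  assert (H2 : RtoC 2 <> RtoC 0) by (intros H; apply RtoC_inj in H; lra).
  replace (Ci / RtoC 2 * (RtoC 1 / z - RtoC 1 / w))%C with (Ci / RtoC 2 * ((w - z) / (z * w)))%C
    by (field; auto).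
  rewrite Hzw, Hwz. unfold poisson. fold d.
  replace (RtoC (exp x * sin th / d)) with (RtoC (exp x * sin th) / RtoC d)%C
    by (rewrite <- RtoC_div; [reflexivity|lra]).
  replace (Ci / RtoC 2 * (- RtoC 2 * Ci * RtoC (exp x * sin th) / RtoC d))%C with
    (- (Ci * Ci) * (RtoC (exp x * sin th) / RtoC d))%C by (field; auto).
  replace (Ci * Ci)%C with (- RtoC 1)%C; [ring|].
  unfold Ci, Copp, Cmult, RtoC; simpl. f_equal; ring.
Qed.

Lemma poisson_even th x : poisson th (- x) = poisson th x.
Proof.
  unfold poisson. rewrite exp_Ropp. pose proof (exp_pos x).
  set (u := exp x) in *.
  destruct (Req_dec (1 + 2 * u * cos th + u^2) 0) as [E|E].
  (* Degenerate case: both denominators vanish, and both sides are 0 by the convention / 0 = 0. *)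
  - replace (1 + 2 * / u * cos th + (/ u)^2) with ((1 + 2 * u * cos th + u^2) * (/ u)^2)
      by (field; lra). rewrite E, Rmult_0_l. unfold Rdiv. rewrite Rinv_0. ring.
  - field. repeat split; try lra; try (intros H0; apply E; lra).
Qed.

Lemma mel_int_C c : 0 < c < 1 ->
  exists l : C_NormedModule, is_int (fun x => RtoC (exp (c * x) / (1 + exp x))) l.
Proof.
  intros Hc.
  destruct (mel_int_exists banach_C (inv1_resfam 0 ltac:(pose proof PI_RGT_0; lra)) c Hc 0 (RtoC 1))
    as [l Hl].
  { intros x _. exists x, 0. split; [lra|reflexivity]. }
  exists l. eapply int_ext; [|exact Hl]. intros x. unfold mel.
  rewrite ep_0, pol_0. unfold inv1.
  change (RtoC (exp (c * x)) * (RtoC 1 / (RtoC 1 + RtoC (exp x))) = RtoC (exp (c * x) / (1 + exp x)))%C.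
  pose proof (exp_pos x). rewrite RtoC_div, RtoC_plus by lra. field.
  change (RtoC 1 + RtoC (exp x) <> RtoC 0)%C.
    rewrite <- RtoC_plus. intros H0. apply RtoC_inj in H0. lra.
Qed.

(** Rotation to the angles [th] and [- th] does not change the value [l]. Multiplying by the
    opposite phases removes the powers of exp (i th), which leaves the Poisson kernel in the
    integrand and the sine of c th in the value. *)
Lemma poisson_int c th (l : C_NormedModule) : 0 < c < 1 -> 0 < th < PI ->
  is_int (fun x => RtoC (exp (c * x) / (1 + exp x))) l ->
  is_int (fun x => RtoC (exp (c * x) * poisson th x)) (RtoC (sin (c * th)) * l)%C.
Proof.
  intros Hc Hth Hl.
  pose proof (inv1_resfam th ltac:(lra)) as HR.
  assert (H0 : is_int (mel (V := C_NormedModule) inv1 c (RtoC 1) 0) l).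
  { eapply int_ext; [|exact Hl]. intros x. unfold mel.
    rewrite ep_0, pol_0. unfold inv1.
    change (RtoC (exp (c * x) / (1 + exp x)) = RtoC (exp (c * x)) * (RtoC 1 / (RtoC 1 + RtoC (exp x))))%C.
    pose proof (exp_pos x). rewrite RtoC_div, RtoC_plus by lra. field.
    change (RtoC 1 + RtoC (exp x) <> RtoC 0)%C.
    rewrite <- RtoC_plus. intros H0. apply RtoC_inj in H0. lra. }
  assert (Hok : forall t, - th <= t <= th -> forall x : R, Rbar_lt x p_infty -> sector th (pol x t)).
  { intros t Ht x _. exists x, t. auto. }
  assert (H1 : is_int (mel (V := C_NormedModule) inv1 c (RtoC 1) th) l).
  { apply (mel_int_rot banach_C HR c Hc _ 0 th); [lra| |exact H0].
    intros t Ht; exact (Hok t ltac:(lra)). }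
  (* [mel_int_rot] only increases the angle: the integral at [- th] is rotated up to 0 and
     identified there by uniqueness. *)
  assert (H2 : is_int (mel (V := C_NormedModule) inv1 c (RtoC 1) (- th)) l).
  { destruct (mel_int_exists banach_C HR c Hc (- th) (RtoC 1)) as [l' Hl'].
    { exact (Hok (- th) ltac:(lra)). }
    assert (H3 : is_int (mel (V := C_NormedModule) inv1 c (RtoC 1) 0) l').
    { apply (mel_int_rot banach_C HR c Hc _ (- th) 0); [lra| |exact Hl'].
      intros t Ht; exact (Hok t ltac:(lra)). }
    now rewrite (int_unique _ _ _ H0 H3). }
  pose proof (int_minus _ _ _ _ (int_scal _ _ (Ci / RtoC 2 * cis (- (c * th)))%C H1)
    (int_scal _ _ (Ci / RtoC 2 * cis (c * th))%C H2)) as H3.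
  assert (H2c : RtoC 2 <> RtoC 0) by (intros H; apply RtoC_inj in H; lra).
  assert (Hcis : forall t, (cis (- t) * cis t = RtoC 1)%C).
  { intros t. rewrite <- cis_plus. replace (- t + t) with 0 by ring. apply cis_0. }
  replace (RtoC (sin (c * th)) * l)%C with
    ((Ci / RtoC 2 * cis (- (c * th)))%C *v l -v (Ci / RtoC 2 * cis (c * th))%C *v l).
  - eapply int_ext; [|exact H3]. intros x. simpl.
    rewrite RtoC_mult, <- poisson_C by exact Hth. unfold mel.
    change ((Ci / RtoC 2 * cis (- (c * th))) * (ep c x th * inv1 (pol x th) (RtoC 1))
      - (Ci / RtoC 2 * cis (c * th)) * (ep c x (- th) * inv1 (pol x (- th)) (RtoC 1))
      = RtoC (exp (c * x)) * (Ci / RtoC 2 * (inv1 (pol x th) (RtoC 1) - inv1 (pol x (- th)) (RtoC 1))))%C.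
    unfold ep. replace (c * - th) with (- (c * th)) by ring.
    transitivity (RtoC (exp (c * x)) * (Ci / RtoC 2) * (cis (- (c * th)) * cis (c * th))
      * (inv1 (pol x th) (RtoC 1) - inv1 (pol x (- th)) (RtoC 1)))%C; [ring|].
    rewrite Hcis. ring.
  - change ((Ci / RtoC 2 * cis (- (c * th))) * l - (Ci / RtoC 2 * cis (c * th)) * l
      = RtoC (sin (c * th)) * l)%C.
    transitivity (Ci / RtoC 2 * (cis (- (c * th)) - cis (c * th)) * l)%C; [ring|].
    f_equal.
    replace (cis (- (c * th)) - cis (c * th))%C with (- RtoC 2 * Ci * RtoC (sin (c * th)))%C.
    + replace (Ci / RtoC 2 * (- RtoC 2 * Ci * RtoC (sin (c * th))))%C with
        (- (Ci * Ci) * RtoC (sin (c * th)))%C by (field; auto).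
      replace (Ci * Ci)%C with (- RtoC 1)%C; [ring|].
      unfold Ci, Copp, Cmult, RtoC; simpl. f_equal; ring.
    + unfold cis, Cminus, Cplus, Copp, Cmult, RtoC, Ci; simpl. rewrite cos_neg, sin_neg.
      f_equal; ring.
Qed.

Lemma cosh_mono c d x : 0 <= c <= d ->
  exp (c * x) + exp (- (c * x)) <= exp (d * x) + exp (- (d * x)).
Proof.
  intros H.
  assert (E1 : exp (d * x) = exp (c * x) * exp ((d - c) * x)) by (rewrite <- exp_plus; f_equal; ring).
  assert (E2 : exp (- (c * x)) = exp (- (d * x)) * exp ((d - c) * x))
    by (rewrite <- exp_plus; f_equal; ring).
  rewrite E1, E2. set (p := exp ((d - c) * x)).
  assert (Hp : 0 <= (exp (c * x) - exp (- (d * x))) * (p - 1)); [|nra].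
  destruct (Rle_lt_dec 0 x).
  - apply Rmult_le_pos.
    + assert (exp (- (d * x)) <= exp (c * x)) by (apply exp_le_mono; nra). lra.
    + assert (exp 0 <= p) by (apply exp_le_mono; nra). rewrite exp_0 in *. lra.
  - assert (exp (c * x) <= exp (- (d * x))) by (apply exp_le_mono; nra).
    assert (p <= exp 0) by (apply exp_le_mono; nra). rewrite exp_0 in *. nra.
Qed.

(** Divided by sin th, the kernel develops a singularity of order x^(-2) at the origin as th tends
    to PI. The double zero of cosh (d x) - 1 absorbs it, and a factor sin th remains in front of
    integrable weights. *)
Lemma poisson_bound d th x : 0 < d < 1 -> 0 < th < PI ->
  (exp (d * x) + exp (- (d * x)) - 2) * poisson th x
  <= 2 * sin th * (exp (d * x) / (1 + exp x) + exp ((1 - d) * x) / (1 + exp x)).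
Proof.
  intros Hd Hth.
  assert (Hs : 0 < sin th) by (apply sin_gt_0; lra).
  assert (W : forall x, 0 <= x -> (exp (d * x) + exp (- (d * x)) - 2) * poisson th x
    <= 2 * sin th * (exp (d * x) / (1 + exp x))).
  { clear x. intros x Hx. unfold poisson.
    pose proof (den_ge (exp x) th th ltac:(left; apply exp_pos) ltac:(lra) ltac:(lra)) as Hden.
    pose proof (cos_gt_m1 th ltac:(lra)) as Hc. pose proof (exp_pos x) as E.
    set (v := exp (d * x)).
    assert (Ev : exp (- (d * x)) = / v) by apply exp_Ropp.
    assert (Hv : 0 < v) by apply exp_pos.
    set (u := exp x) in *.
    assert (Huv : v <= u) by (apply exp_le_mono; nra).
    assert (Hv1 : 1 <= v) by (rewrite <- exp_0; apply exp_le_mono; nra).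
    set (D := 1 + 2 * u * cos th + u^2) in *.
    assert (HD0 : 0 < D) by nra.
    assert (HD1 : (u - 1)^2 <= D) by (unfold D; pose proof (COS_bound th); nra).
    rewrite Ev.
    assert (Hk : (v - 1)^2 * u^2 <= v^2 * (u - 1)^2).
    { assert (0 <= (v - 1) * u <= v * (u - 1)) by nra.
      replace ((v - 1)^2 * u^2) with (((v - 1) * u)^2) by ring.
      replace (v^2 * (u - 1)^2) with ((v * (u - 1))^2) by ring.
      apply pow_incr. lra. }
    apply Rmult_le_reg_r with (v * D * (1 + u) * u).
    { repeat apply Rmult_lt_0_compat; lra. }
    replace ((v + / v - 2) * (u * sin th / D) * (v * D * (1 + u) * u)) with
      (sin th * ((v - 1)^2 * u^2) * (1 + u)) by (field; lra).
    replace (2 * sin th * (v / (1 + u)) * (v * D * (1 + u) * u)) with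
      (sin th * (v^2 * D) * (2 * u)) by (field; lra).
    apply Rmult_le_compat.
    - apply Rmult_le_pos; [lra|]. apply Rmult_le_pos; apply pow2_ge_0.
    - lra.
    - apply Rmult_le_compat_l; [lra|]. eapply Rle_trans; [exact Hk|].
      apply Rmult_le_compat_l; [apply pow2_ge_0|exact HD1].
    - lra. }
  pose proof (exp_pos x) as E. pose proof (exp_pos (d * x)) as E1.
  pose proof (exp_pos ((1 - d) * x)) as E2.
  assert (0 < exp (d * x) / (1 + exp x)) by (apply Rdiv_lt_0_compat; lra).
  assert (0 < exp ((1 - d) * x) / (1 + exp x)) by (apply Rdiv_lt_0_compat; lra).
  destruct (Rle_lt_dec 0 x) as [Hx|Hx].
  - specialize (W x Hx). nra.
  - specialize (W (- x) ltac:(lra)). rewrite poisson_even in W.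
    replace (d * - x) with (- (d * x)) in W by ring. rewrite Ropp_involutive in W.
    replace (exp (- (d * x)) / (1 + exp (- x))) with (exp ((1 - d) * x) / (1 + exp x)) in W.
    + nra.
    + replace ((1 - d) * x) with (x + - (d * x)) by ring.
      rewrite exp_plus, !exp_Ropp. field. repeat split; try lra.
Qed.

(* Euler's reflection integral.  The Poisson kernels of the strip at height
   [th] collapse to a point mass as [th] tends to [PI], so comparing the
   exponent [c] with the explicit exponent [1/2] suffices. *)
Lemma euler_integral c : 0 < c < 1 ->
  is_int (V := C_NormedModule) (fun x => RtoC (exp (c * x) / (1 + exp x))) (RtoC (PI / sin (PI * c))).
Proof.
  intros Hc. destruct (mel_int_C c Hc) as [l Hl].
  pose proof PI_RGT_0 as HPI.
  (* For the exponent 1/2 the antiderivative is 2 atan (exp (x / 2)), and the value PI is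
     explicit. *)
  assert (Hh : is_int (V := C_NormedModule) (fun x => RtoC (exp (/ 2 * x) / (1 + exp x))) (RtoC PI)).
  { pose proof (atan_majorant 1 ltac:(lra)) as [M1 M2 M3].
    eapply int_ext with (f := fun x => RtoC (1 * exp (/ 2 * x) / (1^2 + exp x))).
    { intros x. apply (f_equal RtoC). f_equal; ring. }
    eapply int_deriv with (F := fun x => RtoC (2 * atan (exp (/ 2 * x) / 1))).
    - intros x. apply (deriv_RtoC (fun x => 2 * atan (exp (/ 2 * x) / 1))). apply M1.
    - apply is_lim_spec in M2. intros eps Heps. destruct (M2 (mkposreal _ Heps)) as [N HN].
      exists N. intros x Hx. specialize (HN x Hx). simpl in HN.
      change (Cmod (RtoC (2 * atan (exp (/ 2 * x) / 1)) - RtoC 0)%C <= eps).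
      rewrite <- RtoC_minus, Cmod_R. lra.
    - apply is_lim_spec in M3. intros eps Heps. destruct (M3 (mkposreal _ Heps)) as [N HN].
      exists N. intros x Hx. specialize (HN x Hx). simpl in HN.
      change (Cmod (RtoC (2 * atan (exp (/ 2 * x) / 1)) - RtoC PI)%C <= eps).
      rewrite <- RtoC_minus, Cmod_R. lra. }
  set (d := Rmax c (/ 2)).
  assert (Hcd : c <= d) by apply Rmax_l. assert (Hhd : / 2 <= d) by apply Rmax_r.
  assert (Hd : 0 < d < 1) by (split; [lra|apply Rmax_lub_lt; lra]).
  destruct (mel_majorant d Hd) as (g1 & G1 & L1 & HG1 & Hg1).
  destruct (mel_majorant (1 - d) ltac:(lra)) as (g2 & G2 & L2 & HG2 & Hg2).
  assert (Hbd : forall th, 0 < th < PI ->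
    Cmod (RtoC (sin (c * th)) * l - RtoC (sin (/ 2 * th)) * RtoC PI)%C
    <= sin th * L1 + sin th * L2).
  { intros th Hth.
    assert (Hs : 0 < sin th) by (apply sin_gt_0; lra).
    pose proof (poisson_int c th l Hc Hth Hl) as A1.
    pose proof (poisson_int (/ 2) th _ ltac:(lra) Hth Hh) as A2.
    pose proof (int_minus _ _ _ _ A1 A2) as A3.
    (* Averaging with the reflected integrand replaces exponentials by hyperbolic cosines, whose
       difference vanishes to second order at 0, as [poisson_bound] requires. *)
    pose proof (int_scal _ _ (RtoC (/ 2))
      (int_plus _ _ _ _ A3 (anti_flip _ _ A3))) as A4.
    set (z := (RtoC (sin (c * th)) * l)%C) in *.
    set (w := (RtoC (sin (/ 2 * th)) * RtoC PI)%C) in *.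
    assert (Ez : RtoC (/ 2) *v ((z : C_NormedModule) -v w +v (z -v w)) = (z : C_NormedModule) -v w).
    { change (RtoC (/ 2) * (z - w + (z - w)) = z - w)%C.
      rewrite RtoC_inv by lra. field. }
    rewrite Ez in A4.
    assert (M : is_majorant (fun x => sin th * g1 x + sin th * g2 x)
       (fun x => sin th * G1 x + sin th * G2 x) (sin th * L1 + sin th * L2)).
    { pose proof (majorant_scal _ _ _ (sin th) HG1) as [B1 B2 B3].
      pose proof (majorant_scal _ _ _ (sin th) HG2) as [B4 B5 B6].
      split.
      - intros x. apply (is_derive_plus (K := R_AbsRing) (V := R_NormedModule)); auto.
      - replace (Finite 0) with (Finite (0 + 0)) by (f_equal; ring). now apply is_lim_plus'.
      - now apply is_lim_plus'. }
    apply (int_bound _ _ _ _ _ M A4). intros x. simpl.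
    rewrite poisson_even.
    set (k := poisson th x).
    assert (Hk : 0 <= k).
    { unfold k, poisson. apply Rmult_le_pos.
      - apply Rmult_le_pos; [left; apply exp_pos|lra].
      - left. apply Rinv_0_lt_compat.
        pose proof (den_ge (exp x) th th ltac:(left; apply exp_pos) ltac:(lra) ltac:(lra)).
        pose proof (cos_gt_m1 th ltac:(lra)). pose proof (exp_pos x). nra. }
    replace (c * - x) with (- (c * x)) by ring. replace (/ 2 * - x) with (- (/ 2 * x)) by ring.
    match goal with |- norm ?e <= _ =>
      replace e with (RtoC (/ 2 * ((exp (c * x) + exp (- (c * x))) - (exp (/ 2 * x) + exp (- (/ 2 * x)))) * k)
        : C_NormedModule) end.
    2:{ change (RtoC (/ 2 * ((exp (c * x) + exp (- (c * x))) - (exp (/ 2 * x) + exp (- (/ 2 * x)))) * k)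
        = RtoC (/ 2) * ((RtoC (exp (c * x) * k) - RtoC (exp (/ 2 * x) * k))
          + (RtoC (exp (- (c * x)) * k) - RtoC (exp (- (/ 2 * x)) * k))))%C.
      rewrite <- !RtoC_minus, <- RtoC_plus, <- RtoC_mult. f_equal. ring. }
    change (Cmod (RtoC (/ 2 * ((exp (c * x) + exp (- (c * x))) - (exp (/ 2 * x) + exp (- (/ 2 * x)))) * k))
      <= sin th * g1 x + sin th * g2 x).
    rewrite Cmod_R, !Rabs_mult, (Rabs_pos_eq k), (Rabs_pos_eq (/ 2)) by lra.
    apply Rle_trans with (/ 2 * ((exp (d * x) + exp (- (d * x)) - 2) * k)).
    - rewrite Rmult_assoc. apply Rmult_le_compat_l; [lra|]. apply Rmult_le_compat_r; [exact Hk|].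
      pose proof (cosh_mono 0 c x ltac:(lra)) as C1. pose proof (cosh_mono c d x ltac:(lra)) as C2.
      pose proof (cosh_mono 0 (/ 2) x ltac:(lra)) as C3. pose proof (cosh_mono (/ 2) d x ltac:(lra)) as C4.
      rewrite Rmult_0_l, Ropp_0, exp_0 in C1, C3.
      apply Rabs_le. lra.
    - pose proof (poisson_bound d th x Hd Hth). specialize (Hg1 x). specialize (Hg2 x).
      fold k in H. nra. }
  assert (Hlim : (RtoC (sin (c * PI)) * l = RtoC PI)%C).
  { apply (nrm_le_eps_eq (V := C_NormedModule)). intros eps Heps.
    change (Cmod (RtoC (sin (c * PI)) * l - RtoC PI)%C <= eps).
    (* An upper bound for the error that is continuous in [th] and vanishes at PI. *)
    pose (f := fun th => Cmod l * Rabs (sin (c * PI) - sin (c * th))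
      + PI * Rabs (sin (/ 2 * th) - sin (/ 2 * PI)) + (sin th * L1 + sin th * L2)).
    assert (Hf0 : f PI = 0).
    { unfold f. rewrite sin_PI. replace (sin (c * PI) - sin (c * PI)) with 0 by ring.
      replace (sin (/ 2 * PI) - sin (/ 2 * PI)) with 0 by ring. rewrite Rabs_R0. ring. }
    assert (Hfc : continuous f PI).
    { unfold f.
      assert (Hsin : forall k t, continuous (fun th => sin (k * th)) t).
      { intros k t. apply (ex_derive_continuous (V := R_NormedModule)). auto_derive. exact I. }
      apply (continuous_plus (V := R_NormedModule)).
      - apply (continuous_plus (V := R_NormedModule)).
        + apply (continuous_mult (K := R_AbsRing)); [apply continuous_const|].
          apply (continuous_comp (fun th => sin (c * PI) - sin (c * th)) Rabs).
          * apply (continuous_minus (V := R_NormedModule)); [apply continuous_const|apply Hsin].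
          * apply continuous_Rabs.
        + apply (continuous_mult (K := R_AbsRing)); [apply continuous_const|].
          apply (continuous_comp (fun th => sin (/ 2 * th) - sin (/ 2 * PI)) Rabs).
          * apply (continuous_minus (V := R_NormedModule)); [apply Hsin|apply continuous_const].
          * apply continuous_Rabs.
      - apply (ex_derive_continuous (V := R_NormedModule)). auto_derive. auto. }
    assert (He2 : 0 < eps / 2) by lra.
    apply filterlim_locally with (eps := mkposreal _ He2) in Hfc. destruct Hfc as [r Hr].
    set (th := PI - Rmin (r / 2) (PI / 2)).
    assert (Hm : 0 < Rmin (r / 2) (PI / 2)) by (apply Rmin_glb_lt; [pose proof (cond_pos r); lra|lra]).
    assert (Hm2 : Rmin (r / 2) (PI / 2) <= PI / 2) by apply Rmin_r.
    assert (Hm3 : Rmin (r / 2) (PI / 2) <= r / 2) by apply Rmin_l.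
    assert (Hth : 0 < th < PI) by (unfold th; lra).
    specialize (Hr th).
    assert (Hrb : ball PI r th).
    { change (Rabs (th - PI) < r). unfold th. rewrite Rabs_left; pose proof (cond_pos r); lra. }
    specialize (Hr Hrb). change (Rabs (f th - f PI) < eps / 2) in Hr.
    rewrite Hf0, Rminus_0_r in Hr. pose proof (Rle_abs (f th)).
    specialize (Hbd th Hth).
    assert (S2 : sin (/ 2 * PI) = 1) by (rewrite <- sin_PI2; f_equal; field).
    replace (RtoC (sin (c * PI)) * l - RtoC PI)%C with
      (RtoC (sin (c * PI) - sin (c * th)) * l
       + (RtoC PI * RtoC (sin (/ 2 * th) - sin (/ 2 * PI))
       + (RtoC (sin (c * th)) * l - RtoC (sin (/ 2 * th)) * RtoC PI)))%C.
    2:{ rewrite S2, !RtoC_minus. ring. }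
    eapply Rle_trans; [apply Cmod_triangle|].
    eapply Rle_trans; [apply Rplus_le_compat_l, Cmod_triangle|].
    rewrite !Cmod_mult, !Cmod_R, (Rabs_pos_eq PI) by lra. unfold f in *. lra. }
  assert (Hsp : 0 < sin (c * PI)) by (apply sin_gt_0; nra).
  replace (RtoC (PI / sin (PI * c))) with l; [exact Hl|].
  rewrite (Rmult_comm PI c), RtoC_div by lra.
  assert (Hdiv : forall a b z : C, a <> RtoC 0 -> (a * z = b)%C -> z = (b / a)%C).
  { intros a b z Ha <-. field. exact Ha. }
  apply Hdiv; [|exact Hlim].
  intros H. apply RtoC_inj in H. lra.
Qed.

(** * Resolvents of positive operators *)

Lemma contraction_fixpoint {V : cspace} (f : V -> V) q : banach V -> 0 <= q < 1 ->
  (forall x y, nrm (f x -v f y) <= q * nrm (x -v y)) -> exists x, f x = x.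
Proof.
  intros HV Hq Hf.
  set (u := fun n => Nat.iter n f 0v).
  set (d := nrm (f 0v -v 0v)).
  assert (Hd : 0 <= d) by apply nrm_ge0.
  assert (H1 : forall n, nrm (u (S n) -v u n) <= q^n * d).
  { induction n as [|n IH]; [simpl; unfold d; lra|].
    eapply Rle_trans; [apply Hf|]. simpl pow. rewrite Rmult_assoc.
    apply Rmult_le_compat_l; [lra|exact IH]. }
  assert (H2 : forall n k, nrm (u (n + k)%nat -v u n) <= q^n * (d / (1 - q))).
  { intros n k. apply Rle_trans with ((1 - q^k) * (q^n * (d / (1 - q)))).
    - induction k as [|k IH].
      + rewrite Nat.add_0_r. replace (u n -v u n) with (0v : V) by vec. rewrite nrm_zero. simpl. lra.
      + eapply Rle_trans; [apply (nrm_tri3 _ (u (n + k)%nat))|].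
        rewrite Nat.add_succ_r. specialize (H1 (n + k)%nat).
        rewrite pow_add in H1.
        replace ((1 - q^S k) * (q^n * (d / (1 - q)))) with
          (q^n * q^k * d + (1 - q^k) * (q^n * (d / (1 - q)))) by (simpl; field; lra). lra.
    - rewrite <- (Rmult_1_l (q^n * (d / (1 - q)))) at 2.
      apply Rmult_le_compat_r.
      + apply Rmult_le_pos; [apply pow_le; lra|]. apply Rdiv_le_0_compat; lra.
      + assert (0 <= q^k) by (apply pow_le; lra). lra. }
  assert (Hlim : forall eps, 0 < eps -> exists N, forall n, (N <= n)%nat -> q^n * (d / (1 - q)) < eps).
  { intros eps Heps.
    assert (Hp : 0 <= d / (1 - q)) by (apply Rdiv_le_0_compat; lra).
    destruct (pow_lt_1_zero q ltac:(rewrite Rabs_pos_eq; lra) (eps / (1 + d / (1 - q)))) as [N HN].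
    { apply Rdiv_lt_0_compat; lra. }
    exists N. intros n Hn. specialize (HN n Hn).
    rewrite Rabs_pos_eq in HN by (apply pow_le; lra).
    assert (0 <= q^n) by (apply pow_le; lra).
    apply Rmult_lt_compat_r with (r := 1 + d / (1 - q)) in HN; [|lra].
    replace (eps / (1 + d / (1 - q)) * (1 + d / (1 - q))) with eps in HN by (field; split; lra).
    nra. }
  destruct (HV u) as [x Hx].
  { intros eps Heps. destruct (Hlim (eps / 2)) as [N HN]; [lra|].
    exists N. intros n m Hn Hm.
    eapply Rle_lt_trans; [apply (nrm_tri3 _ (u N))|]. rewrite (nrm_minus_sym (u N)).
    pose proof (HN N (le_n N)).
    replace n with (N + (n - N))%nat by lia. replace m with (N + (m - N))%nat by lia.
    pose proof (H2 N (n - N)%nat). pose proof (H2 N (m - N)%nat). lra. }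
  exists x. apply nrm_le_eps_eq. intros eps Heps.
  destruct (Hx (eps / 2)) as [N HN]; [lra|].
  pose proof (HN N (le_n N)) as A1. pose proof (HN (S N) ltac:(lia)) as A2.
  eapply Rle_trans; [apply (nrm_tri3 _ (u (S N)))|].
  specialize (Hf x (u N)). change (f (u N)) with (u (S N)) in Hf.
  rewrite (nrm_minus_sym x) in Hf. pose proof (nrm_ge0 (u N -v x)). nra.
Qed.

Section Resolvent.
Context {X : cspace}.
Variable A : linrel X X.

Lemma shift_inv_iff lam y x : shift_inv A lam y x <-> A x (y -v lam *v x).
Proof.
  unfold shift_inv; simpl. split.
  - intros (a & b & (c & -> & ->) & Hb & ->).
    replace (lam *v x +v b -v lam *v x) with b by vec. exact Hb.
  - intros H. exists (lam *v x), (y -v lam *v x). split; [|split].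
    + exists x. auto.
    + exact H.
    + vec.
Qed.

(** Bijectivity of lam + A with an inverse bounded by [K]; uniqueness of the preimage is contained
    in the estimate, by linearity. *)
Definition res_at (lam : C) (K : R) : Prop :=
  (forall y, exists x, A x (y -v lam *v x)) /\
  (forall x y, A x (y -v lam *v x) -> nrm x <= K * nrm y).

Definition Rv (lam : C) (y : X) : X :=
  epsilon (inhabits (0v : X)) (fun x => A x (y -v lam *v x)).

Lemma Rv_spec lam K y : res_at lam K -> A (Rv lam y) (y -v lam *v Rv lam y).
Proof. intros [H _]. unfold Rv. apply epsilon_spec, H. Qed.

Lemma graph_lin (a b : C) x y x' y' : A x y -> A x' y' ->
  A (a *v x +v b *v x') (a *v y +v b *v y').
Proof. intros H H'. apply graph_plus; now apply graph_scal. Qed.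

Lemma res_at_unique lam K y x x' : res_at lam K ->
  A x (y -v lam *v x) -> A x' (y -v lam *v x') -> x = x'.
Proof.
  intros [_ HK] H H'. apply nrm_sub_eq0. apply Rle_antisym; [|apply nrm_ge0].
  replace 0 with (K * nrm (0v : X)) by (rewrite nrm_zero; ring).
  apply HK. pose proof (graph_lin (RtoC 1) (- RtoC 1)%C _ _ _ _ H H') as H2.
  replace (x -v x') with (RtoC 1 *v x +v (- RtoC 1)%C *v x') by vec.
  match goal with |- graph A _ ?z => replace z with
    (RtoC 1 *v (y -v lam *v x) +v (- RtoC 1)%C *v (y -v lam *v x')) by vec end.
  exact H2.
Qed.
Lemma Rv_eq lam K y x : res_at lam K -> A x (y -v lam *v x) -> Rv lam y = x.
Proof. intros H Hx. eapply res_at_unique; [exact H|now apply Rv_spec with K|exact Hx]. Qed.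

Lemma Rv_blin lam K : res_at lam K -> blin (Rv lam) K.
Proof.
  intros H. split.
  - intros y y'. apply (Rv_eq _ K); [exact H|].
    pose proof (graph_plus A _ _ _ _ (Rv_spec _ _ y H) (Rv_spec _ _ y' H)) as H2.
    match goal with |- graph A _ ?z => replace z with
      (y -v lam *v Rv lam y +v (y' -v lam *v Rv lam y')) by vec end. exact H2.
  - intros c y. apply (Rv_eq _ K); [exact H|].
    pose proof (graph_scal A c _ _ (Rv_spec _ _ y H)) as H2.
    match goal with |- graph A _ ?z => replace z with
      (c *v (y -v lam *v Rv lam y)) by vec end. exact H2.
  - intros y. apply H. now apply Rv_spec with K.
Qed.

Lemma Rv_resfam K0 : 0 <= K0 ->
  resfam (fun lam => res_at lam (K0 / (1 + Cmod lam))) K0 Rv.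
Proof.
  intros HK. split; [exact HK| |].
  - intros lam H. now apply Rv_blin.
  - intros lam mu Hl Hm y.
    rewrite (Rv_eq lam _ y (Rv mu y +v (mu - lam)%C *v Rv lam (Rv mu y)) Hl); [vec|].
    pose proof (Rv_spec _ _ y Hm) as H1. pose proof (Rv_spec _ _ (Rv mu y) Hl) as H2.
    pose proof (graph_plus A _ _ _ _ H1 (graph_scal A (mu - lam)%C _ _ H2)) as H3.
    match goal with |- graph A _ ?z => match type of H3 with graph A _ ?w =>
      replace z with w by vec end end. exact H3.
Qed.

(** The equation (lam + A) x = y is the fixed point equation x = (t + A)^(-1) (y - (lam - t) x), a
    contraction with ratio [q]; the bound is that of the Neumann series. *)
Lemma res_at_perturb (HX : banach X) lam t K q :
  res_at t K -> 0 <= K -> 0 <= q < 1 -> Cmod (lam - t) * K <= q ->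
  res_at lam (K / (1 - q)).
Proof.
  intros H HK Hq Hle. split.
  - intros y.
    destruct (contraction_fixpoint (fun x => Rv t (y -v (lam - t)%C *v x)) q HX Hq) as [x Hx].
    { intros x x'. rewrite <- (blin_minus (Rv_blin t K H)).
      eapply Rle_trans; [apply (Rv_blin t K H)|].
      replace (y -v (lam - t)%C *v x -v (y -v (lam - t)%C *v x')) with
        ((- (lam - t))%C *v (x -v x')) by vec.
      rewrite nrm_scal_eq, Cmod_opp. pose proof (nrm_ge0 (x -v x')). nra. }
    exists x. pose proof (Rv_spec t K (y -v (lam - t)%C *v x) H) as H1. rewrite Hx in H1.
    match goal with |- graph A _ ?z => match type of H1 with graph A _ ?w =>
      replace z with w by vec end end. exact H1.
  - intros x y Hx.
    assert (H1 : nrm x <= K * nrm (y -v (lam - t)%C *v x)).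
    { apply H. match goal with |- graph A _ ?z => match type of Hx with graph A _ ?w =>
      replace z with w by vec end end. exact Hx. }
    pose proof (nrm_tri_minus y ((lam - t)%C *v x)) as H2. rewrite nrm_scal_eq in H2.
    pose proof (nrm_ge0 x). pose proof (nrm_ge0 y). pose proof (Cmod_ge_0 (lam - t)).
    apply Rmult_le_reg_r with (1 - q); [lra|].
    replace (K / (1 - q) * nrm y * (1 - q)) with (K * nrm y) by (field; lra).
    nra.
Qed.

Variable M : R.
Hypothesis HA : positive_with A M.

Lemma positive_exists s : 0 <= s -> forall y, exists x, A x (y -v RtoC s *v x).
Proof.
  intros Hs y. destruct HA as (_ & H & _). destruct (H s Hs) as (_ & Hd & _).
  destruct (Hd y) as [x (a & b & (c & -> & ->) & (d & (e & He & ->) & ->) & ->)].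
  exists x. match goal with |- graph A _ ?z => replace z with e by vec end. exact He.
Qed.
Lemma positive_unique s : 0 <= s -> forall x, A x (0v -v RtoC s *v x) -> x = 0v.
Proof.
  intros Hs x Hx. destruct HA as (_ & H & _). destruct (H s Hs) as (Hu & _ & _).
  assert (G : forall x, A x (0v -v RtoC s *v x) ->
    ((s *: lr_id X + (-1) *: ((-1) *: A))^-1)%lr 0v x).
  { clear x Hx. intros x Hx. exists (RtoC s *v x), (0v -v RtoC s *v x). split; [|split].
    - exists x. split; reflexivity.
    - exists ((- RtoC 1)%C *v (0v -v RtoC s *v x)). split.
      + exists (0v -v RtoC s *v x). split; [exact Hx|].
        apply f_equal2; [|reflexivity]. symmetry. apply (RtoC_opp 1).
      + change (0v -v RtoC s *v x = RtoC (-1) *v ((- RtoC 1)%C *v (0v -v RtoC s *v x))).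
        vec.
    - vec. }
  apply (Hu 0v); [now apply G|]. apply G.
  match goal with |- graph A _ ?z => replace z with (0v : X) by vec end. apply graph_zero.
Qed.

Lemma positive_res_pos s : 0 < s -> res_at (RtoC s) (M / (1 + s)).
Proof.
  intros Hs. split; [apply positive_exists; lra|].
  intros x y Hx.
  destruct HA as (HM & _ & Hn). specialize (Hn s Hs).
  unfold op_norm in Hn.
  match type of Hn with context [Lub_Rbar ?E] => pose proof (Lub_Rbar_correct E) as [Hub _];
    set (L := Lub_Rbar E) in * end.
  destruct (Req_dec (nrm y) 0) as [Hy|Hy].
  - apply nrm_eq0 in Hy. subst y. rewrite nrm_zero, Rmult_0_r.
    rewrite (positive_unique s ltac:(lra) x Hx), nrm_zero. lra.
  - assert (Hy0 : 0 < nrm y) by (pose proof (nrm_ge0 y); lra).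
    assert (H1 : Rbar_le (nrm (RtoC (/ nrm y) *v x)) L).
    { apply Hub. exists (RtoC (/ nrm y) *v y), (RtoC (/ nrm y) *v x). split; [|split; [|reflexivity]].
      - rewrite nrm_scal_eq, Cmod_R, Rabs_pos_eq by (left; now apply Rinv_0_lt_compat).
        right. field. lra.
      - apply shift_inv_iff. pose proof (graph_scal A (RtoC (/ nrm y)) _ _ Hx) as H2.
        match goal with |- graph A _ ?z => match type of H2 with graph A _ ?w =>
          replace z with w end end; [exact H2|].
        change (RtoC (/ nrm y) *v (y -v RtoC s *v x) = RtoC (/ nrm y) *v y -v RtoC s *v (RtoC (/ nrm y) *v x)).
        vec. }
    rewrite nrm_scal_eq, Cmod_R, Rabs_pos_eq in H1 by (left; now apply Rinv_0_lt_compat).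
    destruct L as [l| |].
    + simpl in H1, Hn.
      apply Rmult_le_compat_l with (r := nrm y * (1 + s)) in H1; [|nra].
      replace (nrm y * (1 + s) * (/ nrm y * nrm x)) with ((1 + s) * nrm x) in H1 by (field; lra).
      apply Rmult_le_reg_l with (1 + s); [lra|].
      replace ((1 + s) * (M / (1 + s) * nrm y)) with (M * nrm y) by (field; lra). nra.
    (* An infinite operator norm times 1 + s > 0 is infinite and cannot be bounded by [M]. *)
    + exfalso. simpl in Hn. destruct (Rle_dec 0 (1 + s)) as [r|r]; [|lra].
      destruct (Rle_lt_or_eq_dec 0 (1 + s) r); [exact Hn|lra].
    + destruct H1.
Qed.

(** Positivity prescribes the constant only for s > 0; the bound at 0 is the limit of small s,
    chosen in terms of eps and the norm of [x]. *)
Lemma positive_res s : 0 <= s -> res_at (RtoC s) (M / (1 + s)).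
Proof.
  intros [Hs| <-]; [now apply positive_res_pos|].
  split; [apply positive_exists; lra|].
  intros x y Hx. pose proof (proj1 HA) as HM. replace (M / (1 + 0)) with M by field.
  apply le_epsilon. intros eps Heps.
  pose proof (nrm_ge0 x) as Nx. pose proof (nrm_ge0 y) as Ny.
  set (s := eps / (M * (1 + nrm x))).
  assert (HMn : 0 < M * (1 + nrm x)) by nra.
  assert (Hs : 0 < s) by (apply Rdiv_lt_0_compat; lra).
  assert (H1 : nrm x <= M / (1 + s) * nrm (y +v RtoC s *v x)).
  { apply (positive_res_pos s Hs).
    match goal with |- graph A _ ?z => match type of Hx with graph A _ ?w =>
      replace z with w by vec end end. exact Hx. }
  pose proof (nrm_tri y (RtoC s *v x)) as H2. rewrite nrm_scal_eq, Cmod_R, Rabs_pos_eq in H2 by lra.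
  assert (H3 : M / (1 + s) <= M).
  { apply Rmult_le_reg_r with (1 + s); [lra|].
    replace (M / (1 + s) * (1 + s)) with M by (field; lra). nra. }
  assert (H4 : M * (s * nrm x) <= eps).
  { unfold s. apply Rle_trans with (eps * (nrm x / (1 + nrm x))).
    - right. field. lra.
    - rewrite <- (Rmult_1_r eps) at 2. apply Rmult_le_compat_l; [lra|].
      apply Rmult_le_reg_r with (1 + nrm x); [lra|].
      replace (nrm x / (1 + nrm x) * (1 + nrm x)) with (nrm x) by (field; lra). lra. }
  assert (0 <= M / (1 + s)) by (apply Rdiv_le_0_compat; lra).
  pose proof (nrm_ge0 (y +v RtoC s *v x)). nra.
Qed.
End Resolvent.

(** * Collapsing the contour *)

Lemma deriv_comp {V : cspace} (F : R -> V) (g : R -> R) x d g' :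
  has_deriv F (g x) d -> is_derive g x g' ->
  has_deriv (fun x => F (g x)) x (RtoC g' *v d).
Proof.
  intros HF Hg eps Heps.
  pose proof (deriv_RtoC g x g' Hg) as Hg1.
  pose proof (nrm_ge0 d) as Nd. pose proof (Rabs_pos g') as Ng.
  set (e := Rmin 1 (eps / (2 + Rabs g' + nrm d))).
  assert (He : 0 < e) by (apply Rmin_glb_lt; [lra|apply Rdiv_lt_0_compat; lra]).
  assert (He1 : e <= 1) by apply Rmin_l.
  assert (He2 : e * (2 + Rabs g' + nrm d) <= eps).
  { apply Rle_trans with (eps / (2 + Rabs g' + nrm d) * (2 + Rabs g' + nrm d)).
    - apply Rmult_le_compat_r; [lra|apply Rmin_r].
    - right. field. lra. }
  destruct (Hg1 e He) as (d1 & Hd1 & H1).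
  destruct (HF e He) as (d2 & Hd2 & H2).
  exists (Rmin d1 (d2 / (1 + Rabs g'))). split.
  { apply Rmin_glb_lt; [lra|apply Rdiv_lt_0_compat; lra]. }
  intros h Hh. specialize (H1 h (Rlt_le_trans _ _ _ Hh (Rmin_l _ _))).
  assert (Hh2 : Rabs h * (1 + Rabs g') < d2).
  { apply Rlt_le_trans with (d2 / (1 + Rabs g') * (1 + Rabs g')).
    - apply Rmult_lt_compat_r; [lra|]. eapply Rlt_le_trans; [exact Hh|apply Rmin_r].
    - right. field. lra. }
  change (Cmod (g (x + h)%R - g x - h * g')%C <= e * Rabs h) in H1.
  rewrite <- RtoC_minus, <- RtoC_mult, <- RtoC_minus, Cmod_R in H1.
  set (k := g (x + h) - g x) in *.
  assert (Hk : Rabs k <= Rabs h * (1 + Rabs g')).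
  { replace k with ((k - h * g') + h * g') by ring.
    eapply Rle_trans; [apply Rabs_triang|]. rewrite (Rabs_mult h g').
    pose proof (Rabs_pos h). nra. }
  specialize (H2 k ltac:(lra)). replace (g x + k) with (g (x + h)) in H2 by (unfold k; ring).
  replace (F (g (x + h)) -v F (g x) -v RtoC h *v (RtoC g' *v d)) with
    ((F (g (x + h)) -v F (g x) -v RtoC k *v d) +v RtoC (k - h * g') *v d) by vec.
  eapply Rle_trans; [apply nrm_tri|]. rewrite nrm_scal_eq, Cmod_R.
  pose proof (Rabs_pos h). pose proof (Rabs_pos k).
  assert (e * Rabs k <= e * (Rabs h * (1 + Rabs g'))) by (apply Rmult_le_compat_l; lra).
  assert (Rabs (k - h * g') * nrm d <= e * Rabs h * nrm d) by (apply Rmult_le_compat_r; lra).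
  assert (e * (2 + Rabs g' + nrm d) * Rabs h <= eps * Rabs h) by (apply Rmult_le_compat_r; lra).
  nra.
Qed.

Lemma cont_comp {V : cspace} (F : R -> V) (g : R -> R) x :
  cont_at F (g x) -> continuous g x -> cont_at (fun x => F (g x)) x.
Proof.
  intros HF Hg eps Heps. destruct (HF eps Heps) as (d1 & Hd1 & H1).
  destruct (cont_RtoC g x Hg (d1 / 2)) as (d & Hd & H2); [lra|].
  exists d. split; [exact Hd|]. intros h Hh. specialize (H2 h Hh).
  change (Cmod (g (x + h)%R - g x)%C <= d1 / 2) in H2.
  rewrite <- RtoC_minus, Cmod_R in H2.
  specialize (H1 (g (x + h) - g x) ltac:(lra)).
  now replace (g x + (g (x + h) - g x)) with (g (x + h)) in H1 by ring.
Qed.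

Section RiemannLink.
Context {V : cspace}.
Hypothesis HV : banach V.

Lemma RInt_of_deriv (f F : R -> V) a b :
  (forall x, Rmin a b <= x <= Rmax a b -> has_deriv F x (f x)) ->
  (forall x, Rmin a b <= x <= Rmax a b -> cont_at f x) ->
  is_RInt (V := realify V) f a b (F b -v F a).
Proof.
  intros HF Hf.
  apply (is_RInt_derive (V := rcomplete HV) F f a b).
  - intros x Hx. split; [apply is_linear_scal_l|].
    intros z Hz. apply (is_filter_lim_locally_unique (K := R_AbsRing) (V := R_NormedModule) x z) in Hz. subst z.
    intros eps. destruct (HF x Hx eps (cond_pos eps)) as (d & Hd & Hh).
    exists (mkposreal d Hd). intros y Hy. specialize (Hh (y - x) Hy).
    rewrite (Rplus_minus x y) in Hh. exact Hh.
  - intros x Hx. apply filterlim_locally. intros eps.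
    destruct (Hf x Hx (eps / 2)) as (d & Hd & Hh); [pose proof (cond_pos eps); lra|].
    exists (mkposreal d Hd). intros y Hy.
    apply (ball_nrm (V := V)). specialize (Hh (y - x) Hy).
    rewrite (Rplus_minus x y) in Hh.
    pose proof (cond_pos eps). lra.
Qed.

Lemma RInt_gen_right (f F : R -> V) a L :
  (forall x, a <= x -> has_deriv F x (f x)) -> (forall x, a <= x -> cont_at f x) ->
  lim_p F L ->
  is_RInt_gen (V := realify V) f (at_point a) (Rbar_locally p_infty) (L -v F a).
Proof.
  intros HF Hf HL P [d Hd].
  destruct (HL (d / 2)) as [N HN]; [pose proof (cond_pos d); lra|].
  apply (Filter_prod _ _ _ (fun x => x = a) (fun x => Rmax N a < x)).
  - reflexivity.
  - exists (Rmax N a). auto.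
  - intros x y -> Hy. pose proof (Rmax_l N a). pose proof (Rmax_r N a).
    exists (F y -v F a). split.
    + apply RInt_of_deriv; intros x Hx; simpl in Hx; rewrite Rmin_left in Hx by lra;
        [apply HF|apply Hf]; lra.
    + apply Hd. apply (ball_nrm (V := V)).
      replace (F y -v F a -v (L -v F a)) with (F y -v L) by vec.
      specialize (HN y ltac:(lra)). pose proof (cond_pos d). lra.
Qed.
Lemma RInt_gen_left (f F : R -> V) a L :
  (forall x, a <= x -> has_deriv F x (f x)) -> (forall x, a <= x -> cont_at f x) ->
  lim_p F L ->
  is_RInt_gen (V := realify V) f (Rbar_locally p_infty) (at_point a) (F a -v L).
Proof.
  intros HF Hf HL P [d Hd].
  destruct (HL (d / 2)) as [N HN]; [pose proof (cond_pos d); lra|].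
  apply (Filter_prod _ _ _ (fun x => Rmax N a < x) (fun x => x = a)).
  - exists (Rmax N a). auto.
  - reflexivity.
  - intros y x Hy ->. pose proof (Rmax_l N a). pose proof (Rmax_r N a).
    exists (F a -v F y). split.
    + apply RInt_of_deriv; intros x Hx; simpl in Hx; rewrite Rmin_right in Hx by lra;
        [apply HF|apply Hf]; lra.
    + apply Hd. apply (ball_nrm (V := V)).
      replace (F a -v F y -v (F a -v L)) with (-v (F y -v L)) by vec. rewrite nrm_opp.
      specialize (HN y ltac:(lra)). pose proof (cond_pos d). lra.
Qed.
Lemma RInt_gen_uniq (f : R -> V) Fa Fb l l' : ProperFilter' Fa -> ProperFilter' Fb ->
  is_RInt_gen (V := realify V) f Fa Fb l -> is_RInt_gen (V := realify V) f Fa Fb l' -> l = l'.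
Proof.
  intros HFa HFb H H'.
  rewrite <- (is_RInt_gen_unique (V := rcomplete HV) f l H).
  apply (is_RInt_gen_unique (V := rcomplete HV) f l' H').
Qed.
End RiemannLink.

Lemma Carg_polar s t : 0 < s -> - PI < t < PI -> Carg (RtoC s * cis t)%C = t.
Proof.
  intros Hs Ht.
  assert (Hm : Cmod (RtoC s * cis t)%C = s).
  { rewrite Cmod_mult, Cmod_cis, Cmod_R, Rabs_pos_eq; lra. }
  unfold Carg. rewrite Hm.
  replace (Re (RtoC s * cis t)%C) with (s * cos t) by (unfold cis, RtoC, Cmult; simpl; ring).
  replace (Im (RtoC s * cis t)%C) with (s * sin t) by (unfold cis, RtoC, Cmult; simpl; ring).
  replace (s * cos t / s) with (cos t) by (field; lra).
  destruct (Rle_dec 0 (s * sin t)) as [H|H]; destruct (Rle_lt_dec 0 t) as [H0|H0].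
  - apply acos_cos. lra.
  - exfalso. assert (0 < sin (- t)) by (apply sin_gt_0; lra). rewrite sin_neg in H1. nra.
  - exfalso. apply H. apply Rmult_le_pos; [lra|]. apply sin_ge_0; lra.
  - rewrite <- cos_neg, acos_cos; lra.
Qed.

(** For 0 < th < 2 PI the number - lam has principal argument th - PI, so the principal branch is a
    constant phase times the continuous branch [ep]. For this reason the lower ray is given the
    angle 2 PI - psi instead of - psi. *)
Lemma contour_weight a s th : 0 < s -> 0 < th < 2 * PI ->
  (Cpower (- (RtoC s * cis th)) (- a) * cis th = cis (a * PI) * RtoC (/ s) * ep (1 - a) (ln s) th)%C.
Proof.
  intros Hs Hth.
  replace (- (RtoC s * cis th))%C with (RtoC s * cis (th - PI))%C.
  2:{ unfold Rminus. rewrite cis_plus. replace (cis (- PI)) with (- RtoC 1)%C; [ring|].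
      unfold cis. rewrite cos_neg, sin_neg, cos_PI, sin_PI.
      unfold RtoC, Copp; simpl. f_equal; ring. }
  unfold Cpower. rewrite Carg_polar by lra.
  rewrite Cmod_mult, Cmod_cis, Cmod_R, Rabs_pos_eq by lra. rewrite Rmult_1_r.
  unfold Rpower, ep.
  replace (exp ((1 - a) * ln s)) with (s * exp (- a * ln s)).
  2:{ rewrite <- (exp_ln s) at 1 by exact Hs. rewrite <- exp_plus. f_equal. ring. }
  rewrite RtoC_mult, RtoC_inv by lra.
  replace (cis ((1 - a) * th)) with (cis th * cis (- (a * th)))%C
    by (rewrite <- cis_plus; f_equal; ring).
  replace (cis (- a * (th - PI))) with (cis (- (a * th)) * cis (a * PI))%C
    by (rewrite <- cis_plus; f_equal; ring).
  assert (Hs0 : RtoC s <> RtoC 0) by (intros H; apply RtoC_inj in H; lra).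
  field. exact Hs0.
Qed.

Section ContourDomain.
Context {X : cspace} {A : linrel X X} {M : R}.
Hypothesis HX : banach X.
Hypothesis HA : positive_with A M.

Lemma res_at_weaken lam K K' : K <= K' -> res_at A lam K -> res_at A lam K'.
Proof.
  intros H [H1 H2]. split; [exact H1|]. intros x y Hx.
  eapply Rle_trans; [apply H2; exact Hx|]. apply Rmult_le_compat_r; [apply nrm_ge0|exact H].
Qed.

(** Perturbation from the real point of the same modulus. The squared chord 2 - 2 cos th is at most
    2 (sin psi)^2 and M sin psi <= 1/2, so the contraction ratio is at most 3/4 and the constant
    grows by the factor 4. *)
Lemma sector_res psi x th : 0 < psi < asin (1 / (2 * M)) -> - psi <= th <= psi ->
  res_at A (pol x th) (4 * M / (1 + Cmod (pol x th))).
Proof.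
  intros Hpsi Hth. pose proof (proj1 HA) as HM. pose proof (exp_pos x) as E.
  assert (Hm : 0 < 1 / (2 * M) <= 1 / 2).
  { split; [apply Rdiv_lt_0_compat; lra|]. apply Rmult_le_compat_l; [lra|].
    apply Rinv_le_contravar; lra. }
  pose proof (asin_bound (1 / (2 * M))) as Hab. pose proof PI_RGT_0.
  assert (Hs : sin psi < 1 / (2 * M)).
  { rewrite <- (sin_asin (1 / (2 * M))) by lra. apply sin_increasing_1; lra. }
  assert (Hs0 : 0 < sin psi) by (apply sin_gt_0; lra).
  assert (Hc0 : 0 <= cos psi) by (apply cos_ge_0; lra).
  assert (Hcth : cos psi <= cos th).
  { destruct (Rle_lt_dec 0 th); [apply cos_decr_1; lra|].
    rewrite <- (cos_neg th). apply cos_decr_1; lra. }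
  set (d := Cmod (cis th - RtoC 1)).
  assert (Hd0 : 0 <= d) by apply Cmod_ge_0.
  assert (Hd : d^2 = 2 - 2 * cos th).
  { unfold d, Cmod. rewrite pow2_sqrt by (apply Rplus_le_le_0_compat; apply pow2_ge_0).
    unfold cis, RtoC; simpl. pose proof (sin2_cos2 th) as Q. unfold Rsqr in Q. nra. }
  assert (HMs : M * sin psi <= / 2).
  { apply Rlt_le in Hs. apply Rmult_le_compat_l with (r := M) in Hs; [|lra].
    eapply Rle_trans; [exact Hs|]. right. field. lra. }
  assert (HMd : M * d <= 3 / 4).
  { apply Rsqr_incr_0_var; [|lra]. rewrite !Rsqr_pow2, Rpow_mult_distr, Hd.
    pose proof (sin2_cos2 psi) as Q. unfold Rsqr in Q.
    assert (2 - 2 * cos th <= 2 * sin psi^2) by nra.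
    assert (M^2 * (2 - 2 * cos th) <= M^2 * (2 * sin psi^2)) by (apply Rmult_le_compat_l; [apply pow2_ge_0|lra]).
    assert ((M * sin psi)^2 <= (/ 2)^2) by (apply pow_incr; nra). nra. }
  pose proof (positive_res A M HA (exp x) ltac:(lra)) as H0.
  assert (Hq := res_at_perturb A HX (pol x th) _ _ (3/4) H0 ltac:(apply Rdiv_le_0_compat; lra) ltac:(lra)).
  replace (4 * M / (1 + Cmod (pol x th))) with (M / (1 + exp x) / (1 - 3 / 4)).
  2:{ rewrite Cmod_pol. field. lra. }
  apply Hq.
  replace (pol x th - RtoC (exp x))%C with (RtoC (exp x) * (cis th - RtoC 1))%C by (unfold pol; ring).
  rewrite Cmod_mult, Cmod_R, (Rabs_pos_eq (exp x)) by lra. fold d.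
  apply Rmult_le_reg_r with (1 + exp x); [lra|].
  replace (exp x * d * (M / (1 + exp x)) * (1 + exp x)) with (exp x * (M * d)) by (field; lra).
  nra.
Qed.

(** Perturbation from 0 with ratio 1/2; the resulting bound 2 M is weakened to the form shared with
    the sector. *)
Lemma disc_res x th : exp x <= 1 / (2 * M) ->
  res_at A (pol x th) (4 * M / (1 + Cmod (pol x th))).
Proof.
  intros Hx. pose proof (proj1 HA) as HM. pose proof (exp_pos x) as E.
  assert (Hm : 1 / (2 * M) <= 1 / 2).
  { apply Rmult_le_compat_l; [lra|]. apply Rinv_le_contravar; lra. }
  pose proof (positive_res A M HA 0 ltac:(lra)) as H0.
  replace (M / (1 + 0)) with M in H0 by field.
  assert (Hq := res_at_perturb A HX (pol x th) _ _ (1/2) H0 ltac:(lra) ltac:(lra)).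
  apply res_at_weaken with (M / (1 - 1 / 2)).
  - rewrite Cmod_pol. apply Rmult_le_reg_r with (1 + exp x); [lra|].
    replace (4 * M / (1 + exp x) * (1 + exp x)) with (4 * M) by (field; lra). nra.
  - apply Hq. replace (pol x th - RtoC 0)%C with (pol x th) by ring. rewrite Cmod_pol.
    apply Rmult_le_compat_r with (r := M) in Hx; [|lra].
    eapply Rle_trans; [exact Hx|]. right. field. lra.
Qed.
End ContourDomain.

Section Contour.
Context {X : cspace} {A : linrel X X} {M psi r a : R}.
Hypothesis HX : banach X.
Hypothesis HA : positive_with A M.
Hypothesis Hpsi : 0 < psi < asin (1 / (2 * M)).
Hypothesis Hr : 0 < r < 1 / (2 * M).
Hypothesis Ha : 0 < a < 1.
Variable y : X.

Let c := 1 - a.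
Let D (lam : C) : Prop := res_at A lam (4 * M / (1 + Cmod lam)).
Let m := mel (Rv A) c y.
Let b := Finite (ln (1 / (2 * M))).

Lemma contour_M : 1 <= M.
Proof. apply HA. Qed.
Lemma contour_psi : psi < PI / 2.
Proof. pose proof (asin_bound (1 / (2 * M))). lra. Qed.
Lemma contour_resfam : resfam D (4 * M) (Rv A).
Proof. apply Rv_resfam. pose proof contour_M. lra. Qed.
Lemma contour_ok_lo th : 0 <= th <= psi -> forall x : R, Rbar_lt x p_infty -> D (pol x th).
Proof. intros H x _. apply (sector_res HX HA psi); lra. Qed.
Lemma pol_period x th : pol x (th - 2 * PI) = pol x th.
Proof.
  unfold pol. f_equal. unfold cis. f_equal.
  - rewrite <- (cos_period (th - 2 * PI) 1). f_equal. simpl. ring.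
  - rewrite <- (sin_period (th - 2 * PI) 1). f_equal. simpl. ring.
Qed.
Lemma contour_ok_hi th : 2 * PI - psi <= th <= 2 * PI ->
  forall x : R, Rbar_lt x p_infty -> D (pol x th).
Proof. intros H x _. rewrite <- pol_period. apply (sector_res HX HA psi); lra. Qed.
Lemma contour_ok_disc th : forall x : R, Rbar_lt x b -> D (pol x th).
Proof.
  intros x Hx. apply (disc_res HX HA). simpl in Hx. left.
  pose proof contour_M. apply exp_increasing in Hx. rewrite exp_ln in Hx; [exact Hx|].
  apply Rdiv_lt_0_compat; lra.
Qed.
Lemma contour_lnr : Rbar_lt (ln r) b.
Proof. simpl. apply ln_increasing; lra. Qed.

Lemma ray_deriv th F s : 0 < s -> anti p_infty (m th) F ->
  has_deriv (fun s => cis (a * PI) *v F (ln s)) s (cis (a * PI) *v (RtoC (/ s) *v m th (ln s))).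
Proof.
  intros Hs [HF _]. apply (deriv_blin (blin_scalar (cis (a * PI)))).
  apply (deriv_comp F ln s (m th (ln s)) (/ s)); [apply HF; exact I|].
  apply is_derive_Reals. now apply derivable_pt_lim_ln.
Qed.
Lemma ray_cont th s : 0 < s -> (forall x : R, Rbar_lt x p_infty -> D (pol x th)) ->
  cont_at (fun s => cis (a * PI) *v (RtoC (/ s) *v m th (ln s))) s.
Proof.
  intros Hs Hok. apply (cont_blin (blin_scalar (cis (a * PI)))).
  apply (cont_prod (fun s => RtoC (/ s))).
  - apply (cont_RtoC Rinv). apply continuous_Rinv. lra.
  - apply (cont_comp (m th) ln).
    + eapply deriv_cont, (mel_deriv_ok contour_resfam c ltac:(unfold c; lra) p_infty th y Hok); exact I.
    + apply (ex_derive_continuous (V := R_NormedModule)). exists (/ s).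
      apply is_derive_Reals. now apply derivable_pt_lim_ln.
Qed.
Lemma lim_ln_p (F : R -> X) l : lim_p F l ->
  lim_p (fun s => cis (a * PI) *v F (ln s)) (cis (a * PI) *v l).
Proof.
  intros H. apply (lim_p_blin (blin_scalar (cis (a * PI)))).
  intros eps Heps. destruct (H eps Heps) as [N HN]. exists (exp N). intros x Hx.
  apply HN. rewrite <- (ln_exp N). apply ln_increasing; [apply exp_pos|exact Hx].
Qed.

Let f0 (lam : C) : X := Cpower (- lam) (- a) *v Rv A lam y.

Lemma ray_integrand th s : 0 < s -> 0 < th < 2 * PI ->
  cis (a * PI) *v (RtoC (/ s) *v m th (ln s)) = cis th *v f0 (RtoC s * cis th)%C.
Proof.
  intros Hs Hth. unfold m, mel, f0, pol. rewrite exp_ln by exact Hs.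
  transitivity ((Cpower (- (RtoC s * cis th)) (- a) * cis th)%C *v Rv A (RtoC s * cis th)%C y); [|vec].
  rewrite contour_weight by assumption. fold c. vec.
Qed.

Lemma arc_integrand th : 0 < th < 2 * PI ->
  cis (a * PI) *v (Ci *v m th (ln r)) = (Ci * (RtoC r * cis th))%C *v f0 (RtoC r * cis th)%C.
Proof.
  intros Hth. unfold m, mel, f0, pol. rewrite exp_ln by lra.
  transitivity ((Ci * RtoC r * (Cpower (- (RtoC r * cis th)) (- a) * cis th))%C *v Rv A (RtoC r * cis th)%C y); [|vec].
  rewrite contour_weight by lra. fold c. rewrite RtoC_inv by lra. vec_coefs. field.
  intros H; apply RtoC_inj in H; lra.
Qed.

(** The jump of lam^(-a) across the half-line: because of this factor the two rays of the contour do
    not cancel. *)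
Lemma mel_2PI x : m (2 * PI) x = cis (- (2 * PI * a)) *v m 0 x.
Proof.
  unfold m, mel. rewrite <- (pol_period x (2 * PI)). replace (2 * PI - 2 * PI) with 0 by ring.
  unfold ep. replace (c * (2 * PI)) with (- (2 * PI * a) + 2 * PI) by (unfold c; ring).
  rewrite cis_plus. replace (cis (2 * PI)) with (RtoC 1).
  2:{ unfold cis. now rewrite cos_2PI, sin_2PI. }
  rewrite Rmult_0_r, cis_0. vec.
Qed.

(** The antiderivatives cancel at the two corners of the contour and leave exp (i a PI) (J0 - J2),
    where J2 is [J0] times the jump factor; the difference of the two phases is 2 i sin (PI a). *)
Lemma contour_value J0 : is_int (m 0) J0 ->
  exists l1 l2 l3 : X,
    is_path_int f0 (fun s => (s * cis (- psi))%C) (fun _ => cis (- psi))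
      (Rbar_locally p_infty) (at_point r) l1 /\
    is_path_int f0 (fun th => (r * cis th)%C) (fun th => (Ci * (r * cis th))%C)
      (at_point (2 * PI - psi)) (at_point psi) l2 /\
    is_path_int f0 (fun s => (s * cis psi)%C) (fun _ => cis psi)
      (at_point r) (Rbar_locally p_infty) l3 /\
    l1 +v l2 +v l3 = (2 * PI * Ci)%C *v (RtoC (sin (PI * a) / PI) *v J0).
Proof.
  intros HJ. pose proof contour_M as HM. pose proof contour_psi as Hp. pose proof PI_RGT_0 as HPI.
  pose proof contour_resfam as HR. assert (Hc : 0 < c < 1) by (unfold c; lra).
  assert (HJ1 : is_int (m psi) J0).
  { apply (mel_int_rot HX HR c Hc y 0 psi); [lra|exact contour_ok_lo|exact HJ]. }
  destruct (mel_int_exists HX HR c Hc (2 * PI - psi) y) as [J2 HJ2].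
  { apply contour_ok_hi; lra. }
  assert (HJ3 : is_int (m (2 * PI)) J2).
  { apply (mel_int_rot HX HR c Hc y (2 * PI - psi) (2 * PI)); [lra|exact contour_ok_hi|exact HJ2]. }
  assert (EJ : J2 = cis (- (2 * PI * a)) *v J0).
  { apply (int_unique (m (2 * PI))); [exact HJ3|].
    eapply int_ext; [|exact (int_scal _ _ (cis (- (2 * PI * a))) HJ)].
    intros x. simpl. symmetry. apply mel_2PI. }
  destruct HJ1 as (F1 & HF1 & L1). destruct HJ2 as (F2 & HF2 & L2).
  (* Inside the disc the resolvent exists for every angle; [Phi] joins the antiderivatives on the
     two rays through the arc. *)
  pose (Phi := fun th => epsilon (inhabits (fun _ : R => 0v : X)) (fun F => anti b (m th) F)).
  assert (HPhi : forall th, anti b (m th) (Phi th)).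
  { intros th. unfold Phi. apply epsilon_spec.
    apply (mel_anti_exists HX HR c Hc b th y); [discriminate|apply contour_ok_disc]. }
  assert (HPd : forall th, has_deriv (fun th => Phi th (ln r)) th (Ci *v m th (ln r))).
  { intros th. apply (anti_deriv_th HR c Hc b Phi y (th - 1) (th + 1)); [discriminate| |lra|exact contour_lnr].
    intros t _. split; [apply contour_ok_disc|apply HPhi]. }
  assert (E1 : F1 (ln r) = Phi psi (ln r)).
  { apply (anti_unique b (m psi)); [|apply HPhi|exact contour_lnr].
    destruct HF1 as [Q1 Q2]. split; [intros x _; now apply Q1|exact Q2]. }
  assert (E2 : F2 (ln r) = Phi (2 * PI - psi) (ln r)).
  { apply (anti_unique b (m (2 * PI - psi))); [|apply HPhi|exact contour_lnr].
    destruct HF2 as [Q1 Q2]. split; [intros x _; now apply Q1|exact Q2]. }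
  set (e := cis (a * PI)).
  exists (e *v F2 (ln r) -v e *v J2), (e *v Phi psi (ln r) -v e *v Phi (2 * PI - psi) (ln r)),
    (e *v J0 -v e *v F1 (ln r)).
  assert (Hcis : cis (- psi) = cis (2 * PI - psi)).
  { unfold cis. f_equal.
    - rewrite <- (cos_period (- psi) 1). f_equal. simpl. ring.
    - rewrite <- (sin_period (- psi) 1). f_equal. simpl. ring. }
  split; [|split; [|split]].
  - eapply is_RInt_gen_ext; [|apply (RInt_gen_left HX
      (fun s => e *v (RtoC (/ s) *v m (2 * PI - psi) (ln s))) (fun s => e *v F2 (ln s)) r (e *v J2))].
    + apply (Filter_prod _ _ _ (fun x => r < x) (fun x => x = r)); [exists r; auto|reflexivity|].
      intros u v Hu -> s Hs. simpl in Hs. rewrite Rmin_right in Hs by lra.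
      rewrite Hcis. apply ray_integrand; lra.
    + intros x Hx. apply (ray_deriv (2 * PI - psi) F2 x); [lra|exact HF2].
    + intros x Hx. apply (ray_cont (2 * PI - psi) x); [lra|apply contour_ok_hi; lra].
    + now apply lim_ln_p.
  - apply is_RInt_gen_at_point.
    apply (is_RInt_ext (V := realify X) (fun th => e *v (Ci *v m th (ln r)))).
    + intros th Hth. rewrite Rmin_right, Rmax_left in Hth by lra. apply arc_integrand. lra.
    + apply (RInt_of_deriv HX (fun th => e *v (Ci *v m th (ln r))) (fun th => e *v Phi th (ln r))).
      * intros th _. apply (deriv_blin (blin_scalar e)). apply HPd.
      * intros th _. apply (cont_blin (blin_scalar e)).
        apply (cont_blin (blin_scalar Ci)).
        apply (deriv_cont _ _ (Ci *v melD (Rv A) c y th (ln r))).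
        apply (mel_deriv_th HR c y th (ln r) 1); [lra|lra|].
        intros h _. apply contour_ok_disc, contour_lnr.
  - eapply is_RInt_gen_ext; [|apply (RInt_gen_right HX
      (fun s => e *v (RtoC (/ s) *v m psi (ln s))) (fun s => e *v F1 (ln s)) r (e *v J0))].
    + apply (Filter_prod _ _ _ (fun x => x = r) (fun x => r < x)); [reflexivity|exists r; auto|].
      intros u v -> Hu s Hs. simpl in Hs. rewrite Rmin_left in Hs by lra.
      apply ray_integrand; lra.
    + intros x Hx. apply (ray_deriv psi F1 x); [lra|exact HF1].
    + intros x Hx. apply (ray_cont psi x); [lra|apply contour_ok_lo; lra].
    + now apply lim_ln_p.
  - rewrite E1, E2, EJ.
    transitivity ((e - e * cis (- (2 * PI * a)))%C *v J0); [vec|].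
    transitivity ((2 * PI * Ci * RtoC (sin (PI * a) / PI))%C *v J0); [|vec].
    f_equal. unfold e. rewrite <- cis_plus.
    replace (a * PI + - (2 * PI * a)) with (- (PI * a)) by ring.
    rewrite (Rmult_comm a PI), RtoC_div by lra.
    transitivity (2 * Ci * RtoC (sin (PI * a)))%C.
    + unfold cis, RtoC, Cmult, Cminus, Cplus, Copp, Ci; simpl. rewrite cos_neg, sin_neg.
      f_equal; ring.
    + field. intros H; apply RtoC_inj in H; lra.
Qed.
End Contour.

(* The negative power A^(-a) is [fpow (Rv A) a]. *)
Definition fpow_coef (a : R) : R := sin (PI * a) / PI.
Definition fpow {V : cspace} (Psi : C -> V -> V) (a : R) (y : V) : V :=
  RtoC (fpow_coef a) *v
    epsilon (inhabits (0v : V)) (fun l => is_int (mel Psi (1 - a) y 0) l).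

Lemma asin_half_pos M : 1 <= M -> 0 < asin (1 / (2 * M)).
Proof.
  intros HM.
  assert (H : 0 < 1 / (2 * M) <= 1 / 2).
  { split; [apply Rdiv_lt_0_compat; lra|]. apply Rmult_le_compat_l; [lra|].
    apply Rinv_le_contravar; lra. }
  pose proof (asin_bound (1 / (2 * M))). pose proof PI_RGT_0.
  destruct (Rle_lt_dec (asin (1 / (2 * M))) 0) as [Hle|]; [exfalso|assumption].
  assert (H2 : sin (asin (1 / (2 * M))) <= sin 0) by (apply sin_incr_1; lra).
  rewrite sin_asin, sin_0 in H2; lra.
Qed.

Section NegPower.
Context {X : cspace} {A : linrel X X}.
Hypothesis HX : banach X.

Lemma contour_res_at M psi r lam : positive_with A M ->
  0 < psi < asin (1 / (2 * M)) -> 0 < r < 1 / (2 * M) -> on_contour psi r lam ->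
  exists K, res_at A lam K.
Proof.
  intros HA Hpsi Hr [(s & Hs & [-> | ->])|(th & Hth & ->)].
  - eexists. replace (RtoC s * cis (- psi))%C with (pol (ln s) (- psi)).
    + apply (sector_res HX HA psi); lra.
    + unfold pol. rewrite exp_ln by lra. reflexivity.
  - eexists. replace (RtoC s * cis psi)%C with (pol (ln s) psi).
    + apply (sector_res HX HA psi); lra.
    + unfold pol. rewrite exp_ln by lra. reflexivity.
  - eexists. replace (RtoC r * cis th)%C with (pol (ln r) th).
    + apply (disc_res HX HA). rewrite exp_ln; lra.
    + unfold pol. rewrite exp_ln by lra. reflexivity.
Qed.

(** In one direction a single admissible contour determines [x], and one must be exhibited because
    [neg_power] quantifies over admissible contours. In the other, every contour, with its own
    constant [M], collapses to the same half-line integral [l]. *)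
Lemma neg_power_value a y x l : (exists M, positive_with A M) -> 0 < a < 1 ->
  is_int (mel (Rv A) (1 - a) y 0) l ->
  neg_power A a y x <-> x = RtoC (fpow_coef a) *v l.
Proof.
  intros (M0 & HM0) Ha Hl. pose proof PI_RGT_0 as HPI.
  assert (H2 : (2 * PI * Ci)%C <> RtoC 0).
  { intros H. apply (f_equal snd) in H. unfold Cmult, RtoC, Ci in H; simpl in H. lra. }
  assert (Hinv : forall v : X, (/ (2 * PI * Ci))%C *v ((2 * PI * Ci)%C *v v) = v).
  { intros v. transitivity ((/ (2 * PI * Ci) * (2 * PI * Ci))%C *v v); [vec|].
    rewrite (Cinv_l _ H2). apply Cscal_one. }
  split.
  - intros H. pose proof (proj1 HM0) as HM1. pose proof (asin_half_pos M0 HM1) as Hpos.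
    set (psi := asin (1 / (2 * M0)) / 2). set (r := 1 / (2 * M0) / 2).
    assert (Hm : 0 < 1 / (2 * M0)) by (apply Rdiv_lt_0_compat; lra).
    assert (Hpsi : 0 < psi < asin (1 / (2 * M0))) by (unfold psi; lra).
    assert (Hr : 0 < r < 1 / (2 * M0)) by (unfold r; lra).
    destruct (H psi r) as (Rs & l' & HRs & (m1 & m2 & m3 & I1 & I2 & I3 & ->) & ->).
    { exists M0. auto. }
    destruct (contour_value HX HM0 Hpsi Hr Ha y l Hl) as (l1 & l2 & l3 & K1 & K2 & K3 & E).
    (* [Rs] is prescribed on the contour only, so its path integrals are compared on the parameter
       ranges. *)
    assert (ERs : forall lam, on_contour psi r lam -> Rs lam = Rv A lam y).
    { intros lam Hlam. destruct (contour_res_at M0 psi r lam HM0 Hpsi Hr Hlam) as [K HK].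
      symmetry. apply (Rv_eq A lam K); [exact HK|]. apply shift_inv_iff. auto. }
    assert (Hpb : psi < PI / 2).
    { pose proof (asin_bound (1 / (2 * M0))). lra. }
    assert (E1 : m1 = l1).
    { eapply (RInt_gen_uniq HX); [| |eapply is_RInt_gen_ext; [|exact I1]|exact K1].
      - apply Proper_StrongProper. apply Rbar_locally_filter.
      - apply Proper_StrongProper. apply at_point_filter.
      - apply (Filter_prod _ _ _ (fun x => r < x) (fun x => x = r)); [exists r; auto|reflexivity|].
        intros u v Hu -> s Hs. simpl in Hs. rewrite Rmin_right in Hs by lra.
        rewrite ERs; [reflexivity|]. left. exists s. split; [lra|auto]. }
    assert (E2 : m2 = l2).
    { eapply (RInt_gen_uniq HX); [| |eapply is_RInt_gen_ext; [|exact I2]|exact K2].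
      - apply Proper_StrongProper. apply at_point_filter.
      - apply Proper_StrongProper. apply at_point_filter.
      - apply (Filter_prod _ _ _ (fun x => x = 2 * PI - psi) (fun x => x = psi)); [reflexivity|reflexivity|].
        intros u v -> -> s Hs. simpl in Hs. rewrite Rmin_right, Rmax_left in Hs by lra.
        rewrite ERs; [reflexivity|]. right. exists s. split; [lra|auto]. }
    assert (E3 : m3 = l3).
    { eapply (RInt_gen_uniq HX); [| |eapply is_RInt_gen_ext; [|exact I3]|exact K3].
      - apply Proper_StrongProper. apply at_point_filter.
      - apply Proper_StrongProper. apply Rbar_locally_filter.
      - apply (Filter_prod _ _ _ (fun x => x = r) (fun x => r < x)); [reflexivity|exists r; auto|].
        intros u v -> Hu s Hs. simpl in Hs. rewrite Rmin_left in Hs by lra.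
        rewrite ERs; [reflexivity|]. left. exists s. split; [lra|auto]. }
    rewrite E1, E2, E3.
    change ((/ (2 * PI * Ci))%C *v (l1 +v l2 +v l3) = RtoC (fpow_coef a) *v l).
    rewrite E. apply Hinv.
  - intros -> psi r (M & HM & Hpsi & Hr).
    destruct (contour_value HX HM Hpsi Hr Ha y l Hl) as (l1 & l2 & l3 & K1 & K2 & K3 & E).
    exists (fun lam => Rv A lam y), (l1 +v l2 +v l3). split; [|split].
    + intros lam Hlam. destruct (contour_res_at M psi r lam HM Hpsi Hr Hlam) as [K HK].
      apply shift_inv_iff. now apply Rv_spec with K.
    + exists l1, l2, l3. auto.
    + change (RtoC (fpow_coef a) *v l = (/ (2 * PI * Ci))%C *v (l1 +v l2 +v l3)).
      rewrite E. symmetry. apply Hinv.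
  Unshelve. all: apply filter_filter.
Qed.
End NegPower.

(** * Fractional powers as integrals over the half-line *)

Definition DR (lam : C) : Prop := exists t, 0 <= t /\ lam = RtoC t.

Lemma DR_pol x : DR (pol x 0).
Proof. exists (exp x). split; [left; apply exp_pos|apply pol_0]. Qed.
Lemma DR_t t : 0 <= t -> DR (RtoC t).
Proof. intros H. exists t. auto. Qed.

Section Fpow.
Context {V : cspace} {K : R} {Psi : C -> V -> V}.
Hypothesis HV : banach V.
Hypothesis HR : resfam DR K Psi.

Lemma fpow_int a y : 0 < a < 1 ->
  is_int (fun x => RtoC (fpow_coef a) *v mel Psi (1 - a) y 0 x) (fpow Psi a y).
Proof.
  intros Ha. unfold fpow. apply int_scal. apply epsilon_spec.
  apply (mel_int_exists HV HR); [lra|]. intros x _. apply DR_pol.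
Qed.

Lemma fpow_eq a y l : 0 < a < 1 ->
  is_int (mel Psi (1 - a) y 0) l -> fpow Psi a y = RtoC (fpow_coef a) *v l.
Proof.
  intros Ha Hl. eapply int_unique; [now apply fpow_int|]. now apply int_scal.
Qed.

Lemma fpow_comm {W : cspace} {Phi : C -> W -> W} {K'} (HW : banach W) (HR' : resfam DR K' Phi)
  (L : V -> W) B a y : blin L B -> 0 < a < 1 ->
  (forall t y, 0 < t -> L (Psi (RtoC t) y) = Phi (RtoC t) (L y)) ->
  L (fpow Psi a y) = fpow Phi a (L y).
Proof.
  intros HL Ha Hc. eapply int_unique; [apply (int_blin HL), fpow_int; exact Ha|].
  eapply int_ext; [|eapply int_scal, epsilon_spec, (mel_int_exists HW HR' (1 - a) ltac:(lra) 0 (L y))].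
  - intros x. simpl. rewrite (blin_scal HL). f_equal. unfold mel. rewrite (blin_scal HL), pol_0.
    f_equal. symmetry. apply Hc. apply exp_pos.
  - intros x _. apply DR_pol.
Qed.
Lemma fpow_blin a : 0 < a < 1 -> exists B, 0 <= B /\ blin (fpow Psi a) B.
Proof.
  intros Ha.
  destruct (mel_majorant (1 - a) ltac:(lra)) as (g & G & L & HG & Hg).
  pose proof (rf_K HR) as HK.
  assert (Hb : forall y, nrm (fpow Psi a y) <= Rabs (fpow_coef a) * K * L * nrm y).
  { intros y. replace (Rabs (fpow_coef a) * K * L * nrm y) with (Rabs (fpow_coef a) * K * nrm y * L) by ring.
    eapply int_bound; [apply (majorant_scal g G L (Rabs (fpow_coef a) * K * nrm y) HG)|now apply fpow_int|].
    intros x. simpl. rewrite nrm_scal_eq, Cmod_R, !Rmult_assoc.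
    apply Rmult_le_compat_l; [apply Rabs_pos|]. rewrite <- Rmult_assoc.
    eapply Rle_trans; [apply (mel_nrm HR), DR_pol|].
    apply Rmult_le_compat_l; [|apply Hg]. apply Rmult_le_pos; [exact HK|apply nrm_ge0]. }
  exists (Rabs (Rabs (fpow_coef a) * K * L)). split; [apply Rabs_pos|]. split.
  - intros y y'. eapply int_unique; [now apply fpow_int|].
    eapply int_ext; [|exact (int_plus _ _ _ _ (fpow_int a y Ha) (fpow_int a y' Ha))].
    intros x. simpl. unfold mel. rewrite (blin_plus (rf_lin HR _ (DR_pol x))). vec.
  - intros c y. eapply int_unique; [now apply fpow_int|].
    eapply int_ext; [|exact (int_scal _ _ c (fpow_int a y Ha))].
    intros x. simpl. unfold mel. rewrite (blin_scal (rf_lin HR _ (DR_pol x))). vec.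
  - intros y. eapply Rle_trans; [apply Hb|]. apply Rmult_le_compat_r; [apply nrm_ge0|apply Rle_abs].
Qed.
End Fpow.

(** * The law of exponents *)

Definition rshift {V : cspace} (Psi : C -> V -> V) (tau : R) (lam : C) : V -> V :=
  Psi (lam + RtoC tau)%C.

Section ExponentLaw.
Context {V : cspace} {K : R} {Psi : C -> V -> V}.
Hypothesis HV : banach V.
Hypothesis HR : resfam DR K Psi.

Let P (t : R) : V -> V := Psi (RtoC t).

Lemma real_blin t : 0 <= t -> blin (P t) (K / (1 + t)).
Proof.
  intros Ht. pose proof (rf_lin HR _ (DR_t t Ht)) as H.
  now rewrite Cmod_R, Rabs_pos_eq in H by exact Ht.
Qed.
Lemma real_id s t y : 0 <= s -> 0 <= t -> P s y -v P t y = RtoC (t - s) *v P s (P t y).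
Proof. intros Hs Ht. rewrite RtoC_minus. apply (rf_id HR); now apply DR_t. Qed.
Lemma real_nrm t y : 0 <= t -> nrm (P t y) <= K * nrm y.
Proof.
  intros Ht. eapply Rle_trans; [apply (real_blin t Ht)|].
  apply Rmult_le_compat_r; [apply nrm_ge0|]. pose proof (rf_K HR).
  apply Rmult_le_reg_r with (1 + t); [lra|]. replace (K / (1 + t) * (1 + t)) with K by (field; lra). nra.
Qed.

(* The behaviour of tau |-> (tau + A)^(-a): it solves F' = - a (tau + A)^(-1) F
   and is asymptotic to tau^(-a). *)
Record power_family (a : R) (F : R -> V -> V) (B : R) : Prop := PowerFamily {
  pf_B : 0 <= B;
  pf_blin : forall t, 0 <= t -> blin (F t) B;
  pf_comm : forall t s y, 0 <= t -> 0 <= s -> F t (P s y) = P s (F t y);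
  pf_quad : forall t t' y, 0 <= t -> 0 <= t' -> Rabs (t' - t) <= 1 ->
    nrm (F t' y -v F t y +v RtoC ((t' - t) * a) *v P t (F t y)) <= B * (t' - t)^2 * nrm y;
  pf_decay : forall t y, 1 <= t -> exp (a * ln t) * nrm (F t y) <= B * nrm y;
  pf_asym : forall t z, 1 <= t ->
    nrm (RtoC (exp (a * ln t)) *v F t (P 0 z) -v P 0 z) <= B / t * nrm z
}.
Arguments pf_B {a F B} _.
Arguments pf_blin {a F B} _ _ _.
Arguments pf_comm {a F B} _ _ _ _ _ _.
Arguments pf_quad {a F B} _ _ _ _ _ _ _.
Arguments pf_decay {a F B} _ _ _ _.
Arguments pf_asym {a F B} _ _ _ _.

Lemma pf_lip a F B t t' y : power_family a F B -> 0 <= t -> 0 <= t' -> Rabs (t' - t) <= 1 ->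
  nrm (F t' y -v F t y) <= Rabs (t' - t) * (Rabs a * K * B + B) * nrm y.
Proof.
  intros HF Ht Ht' Hd.
  pose proof (pf_quad HF t t' y Ht Ht' Hd) as H.
  replace (F t' y -v F t y) with ((F t' y -v F t y +v RtoC ((t' - t) * a) *v P t (F t y))
    -v RtoC ((t' - t) * a) *v P t (F t y)) by vec.
  eapply Rle_trans; [apply nrm_tri_minus|]. rewrite nrm_scal_eq, Cmod_R, Rabs_mult.
  assert (H2 : nrm (P t (F t y)) <= K * (B * nrm y)).
  { eapply Rle_trans; [now apply real_nrm|]. apply Rmult_le_compat_l; [apply (rf_K HR)|].
    now apply (pf_blin HF). }
  pose proof (Rabs_pos (t' - t)) as D0. pose proof (Rabs_pos a). pose proof (pf_B HF). pose proof (nrm_ge0 y).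
  assert (Q3 : B * (t' - t)^2 * nrm y <= B * Rabs (t' - t) * nrm y).
  { apply Rmult_le_compat_r; [lra|]. apply Rmult_le_compat_l; [lra|].
    rewrite <- pow2_abs. nra. }
  assert (Q4 : Rabs (t' - t) * Rabs a * nrm (P t (F t y)) <= Rabs (t' - t) * Rabs a * (K * (B * nrm y))).
  { apply Rmult_le_compat_l; [|exact H2]. now apply Rmult_le_pos. }
  nra.
Qed.

(** Product rule: commutation with the resolvent lets the rates - a and - b add. [C1] collects the
    second-order errors of both factors and the product of their first-order increments; the
    additional [B] comes from the asymptotics. *)
Lemma power_family_comp a b F G B B' : power_family a F B -> power_family b G B' ->
  exists B'', power_family (a + b) (fun t y => F t (G t y)) B''.
Proof.
  intros HF HG. pose proof (pf_B HF) as B0. pose proof (pf_B HG) as B0'. pose proof (rf_K HR) as K0.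
  set (L := Rabs a * K * B + B).
  assert (L0 : 0 <= L).
  { unfold L. pose proof (Rabs_pos a). assert (0 <= Rabs a * K * B) by (repeat apply Rmult_le_pos; lra). lra. }
  set (C1 := B * B' + B * B' + Rabs b * L * K * B').
  assert (C10 : 0 <= Rabs b * L * K * B').
  { repeat apply Rmult_le_pos; try lra. apply Rabs_pos. }
  assert (HBB : 0 <= B * B') by nra.
  set (C2 := C1 + B). exists C2. split.
  - unfold C2, C1. lra.
  - intros t Ht. refine (blin_weaken (K := B * B') _ _ _).
    + apply blin_comp; [exact B0|now apply (pf_blin HF)|now apply (pf_blin HG)].
    + unfold C2, C1. lra.
  - intros t s y Ht Hs. now rewrite (pf_comm HG), (pf_comm HF).
  - intros t t' y Ht Ht' Hd. set (d := t' - t) in *.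
    replace (F t' (G t' y) -v F t (G t y) +v RtoC (d * (a + b)) *v P t (F t (G t y))) with
      (F t' (G t' y -v G t y +v RtoC (d * b) *v P t (G t y))
       +v (F t' (G t y) -v F t (G t y) +v RtoC (d * a) *v P t (F t (G t y)))
       -v RtoC (d * b) *v (F t' (P t (G t y)) -v F t (P t (G t y)))).
    2:{ rewrite (blin_plus (pf_blin HF t' Ht')), (blin_minus (pf_blin HF t' Ht')),
          (blin_scal (pf_blin HF t' Ht')), !(pf_comm HF) by assumption. vec. }
    pose proof (nrm_ge0 y) as Y0.
    assert (T1 : nrm (F t' (G t' y -v G t y +v RtoC (d * b) *v P t (G t y))) <= B * (B' * d^2 * nrm y)).
    { eapply Rle_trans; [now apply (pf_blin HF)|]. apply Rmult_le_compat_l; [exact B0|].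
      now apply (pf_quad HG). }
    assert (NG : nrm (G t y) <= B' * nrm y) by now apply (pf_blin HG).
    assert (T2 : nrm (F t' (G t y) -v F t (G t y) +v RtoC (d * a) *v P t (F t (G t y)))
       <= B * d^2 * (B' * nrm y)).
    { eapply Rle_trans; [now apply (pf_quad HF)|]. apply Rmult_le_compat_l; [|exact NG].
      apply Rmult_le_pos; [exact B0|apply pow2_ge_0]. }
    assert (T3 : nrm (F t' (P t (G t y)) -v F t (P t (G t y))) <= Rabs d * L * (K * (B' * nrm y))).
    { eapply Rle_trans; [now apply (pf_lip _ _ _ _ _ _ HF)|]. apply Rmult_le_compat_l.
      - apply Rmult_le_pos; [apply Rabs_pos|exact L0].
      - eapply Rle_trans; [now apply real_nrm|]. now apply Rmult_le_compat_l. }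
    eapply Rle_trans; [apply nrm_tri_minus|].
    eapply Rle_trans; [apply Rplus_le_compat_r, nrm_tri|].
    rewrite nrm_scal_eq, Cmod_R, Rabs_mult.
    assert (T4 : Rabs d * Rabs b * nrm (F t' (P t (G t y)) -v F t (P t (G t y)))
       <= Rabs d * Rabs b * (Rabs d * L * (K * (B' * nrm y)))).
    { apply Rmult_le_compat_l; [|exact T3]. apply Rmult_le_pos; apply Rabs_pos. }
    replace (Rabs d * Rabs b * (Rabs d * L * (K * (B' * nrm y)))) with
      (Rabs b * L * K * B' * d^2 * nrm y) in T4 by (rewrite <- (pow2_abs d); ring).
    pose proof (pow2_ge_0 d). assert (0 <= B * d^2 * nrm y) by (apply Rmult_le_pos; [apply Rmult_le_pos|]; lra).
    unfold C2, C1. lra.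
  - intros t y Ht. rewrite Rmult_plus_distr_r, exp_plus.
    pose proof (exp_pos (a * ln t)). pose proof (exp_pos (b * ln t)).
    pose proof (pf_decay HF t (G t y) Ht) as D1. pose proof (pf_decay HG t y Ht) as D2.
    assert (exp (b * ln t) * (exp (a * ln t) * nrm (F t (G t y))) <= exp (b * ln t) * (B * nrm (G t y)))
      by (apply Rmult_le_compat_l; lra).
    assert (B * (exp (b * ln t) * nrm (G t y)) <= B * (B' * nrm y)) by (apply Rmult_le_compat_l; lra).
    pose proof (nrm_ge0 y). assert (0 <= (B * B' + Rabs b * L * K * B' + B) * nrm y) by (apply Rmult_le_pos; lra).
    unfold C2, C1. lra.
  - intros t z Ht. rewrite Rmult_plus_distr_r, exp_plus.
    set (p := exp (a * ln t)). set (q := exp (b * ln t)).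
    assert (Hp : 0 < p) by apply exp_pos.
    assert (Ht0 : 0 <= t) by lra.
    replace (RtoC (p * q) *v F t (G t (P 0 z)) -v P 0 z) with
      (RtoC p *v F t (RtoC q *v G t (P 0 z) -v P 0 z) +v (RtoC p *v F t (P 0 z) -v P 0 z)).
    2:{ rewrite (blin_minus (pf_blin HF t Ht0)), (blin_scal (pf_blin HF t Ht0)). vec. }
    eapply Rle_trans; [apply nrm_tri|].
    rewrite nrm_scal_eq, Cmod_R, Rabs_pos_eq by lra.
    pose proof (pf_decay HF t (RtoC q *v G t (P 0 z) -v P 0 z) Ht) as D1.
    pose proof (pf_asym HG t z Ht) as D2. pose proof (pf_asym HF t z Ht) as D3.
    fold p in D1, D3. fold q in D2.
    apply Rmult_le_compat_l with (r := B) in D2; [|exact B0].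
    replace (B * (B' / t * nrm z)) with (B * B' * (nrm z / t)) in D2 by (field; lra).
    replace (B / t * nrm z) with (B * (nrm z / t)) in D3 by (field; lra).
    replace (C2 / t * nrm z) with (C2 * (nrm z / t)) by (field; lra).
    assert (0 <= nrm z / t) by (apply Rdiv_le_0_compat; [apply nrm_ge0|lra]).
    assert (0 <= (B * B' + Rabs b * L * K * B') * (nrm z / t)) by (apply Rmult_le_pos; lra).
    unfold C2, C1. lra.
Qed.

(* For exponent 1 the function F(t) (t + A) x is constant, and it tends to x. *)
Lemma power_family_one F B : power_family 1 F B -> forall z, F 0 z = P 0 z.
Proof.
  intros HF z. pose proof (pf_B HF) as B0. pose proof (rf_K HR) as K0.
  set (y := P 0 z).
  (* With y = A^(-1) z, the vector t y + z is (t + A) y. *)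
  pose (W := fun t => F t (RtoC t *v y +v z)).
  assert (HPw : forall t, 0 <= t -> P t (RtoC t *v y +v z) = y).
  { intros t Ht. rewrite (blin_plus (real_blin t Ht)), (blin_scal (real_blin t Ht)).
    pose proof (real_id t 0 z Ht ltac:(lra)) as H. fold y in H.
    transitivity (y +v ((P t z -v y) -v RtoC (0 - t) *v P t y)); [vec|]. rewrite H. vec. }
  assert (Hconst : forall T, 1 <= T -> W T = W 0).
  { intros T HT.
    set (C1 := (K * B + B) * nrm y + B * (T * nrm y + nrm z)).
    apply (quad_const W C1); [lra|]. intros t t' Ht Ht' Hd. unfold W.
    set (w := RtoC t *v y +v z).
    replace (RtoC t' *v y +v z) with (w +v RtoC (t' - t) *v y) by (unfold w; vec).
    assert (Ht0 : 0 <= t) by lra. assert (Ht0' : 0 <= t') by lra.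
    assert (E : P t (F t w) = F t y).
    { rewrite <- (pf_comm HF) by lra. unfold w. now rewrite HPw. }
    pose proof (pf_quad HF t t' w Ht0 Ht0' Hd) as Q. rewrite Rmult_1_r, E in Q.
    pose proof (pf_lip _ _ _ _ _ y HF Ht0 Ht0' Hd) as Q2. rewrite Rabs_R1, Rmult_1_l in Q2.
    replace (F t' (w +v RtoC (t' - t) *v y) -v F t w) with
      ((F t' w -v F t w +v RtoC (t' - t) *v F t y) +v RtoC (t' - t) *v (F t' y -v F t y)).
    2:{ rewrite (blin_plus (pf_blin HF t' Ht0')), (blin_scal (pf_blin HF t' Ht0')). vec. }
    eapply Rle_trans; [apply nrm_tri|]. rewrite nrm_scal_eq, Cmod_R.
    assert (Nw : nrm w <= T * nrm y + nrm z).
    { unfold w. eapply Rle_trans; [apply nrm_tri|]. rewrite nrm_scal_eq, Cmod_R, Rabs_pos_eq by lra.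
      pose proof (nrm_ge0 y). nra. }
    assert (Q3 : Rabs (t' - t) * nrm (F t' y -v F t y) <= Rabs (t' - t) * (Rabs (t' - t) * (K * B + B) * nrm y)).
    { apply Rmult_le_compat_l; [apply Rabs_pos|exact Q2]. }
    replace (Rabs (t' - t) * (Rabs (t' - t) * (K * B + B) * nrm y)) with ((K * B + B) * nrm y * (t' - t)^2) in Q3
      by (rewrite <- (pow2_abs (t' - t)); ring).
    assert (Q4 : B * (t' - t)^2 * nrm w <= B * (t' - t)^2 * (T * nrm y + nrm z)).
    { apply Rmult_le_compat_l; [|exact Nw]. apply Rmult_le_pos; [exact B0|apply pow2_ge_0]. }
    unfold C1. lra. }
  assert (E0 : W 0 = F 0 z).
  { unfold W. f_equal. rewrite Cscal_zero_l. vec. }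
  apply nrm_le_eps_eq. intros eps Heps.
  pose proof (nrm_ge0 z) as Z0.
  (* At the point [T], decay and asymptotics each contribute an error of at most B |z| / T. *)
  set (T := 1 + 2 * B * nrm z / eps).
  assert (HT0 : 0 <= 2 * B * nrm z / eps) by (apply Rdiv_le_0_compat; [nra|exact Heps]).
  assert (HT : 1 <= T) by (unfold T; lra).
  rewrite <- E0, <- (Hconst T HT). unfold W.
  rewrite (blin_plus (pf_blin HF T ltac:(lra))), (blin_scal (pf_blin HF T ltac:(lra))).
  pose proof (pf_asym HF T z HT) as Q1. pose proof (pf_decay HF T z HT) as Q2.
  rewrite Rmult_1_l, exp_ln in Q1, Q2 by lra. fold y in Q1. fold y.
  replace (RtoC T *v F T y +v F T z -v y) with ((RtoC T *v F T y -v y) +v F T z) by vec.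
  eapply Rle_trans; [apply nrm_tri|].
  assert (Q3 : nrm (F T z) <= B / T * nrm z).
  { apply Rmult_le_reg_l with T; [lra|].
    replace (T * (B / T * nrm z)) with (B * nrm z) by (field; lra). exact Q2. }
  assert (Q4 : 2 * (B / T * nrm z) <= eps); [|lra].
  apply Rmult_le_reg_r with T; [lra|].
  replace (2 * (B / T * nrm z) * T) with (2 * B * nrm z) by (field; lra).
  unfold T. rewrite Rmult_plus_distr_l.
  replace (eps * (2 * B * nrm z / eps)) with (2 * B * nrm z) by (field; lra). lra.
Qed.

Lemma rshift_resfam t : 0 <= t -> resfam DR K (rshift Psi t).
Proof.
  intros Ht. split; [apply (rf_K HR)| |].
  - intros lam (s & Hs & ->). unfold rshift. rewrite <- RtoC_plus, Cmod_R, Rabs_pos_eq by exact Hs.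
    refine (blin_weaken (real_blin (s + t) ltac:(lra)) _ _).
    apply Rmult_le_compat_l; [apply (rf_K HR)|]. apply Rinv_le_contravar; lra.
  - intros lam mu (s & Hs & ->) (u & Hu & ->) y. unfold rshift.
    rewrite <- !RtoC_plus. rewrite (rf_id HR); [|apply DR_t; lra|apply DR_t; lra].
    f_equal. rewrite !RtoC_plus. ring.
Qed.

(** Integration by parts gives a R(t) I = int s^(-a) R(s + t)^2 y ds: the exact derivative [melD],
    whose integral is 0, is added under [P t]. What remains of the integrand is (t' - t)^2 times a
    product of three resolvents. *)
Lemma int_rate_quad a t t' y I I' : 0 < a < 1 -> 0 <= t -> 0 <= t' -> forall g G L,
  is_majorant g G L -> (forall x, exp ((1 - a) * x) / (1 + exp x) <= g x) ->
  is_int (mel (rshift Psi t) (1 - a) y 0) I -> is_int (mel (rshift Psi t') (1 - a) y 0) I' ->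
  nrm (I' -v I +v RtoC ((t' - t) * a) *v P t I) <= K^3 * L * (t' - t)^2 * nrm y.
Proof.
  intros Ha Ht Ht' g G L HG Hg HI HI'. pose proof (rf_K HR) as K0.
  assert (HD : is_int (fun x => RtoC a *v P t (mel (rshift Psi t) (1 - a) y 0 x)
     +v P t (melD (rshift Psi t) (1 - a) y 0 x)) (RtoC a *v P t I +v 0v)).
  { apply int_plus.
    - apply int_scal. now apply (int_blin (real_blin t Ht)).
    - rewrite <- (blin_zero (real_blin t Ht)). apply (int_blin (real_blin t Ht)).
      apply (mel_byparts (rshift_resfam t Ht)); [lra|]. intros x _. apply DR_pol. }
  pose proof (int_plus _ _ _ _ (int_minus _ _ _ _ HI' HI) (int_scal _ _ (RtoC (t' - t)) HD)) as H.
  replace (I' -v I +v RtoC ((t' - t) * a) *v P t I) with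
    (I' -v I +v RtoC (t' - t) *v (RtoC a *v P t I +v 0v)) by vec.
  replace (K^3 * L * (t' - t)^2 * nrm y) with (K^3 * (t' - t)^2 * nrm y * L) by ring.
  apply (int_bound _ _ _ _ _ (majorant_scal g G L (K^3 * (t' - t)^2 * nrm y) HG) H).
  intros x. simpl. unfold melD, mel, rshift. rewrite ep_0, pol_0, <- !RtoC_plus.
  set (u := exp x). assert (Hu : 0 < u) by apply exp_pos.
  set (p := exp ((1 - a) * x)). assert (Hp : 0 < p) by apply exp_pos.
  change (Psi (RtoC (u + t))) with (P (u + t)). change (Psi (RtoC (u + t'))) with (P (u + t')).
  assert (Hut : 0 <= u + t) by lra. assert (Hut' : 0 <= u + t') by lra.
  set (z := P (u + t) y).
  assert (E1 : P t z = P (u + t) z +v RtoC u *v P t (P (u + t) z)).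
  { pose proof (real_id t (u + t) z Ht Hut) as E. replace (u + t - t) with u in E by ring.
    rewrite <- E. vec. }
  assert (E2 : P (u + t') y -v z = RtoC (t - t') *v P (u + t') z).
  { unfold z. rewrite real_id by lra. do 2 f_equal. ring. }
  assert (E3 : P (u + t') z -v P (u + t) z = RtoC (t - t') *v P (u + t') (P (u + t) z)).
  { rewrite real_id by lra. do 2 f_equal. ring. }
  rewrite (blin_minus (real_blin t Ht)), !(blin_scal (real_blin t Ht)).
  match goal with |- norm ?e <= _ => replace e with
    (RtoC (p * (t' - t)^2) *v P (u + t') (P (u + t) z)) end.
  2:{ transitivity (RtoC (p * (t - t')) *v (RtoC (t - t') *v P (u + t') (P (u + t) z))).
      { rewrite Cscal_assoc. apply (f_equal2 (fun c v => c *v v)); [|reflexivity].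
        change (RtoC (p * (t' - t)^2) = RtoC (p * (t - t')) * RtoC (t - t'))%C.
        rewrite <- RtoC_mult. f_equal. ring. }
      rewrite <- E3.
      transitivity (RtoC p *v (RtoC (t - t') *v P (u + t') z -v RtoC (t - t') *v P (u + t) z)); [vec|].
      rewrite <- E2.
      transitivity (RtoC p *v (P (u + t') y -v z +v RtoC (t' - t) *v (P t z -v RtoC u *v P t (P (u + t) z)))).
      { rewrite E1. vec. }
      rewrite RtoC_minus. vec. }
  rewrite nrm_scal_eq, Cmod_R, Rabs_pos_eq.
  2:{ apply Rmult_le_pos; [lra|apply pow2_ge_0]. }
  assert (N : nrm (P (u + t') (P (u + t) z)) <= K * (K * (K / (1 + u) * nrm y))).
  { eapply Rle_trans; [now apply real_nrm|]. apply Rmult_le_compat_l; [exact K0|].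
    eapply Rle_trans; [now apply real_nrm|]. apply Rmult_le_compat_l; [exact K0|].
    unfold z. eapply Rle_trans; [now apply (real_blin (u + t))|].
    apply Rmult_le_compat_r; [apply nrm_ge0|]. apply Rmult_le_compat_l; [exact K0|].
    apply Rinv_le_contravar; lra. }
  specialize (Hg x). fold u p in Hg.
  assert (0 <= K^3 * (t' - t)^2 * nrm y).
  { apply Rmult_le_pos; [apply Rmult_le_pos; [apply pow_le; lra|apply pow2_ge_0]|apply nrm_ge0]. }
  apply Rle_trans with (K^3 * (t' - t)^2 * nrm y * (p / (1 + u))).
  - apply Rle_trans with (p * (t' - t)^2 * (K * (K * (K / (1 + u) * nrm y)))).
    + apply Rmult_le_compat_l; [|exact N]. apply Rmult_le_pos; [lra|apply pow2_ge_0].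
    + right. field. lra.
  - now apply Rmult_le_compat_l.
Qed.

(** The substitution s = t exp x, a translation in the logarithmic variable, extracts the factor
    t^(-a) from the integral of s^(-a) R(s + t) y. *)
Lemma shifted_rescale a t y I : 0 < a < 1 -> 1 <= t ->
  is_int (mel (rshift Psi t) (1 - a) y 0) I ->
  is_int (fun x => RtoC (exp ((1 - a) * x)) *v (RtoC t *v P (t * (1 + exp x)) y))
    (RtoC (exp (a * ln t)) *v I).
Proof.
  intros Ha Ht HI.
  eapply int_ext; [|exact (int_scal _ _ (RtoC (exp (a * ln t))) (int_shift _ _ (ln t) HI))].
  intros x. simpl. unfold mel, rshift. rewrite ep_0, pol_0, <- RtoC_plus.
  rewrite exp_plus, exp_ln by lra.
  replace (exp x * t + t) with (t * (1 + exp x)) by ring.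
  change (Psi (RtoC (t * (1 + exp x)))) with (P (t * (1 + exp x))).
  rewrite !Cscal_assoc. apply (f_equal2 (fun c v => c *v v)); [|reflexivity].
  change (RtoC (exp (a * ln t)) * RtoC (exp ((1 - a) * (x + ln t))) = RtoC (exp ((1 - a) * x)) * RtoC t)%C.
  rewrite <- !RtoC_mult. f_equal.
  rewrite <- exp_plus. replace t with (exp (ln t)) at 3 by (apply exp_ln; lra).
  rewrite <- exp_plus. f_equal. ring.
Qed.

(** The value of the normalising constant matters for [pf_asym]: mu R(mu) A^(-1) z differs from
    A^(-1) z by R(mu) z, of order 1 / mu, so the rescaled integral tends to Euler's integral times
    A^(-1) z. *)
Lemma fpow_power_family a : 0 < a < 1 ->
  exists B, power_family a (fun t => fpow (rshift Psi t) a) B.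
Proof.
  intros Ha. pose proof (rf_K HR) as K0.
  destruct (mel_majorant (1 - a) ltac:(lra)) as (g & G & L & HG & Hg).
  set (k := fpow_coef a).
  assert (HL : 0 <= L).
  { eapply Rle_trans; [apply (nrm_ge0 (0v : C_NormedModule))|].
    eapply (int_bound (V := C_NormedModule) (fun _ => 0v) 0v g G L HG).
    - exists (fun _ => 0v). split; [split|]; [intros; apply deriv_const|apply lim_m_const|apply lim_p_const].
    - intros x. rewrite nrm_zero. eapply Rle_trans; [|apply Hg]. pose proof (exp_pos x).
      apply Rmult_le_pos; [left; apply exp_pos|]. left. apply Rinv_0_lt_compat. lra. }
  pose proof (Rabs_pos k) as k0.
  set (B1 := Rabs k * (K * L)). set (B2 := Rabs k * (K^3 * L)).
  assert (H1 : 0 <= B1) by (unfold B1; repeat apply Rmult_le_pos; lra).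
  assert (H2 : 0 <= B2).
  { unfold B2. apply Rmult_le_pos; [lra|]. apply Rmult_le_pos; [apply pow_le; lra|lra]. }
  assert (HI : forall t y, 0 <= t -> exists I, is_int (mel (rshift Psi t) (1 - a) y 0) I
     /\ fpow (rshift Psi t) a y = RtoC k *v I).
  { intros t y Ht. destruct (mel_int_exists HV (rshift_resfam t Ht) (1 - a) ltac:(lra) 0 y) as [I HI].
    { intros x _. apply DR_pol. }
    exists I. split; [exact HI|]. now apply (fpow_eq HV (rshift_resfam t Ht)). }
  exists (B1 + B2). split.
  - lra.
  - intros t Ht. destruct (fpow_blin HV (rshift_resfam t Ht) a Ha) as (B & HB & Hbl).
    split; [apply Hbl|apply Hbl|]. intros y.
    destruct (HI t y Ht) as (I & HI1 & ->). rewrite nrm_scal_eq, Cmod_R.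
    assert (Hn : nrm I <= K * nrm y * L).
    { apply (int_bound _ _ _ _ _ (majorant_scal g G L (K * nrm y) HG) HI1). intros x.
      eapply Rle_trans; [apply (mel_nrm (rshift_resfam t Ht)), DR_pol|].
      apply Rmult_le_compat_l; [|apply Hg]. apply Rmult_le_pos; [exact K0|apply nrm_ge0]. }
    apply Rmult_le_compat_l with (r := Rabs k) in Hn; [|exact k0].
    pose proof (nrm_ge0 y). unfold B1 at 1. nra.
  - intros t s y Ht Hs. symmetry.
    apply (fpow_comm HV (rshift_resfam t Ht) HV (rshift_resfam t Ht) (P s) (K / (1 + s)));
      [now apply real_blin|exact Ha|].
    intros u z Hu. unfold rshift. rewrite <- RtoC_plus.
    apply (rf_comm HR); apply DR_t; lra.
  - intros t t' y Ht Ht' _.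
    destruct (HI t y Ht) as (I & HI1 & ->). destruct (HI t' y Ht') as (I' & HI1' & ->).
    pose proof (int_rate_quad a t t' y I I' Ha Ht Ht' g G L HG Hg HI1 HI1') as Q.
    rewrite (blin_scal (real_blin t Ht)).
    replace (RtoC k *v I' -v RtoC k *v I +v RtoC ((t' - t) * a) *v (RtoC k *v P t I)) with
      (RtoC k *v (I' -v I +v RtoC ((t' - t) * a) *v P t I)) by vec.
    rewrite nrm_scal_eq, Cmod_R.
    apply Rmult_le_compat_l with (r := Rabs k) in Q; [|exact k0].
    pose proof (nrm_ge0 y). pose proof (pow2_ge_0 (t' - t)).
    assert (0 <= B1 * (t' - t)^2 * nrm y) by (apply Rmult_le_pos; [apply Rmult_le_pos|]; lra).
    unfold B2 at 1. lra.
  - intros t y Ht. destruct (HI t y ltac:(lra)) as (I & HI1 & ->).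
    pose proof (shifted_rescale a t y I Ha Ht HI1) as HS.
    pose proof (exp_pos (a * ln t)).
    assert (Hn : nrm (RtoC (exp (a * ln t)) *v I) <= K * nrm y * L).
    { apply (int_bound _ _ _ _ _ (majorant_scal g G L (K * nrm y) HG) HS). intros x. simpl.
      pose proof (exp_pos x). pose proof (exp_pos ((1 - a) * x)).
      assert (0 < t * (1 + exp x)) by nra.
      rewrite !nrm_scal_eq, !Cmod_R, !Rabs_pos_eq by lra.
      apply Rle_trans with (K * nrm y * (exp ((1 - a) * x) / (1 + exp x))).
      - replace (K * nrm y * (exp ((1 - a) * x) / (1 + exp x))) with
          (exp ((1 - a) * x) * (t * (K / (t * (1 + exp x)) * nrm y))) by (field; lra).
        apply Rmult_le_compat_l; [lra|]. apply Rmult_le_compat_l; [lra|].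
        eapply Rle_trans; [apply real_blin; lra|]. apply Rmult_le_compat_r; [apply nrm_ge0|].
        apply Rmult_le_compat_l; [exact K0|]. apply Rinv_le_contravar; lra.
      - apply Rmult_le_compat_l; [|apply Hg]. apply Rmult_le_pos; [exact K0|apply nrm_ge0]. }
    rewrite nrm_scal_eq, Cmod_R, Rabs_pos_eq in Hn by lra.
    rewrite nrm_scal_eq, Cmod_R.
    apply Rmult_le_compat_l with (r := Rabs k) in Hn; [|exact k0].
    pose proof (nrm_ge0 y). assert (0 <= B2 * nrm y) by (apply Rmult_le_pos; lra). unfold B1. lra.
  - intros t z Ht. destruct (HI t (P 0 z) ltac:(lra)) as (I & HI1 & ->).
    pose proof (shifted_rescale a t (P 0 z) I Ha Ht HI1) as HS.
    pose proof (int_scal _ _ (RtoC k) HS) as HS2.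
    (* The constant sin (PI a) / PI is the reciprocal of Euler's integral with exponent 1 - a. *)
    assert (HE : is_int (fun x => RtoC k *v (RtoC (exp ((1 - a) * x) / (1 + exp x)) *v P 0 z)) (P 0 z)).
    { pose proof (euler_integral (1 - a) ltac:(lra)) as HEu.
      assert (HB : blin (V := C_NormedModule) (fun c : C_NormedModule => RtoC k *v ((c : C) *v P 0 z))
        (Rabs k * nrm (P 0 z))).
      { split.
        - intros c c'. transitivity (RtoC k *v ((c + c')%C *v P 0 z)); [reflexivity|vec].
        - intros c c'. transitivity (RtoC k *v ((c * c')%C *v P 0 z)); [reflexivity|vec].
        - intros c. rewrite !nrm_scal_eq, Cmod_R. right. change (nrm c) with (Cmod c). ring. }
      pose proof (int_blin HB _ _ HEu) as H. cbv beta in H.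
      assert (Ev : RtoC k *v (RtoC (PI / sin (PI * (1 - a))) *v P 0 z) = P 0 z).
      2:{ rewrite Ev in H. exact H. }
      assert (HPI := PI_RGT_0).
      replace (sin (PI * (1 - a))) with (sin (PI * a)).
      2:{ replace (PI * (1 - a)) with (PI - PI * a) by ring. symmetry. apply sin_PI_x. }
      assert (Hs : 0 < sin (PI * a)) by (apply sin_gt_0; nra).
      rewrite Cscal_assoc. transitivity (RtoC 1 *v P 0 z); [|apply Cscal_one].
      apply (f_equal2 (fun c v => c *v v)); [|reflexivity].
      change (RtoC k * RtoC (PI / sin (PI * a)) = RtoC 1)%C.
      rewrite <- RtoC_mult. f_equal. unfold k, fpow_coef. field. lra. }
    pose proof (int_minus _ _ _ _ HS2 HE) as HM.
    replace (RtoC (exp (a * ln t)) *v (RtoC k *v I) -v P 0 z) with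
      (RtoC k *v (RtoC (exp (a * ln t)) *v I) -v P 0 z) by vec.
    pose proof (nrm_ge0 z) as Z0.
    apply Rle_trans with (Rabs k * (K / t * nrm z) * L).
    + apply (int_bound _ _ _ _ _ (majorant_scal g G L (Rabs k * (K / t * nrm z)) HG) HM). intros x. simpl.
      pose proof (exp_pos x) as E. pose proof (exp_pos ((1 - a) * x)) as E'.
      set (mu := t * (1 + exp x)). assert (Hmu : 0 < mu) by (unfold mu; nra).
      assert (Hmut : t <= mu) by (unfold mu; nra).
      pose proof (real_id 0 mu z ltac:(lra) ltac:(lra)) as Q.
      assert (Q2 : P 0 (P mu z) = P mu (P 0 z)) by (apply (rf_comm HR); apply DR_t; lra).
      rewrite Q2, Rminus_0_r in Q.
      match goal with |- norm ?e <= _ => replace e with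
        (RtoC (- (k * (exp ((1 - a) * x) / (1 + exp x)))) *v P mu z) end.
      2:{ transitivity (RtoC k *v (RtoC (exp ((1 - a) * x) / (1 + exp x)) *v (RtoC mu *v P mu (P 0 z)))
            -v RtoC k *v (RtoC (exp ((1 - a) * x) / (1 + exp x)) *v P 0 z)).
          - rewrite <- Q. vec_coefs; Creal; ring.
          - f_equal. apply (f_equal (fun v => RtoC k *v v)).
            rewrite !Cscal_assoc. apply (f_equal2 (fun c v => c *v v)); [|reflexivity].
            change (RtoC (exp ((1 - a) * x) / (1 + exp x)) * RtoC mu = RtoC (exp ((1 - a) * x)) * RtoC t)%C.
            rewrite <- !RtoC_mult. f_equal. unfold mu. field. lra. }
      rewrite nrm_scal_eq, Cmod_R, Rabs_Ropp, Rabs_mult.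
      rewrite (Rabs_pos_eq (exp ((1 - a) * x) / (1 + exp x))) by (apply Rdiv_le_0_compat; lra).
      assert (N : nrm (P mu z) <= K / t * nrm z).
      { eapply Rle_trans; [apply real_blin; lra|]. apply Rmult_le_compat_r; [exact Z0|].
        apply Rmult_le_compat_l; [exact K0|]. apply Rinv_le_contravar; lra. }
      specialize (Hg x). assert (0 <= exp ((1 - a) * x) / (1 + exp x)) by (apply Rdiv_le_0_compat; lra).
      assert (0 <= K / t * nrm z) by (apply Rmult_le_pos; [apply Rdiv_le_0_compat; lra|exact Z0]).
      apply Rle_trans with (Rabs k * (K / t * nrm z) * (exp ((1 - a) * x) / (1 + exp x))).
      * rewrite Rmult_assoc, (Rmult_comm _ (nrm (P mu z))), <- Rmult_assoc.
        apply Rmult_le_compat_r; [lra|]. now apply Rmult_le_compat_l.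
      * apply Rmult_le_compat_l; [now apply Rmult_le_pos|exact Hg].
    + replace (Rabs k * (K / t * nrm z) * L) with (B1 * (nrm z / t)) by (unfold B1; field; lra).
      replace ((B1 + B2) / t * nrm z) with ((B1 + B2) * (nrm z / t)) by (field; lra).
      apply Rmult_le_compat_r; [apply Rdiv_le_0_compat; lra|lra].
Qed.

Lemma fpow_rshift_0 a y : fpow (rshift Psi 0) a y = fpow Psi a y.
Proof.
  replace (rshift Psi 0) with Psi; [reflexivity|].
  apply functional_extensionality. intros lam. unfold rshift. f_equal. ring.
Qed.

Lemma fpow_fpow_one a b y : 0 < a < 1 -> 0 < b < 1 -> a + b = 1 ->
  fpow Psi a (fpow Psi b y) = P 0 y.
Proof.
  intros Ha Hb Hab. destruct (fpow_power_family a Ha) as [B HF].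
  destruct (fpow_power_family b Hb) as [B' HG].
  destruct (power_family_comp _ _ _ _ _ _ HF HG) as [B2 H]. rewrite Hab in H.
  pose proof (power_family_one _ _ H y) as E. simpl in E. now rewrite !fpow_rshift_0 in E.
Qed.
Lemma fpow_fpow_fpow_one a b c y : 0 < a < 1 -> 0 < b < 1 -> 0 < c < 1 -> a + b + c = 1 ->
  fpow Psi a (fpow Psi b (fpow Psi c y)) = P 0 y.
Proof.
  intros Ha Hb Hc Habc. destruct (fpow_power_family a Ha) as [B1 H1].
  destruct (fpow_power_family b Hb) as [B2 H2]. destruct (fpow_power_family c Hc) as [B3 H3].
  destruct (power_family_comp _ _ _ _ _ _ H2 H3) as [B4 H4].
  destruct (power_family_comp _ _ _ _ _ _ H1 H4) as [B5 H5].
  replace (a + (b + c)) with 1 in H5 by lra.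
  pose proof (power_family_one _ _ H5 y) as E. simpl in E. now rewrite !fpow_rshift_0 in E.
Qed.

Hypothesis Hinj : forall y, P 0 y = 0v -> y = 0v.

Lemma fpow_inj a y y' : 0 < a < 1 -> fpow Psi a y = fpow Psi a y' -> y = y'.
Proof.
  intros Ha E.
  assert (H : P 0 y = P 0 y').
  { rewrite <- !(fpow_fpow_one (1 - a) a) by lra. now rewrite E. }
  assert (H0 : y -v y' = 0v).
  { apply Hinj. rewrite (blin_minus (real_blin 0 (Rle_refl 0))), H. vec. }
  transitivity (y' +v (y -v y')); [vec|]. rewrite H0. vec.
Qed.

(** Both sides become A^(-1) under the injective operator A^(-(1 - a - b)), so that only products
    with exponents of sum 1 have to be computed. *)
Lemma fpow_add a b y : 0 < a -> 0 < b -> a + b < 1 ->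
  fpow Psi a (fpow Psi b y) = fpow Psi (a + b) y.
Proof.
  intros Ha Hb Hab. apply (fpow_inj (1 - (a + b))); [lra|].
  rewrite fpow_fpow_fpow_one by lra. symmetry. apply fpow_fpow_one; lra.
Qed.
End ExponentLaw.

(** * Uniqueness of Cauchy transforms *)

Lemma cont_Cinv (p : R -> C) x : cont_at (V := C_NormedModule) p x -> p x <> RtoC 0 ->
  cont_at (V := C_NormedModule) (fun x => (/ p x)%C) x.
Proof.
  intros Hp Hx eps Heps. assert (H0 : 0 < Cmod (p x)) by now apply Cmod_gt_0.
  set (m := Cmod (p x)) in *.
  assert (He : 0 < Rmin (m / 2) (eps * (m * m / 2))).
  { apply Rmin_glb_lt; [lra|]. apply Rmult_lt_0_compat; [exact Heps|]. nra. }
  destruct (Hp _ He) as (d & Hd & H). exists d. split; [exact Hd|]. intros h Hh. specialize (H h Hh).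
  change (Cmod (p (x + h)%R - p x)%C <= Rmin (m / 2) (eps * (m * m / 2))) in H.
  assert (H1 := Rle_trans _ _ _ H (Rmin_l _ _)). assert (H2 := Rle_trans _ _ _ H (Rmin_r _ _)).
  change (Cmod (/ p (x + h)%R - / p x)%C <= eps).
  assert (H3 : m / 2 <= Cmod (p (x + h))).
  { pose proof (Cmod_triangle (p (x + h)) (- (p (x + h)%R - p x))%C) as T. rewrite Cmod_opp in T.
    replace (p (x + h)%R + - (p (x + h)%R - p x))%C with (p x) in T by ring. fold m in T. lra. }
  assert (Hnz : p (x + h) <> RtoC 0) by (intros E; rewrite E, Cmod_0 in H3; lra).
  replace (/ p (x + h)%R - / p x)%C with (- (p (x + h)%R - p x) / (p (x + h)%R * p x))%C by (field; auto).
  rewrite Cmod_div by now apply Cmult_neq_0. rewrite Cmod_opp, Cmod_mult. fold m.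
  apply Rmult_le_reg_r with (Cmod (p (x + h)) * m); [nra|].
  replace (Cmod (p (x + h)%R - p x)%C / (Cmod (p (x + h)) * m) * (Cmod (p (x + h)) * m))
    with (Cmod (p (x + h)%R - p x)%C) by (field; split; lra).
  eapply Rle_trans; [exact H2|]. apply Rmult_le_compat_l; [lra|]. nra.
Qed.

Lemma cont_plus {V : cspace} (f g : R -> V) x :
  cont_at f x -> cont_at g x -> cont_at (fun x => f x +v g x) x.
Proof.
  intros Hf Hg eps Heps.
  destruct (Hf (eps / 2)) as (d1 & Hd1 & H1); [lra|]. destruct (Hg (eps / 2)) as (d2 & Hd2 & H2); [lra|].
  exists (Rmin d1 d2). split; [now apply Rmin_glb_lt|]. intros h Hh.
  specialize (H1 h (Rlt_le_trans _ _ _ Hh (Rmin_l _ _))).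
  specialize (H2 h (Rlt_le_trans _ _ _ Hh (Rmin_r _ _))).
  replace (f (x + h) +v g (x + h) -v (f x +v g x)) with
    ((f (x + h) -v f x) +v (g (x + h) -v g x)) by vec.
  eapply Rle_trans; [apply nrm_tri|lra].
Qed.

(* Uniqueness for Cauchy transforms on the right half-plane, written with
   mu = exp (x/2). *)
Section CauchyTransform.
Context {V : cspace}.
Hypothesis HV : banach V.

Let mu (x : R) := exp (/ 2 * x).
Let ker (s t : R) (x : R) : C := (/ (RtoC s + Ci * RtoC (t * mu x)))%C.

Lemma ker_den s t x : 0 < s -> (t = 1 \/ t = -1) ->
  s <= Cmod (RtoC s + Ci * RtoC (t * mu x)) /\
  Rmin s 1 / 2 * (1 + mu x) <= Cmod (RtoC s + Ci * RtoC (t * mu x)).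
Proof.
  intros Hs Ht.
  assert (E : Cmod (RtoC s + Ci * RtoC (t * mu x)) = sqrt (s^2 + mu x^2)).
  { unfold Cmod. f_equal. unfold RtoC, Ci, Cplus, Cmult; simpl. destruct Ht as [-> | ->]; ring. }
  rewrite E. pose proof (exp_pos (/ 2 * x)) as Hm. fold (mu x) in Hm.
  assert (G : forall u, 0 <= u -> u^2 <= s^2 + mu x^2 -> u <= sqrt (s^2 + mu x^2)).
  { intros u Hu H. rewrite <- (sqrt_pow2 u Hu). now apply sqrt_le_1_alt. }
  pose proof (pow2_ge_0 (mu x)).
  split; apply G; try lra.
  - assert (0 < Rmin s 1) by (apply Rmin_glb_lt; lra). nra.
  - assert (H1 : Rmin s 1 <= s) by apply Rmin_l. assert (H2 : Rmin s 1 <= 1) by apply Rmin_r.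
    assert (H3 : 0 < Rmin s 1) by (apply Rmin_glb_lt; lra).
    set (m := Rmin s 1) in *.
    assert (m / 2 * (1 + mu x) <= (s + mu x) / 2) by nra.
    assert ((m / 2 * (1 + mu x))^2 <= ((s + mu x) / 2)^2) by (apply pow_incr; split; [nra|assumption]).
    nra.
Qed.
Lemma ker_nz s t x : 0 < s -> (t = 1 \/ t = -1) -> (RtoC s + Ci * RtoC (t * mu x))%C <> RtoC 0.
Proof.
  intros Hs Ht E. destruct (ker_den s t x Hs Ht) as [H _]. rewrite E, Cmod_0 in H. lra.
Qed.
Lemma ker_cont s t x : 0 < s -> (t = 1 \/ t = -1) -> cont_at (V := C_NormedModule) (ker s t) x.
Proof.
  intros Hs Ht. apply cont_Cinv; [|now apply ker_nz].
  apply (cont_plus (V := C_NormedModule) (fun _ => RtoC s) (fun x => (Ci * RtoC (t * mu x))%C)).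
  - apply (cont_RtoC (fun _ => s)). apply continuous_const.
  - apply (cont_blin (blin_scalar (V := C_NormedModule) Ci)).
    apply (cont_RtoC (fun x => t * mu x)). apply (ex_derive_continuous (V := R_NormedModule)).
    unfold mu. auto_derive. exact I.
Qed.
Lemma ker_diff s s1 t x : 0 < s -> 0 < s1 -> (t = 1 \/ t = -1) ->
  (ker s t x - ker s1 t x = RtoC (s1 - s) * (ker s t x * ker s1 t x))%C.
Proof.
  intros Hs Hs1 Ht. unfold ker. rewrite RtoC_minus. field. split; now apply ker_nz.
Qed.

(** The bound makes the integrand of the transform of order mu / (1 + mu)^2, and it is preserved,
    with [B / s1], under multiplication by a kernel ([cauchy_data_step]). *)
Definition cauchy_data (v : R -> V) (B : R) : Prop :=
  (forall x, cont_at v x) /\ (forall x, nrm (v x) <= B * (mu x / (1 + mu x))).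

Let Ek (v w : R -> V) (s x : R) : V := ker s 1 x *v v x +v ker s (-1) x *v w x.
(** A Cauchy integral over the imaginary axis, with the densities [v] and [w] on its two halves. *)
Definition cauchy_tr (v w : R -> V) (s : R) : V :=
  epsilon (inhabits (0v : V)) (fun l => is_int (Ek v w s) l).
Let cst (s : R) := 4 / Rmin s 1.

Lemma cauchy_bound v w B s : 0 <= B -> 0 < s -> cauchy_data v B -> cauchy_data w B ->
  forall x, nrm (Ek v w s x) <= cst s * B * (1 * mu x / (1^2 + exp x)).
Proof.
  intros HB Hs [_ Hv] [_ Hw] x.
  assert (Hm1 : 0 < Rmin s 1) by (apply Rmin_glb_lt; lra).
  pose proof (exp_pos (/ 2 * x)) as Hm. fold (mu x) in Hm.
  assert (Ee : exp x = mu x * mu x) by (unfold mu; rewrite <- exp_plus; f_equal; lra).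
  assert (Hk : forall t (u : V), (t = 1 \/ t = -1) -> nrm u <= B * (mu x / (1 + mu x)) ->
    nrm (ker s t x *v u) <= cst s / 2 * B * (1 * mu x / (1^2 + exp x))).
  { intros t u Ht Hu. destruct (ker_den s t x Hs Ht) as [H0 H1].
    rewrite nrm_scal_eq. unfold ker. rewrite Cmod_inv by now apply ker_nz.
    set (d := Cmod (RtoC s + Ci * RtoC (t * mu x))) in *.
    assert (Hd : 0 < d) by lra.
    assert (Hi : / d <= 2 / (Rmin s 1 * (1 + mu x))).
    { replace (2 / (Rmin s 1 * (1 + mu x))) with (/ (Rmin s 1 / 2 * (1 + mu x))) by (field; lra).
      apply Rinv_le_contravar; [|exact H1]. nra. }
    apply Rle_trans with (2 / (Rmin s 1 * (1 + mu x)) * (B * (mu x / (1 + mu x)))).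
    - apply Rmult_le_compat; [left; now apply Rinv_0_lt_compat|apply nrm_ge0|exact Hi|exact Hu].
    - unfold cst.
      replace (2 / (Rmin s 1 * (1 + mu x)) * (B * (mu x / (1 + mu x)))) with
        (4 / Rmin s 1 / 2 * B * (mu x * / ((1 + mu x) * (1 + mu x)))) by (field; lra).
      apply Rmult_le_compat_l.
      + apply Rmult_le_pos; [|exact HB]. apply Rdiv_le_0_compat; [|lra].
        apply Rdiv_le_0_compat; lra.
      + unfold Rdiv. rewrite Rmult_1_l. apply Rmult_le_compat_l; [lra|].
        apply Rinv_le_contravar; [rewrite Ee; nra|rewrite Ee; nra]. }
  unfold Ek. eapply Rle_trans; [apply nrm_tri|].
  pose proof (Hk 1 (v x) (or_introl eq_refl) (Hv x)). pose proof (Hk (-1) (w x) (or_intror eq_refl) (Hw x)).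
  lra.
Qed.

Lemma cauchy_tr_spec v w B s : 0 <= B -> 0 < s -> cauchy_data v B -> cauchy_data w B ->
  is_int (Ek v w s) (cauchy_tr v w s) /\ nrm (cauchy_tr v w s) <= cst s * B * PI.
Proof.
  intros HB Hs Hv Hw.
  pose proof (majorant_scal _ _ _ (cst s * B) (atan_majorant 1 ltac:(lra))) as HG.
  assert (H : is_int (Ek v w s) (cauchy_tr v w s)).
  { unfold cauchy_tr. apply epsilon_spec. eapply int_exists; [exact HV|exact HG| |].
    - intros x. apply cont_plus; apply cont_prod; try apply ker_cont; auto; [apply Hv|apply Hw].
    - now apply cauchy_bound. }
  split; [exact H|]. eapply int_bound; [exact HG|exact H|]. now apply cauchy_bound.
Qed.

Lemma cauchy_data_step v B s1 t : 0 <= B -> 0 < s1 -> (t = 1 \/ t = -1) -> cauchy_data v B ->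
  cauchy_data (fun x => ker s1 t x *v v x) (B / s1).
Proof.
  intros HB Hs Ht [H1 H2]. split.
  - intros x. apply cont_prod; [now apply ker_cont|apply H1].
  - intros x. rewrite nrm_scal_eq. destruct (ker_den s1 t x Hs Ht) as [H3 _].
    unfold ker. rewrite Cmod_inv by now apply ker_nz.
    replace (B / s1 * (mu x / (1 + mu x))) with (/ s1 * (B * (mu x / (1 + mu x)))) by (unfold Rdiv; ring).
    apply Rmult_le_compat; [left; apply Rinv_0_lt_compat; lra|apply nrm_ge0| |apply H2].
    apply Rinv_le_contravar; lra.
Qed.

(** The zero at [s1] is divided out: 1 / (s + i mu) - 1 / (s1 + i mu) is s1 - s times the product of
    the two kernels, so the quotient is again a Cauchy transform, with densities multiplied by the
    kernel at [s1]. *)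
Lemma cauchy_step v w B s1 : 0 <= B -> 0 < s1 -> cauchy_data v B -> cauchy_data w B ->
  (forall s, 0 < s < s1 -> cauchy_tr v w s = 0v) ->
  let v' := fun x => ker s1 1 x *v v x in let w' := fun x => ker s1 (-1) x *v w x in
  (forall s, 0 < s < s1 -> cauchy_tr v' w' s = 0v) /\
  (forall s, 0 < s -> cauchy_tr v w s = RtoC (s1 - s) *v cauchy_tr v' w' s).
Proof.
  intros HB Hs1 Hv Hw H0 v' w'.
  assert (Hv' : cauchy_data v' (B / s1)) by (apply cauchy_data_step; auto).
  assert (Hw' : cauchy_data w' (B / s1)) by (apply cauchy_data_step; auto).
  assert (HB' : 0 <= B / s1) by (apply Rdiv_le_0_compat; lra).
  assert (Hd : forall s, 0 < s -> cauchy_tr v w s -v cauchy_tr v w s1 = RtoC (s1 - s) *v cauchy_tr v' w' s).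
  { intros s Hs. destruct (cauchy_tr_spec v w B s HB Hs Hv Hw) as [I1 _].
    destruct (cauchy_tr_spec v w B s1 HB Hs1 Hv Hw) as [I2 _].
    destruct (cauchy_tr_spec v' w' (B / s1) s HB' Hs Hv' Hw') as [I3 _].
    eapply int_unique; [exact (int_minus _ _ _ _ I1 I2)|].
    eapply int_ext; [|exact (int_scal _ _ (RtoC (s1 - s)) I3)]. intros x. unfold Ek, v', w'.
    transitivity ((RtoC (s1 - s) * (ker s 1 x * ker s1 1 x))%C *v v x
      +v (RtoC (s1 - s) * (ker s (-1) x * ker s1 (-1) x))%C *v w x); [vec|].
    rewrite <- !ker_diff by auto. vec. }
  (* The value at [s1] follows by continuity from the left; [C1] bounds the quotient uniformly on
     the interval from s1 / 2 to s1. *)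
  assert (H1 : cauchy_tr v w s1 = 0v).
  { apply nrm_le_eps_eq0. intros eps Heps.
    set (C1 := 4 / Rmin (s1 / 2) 1 * (B / s1) * PI).
    assert (Hm : 0 < Rmin (s1 / 2) 1) by (apply Rmin_glb_lt; lra).
    assert (HC1 : 0 <= C1).
    { unfold C1. pose proof PI_RGT_0. apply Rmult_le_pos; [|lra].
      apply Rmult_le_pos; [|exact HB']. apply Rdiv_le_0_compat; lra. }
    set (h := Rmin (s1 / 2) (eps / (1 + C1))).
    assert (Hh : 0 < h) by (apply Rmin_glb_lt; [lra|apply Rdiv_lt_0_compat; lra]).
    assert (Hh1 : h <= s1 / 2) by apply Rmin_l. assert (Hh2 : h <= eps / (1 + C1)) by apply Rmin_r.
    specialize (Hd (s1 - h) ltac:(lra)). rewrite (H0 (s1 - h)) in Hd by lra.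
    replace (s1 - (s1 - h)) with h in Hd by ring.
    replace (cauchy_tr v w s1) with (-v (0v -v cauchy_tr v w s1)) by vec.
    rewrite Hd, nrm_opp, nrm_scal_eq, Cmod_R, Rabs_pos_eq by lra.
    destruct (cauchy_tr_spec v' w' (B / s1) (s1 - h) HB' ltac:(lra) Hv' Hw') as [_ N].
    assert (N2 : nrm (cauchy_tr v' w' (s1 - h)) <= C1).
    { eapply Rle_trans; [exact N|]. unfold C1, cst. pose proof PI_RGT_0.
      apply Rmult_le_compat_r; [lra|]. apply Rmult_le_compat_r; [exact HB'|].
      apply Rmult_le_compat_l; [lra|]. apply Rinv_le_contravar; [exact Hm|].
      apply Rle_min_compat_r. lra. }
    apply Rmult_le_compat_r with (r := 1 + C1) in Hh2; [|lra].
    replace (eps / (1 + C1) * (1 + C1)) with eps in Hh2 by (field; lra).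
    pose proof (nrm_ge0 (cauchy_tr v' w' (s1 - h))). nra. }
  assert (H2 : forall s, 0 < s -> cauchy_tr v w s = RtoC (s1 - s) *v cauchy_tr v' w' s).
  { intros s Hs. rewrite <- (Hd s Hs), H1. vec. }
  split; [|exact H2].
  intros s Hs. specialize (H2 s ltac:(lra)). rewrite (H0 s Hs) in H2.
  assert (Hn : (RtoC (s1 - s)) <> RtoC 0) by (intros E; apply RtoC_inj in E; lra).
  transitivity ((/ RtoC (s1 - s))%C *v (RtoC (s1 - s) *v cauchy_tr v' w' s)).
  - vec_coefs. field. exact Hn.
  - rewrite <- H2. vec.
Qed.

(** The n-th quotient has data bounded by B / s1^n, and the factors taken out amount to |s1 - s|^n.
    The ratio is below 1 for 0 < s < 2 s1, whence [cauchy_double]. *)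
Lemma cauchy_pow v w B s1 s n : 0 <= B -> 0 < s1 -> 0 < s -> cauchy_data v B -> cauchy_data w B ->
  (forall s, 0 < s < s1 -> cauchy_tr v w s = 0v) ->
  nrm (cauchy_tr v w s) <= (Rabs (s1 - s) / s1)^n * (cst s * B * PI).
Proof.
  intros HB Hs1 Hs. revert v w B HB. induction n as [|n IH]; intros v w B HB Hv Hw H0.
  - rewrite Rmult_1_l. now apply (cauchy_tr_spec v w B s).
  - destruct (cauchy_step v w B s1 HB Hs1 Hv Hw H0) as [G1 G2].
    rewrite G2, nrm_scal_eq, Cmod_R by exact Hs.
    assert (HB' : 0 <= B / s1) by (apply Rdiv_le_0_compat; lra).
    specialize (IH _ _ (B / s1) HB' (cauchy_data_step v B s1 1 HB Hs1 ltac:(auto) Hv)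
      (cauchy_data_step w B s1 (-1) HB Hs1 ltac:(auto) Hw) G1).
    apply Rmult_le_compat_l with (r := Rabs (s1 - s)) in IH; [|apply Rabs_pos].
    eapply Rle_trans; [exact IH|]. right. simpl. field. lra.
Qed.

Lemma cauchy_double v w B s1 s : 0 <= B -> 0 < s1 -> 0 < s < 2 * s1 -> cauchy_data v B -> cauchy_data w B ->
  (forall s, 0 < s < s1 -> cauchy_tr v w s = 0v) -> cauchy_tr v w s = 0v.
Proof.
  intros HB Hs1 Hs Hv Hw H0. apply nrm_le_eps_eq0. intros eps Heps.
  set (C1 := cst s * B * PI).
  assert (HC1 : 0 <= C1).
  { eapply Rle_trans; [apply (nrm_ge0 (cauchy_tr v w s))|]. apply (cauchy_tr_spec v w B s); auto; lra. }
  set (q := Rabs (s1 - s) / s1).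
  assert (Hq : 0 <= q < 1).
  { unfold q. split; [apply Rdiv_le_0_compat; [apply Rabs_pos|lra]|].
    apply Rmult_lt_reg_r with s1; [lra|]. unfold Rdiv. rewrite Rmult_assoc, Rinv_l, Rmult_1_r, Rmult_1_l by lra.
    apply Rabs_def1; lra. }
  destruct (pow_lt_1_zero q ltac:(rewrite Rabs_pos_eq; lra) (eps / (1 + C1))) as [N HN].
  { apply Rdiv_lt_0_compat; lra. }
  specialize (HN N (le_n N)). rewrite Rabs_pos_eq in HN by (apply pow_le; lra).
  eapply Rle_trans; [apply (cauchy_pow v w B s1 s N); auto; lra|]. fold q C1.
  apply Rlt_le, Rmult_le_compat_r with (r := 1 + C1) in HN; [|lra].
  replace (eps / (1 + C1) * (1 + C1)) with eps in HN by (field; lra).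
  assert (0 <= q^N) by (apply pow_le; lra). nra.
Qed.

Lemma cauchy_unique v w B s0 : 0 <= B -> 0 < s0 -> cauchy_data v B -> cauchy_data w B ->
  (forall s, 0 < s < s0 -> cauchy_tr v w s = 0v) -> forall s, 0 < s -> cauchy_tr v w s = 0v.
Proof.
  intros HB Hs0 Hv Hw H0.
  assert (H : forall n s, 0 < s < 2^n * s0 -> cauchy_tr v w s = 0v).
  { induction n as [|n IH]; intros s Hs.
    - apply H0. simpl in Hs. lra.
    - simpl in Hs. assert (0 < 2^n) by (apply pow_lt; lra).
      apply (cauchy_double v w B (2^n * s0)); auto; nra. }
  intros s Hs.
  destruct (Pow_x_infinity 2 ltac:(rewrite Rabs_pos_eq; lra) (s / s0 + 1)) as [N HN].
  specialize (HN N (le_n N)). rewrite Rabs_pos_eq in HN by (apply pow_le; lra).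
  apply (H N). split; [exact Hs|].
  apply Rmult_lt_reg_r with (/ s0); [now apply Rinv_0_lt_compat|].
  rewrite Rmult_assoc, Rinv_r, Rmult_1_r by lra. unfold Rdiv in HN. lra.
Qed.
End CauchyTransform.

(** * The resolvent of the square root *)

Lemma int_C_vec {V : cspace} (f : R -> R) l (y : V) :
  is_int (V := C_NormedModule) (fun x => RtoC (f x)) (RtoC l) ->
  is_int (fun x => RtoC (f x) *v y) (RtoC l *v y).
Proof.
  intros H.
  assert (HB : blin (V := C_NormedModule) (fun c : C_NormedModule => (c : C) *v y) (nrm y)).
  { split.
    - intros c c'. transitivity ((c + c')%C *v y); [reflexivity|vec].
    - intros c c'. transitivity ((c * c')%C *v y); [reflexivity|vec].
    - intros c. rewrite nrm_scal_eq. right. change (nrm c) with (Cmod c). ring. }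
  exact (int_blin HB _ _ H).
Qed.

Lemma lim_RtoC_p (f : R -> R) l : is_lim f p_infty (Finite l) ->
  lim_p (V := C_NormedModule) (fun x => RtoC (f x)) (RtoC l).
Proof.
  intros H eps Heps. apply is_lim_spec in H. destruct (H (mkposreal _ Heps)) as [N HN].
  exists N. intros x Hx. specialize (HN x Hx). simpl in HN.
  change (Cmod (RtoC (f x) - RtoC l)%C <= eps). rewrite <- RtoC_minus, Cmod_R. lra.
Qed.
Lemma lim_RtoC_m (f : R -> R) l : is_lim f m_infty (Finite l) ->
  lim_m (V := C_NormedModule) (fun x => RtoC (f x)) (RtoC l).
Proof.
  intros H eps Heps. apply is_lim_spec in H. destruct (H (mkposreal _ Heps)) as [N HN].
  exists N. intros x Hx. specialize (HN x Hx). simpl in HN.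
  change (Cmod (RtoC (f x) - RtoC l)%C <= eps). rewrite <- RtoC_minus, Cmod_R. lra.
Qed.
Lemma int_majorant g G L : is_majorant g G L ->
  is_int (V := C_NormedModule) (fun x => RtoC (g x)) (RtoC L).
Proof.
  intros [H1 H2 H3]. apply int_deriv with (F := fun x => RtoC (G x)).
  - intros x. now apply deriv_RtoC.
  - now apply lim_RtoC_m.
  - now apply lim_RtoC_p.
Qed.

(* With B = A^(1/2), [hres s] is (s + B)^(-1), written as an integral of the
   resolvent of A. *)
Section HalfPower.
Context {V : cspace} {K : R} {Psi : C -> V -> V}.
Hypothesis HV : banach V.
Hypothesis HR : resfam DR K Psi.

Let P (t : R) : V -> V := Psi (RtoC t).
Let H := fpow Psi (1 / 2).
Let mu (x : R) := exp (/ 2 * x).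

(** With t = exp x, [hker] and [tker] are t^(1/2) / (s^2 + t) dt and s t^(-1/2) / (s^2 + t) dt.
    Integrated against R(t) and divided by PI, they are to represent (s + B)^(-1) and B^(-1) (s +
    B)^(-1). *)
Definition hker (s x : R) : R := exp (/ 2 * x) * exp x / (s^2 + exp x).
Definition tker (s x : R) : R := s * exp (/ 2 * x) / (s^2 + exp x).

Definition hint (s : R) (y : V) : V :=
  epsilon (inhabits (0v : V)) (fun l => is_int (fun x => RtoC (hker s x) *v P (exp x) y) l).
Definition tint (s : R) (y : V) : V :=
  epsilon (inhabits (0v : V)) (fun l => is_int (fun x => RtoC (tker s x) *v P (exp x) y) l).
Definition hres (s : R) (y : V) : V := RtoC (/ PI) *v hint s y.

Let P_id s t y : 0 <= s -> 0 <= t -> P s y -v P t y = RtoC (t - s) *v P s (P t y) :=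
  real_id HR s t y.
Let P_blin t : 0 <= t -> blin (P t) (K / (1 + t)) := real_blin HR t.
Let P0_blin : blin (P 0) (K / (1 + 0)) := P_blin 0 (Rle_refl 0).

Lemma res_cont x y : cont_at (fun x => P (exp x) y) x.
Proof.
  assert (E : forall x, P (exp x) y = mel Psi 0 y 0 x).
  { intros z. unfold mel, P. rewrite ep_0, Rmult_0_l, exp_0, pol_0, Cscal_one. reflexivity. }
  intros eps Heps.
  destruct (deriv_cont _ _ _ (mel_deriv HR 0 y 0 x 1 ltac:(lra) ltac:(lra) ltac:(intros; apply DR_pol))
    eps Heps) as (d & Hd & Hh).
  exists d. split; [exact Hd|]. intros h Hlt. rewrite !E. auto.
Qed.
Lemma hker_cont s x : cont_at (V := C_NormedModule) (fun x => RtoC (hker s x)) x.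
Proof.
  apply (cont_RtoC (hker s)). apply (ex_derive_continuous (V := R_NormedModule)). unfold hker.
  pose proof (exp_pos x). pose proof (pow2_ge_0 s). auto_derive. simpl in *. lra.
Qed.
Lemma tker_cont s x : cont_at (V := C_NormedModule) (fun x => RtoC (tker s x)) x.
Proof.
  apply (cont_RtoC (tker s)). apply (ex_derive_continuous (V := R_NormedModule)). unfold tker.
  pose proof (exp_pos x). pose proof (pow2_ge_0 s). auto_derive. simpl in *. lra.
Qed.

Lemma hker_pos s x : 0 < hker s x.
Proof.
  unfold hker. pose proof (exp_pos x). pose proof (exp_pos (/ 2 * x)). pose proof (pow2_ge_0 s).
  apply Rdiv_lt_0_compat; nra.
Qed.
Lemma tker_pos s x : 0 < s -> 0 < tker s x.
Proof.
  intros Hs. unfold tker. pose proof (exp_pos x). pose proof (exp_pos (/ 2 * x)). pose proof (pow2_ge_0 s).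
  apply Rdiv_lt_0_compat; nra.
Qed.
Lemma hker_1 s x : hker s x / (1 + exp x) <= tker 1 x.
Proof.
  unfold hker, tker. pose proof (exp_pos x) as E. pose proof (exp_pos (/ 2 * x)) as E2. pose proof (pow2_ge_0 s).
  rewrite Rmult_1_l, pow1.
  set (u := exp x) in *. set (m := exp (/ 2 * x)) in *.
  apply Rmult_le_reg_r with ((s^2 + u) * (1 + u)); [nra|].
  replace (m * u / (s^2 + u) / (1 + u) * ((s^2 + u) * (1 + u))) with (m * u) by (field; lra).
  replace (m / (1 + u) * ((s^2 + u) * (1 + u))) with (m * (s^2 + u)) by (field; lra). nra.
Qed.
Lemma hker_s s x : 0 < s -> s * (hker s x / (1 + exp x)) <= tker s x.
Proof.
  intros Hs. unfold hker, tker. pose proof (exp_pos x) as E. pose proof (exp_pos (/ 2 * x)) as E2. pose proof (pow2_ge_0 s).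
  set (u := exp x) in *. set (m := exp (/ 2 * x)) in *.
  apply Rmult_le_reg_r with ((s^2 + u) * (1 + u)); [nra|].
  replace (s * (m * u / (s^2 + u) / (1 + u)) * ((s^2 + u) * (1 + u))) with (s * m * u) by (field; lra).
  replace (s * m / (s^2 + u) * ((s^2 + u) * (1 + u))) with (s * m * (1 + u)) by (field; lra). nra.
Qed.

Lemma res_nrm x y : nrm (P (exp x) y) <= K / (1 + exp x) * nrm y.
Proof. apply (real_blin HR). left; apply exp_pos. Qed.

Lemma hint_bound s y x : nrm (RtoC (hker s x) *v P (exp x) y) <= K * nrm y * (hker s x / (1 + exp x)).
Proof.
  rewrite nrm_scal_eq, Cmod_R, Rabs_pos_eq by (left; apply hker_pos).
  pose proof (hker_pos s x). pose proof (exp_pos x). pose proof (res_nrm x y) as N.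
  apply Rmult_le_compat_l with (r := hker s x) in N; [|lra].
  eapply Rle_trans; [exact N|]. right. field. lra.
Qed.
Lemma Ky_ge0 (y : V) : 0 <= K * nrm y.
Proof. apply Rmult_le_pos; [apply (rf_K HR)|apply nrm_ge0]. Qed.

Lemma hint_spec s y : is_int (fun x => RtoC (hker s x) *v P (exp x) y) (hint s y).
Proof.
  unfold hint. apply epsilon_spec.
  apply (int_exists _ _ _ _ HV (majorant_scal _ _ _ (K * nrm y) (atan_majorant 1 ltac:(lra)))).
  - intros x. apply cont_prod; [apply hker_cont|apply res_cont].
  - intros x. eapply Rle_trans; [apply hint_bound|]. apply Rmult_le_compat_l; [apply Ky_ge0|apply hker_1].
Qed.
Lemma tint_spec s y : 0 < s -> is_int (fun x => RtoC (tker s x) *v P (exp x) y) (tint s y).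
Proof.
  intros Hs. unfold tint. apply epsilon_spec.
  apply (int_exists _ _ _ _ HV (majorant_scal _ _ _ (K * nrm y) (atan_majorant s Hs))).
  - intros x. apply cont_prod; [apply tker_cont|apply res_cont].
  - intros x. rewrite nrm_scal_eq, Cmod_R, Rabs_pos_eq by (left; now apply tker_pos).
    rewrite Rmult_comm. apply Rmult_le_compat_r; [left; now apply tker_pos|].
    apply (real_nrm HR). left; apply exp_pos.
Qed.

(** Two estimates, without and with a factor s, add up to the decay in 1 + s. *)
Lemma hint_blin s : 0 <= s -> blin (hint s) (2 * K * PI / (1 + s)).
Proof.
  intros Hs. pose proof PI_RGT_0 as HPI. pose proof (rf_K HR) as K0. split.
  - intros y y'. eapply int_unique; [apply hint_spec|].
    eapply int_ext; [|exact (int_plus _ _ _ _ (hint_spec s y) (hint_spec s y'))].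
    intros x. simpl. rewrite (blin_plus (P_blin _ (Rlt_le _ _ (exp_pos x)))). vec.
  - intros c y. eapply int_unique; [apply hint_spec|].
    eapply int_ext; [|exact (int_scal _ _ c (hint_spec s y))].
    intros x. simpl. rewrite (blin_scal (P_blin _ (Rlt_le _ _ (exp_pos x)))). vec.
  - intros y.
    assert (N1 : nrm (hint s y) <= K * nrm y * PI).
    { apply (int_bound _ _ _ _ _ (majorant_scal _ _ _ (K * nrm y) (atan_majorant 1 ltac:(lra))) (hint_spec s y)).
      intros x. eapply Rle_trans; [apply hint_bound|]. apply Rmult_le_compat_l; [apply Ky_ge0|apply hker_1]. }
    assert (N2 : s * nrm (hint s y) <= K * nrm y * PI).
    { destruct Hs as [Hs| <-]; [|rewrite Rmult_0_l; apply Rmult_le_pos; [apply Ky_ge0|lra]].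
      rewrite <- (Rabs_pos_eq s) at 1 by lra. rewrite <- Cmod_R, <- nrm_scal_eq.
      apply (int_bound _ _ _ _ _ (majorant_scal _ _ _ (K * nrm y) (atan_majorant s Hs))
        (int_scal _ _ (RtoC s) (hint_spec s y))).
      intros x. rewrite nrm_scal_eq, Cmod_R, Rabs_pos_eq by lra.
      apply Rle_trans with (s * (K * nrm y * (hker s x / (1 + exp x)))).
      - apply Rmult_le_compat_l; [lra|apply hint_bound].
      - replace (s * (K * nrm y * (hker s x / (1 + exp x)))) with (K * nrm y * (s * (hker s x / (1 + exp x)))) by ring.
        apply Rmult_le_compat_l; [apply Ky_ge0|now apply hker_s]. }
    apply Rmult_le_reg_r with (1 + s); [lra|].
    replace (2 * K * PI / (1 + s) * nrm y * (1 + s)) with (2 * (K * nrm y * PI)) by (field; lra). lra.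
Qed.

Lemma hres_blin s : 0 <= s -> blin (hres s) (2 * K / (1 + s)).
Proof.
  intros Hs. pose proof PI_RGT_0 as HPI.
  assert (Hi : 0 < / PI) by now apply Rinv_0_lt_compat.
  replace (2 * K / (1 + s)) with (Cmod (RtoC (/ PI)) * (2 * K * PI / (1 + s))).
  - apply (blin_comp (fun v => RtoC (/ PI) *v v) (hint s)); [apply Cmod_ge_0|apply blin_scalar|now apply hint_blin].
  - rewrite Cmod_R, Rabs_pos_eq by lra. field. split; lra.
Qed.

Lemma hres_comm (L : V -> V) B s y : blin L B ->
  (forall t y, 0 < t -> L (P t y) = P t (L y)) -> L (hres s y) = hres s (L y).
Proof.
  intros HL Hc. unfold hres. rewrite (blin_scal HL). f_equal.
  eapply int_unique; [exact (int_blin HL _ _ (hint_spec s y))|].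
  eapply int_ext; [|exact (hint_spec s (L y))]. intros x. simpl.
  rewrite (blin_scal HL). f_equal. symmetry. apply Hc, exp_pos.
Qed.

Lemma H_eq y l : is_int (fun x => RtoC (mu x) *v P (exp x) y) l -> H y = RtoC (/ PI) *v l.
Proof.
  intros Hl. unfold H. rewrite (fpow_eq HV HR (1 / 2) y l); [|lra|].
  - f_equal. f_equal. unfold fpow_coef. replace (PI * (1 / 2)) with (PI / 2) by field.
    rewrite sin_PI2. unfold Rdiv. ring.
  - eapply int_ext; [|exact Hl]. intros x. unfold mel. rewrite ep_0, pol_0. unfold mu, P.
    replace (1 - 1 / 2) with (/ 2) by field. reflexivity.
Qed.

Lemma H_blin : exists B, 0 <= B /\ blin H B.
Proof. apply (fpow_blin HV HR); lra. Qed.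
Lemma H_P t y : 0 <= t -> H (P t y) = P t (H y).
Proof.
  intros Ht. unfold H. symmetry. apply (fpow_comm HV HR HV HR (P t) (K / (1 + t))); [now apply (real_blin HR)|lra|].
  intros u z Hu. apply (rf_comm HR); apply DR_t; lra.
Qed.
Lemma H_H y : H (H y) = P 0 y.
Proof. apply (fpow_fpow_one HV HR); lra. Qed.
Lemma H_hres s y : H (hres s y) = hres s (H y).
Proof.
  destruct H_blin as (B & _ & HB). apply (hres_comm H B); [exact HB|].
  intros t z Ht. apply H_P. lra.
Qed.

Lemma hres_0 y : hres 0 y = H y.
Proof.
  unfold hres. symmetry. apply H_eq. eapply int_ext; [|exact (hint_spec 0 y)].
  intros x. simpl. do 2 f_equal. unfold hker, mu. pose proof (exp_pos x). field. lra.
Qed.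

Let T (s : R) (y : V) : V := RtoC (/ PI) *v tint s y.

Lemma T_hres s y : 0 < s -> H y = hres s y +v RtoC s *v T s y.
Proof.
  intros Hs.
  rewrite (H_eq y (hint s y +v RtoC s *v tint s y)); [unfold hres, T; vec|].
  eapply int_ext; [|exact (int_plus _ _ _ _ (hint_spec s y) (int_scal _ _ (RtoC s) (tint_spec s y Hs)))].
  intros x. simpl.
  transitivity (RtoC (hker s x + s * tker s x) *v P (exp x) y); [vec|].
  do 2 f_equal. unfold hker, tker, mu. pose proof (exp_pos x). field. nra.
Qed.

(** The integral of [tker] is PI by [atan_majorant], R(t) = A^(-1) (1 - t R(t)), and
    [tker s x * exp x] equals [s * hker s x]. *)
Lemma T_eq s y : 0 < s -> T s y = P 0 (y -v RtoC s *v hres s y).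
Proof.
  intros Hs. pose proof PI_RGT_0 as HPI.
  pose proof (int_C_vec (tker s) PI y (int_majorant _ _ _ (atan_majorant s Hs))) as I1.
  pose proof (int_minus _ _ _ _ I1 (int_scal _ _ (RtoC s) (hint_spec s y))) as I2.
  pose proof (int_blin P0_blin _ _ I2) as I3.
  assert (E : tint s y = P 0 (RtoC PI *v y -v RtoC s *v hint s y)).
  { eapply int_unique; [now apply tint_spec|]. eapply int_ext; [|exact I3].
    intros x. simpl. pose proof (exp_pos x) as E.
    pose proof (P_id 0 (exp x) y ltac:(lra) ltac:(lra)) as Q.
    rewrite Rminus_0_r in Q.
    assert (E0 : P (exp x) y = P 0 y -v RtoC (exp x) *v P 0 (P (exp x) y)).
    { rewrite <- Q. vec. }
    rewrite E0 at 2.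
    rewrite (blin_minus P0_blin), !(blin_scal P0_blin).
    transitivity (RtoC (tker s x) *v P 0 y -v RtoC (tker s x * exp x) *v P 0 (P (exp x) y)); [|vec].
    transitivity (RtoC (tker s x) *v P 0 y -v RtoC (s * hker s x) *v P 0 (P (exp x) y)); [vec|].
    do 3 f_equal. unfold tker, hker. field. nra. }
  unfold T. rewrite E. unfold hres.
  rewrite !(blin_minus P0_blin), !(blin_scal P0_blin).
  vec_coefs; rewrite RtoC_inv by lra; field; intros Q; apply RtoC_inj in Q; lra.
Qed.

Let Dd (s : R) (y : V) : V := H (hres s y) -v T s y.

(** [T_hres] and [T_eq] combine to s B^(-1) D = D for the defect D; using this twice replaces B^(-1)
    by A^(-1). For small s the norm of s^2 A^(-1) is below 1 and D vanishes; for large s the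
    relation alone does not exclude that D is an eigenvector. *)
Lemma Dd_eq s y : 0 < s -> Dd s y = RtoC (s^2) *v P 0 (Dd s y).
Proof.
  intros Hs. destruct H_blin as (B & _ & HB).
  assert (E : RtoC s *v H (Dd s y) = Dd s y).
  { unfold Dd. rewrite (blin_minus HB), H_H.
    pose proof (f_equal H (T_hres s y Hs)) as E1.
    rewrite (blin_plus HB), (blin_scal HB), H_H in E1.
    transitivity (RtoC s *v P 0 (hres s y) +v H (hres s y) -v (H (hres s y) +v RtoC s *v H (T s y))); [vec|].
    rewrite <- E1, (T_eq s y Hs).
    rewrite (blin_minus P0_blin), !(blin_scal P0_blin). vec. }
  rewrite <- E at 1. rewrite <- E at 1. rewrite (blin_scal HB), H_H. simpl. rewrite Rmult_1_r. vec.
Qed.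

Lemma Dd_small s y : 0 < s -> s^2 * K <= / 2 -> Dd s y = 0v.
Proof.
  intros Hs Hk. apply nrm_eq0. apply Rle_antisym; [|apply nrm_ge0].
  pose proof (Dd_eq s y Hs) as E. apply (f_equal nrm) in E.
  rewrite nrm_scal_eq, Cmod_R, Rabs_pos_eq in E by apply pow2_ge_0.
  assert (N : nrm (P 0 (Dd s y)) <= K * nrm (Dd s y)) by (apply (real_nrm HR); lra).
  pose proof (nrm_ge0 (Dd s y)). pose proof (pow2_ge_0 s).
  apply Rmult_le_compat_l with (r := s^2) in N; [|lra].
  assert (s^2 * K * nrm (Dd s y) <= / 2 * nrm (Dd s y)) by (apply Rmult_le_compat_r; lra). lra.
Qed.

(** The densities come from partial fractions: s^2 + mu^2 = (s + i mu) (s - i mu) splits the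
    integrand of [Dd] into two Cauchy kernels. *)
Let vdat (sg : R) (y : V) (x : R) : V :=
  RtoC (mu x / (2 * PI)) *v ((Ci * RtoC (sg * mu x))%C *v H (P (exp x) y) -v P (exp x) y).

Lemma vdat_cauchy y : exists B, 0 <= B /\
  cauchy_data (vdat 1 y) B /\ cauchy_data (vdat (-1) y) B.
Proof.
  destruct H_blin as (B & B0 & HB). pose proof PI_RGT_0 as HPI. pose proof (rf_K HR) as K0.
  set (C1 := (B + 1) * K * nrm y).
  assert (HC : 0 <= C1) by (unfold C1; apply Rmult_le_pos; [nra|apply nrm_ge0]).
  exists (2 * C1). split; [lra|].
  assert (G : forall sg, (sg = 1 \/ sg = -1) -> cauchy_data (vdat sg y) (2 * C1)).
  { intros sg Hsg. split.
    - intros x. unfold vdat.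
      assert (Hm : continuous mu x).
      { apply (ex_derive_continuous (V := R_NormedModule)). unfold mu. auto_derive. exact I. }
      apply (cont_prod (fun x => RtoC (mu x / (2 * PI)))).
      + apply (cont_RtoC (fun x => mu x / (2 * PI))).
        apply (ex_derive_continuous (V := R_NormedModule)). unfold mu. auto_derive. lra.
      + unfold minus. apply cont_plus.
        * apply (cont_prod (fun x => (Ci * RtoC (sg * mu x))%C)).
          -- apply (cont_blin (blin_scalar (V := C_NormedModule) Ci)).
             apply (cont_RtoC (fun x => sg * mu x)).
             apply (ex_derive_continuous (V := R_NormedModule)). unfold mu. auto_derive. exact I.
          -- apply (cont_blin HB). apply res_cont.
        * intros eps Heps. destruct (res_cont x y eps Heps) as (d & Hd & Hh).
          exists d. split; [exact Hd|]. intros h Hlt. specialize (Hh h Hlt).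
          rewrite <- nrm_opp. eapply Rle_trans; [|exact Hh]. right. f_equal. vec.
    - intros x. unfold vdat. pose proof (exp_pos (/ 2 * x)) as Hm. change (0 < mu x) in Hm.
      change (exp (/ 2 * x)) with (mu x).
      assert (Ee : exp x = mu x * mu x) by (unfold mu; rewrite <- exp_plus; f_equal; lra).
      rewrite nrm_scal_eq, Cmod_R, Rabs_pos_eq by (apply Rdiv_le_0_compat; lra).
      set (u := nrm (P (exp x) y)).
      assert (Hu : u <= K / (1 + exp x) * nrm y) by apply res_nrm.
      assert (Hu0 : 0 <= u) by apply nrm_ge0.
      assert (N : nrm ((Ci * RtoC (sg * mu x))%C *v H (P (exp x) y) -v P (exp x) y) <= (mu x * B + 1) * u).
      { eapply Rle_trans; [apply nrm_tri_minus|]. rewrite nrm_scal_eq, Cmod_mult, Cmod_Ci, Cmod_R.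
        replace (Rabs (sg * mu x)) with (mu x).
        2:{ rewrite Rabs_mult, (Rabs_pos_eq (mu x)) by lra.
            destruct Hsg as [-> | ->]; [rewrite Rabs_R1|rewrite Rabs_left by lra]; ring. }
        pose proof (blin_nrm HB (P (exp x) y)) as N1. fold u in N1.
        apply Rmult_le_compat_l with (r := mu x) in N1; [|lra]. fold u. lra. }
      assert (N2 : (mu x * B + 1) * u <= (B + 1) * (1 + mu x) * (K / (1 + exp x) * nrm y)).
      { apply Rmult_le_compat; try nra. }
      assert (H2PI : mu x / (2 * PI) <= mu x).
      { unfold Rdiv. rewrite <- (Rmult_1_r (mu x)) at 2. apply Rmult_le_compat_l; [lra|].
        rewrite <- Rinv_1. apply Rinv_le_contravar; [lra|]. pose proof PI2_1. lra. }
      apply Rle_trans with (mu x * ((B + 1) * (1 + mu x) * (K / (1 + exp x) * nrm y))).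
      { apply Rmult_le_compat; [apply Rdiv_le_0_compat; lra|apply nrm_ge0|exact H2PI|lra]. }
      replace (mu x * ((B + 1) * (1 + mu x) * (K / (1 + exp x) * nrm y))) with
        (C1 * (mu x * ((1 + mu x) / (1 + exp x)))) by (unfold C1; field; rewrite Ee; nra).
      replace (2 * C1 * (mu x / (1 + mu x))) with (C1 * (mu x * (2 / (1 + mu x)))) by (field; lra).
      apply Rmult_le_compat_l; [exact HC|]. apply Rmult_le_compat_l; [lra|].
      rewrite Ee. apply Rmult_le_reg_r with ((1 + mu x * mu x) * (1 + mu x)); [nra|].
      replace ((1 + mu x) / (1 + mu x * mu x) * ((1 + mu x * mu x) * (1 + mu x))) with
        ((1 + mu x)^2) by (field; nra).
      replace (2 / (1 + mu x) * ((1 + mu x * mu x) * (1 + mu x))) with (2 * (1 + mu x * mu x)) by (field; lra).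
      pose proof (pow2_ge_0 (mu x - 1)). nra. }
  split; apply G; auto.
Qed.

Lemma Dd_cauchy s y : 0 < s -> Dd s y = cauchy_tr (vdat 1 y) (vdat (-1) y) s.
Proof.
  intros Hs. destruct (vdat_cauchy y) as (B & B0 & H1 & H2).
  destruct (cauchy_tr_spec HV _ _ B s B0 Hs H1 H2) as [I1 _].
  destruct H_blin as (BH & _ & HB).
  pose proof (int_minus _ _ _ _ (int_blin HB _ _ (hint_spec s y)) (tint_spec s y Hs)) as I2.
  pose proof (int_scal _ _ (RtoC (/ PI)) I2) as I3.
  eapply int_unique; [|exact I1].
  replace (Dd s y) with (RtoC (/ PI) *v (H (hint s y) -v tint s y)).
  2:{ unfold Dd, T, hres. rewrite (blin_scal HB). vec. }
  eapply int_ext; [|exact I3]. intros x. simpl. rewrite (blin_scal HB). unfold vdat, hker, tker.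
  pose proof PI_RGT_0 as HPI. pose proof (exp_pos (/ 2 * x)) as Hm.
  change (exp (/ 2 * x)) with (mu x) in *.
  assert (Ee : exp x = mu x * mu x) by (unfold mu; rewrite <- exp_plus; f_equal; lra).
  set (p := P (exp x) y). set (q := H p). clearbody p q.
  rewrite Ee. set (m := mu x) in *. clearbody m.
  assert (Hd : s^2 + m * m <> 0) by nra.
  assert (Z1 : (RtoC s + Ci * RtoC (1 * m))%C <> RtoC 0).
  { intros Z. apply (f_equal fst) in Z. unfold RtoC, Ci, Cplus, Cmult in Z; simpl in Z. lra. }
  assert (Z2 : (RtoC s + Ci * RtoC (-1 * m))%C <> RtoC 0).
  { intros Z. apply (f_equal fst) in Z. unfold RtoC, Ci, Cplus, Cmult in Z; simpl in Z. lra. }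
  rewrite Rmult_1_l in *.
  replace (-1 * m) with (- m) in * by ring. rewrite RtoC_opp in *.
  assert (Hprod : ((RtoC s + Ci * RtoC m) * (RtoC s + Ci * - RtoC m) = RtoC (s^2 + m * m))%C).
  { unfold RtoC, Ci, Cplus, Cmult, Copp; simpl. f_equal; ring. }
  assert (F1 : (/ (RtoC s + Ci * RtoC m) = (RtoC s - Ci * RtoC m) / RtoC (s^2 + m * m))%C).
  { rewrite <- Hprod. field. split; assumption. }
  assert (F2 : (/ (RtoC s + Ci * - RtoC m) = (RtoC s + Ci * RtoC m) / RtoC (s^2 + m * m))%C).
  { rewrite <- Hprod. field. split; assumption. }
  rewrite F1, F2.
  assert (HCi : (Ci * Ci = - RtoC 1)%C).
  { unfold RtoC, Ci, Cmult, Copp; simpl. f_equal; ring. }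
  assert (Hd' : RtoC (s^2 + m * m) <> RtoC 0) by (intros Z; apply RtoC_inj in Z; lra).
  assert (HP' : RtoC PI <> RtoC 0) by (intros Z; apply RtoC_inj in Z; lra).
  rewrite !RtoC_div, !RtoC_inv, !RtoC_mult by lra.
  set (d := RtoC (s^2 + m * m)) in *. clearbody d.
  vec_coefs.
  - field; auto.
  - transitivity ((RtoC m * RtoC m * RtoC m / d / RtoC PI) * - (Ci * Ci))%C; [rewrite HCi|]; field; auto.
Qed.

Lemma hres_eq s y : 0 <= s -> hres s y +v RtoC s *v H (hres s y) = H y.
Proof.
  intros [Hs| <-]; [|rewrite hres_0; vec].
  assert (E : Dd s y = 0v).
  { rewrite (Dd_cauchy s y Hs). destruct (vdat_cauchy y) as (B & B0 & H1 & H2).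
    pose proof (rf_K HR) as K0.
    assert (Hk : 0 < / (2 * (K + 1))) by (apply Rinv_0_lt_compat; lra).
    apply (cauchy_unique HV _ _ B (Rmin 1 (/ (2 * (K + 1)))) B0); auto.
    { apply Rmin_glb_lt; lra. }
    intros t Ht. rewrite <- Dd_cauchy by lra. apply Dd_small; [lra|].
    assert (t < 1) by (eapply Rlt_le_trans; [apply Ht|apply Rmin_l]).
    assert (t < / (2 * (K + 1))) by (eapply Rlt_le_trans; [apply Ht|apply Rmin_r]).
    apply Rle_trans with (t * (K + 1)); [assert (t^2 <= t) by nra; nra|].
    apply Rlt_le, Rmult_le_compat_r with (r := K + 1) in H3; [|lra].
    eapply Rle_trans; [exact H3|]. right. field. lra. }
  rewrite (T_hres s y Hs). unfold Dd in E.
  transitivity (hres s y +v RtoC s *v T s y +v RtoC s *v (H (hres s y) -v T s y)); [vec|].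
  rewrite E. vec.
Qed.

Hypothesis Hinj : forall y, P 0 y = 0v -> y = 0v.

Lemma H_inj y y' : H y = H y' -> y = y'.
Proof. apply (fpow_inj HV HR Hinj); lra. Qed.

(** The resolvent identity is checked after applying the injective B^(-1), where [hres_eq] turns
    both sides into products of two resolvents. Only real parameters occur, hence [fst lam]. *)
Lemma hres_resfam : resfam DR (2 * K) (fun lam => hres (fst lam)).
Proof.
  pose proof (rf_K HR). destruct H_blin as (B & _ & HB). split; [lra| |].
  - intros lam (t & Ht & ->). simpl. rewrite Cmod_R, Rabs_pos_eq by exact Ht. now apply hres_blin.
  - intros lam nu (s & Hs & ->) (t & Ht & ->) y. simpl.
    apply H_inj. rewrite (blin_minus HB), (blin_scal HB).
    pose proof (hres_eq s (hres t y) Hs) as E1.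
    pose proof (hres_eq t y Ht) as E2. apply (f_equal (hres s)) in E2.
    rewrite (blin_plus (hres_blin s Hs)), (blin_scal (hres_blin s Hs)), <- !H_hres in E2.
    rewrite <- E1, <- E2. vec.
Qed.
End HalfPower.

(** * Powers of the square root *)

(** A substitute for dominated convergence in [mel_convolution]: on one side of [u0] the integrand
    is small, on the other the mass of the majorant is. *)
Lemma int_bound_split {V : cspace} (f : R -> V) l g G (L u0 e1 e2 : R) :
  is_majorant g G L -> is_int f l ->
  (forall u, u < u0 -> nrm (f u) <= e1 * g u) -> (forall u, u0 <= u -> nrm (f u) <= e2 * g u) ->
  nrm l <= e1 * G u0 + e2 * (L - G u0).
Proof.
  intros HG (F & HF & Hl) H1 H2.
  assert (A1 : forall u, u < u0 -> nrm (F u) <= e1 * G u).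
  { intros u Hu. apply (anti_bound u0 f F _ _ _ (majorant_scal g G L e1 HG)); auto.
    destruct HF as [HF HF0]. split; [intros; now apply HF|exact HF0]. }
  assert (A2 : nrm (F u0) <= e1 * G u0).
  { apply le_epsilon. intros eps Heps.
    destruct (deriv_cont _ _ _ (proj1 HF u0 I) (eps / 2)) as (d1 & Hd1 & Hh1); [lra|].
    assert (HGc : continuity_pt (fun u => e1 * G u) u0).
    { apply derivable_continuous_pt. exists (e1 * g u0). apply is_derive_Reals.
      apply (majorant_scal g G L e1 HG). }
    destruct (HGc (eps / 2)) as (d2 & Hd2 & Hh2); [lra|].
    set (h := Rmin d1 d2 / 2). assert (0 < Rmin d1 d2) by now apply Rmin_glb_lt.
    pose proof (Rmin_l d1 d2). pose proof (Rmin_r d1 d2).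
    assert (Hh : 0 < h) by (unfold h; lra).
    specialize (Hh1 (- h) ltac:(rewrite Rabs_Ropp, Rabs_pos_eq; unfold h in *; lra)).
    assert (Hh2' : Rabs (e1 * G (u0 + - h) - e1 * G u0) < eps / 2).
    { apply (Hh2 (u0 + - h)). split; [split; [exact I|lra]|].
      simpl. unfold Rdist. replace (u0 + - h - u0) with (- h) by ring.
      rewrite Rabs_Ropp, Rabs_pos_eq; unfold h; lra. }
    apply Rabs_def2 in Hh2'. specialize (A1 (u0 + - h) ltac:(lra)).
    rewrite nrm_minus_sym in Hh1. pose proof (nrm_minus_ge (F u0) (F (u0 + - h))). lra. }
  assert (A3 : nrm (l -v F u0) <= e2 * (L - G u0)).
  { set (cl := fun x => Rmax u0 x).
    apply (lim_le_nrm (fun x => F (cl x) -v F u0) (fun x => e2 * G (cl x) - e2 * G u0)).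
    - intros eps Heps. destruct (Hl eps Heps) as [N HN]. exists N. intros x Hx.
      pose proof (Rmax_r u0 x). specialize (HN (cl x) ltac:(unfold cl; lra)).
      eapply Rle_trans; [|exact HN]. right. f_equal. vec.
    - replace (e2 * (L - G u0)) with (e2 * L - e2 * G u0) by ring.
      apply is_lim_minus'; [|apply is_lim_const].
      apply is_lim_ext_loc with (fun x => e2 * G x).
      + exists u0. intros x Hx. unfold cl. rewrite Rmax_right by lra. reflexivity.
      + apply (majorant_scal g G L e2 HG).
    - intros x. pose proof (Rmax_l u0 x).
      apply (mean_value_ineq F f (fun x => e2 * G x) (fun x => e2 * g x)); [exact H| | |].
      + intros z _. now apply HF.
      + intros z _. apply (majorant_scal g G L e2 HG).
      + intros z Hz. apply H2. lra. }
  replace l with ((l -v F u0) +v F u0) by vec.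
  eapply Rle_trans; [apply nrm_tri|]. lra.
Qed.

Section HalfPowerOfPower.
Context {V : cspace} {K : R} {Psi : C -> V -> V}.
Hypothesis HV : banach V.
Hypothesis HR : resfam DR K Psi.
Hypothesis Hinj : forall y, Psi (RtoC 0) y = 0v -> y = 0v.
Variable al : R.
Hypothesis Hal : 0 < al < 1.
Variable y : V.

Let c := (1 + al) / 2.
Let kap (u : R) := exp (c * u) / (1 + exp u).
Let v := mel Psi (1 - al / 2) y 0.

(** A second-order remainder uniform in [x] is what permits differentiation under the integral sign
    in [mel_convolution]. *)
Lemma taylor_uniform (f f' f'' : R -> V) B :
  (forall x, has_deriv f x (f' x)) -> (forall x, has_deriv f' x (f'' x)) ->
  (forall x, nrm (f'' x) <= B) ->
  forall x h, nrm (f (x + h) -v f x -v RtoC h *v f' x) <= B * h^2.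
Proof.
  intros H1 H2 HB.
  assert (HB0 : 0 <= B) by (eapply Rle_trans; [apply (nrm_ge0 (f'' 0))|apply (HB 0)]).
  assert (Hl0 : forall x z, x <= z -> nrm (f' z -v f' x) <= B * z - B * x).
  { intros x z Hxz. apply (mean_value_ineq f' f'' (fun t => B * t) (fun _ => B)); auto.
    intros t _. auto_derive; [exact I|ring]. }
  assert (Hlip : forall x z, nrm (f' z -v f' x) <= B * Rabs (z - x)).
  { intros x z. destruct (Rle_lt_dec x z).
    - rewrite Rabs_pos_eq by lra. pose proof (Hl0 x z). lra.
    - rewrite nrm_minus_sym, Rabs_left by lra. pose proof (Hl0 z x). lra. }
  intros x h.
  set (w := fun t => f t +v RtoC t *v (-v f' x)).
  assert (Hw : forall t, has_deriv w t (f' t +v (RtoC 1 *v (-v f' x) +v RtoC t *v 0v))).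
  { intros t. apply deriv_plus; [apply H1|].
    apply (deriv_prod (fun t => RtoC t) (fun _ => -v f' x)); [|apply deriv_const].
    apply (deriv_RtoC (fun t => t)). apply (is_derive_id (K := R_AbsRing)). }
  assert (G : forall p q, p <= q -> (forall t, p <= t <= q -> Rabs (t - x) <= Rabs h) ->
    nrm (w q -v w p) <= B * Rabs h * q - B * Rabs h * p).
  { intros p q Hpq Ht.
    apply (mean_value_ineq w (fun t => f' t +v (RtoC 1 *v (-v f' x) +v RtoC t *v 0v))
      (fun t => B * Rabs h * t) (fun _ => B * Rabs h)); auto.
    - intros t _. auto_derive; [exact I|ring].
    - intros t Hpt. replace (f' t +v (RtoC 1 *v (-v f' x) +v RtoC t *v 0v)) with (f' t -v f' x) by vec.
      eapply Rle_trans; [apply Hlip|]. apply Rmult_le_compat_l; auto. }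
  replace (f (x + h) -v f x -v RtoC h *v f' x) with (w (x + h) -v w x).
  2:{ unfold w. rewrite RtoC_plus. vec. }
  rewrite <- (pow2_abs h). destruct (Rle_lt_dec 0 h) as [Hh|Hh].
  - rewrite (Rabs_pos_eq h) in * by lra.
    eapply Rle_trans; [apply G; [lra|]|right; ring].
    intros t Ht. rewrite Rabs_pos_eq; lra.
  - rewrite nrm_minus_sym. rewrite (Rabs_left h) in * by lra.
    eapply Rle_trans; [apply G; [lra|]|right; ring].
    intros t Ht. rewrite Rabs_left1; lra.
Qed.

Lemma v_deriv x : has_deriv v x (melD Psi (1 - al / 2) y 0 x).
Proof. apply (mel_deriv HR (1 - al / 2) y 0 x 1); [lra|lra|]. intros; apply DR_pol. Qed.

Lemma weight_le_1 d x : 0 <= d <= 1 -> exp (d * x) / (1 + exp x) <= 1.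
Proof.
  intros Hd. pose proof (exp_pos x) as E.
  apply Rmult_le_reg_r with (1 + exp x); [lra|].
  replace (exp (d * x) / (1 + exp x) * (1 + exp x)) with (exp (d * x)) by (field; lra).
  destruct (Rle_lt_dec 0 x).
  - assert (exp (d * x) <= exp x) by (apply exp_le_mono; nra). lra.
  - assert (exp (d * x) <= exp 0) by (apply exp_le_mono; nra). rewrite exp_0 in *. lra.
Qed.

Lemma melD_bounded : exists B, forall x, nrm (melD Psi (1 - al / 2) y 0 x) <= B.
Proof.
  pose proof (rf_K HR) as K0. pose proof (nrm_ge0 y) as Y0.
  exists (K * nrm y + K * (K * nrm y)). intros x. set (d := 1 - al / 2).
  assert (Hd : 0 <= d <= 1) by (unfold d; lra).
  pose proof (weight_le_1 d x Hd) as W. pose proof (exp_pos x) as E. pose proof (exp_pos (d * x)) as Ed.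
  unfold melD. eapply Rle_trans; [apply nrm_tri_minus|]. rewrite !nrm_scal_eq, Cmod_mult, Cmod_R, Cmod_ep, Cmod_pol.
  rewrite Rabs_pos_eq by lra.
  assert (N1 : nrm (mel Psi d y 0 x) <= K * nrm y * 1).
  { eapply Rle_trans; [apply (mel_nrm HR), DR_pol|]. apply Rmult_le_compat_l; [nra|exact W]. }
  assert (N2 : nrm (Psi (pol x 0) (Psi (pol x 0) y)) <= K / (1 + exp x) * (K / (1 + exp x) * nrm y)).
  { rewrite pol_0. eapply Rle_trans; [apply (real_blin HR); lra|].
    apply Rmult_le_compat_l; [apply Rdiv_le_0_compat; lra|]. apply (real_blin HR). lra. }
  apply Rplus_le_compat.
  - pose proof (nrm_ge0 (mel Psi d y 0 x)). nra.
  - apply Rmult_le_compat_l with (r := exp (d * x) * exp x) in N2; [|nra].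
    eapply Rle_trans; [exact N2|].
    replace (exp (d * x) * exp x * (K / (1 + exp x) * (K / (1 + exp x) * nrm y))) with
      (K * (K * nrm y) * (exp (d * x) / (1 + exp x) * (exp x / (1 + exp x)))) by (field; lra).
    assert (0 <= K * (K * nrm y)) by (repeat apply Rmult_le_pos; lra).
    rewrite <- (Rmult_1_r (K * (K * nrm y))) at 2. apply Rmult_le_compat_l; [lra|].
    pose proof (weight_le_1 1 x ltac:(lra)) as W1. rewrite Rmult_1_l in W1.
    apply Rle_trans with (1 * 1); [|lra]. apply Rmult_le_compat; try assumption; apply Rdiv_le_0_compat; lra.
Qed.

(* After the translation x = u + 2 Y the integrand defining (e^Y + B)^(-1)
   separates into a scalar weight in u and [v (2 Y + u)]. *)
Lemma hres_mel Yv : is_int (fun u => RtoC (kap u) *v v (2 * Yv + u))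
  (RtoC PI *v mel (fun lam => hres (Psi := Psi) (fst lam)) (1 - al) y 0 Yv).
Proof.
  pose proof PI_RGT_0 as HPI.
  pose proof (int_shift _ _ (2 * Yv) (hint_spec HV HR (exp Yv) y)) as I1.
  pose proof (int_scal _ _ (RtoC (exp ((1 - al) * Yv))) I1) as I2.
  replace (RtoC PI *v mel (fun lam => hres (Psi := Psi) (fst lam)) (1 - al) y 0 Yv) with
    (RtoC (exp ((1 - al) * Yv)) *v hint (Psi := Psi) (exp Yv) y).
  - eapply int_ext; [|exact I2]. intros u. simpl. unfold v, mel. rewrite ep_0, pol_0.
    rewrite (Rplus_comm u (2 * Yv)). rewrite !Cscal_assoc.
    apply (f_equal2 (fun c v => c *v v)); [|reflexivity].
    change (RtoC (exp ((1 - al) * Yv)) * RtoC (hker (exp Yv) (2 * Yv + u))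
      = RtoC (kap u) * RtoC (exp ((1 - al / 2) * (2 * Yv + u))))%C.
    rewrite <- !RtoC_mult. f_equal. unfold hker, kap, c.
    assert (E2 : exp Yv ^ 2 = exp (2 * Yv)).
    { simpl. rewrite Rmult_1_r, <- exp_plus. f_equal. ring. }
    rewrite E2. pose proof (exp_pos u). pose proof (exp_pos (2 * Yv)).
    replace (exp (2 * Yv) + exp (2 * Yv + u)) with (exp (2 * Yv) * (1 + exp u)) by (rewrite exp_plus; ring).
    replace (exp ((1 - al) * Yv) * (exp (/ 2 * (2 * Yv + u)) * exp (2 * Yv + u) / (exp (2 * Yv) * (1 + exp u))))
      with (exp ((1 - al) * Yv) * exp (/ 2 * (2 * Yv + u)) * exp u / (1 + exp u)).
    2:{ rewrite (exp_plus (2 * Yv) u). field. lra. }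
    replace (exp ((1 + al) / 2 * u) / (1 + exp u) * exp ((1 - al / 2) * (2 * Yv + u))) with
      (exp ((1 + al) / 2 * u) * exp ((1 - al / 2) * (2 * Yv + u)) / (1 + exp u)) by (field; lra).
    f_equal. rewrite <- !exp_plus. f_equal. field.
  - unfold mel. rewrite ep_0, pol_0. simpl fst. unfold hres.
    rewrite !Cscal_assoc. apply (f_equal2 (fun c v => c *v v)); [|reflexivity].
    change (RtoC (exp ((1 - al) * Yv)) = RtoC PI * RtoC (exp ((1 - al) * Yv)) * RtoC (/ PI))%C.
    rewrite <- !RtoC_mult. f_equal. field. lra.
Qed.

Lemma kap_deriv x : is_derive kap x ((c * exp (c * x) * (1 + exp x) - exp (c * x) * exp x) / (1 + exp x)^2).
Proof. unfold kap. pose proof (exp_pos x). auto_derive; [lra|]. field. lra. Qed.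
Lemma kap_pos x : 0 < kap x.
Proof. unfold kap. pose proof (exp_pos x). apply Rdiv_lt_0_compat; [apply exp_pos|lra]. Qed.

Lemma mel_convolution I F : anti p_infty v F -> lim_p F I ->
  is_int (mel (fun lam => hres (Psi := Psi) (fst lam)) (1 - al) y 0)
    (RtoC (/ (2 * PI) * (PI / sin (PI * c))) *v I).
Proof.
  intros HF HFl. pose proof PI_RGT_0 as HPI.
  assert (Hc : 0 < c < 1) by (unfold c; lra).
  destruct (mel_majorant_ok c Hc) as (g & G & L & HG & HL0 & HGL & Hg).
  destruct (mel_majorant_ok (1 - al / 2) ltac:(lra)) as (g1 & G1 & L1 & HG1 & HL1 & HGL1 & Hg1).
  set (B := K * nrm y * L1).
  assert (HFb : forall x, nrm (F x) <= B).
  { intros x. apply Rle_trans with (K * nrm y * G1 x).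
    - apply (anti_bound p_infty v F _ _ _ (majorant_scal g1 G1 L1 (K * nrm y) HG1) HF);[|exact Logic.I].
      intros z _. eapply Rle_trans; [apply (mel_nrm HR), DR_pol|].
      apply Rmult_le_compat_l; [apply (Ky_ge0 HR)|apply Hg1].
    - apply Rmult_le_compat_l; [apply (Ky_ge0 HR)|apply HGL1]. }
  assert (HB0 : 0 <= B) by (eapply Rle_trans; [apply (nrm_ge0 (F 0))|apply HFb]).
  assert (HIb : nrm I <= B).
  { apply (lim_le_nrm F (fun _ => B)); [exact HFl|apply is_lim_const|exact HFb]. }
  destruct melD_bounded as (B2 & HB2).
  assert (HT : forall x h, nrm (F (x + h) -v F x -v RtoC h *v v x) <= B2 * h^2).
  { intros x h. apply (taylor_uniform F v _ B2 (fun x => proj1 HF x Logic.I) v_deriv HB2). }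
  pose (W := fun Yv => epsilon (inhabits (0v : V)) (fun l => is_int (fun u => RtoC (kap u) *v F (2 * Yv + u)) l)).
  assert (kap0 : forall u (z : V), nrm (RtoC (kap u) *v z) = kap u * nrm z).
  { intros u z. pose proof (kap_pos u). rewrite nrm_scal_eq, Cmod_R, Rabs_pos_eq; lra. }
  assert (g0 : forall u, 0 <= g u) by (intros u; eapply Rle_trans; [left; apply (kap_pos u)|apply Hg]).
  assert (kapg : forall u (z : V) e, nrm z <= e -> nrm (RtoC (kap u) *v z) <= e * g u).
  { intros u z e He. rewrite kap0, Rmult_comm. pose proof (kap_pos u).
    apply Rmult_le_compat; [apply nrm_ge0|lra|exact He|apply Hg]. }
  assert (HW : forall Yv, is_int (fun u => RtoC (kap u) *v F (2 * Yv + u)) (W Yv)).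
  { intros Yv. unfold W. apply epsilon_spec.
    apply (int_exists _ _ _ _ HV (majorant_scal g G L B HG)).
    - intros u. apply cont_prod.
      + apply (cont_RtoC kap). apply (ex_derive_continuous (V := R_NormedModule)). eexists. apply kap_deriv.
      + apply (cont_comp F (fun u => 2 * Yv + u)); [eapply deriv_cont; apply (proj1 HF); exact Logic.I|].
        apply (ex_derive_continuous (V := R_NormedModule)). auto_derive. exact Logic.I.
    - intros u. now apply kapg. }
  set (kh := PI / sin (PI * c)).
  assert (Hkh : is_int (fun u => RtoC (kap u) *v I) (RtoC kh *v I)).
  { apply (int_C_vec kap). now apply euler_integral. }
  assert (Hder : forall Yv, has_deriv (fun Yv => RtoC (/ (2 * PI)) *v W Yv) Yv
    (mel (fun lam => hres (Psi := Psi) (fst lam)) (1 - al) y 0 Yv)).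
  { intros Yv. set (m := mel (fun lam => hres (Psi := Psi) (fst lam)) (1 - al) y 0 Yv).
    replace m with (RtoC (/ (2 * PI)) *v (RtoC 2 *v (RtoC PI *v m))).
    2:{ rewrite !Cscal_assoc. transitivity (RtoC 1 *v m); [|apply Cscal_one].
        apply (f_equal2 (fun c v => c *v v)); [|reflexivity].
        change (RtoC (/ (2 * PI)) * RtoC 2 * RtoC PI = RtoC 1)%C.
        rewrite <- !RtoC_mult. f_equal. field. lra. }
    apply (deriv_blin (blin_scalar (RtoC (/ (2 * PI))))).
    (* The argument 2 Y + u moves by 2 h, whence the 4; [L] is the mass of the majorant of [kap]. *)
    apply (quad_deriv _ _ _ (4 * B2 * L) 1); [lra|]. intros h _.
    pose proof (int_minus _ _ _ _ (int_minus _ _ _ _ (HW (Yv + h)) (HW Yv))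
      (int_scal _ _ (RtoC h) (int_scal _ _ (RtoC 2) (hres_mel Yv)))) as Q.
    replace (4 * B2 * L * h^2) with (4 * B2 * h^2 * L) by ring.
    apply (int_bound _ _ _ _ _ (majorant_scal g G L (4 * B2 * h^2) HG) Q). intros u. cbv beta.
    replace (RtoC (kap u) *v F (2 * (Yv + h) + u) -v RtoC (kap u) *v F (2 * Yv + u)
      -v RtoC h *v (RtoC 2 *v (RtoC (kap u) *v v (2 * Yv + u)))) with
      (RtoC (kap u) *v (F (2 * Yv + u + 2 * h) -v F (2 * Yv + u) -v RtoC (2 * h) *v v (2 * Yv + u))).
    2:{ replace (2 * (Yv + h) + u) with (2 * Yv + u + 2 * h) by ring. vec. }
    apply kapg. eapply Rle_trans; [apply HT|]. right. ring. }
  replace (RtoC (/ (2 * PI) * kh) *v I) with (RtoC (/ (2 * PI)) *v (RtoC kh *v I)) by vec.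
  apply int_deriv with (F := fun Yv => RtoC (/ (2 * PI)) *v W Yv); [exact Hder| |].
  - replace (0v : V) with (RtoC (/ (2 * PI)) *v (0v : V)) by vec.
    apply (lim_m_blin (blin_scalar (RtoC (/ (2 * PI))))). intros eps Heps.
    set (e := Rmin 1 (eps / (1 + L + B))).
    assert (He : 0 < e) by (apply Rmin_glb_lt; [lra|apply Rdiv_lt_0_compat; lra]).
    assert (He1 : e <= 1) by apply Rmin_l.
    assert (He2 : e * (1 + L + B) <= eps).
    { apply Rle_trans with (eps / (1 + L + B) * (1 + L + B)); [|right; field; lra].
      apply Rmult_le_compat_r; [lra|apply Rmin_r]. }
    destruct (proj2 HF e He) as [N HN].
    pose proof (maj_p HG) as Hp. apply is_lim_spec in Hp. destruct (Hp (mkposreal _ He)) as [N2 HN2].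
    simpl in HN2. exists ((N - N2) / 2). intros Yv HYv.
    replace (W Yv -v 0v) with (W Yv) by vec.
    specialize (HN2 (N - 2 * Yv) ltac:(lra)). apply Rabs_def2 in HN2.
    eapply Rle_trans; [apply (int_bound_split _ _ g G L (N - 2 * Yv) e B HG (HW Yv))|].
    + intros u Hu. apply kapg. specialize (HN (2 * Yv + u) ltac:(lra)).
      replace (F (2 * Yv + u) -v 0v) with (F (2 * Yv + u)) in HN by vec. exact HN.
    + intros u _. now apply kapg.
    + specialize (HGL (N - 2 * Yv)).
      assert (e * G (N - 2 * Yv) <= e * L) by (apply Rmult_le_compat_l; lra).
      assert (B * (L - G (N - 2 * Yv)) <= B * e) by (apply Rmult_le_compat_l; lra).
      lra.
  - apply (lim_p_blin (blin_scalar (RtoC (/ (2 * PI))))). intros eps Heps.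
    set (e := eps / (1 + L + 2 * B)).
    assert (He : 0 < e) by (apply Rdiv_lt_0_compat; lra).
    assert (He2 : e * (1 + L + 2 * B) = eps) by (unfold e; field; lra).
    destruct (HFl e He) as [N HN].
    pose proof (maj_m HG) as Hp. apply is_lim_spec in Hp. destruct (Hp (mkposreal _ He)) as [N2 HN2].
    simpl in HN2. exists ((N + 1 - N2) / 2). intros Yv HYv.
    set (u0 := N + 1 - 2 * Yv).
    specialize (HN2 u0 ltac:(unfold u0; lra)). apply Rabs_def2 in HN2.
    eapply Rle_trans; [apply (int_bound_split _ _ g G L u0 (2 * B) e HG (int_minus _ _ _ _ (HW Yv) Hkh))|].
    + intros u _. cbv beta.
      replace (RtoC (kap u) *v F (2 * Yv + u) -v RtoC (kap u) *v I) with
        (RtoC (kap u) *v (F (2 * Yv + u) -v I)) by vec.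
      apply kapg. eapply Rle_trans; [apply nrm_tri_minus|]. pose proof (HFb (2 * Yv + u)). lra.
    + intros u Hu. cbv beta.
      replace (RtoC (kap u) *v F (2 * Yv + u) -v RtoC (kap u) *v I) with
        (RtoC (kap u) *v (F (2 * Yv + u) -v I)) by vec.
      apply kapg. apply HN. unfold u0 in Hu. lra.
    + specialize (HGL u0).
      assert (2 * B * G u0 <= 2 * B * e) by (apply Rmult_le_compat_l; lra).
      assert (e * (L - G u0) <= e * L) by (apply Rmult_le_compat_l; lra).
      lra.
Qed.

(** The constants agree by the double angle formula, as sin (PI c) = cos (PI al / 2). *)
Lemma fpow_hres : fpow (fun lam => hres (Psi := Psi) (fst lam)) al y = fpow Psi (al / 2) y.
Proof.
  pose proof PI_RGT_0 as HPI.
  destruct (mel_int_exists HV HR (1 - al / 2) ltac:(lra) 0 y) as [I HI].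
  { intros x _. apply DR_pol. }
  rewrite (fpow_eq HV HR (al / 2) y I) by (exact HI || lra).
  destruct HI as (F & HF & HFl).
  pose proof (mel_convolution I F HF HFl) as HM.
  rewrite (fpow_eq HV (hres_resfam HV HR Hinj) al y _ Hal HM), Cscal_assoc.
  apply (f_equal2 (fun c v => c *v v)); [|reflexivity].
  change (RtoC (fpow_coef al) * RtoC (/ (2 * PI) * (PI / sin (PI * c))) = RtoC (fpow_coef (al / 2)))%C.
  rewrite <- RtoC_mult. f_equal. unfold fpow_coef.
  replace (PI * al) with (2 * (PI * (al / 2))) by field. rewrite sin_2a.
  replace (PI * c) with (PI / 2 + PI * (al / 2)) by (unfold c; field).
  rewrite sin_plus, sin_PI2, cos_PI2.
  assert (0 < cos (PI * (al / 2))) by (apply cos_gt_0; nra).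
  field. lra.
Qed.
End HalfPowerOfPower.

(** * The phase space *)

Lemma resfam_sub {V : cspace} (D D' : C -> Prop) K (Psi : C -> V -> V) :
  (forall lam, D' lam -> D lam) -> resfam D K Psi -> resfam D' K Psi.
Proof. intros H [H1 H2 H3]. split; auto. Qed.

Section ResolventConverse.
Context {E : cspace} (T : linrel E E).

Lemma res_at_inv_graph lam y x :
  ((lam *: lr_id E + (-1) *: ((-1) *: T))^-1)%lr y x <-> T x (y -v lam *v x).
Proof.
  split.
  - intros (a & b & (c & -> & ->) & (d & (e & He & ->) & ->) & ->).
    match goal with |- graph T _ ?z => replace z with e by vec end. exact He.
  - intros H. exists (lam *v x), (y -v lam *v x). split; [|split].
    + exists x. split; reflexivity.
    + exists (RtoC (-1) *v (y -v lam *v x)). split; [|vec].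
      exists (y -v lam *v x). split; [exact H|reflexivity].
    + vec.
Qed.

Lemma positive_of_res C : 1 <= C -> (forall s, 0 <= s -> res_at T (RtoC s) (C / (1 + s))) ->
  positive_with T C.
Proof.
  intros HC H. split; [exact HC|split].
  - intros s Hs. specialize (H s Hs). split; [|split].
    + intros y x x' Hx Hx'. apply res_at_inv_graph in Hx. apply res_at_inv_graph in Hx'.
      eapply res_at_unique; eassumption.
    + intros y. destruct (proj1 H y) as [x Hx]. exists x. now apply res_at_inv_graph.
    + exists (C / (1 + s)). intros y x Hx. apply res_at_inv_graph in Hx. now apply (proj2 H).
  - intros s Hs. specialize (H s ltac:(lra)). unfold op_norm.
    match goal with |- context [Lub_Rbar ?F] => pose proof (Lub_Rbar_correct F) as [Hub Hle];
      set (L := Lub_Rbar F) in * end.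
    assert (H1 : Rbar_le L (Finite (C / (1 + s)))).
    { apply Hle. intros r (y & x & Hy & Hx & ->). apply shift_inv_iff in Hx. simpl.
      eapply Rle_trans; [apply (proj2 H); exact Hx|].
      assert (0 <= C / (1 + s)) by (apply Rdiv_le_0_compat; lra).
      change (nrm y <= 1) in Hy. nra. }
    assert (H0 : Rbar_le (Finite 0) L).
    { apply Hub. exists 0v, 0v. split; [|split].
      - change (nrm (0v : E) <= 1). rewrite nrm_zero. lra.
      - apply graph_zero.
      - symmetry. apply nrm_zero. }
    destruct L as [l| |]; [|destruct H1|destruct H0].
    simpl in *. apply Rmult_le_compat_l with (r := 1 + s) in H1; [|lra].
    replace ((1 + s) * (C / (1 + s))) with C in H1 by (field; lra). exact H1.
Qed.

(** The graph is the transposed graph of a continuous map. For a pair off the graph, [d] measures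
    the failure of p = T^(-1) q, and each of the two radii spends half of it. *)
Lemma closed_of_res K : res_at T (RtoC 0) K -> closed_op T.
Proof.
  intros H. intros [p q] Hn. apply NNPP. intros Hg. apply Hn. simpl in Hg.
  pose proof (Rv_blin T _ _ H) as HB. destruct (blin_pos HB) as (K' & HK' & HB').
  assert (HT : forall x y, T x y <-> Rv T (RtoC 0) y = x).
  { intros x y. assert (Ey : forall x, y -v RtoC 0 *v x = y) by (intros; vec).
    split.
    - intros Hx. apply (Rv_eq T (RtoC 0) K); [exact H|]. now rewrite Ey.
    - intros <-. pose proof (Rv_spec T _ _ y H) as H1. now rewrite Ey in H1. }
  set (d := nrm (p -v Rv T (RtoC 0) q)).
  assert (Hd : 0 < d).
  { destruct (Rle_lt_or_eq_dec 0 d (nrm_ge0 _)) as [|E0]; [assumption|].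
    exfalso. apply Hg. apply HT. symmetry. apply nrm_sub_eq0. now symmetry. }
  destruct (nrm_ball p (d / 2) ltac:(lra)) as [e1 He1].
  destruct (nrm_ball q (d / (2 * K'))) as [e2 He2]; [apply Rdiv_lt_0_compat; lra|].
  assert (He : 0 < Rmin e1 e2) by (apply Rmin_glb_lt; apply cond_pos).
  exists (mkposreal _ He). intros [p' q'] [Hp Hq]. simpl in Hp, Hq. simpl. intros Hpq.
  apply HT in Hpq.
  assert (A1 : nrm (p' -v p) < d / 2).
  { apply He1. eapply ball_le; [apply Rmin_l|exact Hp]. }
  assert (A2 : nrm (q' -v q) < d / (2 * K')).
  { apply He2. eapply ball_le; [apply Rmin_r|exact Hq]. }
  assert (A3 : nrm (p' -v Rv T (RtoC 0) q) < d / 2).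
  { rewrite <- Hpq, <- (blin_minus HB). eapply Rle_lt_trans; [apply HB'|].
    apply Rmult_lt_compat_l with (r := K') in A2; [|lra].
    eapply Rlt_le_trans; [exact A2|]. right. field. lra. }
  pose proof (nrm_tri3 p p' (Rv T (RtoC 0) q)) as Q. rewrite (nrm_minus_sym p p') in Q. fold d in Q. lra.
Qed.
End ResolventConverse.

Section PositiveOperator.
Context {X : cspace} {A : linrel X X} {M : R}.
Hypothesis HX : banach X.
Hypothesis HA : positive_with A M.
Hypothesis Hsv : single_valued A.

Lemma positive_resfam : resfam DR M (Rv A).
Proof.
  apply (resfam_sub (fun lam => res_at A lam (M / (1 + Cmod lam)))).
  - intros lam (t & Ht & ->). rewrite Cmod_R, Rabs_pos_eq by exact Ht. now apply positive_res.
  - apply Rv_resfam. pose proof (proj1 HA). lra.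
Qed.
Lemma graph_Rv0 x z : A x z <-> x = Rv A (RtoC 0) z.
Proof.
  pose proof (positive_res A M HA 0 (Rle_refl 0)) as H.
  assert (Ez : forall x, z -v RtoC 0 *v x = z) by (intros; vec). split.
  - intros Hx. symmetry. apply (Rv_eq A _ _ _ _ H). now rewrite Ez.
  - intros ->. pose proof (Rv_spec A _ _ z H) as H1. now rewrite Ez in H1.
Qed.
(** Injectivity of A^(-1) is single-valuedness of [A], read in the transposed graph. *)
Lemma positive_inj y : Rv A (RtoC 0) y = 0v -> y = 0v.
Proof.
  intros H. apply (Hsv 0v); [|apply graph_zero]. apply graph_Rv0. now symmetry.
Qed.
Lemma neg_power_iff a y x : 0 < a < 1 -> neg_power A a y x <-> x = fpow (Rv A) a y.
Proof.
  intros Ha. destruct (mel_int_exists HX positive_resfam (1 - a) ltac:(lra) 0 y) as [l Hl].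
  { intros z _. apply DR_pol. }
  rewrite (fpow_eq HX positive_resfam a y l Ha Hl).
  apply (neg_power_value HX a y x l); auto. now exists M.
Qed.
End PositiveOperator.


(** * Coordinates on the phase space *)

Section PhaseSpace.
Context {X : cspace} {A : linrel X X} {M : R}.
Hypothesis HX : banach X.
Hypothesis HA : positive_with A M.
Hypothesis Hsv : single_valued A.

Local Notation H := (fpow (Rv A) (1 / 2)).

Lemma frac_half_iff x z : frac_power A (1 / 2) x z <-> x = H z.
Proof. apply (neg_power_iff HX HA (1 / 2) z x). lra. Qed.

Let HR := positive_resfam HA.
Let Hinj := positive_inj HA Hsv.

Definition mkh (z : X) : Xhalf A :=
  exist (fun p : X * X => frac_power A (1 / 2) (fst p) (snd p)) (H z, z)
    (proj2 (frac_half_iff (H z) z) eq_refl).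
Definition mkp (u v w : X) : phase_space A := (mkh u, (v, w)).

Lemma halfpow_inj y y' : H y = H y' -> y = y'.
Proof. apply (H_inj HX HR Hinj). Qed.
Lemma graph_halfpow x z : A x z <-> x = H (H z).
Proof. rewrite (H_H HX HR). apply (graph_Rv0 HA). Qed.

(* Coordinates on X^(1/2) x X x X: a point of X^(1/2) is represented by its
   image under A^(1/2). *)
Definition coord0 (u : Xhalf A) : X := snd (proj1_sig u).
Definition coord1 (p : phase_space A) : X := coord0 (fst p).
Definition coord2 (p : phase_space A) : X := fst (snd p).
Definition coord3 (p : phase_space A) : X := snd (snd p).

Lemma incl_coord (u : Xhalf A) : incl _ u = H (coord0 u).
Proof. apply frac_half_iff. exact (proj2_sig u). Qed.
Lemma xhalf_ext (u u' : Xhalf A) : coord0 u = coord0 u' -> u = u'.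
Proof.
  intros E. apply gs_eq. pose proof (incl_coord u) as E1. pose proof (incl_coord u') as E2.
  rewrite <- E, <- E1 in E2. unfold incl in E2. unfold coord0 in E.
  destruct (proj1_sig u), (proj1_sig u'). simpl in *. now subst.
Qed.
Lemma phase_ext (p p' : phase_space A) :
  coord1 p = coord1 p' -> coord2 p = coord2 p' -> coord3 p = coord3 p' -> p = p'.
Proof.
  destruct p as (u & v & w), p' as (u' & v' & w'). unfold coord1, coord2, coord3. simpl.
  intros E -> ->. now rewrite (xhalf_ext u u' E).
Qed.

Lemma nrm_fst {E F : cspace} (p : prod_NormedModule C_AbsRing E F) : nrm (fst p) <= nrm p.
Proof.
  eapply Rle_trans; [apply Rle_abs|]. eapply Rle_trans; [apply Rmax_l|].
  apply (sqrt_plus_sqr (nrm (fst p)) (nrm (snd p))).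
Qed.
Lemma nrm_snd {E F : cspace} (p : prod_NormedModule C_AbsRing E F) : nrm (snd p) <= nrm p.
Proof.
  eapply Rle_trans; [apply Rle_abs|]. eapply Rle_trans; [apply Rmax_r|].
  apply (sqrt_plus_sqr (nrm (fst p)) (nrm (snd p))).
Qed.
Lemma nrm_pair {E F : cspace} (p : prod_NormedModule C_AbsRing E F) :
  nrm p <= nrm (fst p) + nrm (snd p).
Proof.
  pose proof (nrm_ge0 (fst p)). pose proof (nrm_ge0 (snd p)).
  rewrite <- (sqrt_square (nrm (fst p) + nrm (snd p))) by lra.
  apply sqrt_le_1_alt. nra.
Qed.

Lemma coord1_blin : blin coord1 1.
Proof.
  split; [reflexivity|reflexivity|]. intros p. rewrite Rmult_1_l.
  eapply Rle_trans; [|apply (nrm_fst p)]. apply (nrm_snd (proj1_sig (fst p) : prod_NormedModule _ X X)).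
Qed.
Lemma coord2_blin : blin coord2 1.
Proof.
  split; [reflexivity|reflexivity|]. intros p. rewrite Rmult_1_l.
  eapply Rle_trans; [|apply (nrm_snd p)]. apply (nrm_fst (snd p)).
Qed.
Lemma coord3_blin : blin coord3 1.
Proof.
  split; [reflexivity|reflexivity|]. intros p. rewrite Rmult_1_l.
  eapply Rle_trans; [|apply (nrm_snd p)]. apply (nrm_snd (snd p)).
Qed.
Lemma phase_nrm : exists B, 0 < B /\ forall p, nrm p <= B * (nrm (coord1 p) + nrm (coord2 p) + nrm (coord3 p)).
Proof.
  destruct (H_blin HX HR) as (B & HB0 & HB). exists (B + 1). split; [lra|]. intros p.
  pose proof (nrm_pair p) as N1. pose proof (nrm_pair (snd p)) as N2.
  assert (N3 : nrm (fst p) <= (B + 1) * nrm (coord1 p)).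
  { eapply Rle_trans; [apply (nrm_pair (proj1_sig (fst p) : prod_NormedModule _ X X))|].
    change (nrm (incl _ (fst p)) + nrm (coord1 p) <= (B + 1) * nrm (coord1 p)).
    rewrite incl_coord. pose proof (blin_nrm HB (coord1 p)) as N4. unfold coord1 in *. lra. }
  fold (coord2 p) in N2. fold (coord3 p) in N2.
  assert (N5 : nrm p <= (B + 1) * nrm (coord1 p) + (nrm (coord2 p) + nrm (coord3 p))).
  { eapply Rle_trans; [exact N1|]. now apply Rplus_le_compat. }
  pose proof (nrm_ge0 (coord2 p)). pose proof (nrm_ge0 (coord3 p)).
  eapply Rle_trans; [exact N5|]. nra.
Qed.
Lemma banach_phase_space : banach (phase_space A).
Proof.
  intros u Hu. destruct phase_nrm as (B & HB0 & HB).
  assert (G : forall c : phase_space A -> X, blin c 1 -> exists l, seq_lim (fun n => c (u n)) l).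
  { intros c Hc. apply HX. intros eps Heps. destruct (Hu eps Heps) as [N HN]. exists N.
    intros n m Hn Hm. rewrite <- (blin_minus Hc). eapply Rle_lt_trans; [apply Hc|].
    rewrite Rmult_1_l. auto. }
  destruct (G _ coord1_blin) as [l1 H1], (G _ coord2_blin) as [l2 H2], (G _ coord3_blin) as [l3 H3].
  exists (mkp l1 l2 l3). intros eps Heps.
  assert (He : 0 < eps / (3 * B)) by (apply Rdiv_lt_0_compat; lra).
  destruct (H1 _ He) as [N1 K1], (H2 _ He) as [N2 K2], (H3 _ He) as [N3 K3].
  exists (N1 + N2 + N3)%nat. intros n Hn.
  specialize (K1 n ltac:(lia)). specialize (K2 n ltac:(lia)). specialize (K3 n ltac:(lia)).
  eapply Rle_lt_trans; [apply HB|].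
  rewrite (blin_minus coord1_blin), (blin_minus coord2_blin), (blin_minus coord3_blin).
  change (coord1 (mkp l1 l2 l3)) with l1. change (coord2 (mkp l1 l2 l3)) with l2.
  change (coord3 (mkp l1 l2 l3)) with l3.
  apply Rlt_le_trans with (B * (3 * (eps / (3 * B)))); [apply Rmult_lt_compat_l; lra|].
  right. field. lra.
Qed.

(** The block pattern is common to [Lambda] and its powers. Entries of the first row take values in
    X^(1/2), whose elements are H y; entries of the first column act on H (coord1 p). Zero entries
    drop out because H is injective. *)
Lemma op_matrix_iff (T11 T12 T21 T22 T33 : linrel X X) p q :
  let O := lr_zero X X in
  op_matrix A T11 T12 O T21 T22 O O O T33 p q <->
  (exists y1 y2, T11 (H (coord1 p)) (H y1) /\ T12 (coord2 p) (H y2) /\ coord1 q = y1 +v y2) /\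
  (exists a b, T21 (H (coord1 p)) a /\ T22 (coord2 p) b /\ coord2 q = a +v b) /\ T33 (coord3 p) (coord3 q).
Proof.
  intros O. destruct (H_blin HX HR) as (B & _ & HB).
  assert (H0 : H 0v = 0v) by apply (blin_zero HB).
  split.
  - intros ((y1 & y2 & y3 & R1 & R2 & R3 & E1) & (a & b & d & R4 & R5 & R6 & E2) &
      (e & f & g & R7 & R8 & R9 & E3)).
    simpl in R1, R2, R3, R4, R5, R6, R7, R8, R9. subst d e f.
    fold (coord2 p) in R2, R5. fold (coord3 p) in R9.
    rewrite incl_coord in R1, R4. rewrite incl_coord in R1, R2, R3.
    split; [|split].
    + exists (coord0 y1), (coord0 y2). split; [exact R1|split; [exact R2|]].
      unfold coord1. etransitivity; [exact (f_equal coord0 E1)|].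
      change (coord0 y1 +v coord0 y2 +v coord0 y3 = coord0 y1 +v coord0 y2).
      rewrite (halfpow_inj (coord0 y3) 0v) by now rewrite H0. vec.
    + exists a, b. split; [exact R4|split; [exact R5|]]. etransitivity; [exact E2|]. vec.
    + replace (coord3 q) with g by (symmetry; etransitivity; [exact E3|vec]). exact R9.
  - intros ((y1 & y2 & R1 & R2 & E1) & (a & b & R4 & R5 & E2) & R9). split; [|split].
    + exists (mkh y1), (mkh y2), 0v. split; [|split; [|split]].
      * simpl. rewrite incl_coord. exact R1.
      * exact R2.
      * reflexivity.
      * apply xhalf_ext. etransitivity; [exact E1|].
        change (y1 +v y2 = y1 +v y2 +v 0v). vec.
    + exists a, b, 0v. split; [|split; [|split]].
      * simpl. rewrite incl_coord. exact R4.
      * exact R5.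
      * reflexivity.
      * etransitivity; [exact E2|]. vec.
    + exists 0v, 0v, (coord3 q). split; [|split; [|split]].
      * reflexivity.
      * reflexivity.
      * exact R9.
      * change (coord3 q = 0v +v 0v +v coord3 q). vec.
Qed.

(** For p = (u, v, w), the vectors z, b and d are A u, A^(1/2) v and A^(1/2) w, so that only bounded
    operators remain. The coefficients of (z, b) form the unipotent matrix with rows (0, -1) and (1,
    2). *)
Lemma Lambda_iff p q : Lambda A p q <-> exists z b d, coord1 p = H z /\ coord2 p = H b /\ coord3 p = H d /\
  coord1 q = -v b /\ coord2 q = z +v RtoC 2 *v b /\ coord3 q = RtoC 2 *v d.
Proof.
  destruct (H_blin HX HR) as (B & _ & HB).
  assert (H0 : H 0v = 0v) by apply (blin_zero HB).
  unfold Lambda. etransitivity; [apply op_matrix_iff|]. split.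
  - intros ((y1 & y2 & R1 & (v & -> & R2) & E1) & (z & b2 & R3 & (b & R4 & ->) & E2) & (d & R5 & E3)).
    apply graph_halfpow, halfpow_inj in R3. apply frac_half_iff in R4, R5. simpl in R1.
    exists z, b, d. repeat (split; [assumption|]). split; [|split; assumption].
    rewrite E1. rewrite (halfpow_inj y1 0v) by now rewrite H0.
    rewrite (halfpow_inj y2 (-v b)); [vec|]. rewrite R2, R4, (blin_opp HB). vec.
  - intros (z & b & d & R1 & R2 & R3 & E1 & E2 & E3). split; [|split].
    + exists 0v, (-v b). split; [exact H0|]. split; [|rewrite E1; vec].
      exists (coord2 p). split; [reflexivity|]. rewrite R2, (blin_opp HB). vec.
    + exists z, (RtoC 2 *v b). split; [apply graph_halfpow; now rewrite R1|]. split; [|exact E2].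
      exists b. split; [now apply frac_half_iff|reflexivity].
    + exists d. split; [now apply frac_half_iff|exact E3].
Qed.
End PhaseSpace.

(** * The resolvent of Lambda *)

Section LambdaResolvent.
Context {X : cspace} {A : linrel X X} {M : R}.
Hypothesis HX : banach X.
Hypothesis HA : positive_with A M.
Hypothesis Hsv : single_valued A.

Local Notation H := (fpow (Rv A) (1 / 2)).
Local Notation S s := (hres (Psi := Rv A) s).

Let HR := positive_resfam HA.
Let K0 : 1 <= M := proj1 HA.

(** [lres1] and [lres2] are K (f + g) + S f and L (f + g) - S f: S^2 meets only the sum f + g,
    because the nilpotent part of the coefficient matrix depends on the sum alone. *)
Definition lres1 s (f g : X) : X := S s (f +v g) -v RtoC s *v S s (S s (f +v g)) +v S s f.
Definition lres2 s (f g : X) : X := RtoC s *v S s (S s (f +v g)) -v S s f.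
Definition lres3 s (h : X) : X := RtoC (/ 2) *v S (s / 2) h.
Definition lres (s : R) (q : phase_space A) : phase_space A :=
  mkp HX HA (lres1 s (coord1 q) (coord2 q)) (lres2 s (coord1 q) (coord2 q)) (lres3 s (coord3 q)).

Let S_bl s (Hs : 0 <= s) : blin (S s) (2 * M / (1 + s)) := hres_blin HX HR s Hs.
Let S_eq s y (Hs : 0 <= s) : S s y +v RtoC s *v H (S s y) = H y := hres_eq HX HR s y Hs.
Let SH_eq s y (Hs : 0 <= s) : RtoC s *v S s (H y) = H y -v S s y.
Proof. rewrite <- (H_hres HX HR s y), <- (S_eq s y Hs). vec. Qed.

Lemma lres_eq s p q : 0 <= s -> Lambda A p (q -v RtoC s *v p) -> p = lres s q.
Proof.
  intros Hs HL. apply (Lambda_iff HX HA Hsv) in HL.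
  destruct HL as (z & b & d & E1 & E2 & E3 & F1 & F2 & F3).
  rewrite (blin_minus coord1_blin), (blin_scal coord1_blin), E1 in F1.
  rewrite (blin_minus coord2_blin), (blin_scal coord2_blin), E2 in F2.
  rewrite (blin_minus coord3_blin), (blin_scal coord3_blin), E3 in F3.
  assert (G1 : coord1 q = RtoC s *v H z -v b).
  { transitivity (coord1 q -v RtoC s *v H z +v RtoC s *v H z); [vec|]. rewrite F1. vec. }
  assert (G2 : coord2 q = RtoC s *v H b +v z +v RtoC 2 *v b).
  { transitivity (coord2 q -v RtoC s *v H b +v RtoC s *v H b); [vec|]. rewrite F2. vec. }
  assert (G3 : coord3 q = RtoC s *v H d +v RtoC 2 *v d).
  { transitivity (coord3 q -v RtoC s *v H d +v RtoC s *v H d); [vec|]. rewrite F3. vec. }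
  pose proof (S_bl s Hs) as HS.
  assert (E : S s (coord1 q +v coord2 q) = H (z +v b)).
  { rewrite G1, G2. replace (RtoC s *v H z -v b +v (RtoC s *v H b +v z +v RtoC 2 *v b)) with
      (RtoC s *v H z +v RtoC s *v H b +v z +v b) by vec.
    destruct (H_blin HX HR) as (B & _ & HB).
    rewrite !(blin_plus HS), !(blin_scal HS), !SH_eq, (blin_plus HB) by exact Hs. vec. }
  assert (E' : S s (coord1 q) = H z -v S s z -v S s b).
  { rewrite G1, (blin_minus HS), (blin_scal HS), SH_eq by exact Hs. vec. }
  destruct (H_blin HX HR) as (B & _ & HB).
  apply (phase_ext HX HA).
  - rewrite E1. change (H z = lres1 s (coord1 q) (coord2 q)). unfold lres1. rewrite E, E', SH_eq by exact Hs.
    rewrite (blin_plus HB), (blin_plus HS). vec.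
  - rewrite E2. change (H b = lres2 s (coord1 q) (coord2 q)). unfold lres2. rewrite E, E', SH_eq by exact Hs.
    rewrite (blin_plus HB), (blin_plus HS). vec.
  - rewrite E3. change (H d = lres3 s (coord3 q)). unfold lres3. rewrite G3.
    assert (Hs2 : 0 <= s / 2) by lra. pose proof (S_bl _ Hs2) as HS2.
    replace (RtoC s *v H d +v RtoC 2 *v d) with (RtoC 2 *v (RtoC (s / 2) *v H d +v d)).
    2:{ replace (RtoC (s / 2)) with (RtoC s / RtoC 2)%C by (rewrite RtoC_div by lra; reflexivity). vec_coefs; field. }
    rewrite (blin_scal HS2), (blin_plus HS2), (blin_scal HS2), SH_eq by exact Hs2.
    rewrite RtoC_inv by lra. vec_coefs; field.
Qed.

Lemma lres_spec s q : 0 <= s -> Lambda A (lres s q) (q -v RtoC s *v lres s q).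
Proof.
  intros Hs. apply (Lambda_iff HX HA Hsv).
  pose proof (S_bl s Hs) as HS. destruct (H_blin HX HR) as (B & _ & HB).
  assert (Hs2 : 0 <= s / 2) by lra. pose proof (S_bl _ Hs2) as HS2.
  set (f := coord1 q). set (g := coord2 q). set (h := coord3 q).
  (* This is B S, expressed without the unbounded B. *)
  set (C := fun y => y -v RtoC s *v S s y).
  assert (HC : forall y, H (C y) = S s y).
  { intros y. unfold C. rewrite (blin_minus HB), (blin_scal HB), <- (S_eq s y Hs). vec. }
  (* The witnesses are B applied to the components of the solution: [z] by B S = C, [b] read off
     from the first row, and [d] by B S = 1 - (s / 2) S at the argument s / 2. *)
  set (z := C (C (f +v g) +v f)).
  set (b := RtoC s *v lres1 s f g -v f).
  set (d := RtoC (/ 2) *v (h -v RtoC (s / 2) *v S (s / 2) h)).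
  assert (E1 : lres1 s f g = H z).
  { unfold z. rewrite HC. unfold lres1, C. generalize (f +v g); intros w.
    rewrite (blin_plus HS), (blin_minus HS), (blin_scal HS). vec. }
  assert (E2 : lres2 s f g = H b).
  { unfold b, lres1, lres2. rewrite (blin_minus HB), (blin_scal HB), (blin_plus HB), (blin_minus HB), (blin_scal HB).
    rewrite <- (S_eq s f Hs).
    pose proof (S_eq s (S s (f +v g)) Hs) as Q.
    rewrite <- Q. vec. }
  assert (E3 : lres3 s h = H d).
  { unfold d, lres3. rewrite (blin_scal HB), (blin_minus HB), (blin_scal HB), <- (S_eq _ h Hs2). vec. }
  exists z, b, d. split; [exact E1|split; [exact E2|split; [exact E3|]]].
  rewrite (blin_minus coord1_blin), (blin_minus coord2_blin), (blin_minus coord3_blin),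
    (blin_scal coord1_blin), (blin_scal coord2_blin), (blin_scal coord3_blin).
  change (coord1 (lres s q)) with (lres1 s f g). change (coord2 (lres s q)) with (lres2 s f g).
  change (coord3 (lres s q)) with (lres3 s h). fold f g h.
  split; [|split].
  - unfold b. vec.
  - unfold z, b, C, lres1, lres2.
    assert (G : g = f +v g -v f) by vec. rewrite G at 1.
    generalize (f +v g); intros w. rewrite (blin_plus HS), (blin_minus HS), (blin_scal HS). vec.
  - unfold d, lres3. rewrite RtoC_inv, RtoC_div by lra. vec_coefs; field.
Qed.

(** Since s S(s) is bounded by [k], the terms s S^2 decay like S. The halved argument in [lres3]
    costs a factor 2, which the coefficient 1/2 absorbs. *)
Lemma lres_nrm : exists B, 1 <= B /\ forall s q, 0 <= s -> nrm (lres s q) <= B / (1 + s) * nrm q.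
Proof.
  destruct (phase_nrm HX HA) as (B & HB & HN).
  set (k := 2 * M). set (D := k * ((1 + k) * 2 + 1) + k * (2 * k + 1) + k).
  assert (HD : 0 <= D) by (unfold D, k; nra).
  exists (1 + B * D). split; [nra|]. intros s q Hs.
  assert (Hs2 : 0 <= s / 2) by lra.
  pose proof (blin_nrm (coord1_blin) q) as N1. pose proof (blin_nrm (coord2_blin) q) as N2.
  pose proof (blin_nrm (coord3_blin) q) as N3. rewrite Rmult_1_l in N1, N2, N3.
  set (f := coord1 q) in *. set (g := coord2 q) in *. set (h := coord3 q) in *. set (n := nrm q) in *.
  assert (Hn : 0 <= n) by apply nrm_ge0.
  set (r := k / (1 + s)).
  assert (Hr : 0 <= r) by (apply Rdiv_le_0_compat; unfold k; lra).
  assert (Hsr : s * r <= k).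
  { unfold r. apply Rmult_le_reg_r with (1 + s); [lra|].
    replace (s * (k / (1 + s)) * (1 + s)) with (s * k) by (field; lra). unfold k; nra. }
  assert (HS : forall y, nrm (S s y) <= r * nrm y) by apply (S_bl s Hs).
  pose proof (HS f) as Nf.
  pose proof (HS (f +v g)) as N4. pose proof (HS (S s (f +v g))) as N5.
  pose proof (nrm_tri f g) as N6.
  set (w := S s (f +v g)) in *.
  assert (Nw : nrm w <= r * (2 * n)).
  { eapply Rle_trans; [exact N4|]. apply Rmult_le_compat_l; lra. }
  assert (Nf' : nrm (S s f) <= r * n).
  { eapply Rle_trans; [exact Nf|]. apply Rmult_le_compat_l; lra. }
  assert (Nww : nrm (RtoC s *v S s w) <= k * (r * (2 * n))).
  { rewrite nrm_scal_eq, Cmod_R, Rabs_pos_eq by lra.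
    apply Rle_trans with (s * (r * nrm w)); [apply Rmult_le_compat_l; lra|].
    rewrite <- Rmult_assoc. apply Rmult_le_compat; auto; [nra|apply nrm_ge0]. }
  assert (M1 : nrm (lres1 s f g) <= r * ((1 + k) * 2 + 1) * n).
  { unfold lres1. fold w. eapply Rle_trans; [apply nrm_tri|].
    pose proof (nrm_tri_minus w (RtoC s *v S s w)). lra. }
  assert (M2 : nrm (lres2 s f g) <= r * (2 * k + 1) * n).
  { unfold lres2. fold w. eapply Rle_trans; [apply nrm_tri_minus|]. lra. }
  assert (M3 : nrm (lres3 s h) <= r * n).
  { unfold lres3. rewrite nrm_scal_eq, Cmod_R, Rabs_pos_eq by lra.
    pose proof (blin_nrm (S_bl _ Hs2) h) as Q. fold k in Q.
    assert (k / (1 + s / 2) <= 2 * r).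
    { unfold r. apply Rmult_le_reg_r with ((1 + s / 2) * (1 + s)); [nra|].
      replace (k / (1 + s / 2) * ((1 + s / 2) * (1 + s))) with (k * (1 + s)) by (field; lra).
      replace (2 * (k / (1 + s)) * ((1 + s / 2) * (1 + s))) with (k * (2 + s)) by (field; lra).
      apply Rmult_le_compat_l; unfold k; lra. }
    assert (k / (1 + s / 2) * nrm h <= 2 * r * n).
    { apply Rmult_le_compat; auto; [apply Rdiv_le_0_compat; unfold k; lra|apply nrm_ge0]. }
    lra. }
  eapply Rle_trans; [apply HN|].
  change (coord1 (lres s q)) with (lres1 s f g). change (coord2 (lres s q)) with (lres2 s f g).
  change (coord3 (lres s q)) with (lres3 s h).
  apply Rle_trans with (B * (D / (1 + s) * n)).
  - apply Rmult_le_compat_l; [lra|].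
    replace (D / (1 + s) * n) with (r * ((1 + k) * 2 + 1) * n + r * (2 * k + 1) * n + r * n)
      by (unfold r, D; field; lra). lra.
  - replace (B * (D / (1 + s) * n)) with (B * D * (n / (1 + s))) by (field; lra).
    replace ((1 + B * D) / (1 + s) * n) with ((1 + B * D) * (n / (1 + s))) by (field; lra).
    apply Rmult_le_compat_r; [apply Rdiv_le_0_compat; lra|lra].
Qed.

Lemma Lambda_res : exists B, 1 <= B /\ forall s, 0 <= s -> res_at (Lambda A) (RtoC s) (B / (1 + s)).
Proof.
  destruct lres_nrm as (B & HB & HN). exists B. split; [exact HB|]. intros s Hs. split.
  - intros q. exists (lres s q). now apply lres_spec.
  - intros p q HL. rewrite (lres_eq s p q Hs HL). now apply HN.
Qed.

Lemma Rv_Lambda s q : 0 <= s -> Rv (Lambda A) (RtoC s) q = lres s q.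
Proof.
  intros Hs. destruct Lambda_res as (B & _ & HB).
  apply (Rv_eq _ _ _ _ _ (HB s Hs)). now apply lres_spec.
Qed.

Lemma Lambda_single_valued : single_valued (Lambda A).
Proof.
  intros p q q' H1 H2. apply (Lambda_iff HX HA Hsv) in H1, H2.
  destruct H1 as (z & b & d & E1 & E2 & E3 & F1 & F2 & F3).
  destruct H2 as (z' & b' & d' & E1' & E2' & E3' & F1' & F2' & F3').
  rewrite E1 in E1'. rewrite E2 in E2'. rewrite E3 in E3'.
  apply (halfpow_inj HX HA Hsv) in E1', E2', E3'. subst.
  apply (phase_ext HX HA); congruence.
Qed.

(** In coordinates the domain is a product of ranges of A^(-1/2), and this range contains the dense
    range of A^(-1). *)
Lemma Lambda_dense : densely_defined A -> densely_defined (Lambda A).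
Proof.
  intros HD p eps. destruct (phase_nrm HX HA) as (B & HB & HN).
  assert (He : 0 < eps / (3 * B)) by (apply Rdiv_lt_0_compat; [apply cond_pos|lra]).
  assert (G : forall x : X, exists z, nrm (H z -v x) < eps / (3 * B)).
  { intros x. destruct (nrm_ball x _ He) as [e Hb]. destruct (HD x e) as (x' & (y & Hy) & Hx').
    apply (graph_halfpow HX HA) in Hy. exists (H y). rewrite <- Hy. auto. }
  destruct (G (coord1 p)) as [z Hz], (G (coord2 p)) as [b Hb], (G (coord3 p)) as [d Hd].
  exists (mkp HX HA (H z) (H b) (H d)). split.
  - exists (mkp HX HA (-v b) (z +v RtoC 2 *v b) (RtoC 2 *v d)). apply (Lambda_iff HX HA Hsv).
    exists z, b, d. repeat split; reflexivity.
  - apply ball_nrm. eapply Rle_lt_trans; [apply HN|].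
    rewrite (blin_minus coord1_blin), (blin_minus coord2_blin), (blin_minus coord3_blin).
    change (B * (nrm (H z -v coord1 p) + nrm (H b -v coord2 p) + nrm (H d -v coord3 p)) < eps).
    apply Rlt_le_trans with (B * (3 * (eps / (3 * B)))); [apply Rmult_lt_compat_l; lra|].
    right. field. lra.
Qed.

Lemma Lambda_positive : densely_defined A -> positive_op (Lambda A).
Proof.
  intros HD. destruct Lambda_res as (B & HB & HL).
  split; [exact Lambda_single_valued|split; [|split; [now apply Lambda_dense|]]].
  - apply closed_of_res with (B / (1 + 0)). apply HL. lra.
  - exists B. now apply positive_of_res.
Qed.
End LambdaResolvent.

(** * Fractional powers of Lambda *)

Section FpowSquare.
Context {V : cspace} {K : R} {Psi : C -> V -> V}.
Hypothesis HV : banach V.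
Hypothesis HR : resfam DR K Psi.

(* Integration by parts: the derivative of [Psi] along the half-line is [- Psi^2]. *)
Lemma fpow_square_int a y : 0 < a < 1 ->
  is_int (fun x => RtoC (fpow_coef a * exp ((1 - a) * x)) *v
      (RtoC (exp x) *v Psi (RtoC (exp x)) (Psi (RtoC (exp x)) y)))
    (RtoC (1 - a) *v fpow Psi a y).
Proof.
  intros Ha.
  pose proof (mel_byparts HR (1 - a) ltac:(lra) y (fun x _ => DR_pol x)) as I1.
  pose proof (int_minus _ _ _ _ (int_scal _ _ (RtoC (1 - a)) (fpow_int HV HR a y Ha))
    (int_scal _ _ (RtoC (fpow_coef a)) I1)) as I2.
  rewrite Cscal_zero_r in I2.
  replace (RtoC (1 - a) *v fpow Psi a y) with (RtoC (1 - a) *v fpow Psi a y -v 0v) by vec.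
  eapply int_ext; [|exact I2]. intros x. simpl. unfold melD, mel. rewrite ep_0, pol_0. vec.
Qed.

(** The resolvent of 2 B at s is S(s / 2) / 2; translating the logarithmic variable by - ln 2 brings
    out 2^(-a). *)
Lemma fpow_half_int a y : 0 < a < 1 ->
  is_int (fun x => RtoC (fpow_coef a * exp ((1 - a) * x)) *v
      (RtoC (/ 2) *v Psi (RtoC (exp x / 2)) y))
    (RtoC (Rpower 2 (- a)) *v fpow Psi a y).
Proof.
  intros Ha.
  pose proof (int_scal _ _ (RtoC (Rpower 2 (- a))) (int_shift _ _ (- ln 2) (fpow_int HV HR a y Ha))) as I.
  eapply int_ext; [|exact I]. intros x. simpl. unfold mel. rewrite ep_0, pol_0.
  replace (exp (x + - ln 2)) with (exp x / 2).
  2:{ rewrite exp_plus, exp_Ropp, exp_ln by lra. reflexivity. }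
  replace (exp ((1 - a) * (x + - ln 2))) with (exp ((1 - a) * x) * (/ 2 * exp (a * ln 2))).
  2:{ replace ((1 - a) * (x + - ln 2)) with ((1 - a) * x + (- ln 2 + a * ln 2)) by ring.
      rewrite !exp_plus, exp_Ropp, exp_ln by lra. reflexivity. }
  unfold Rpower. rewrite !Cscal_assoc. apply (f_equal2 (fun c v => c *v v)); [|reflexivity].
  change (RtoC (exp (- a * ln 2)) * RtoC (fpow_coef a) * RtoC (exp ((1 - a) * x) * (/ 2 * exp (a * ln 2)))
    = RtoC (fpow_coef a * exp ((1 - a) * x)) * RtoC (/ 2))%C.
  rewrite <- !RtoC_mult. f_equal.
  assert (E : exp (- a * ln 2) * exp (a * ln 2) = 1).
  { rewrite <- exp_plus. replace (- a * ln 2 + a * ln 2) with 0 by ring. apply exp_0. }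
  replace (exp (- a * ln 2) * fpow_coef a * (exp ((1 - a) * x) * (/ 2 * exp (a * ln 2)))) with
    (fpow_coef a * exp ((1 - a) * x) * / 2 * (exp (- a * ln 2) * exp (a * ln 2))) by ring.
  rewrite E. ring.
Qed.
End FpowSquare.

Section LambdaPower.
Context {X : cspace} {A : linrel X X} {M : R}.
Hypothesis HX : banach X.
Hypothesis HA : positive_with A M.
Hypothesis Hsv : single_valued A.

Let HR := positive_resfam HA.
Let Hinj := positive_inj HA Hsv.
Let HS := hres_resfam HX HR Hinj.

(** The coordinate maps are bounded and pass through the integral, which reduces the power of
    [Lambda] to three integrals in X: of S, of s S^2 and of S(s / 2). *)
Lemma neg_power_Lambda al q p : 0 < al < 1 ->
  neg_power (Lambda A) al q p <->
  let Q := fpow (Rv A) (al / 2) in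
  coord1 p = RtoC (1 + al) *v Q (coord1 q) +v RtoC al *v Q (coord2 q) /\
  coord2 p = RtoC (- al) *v Q (coord1 q) +v RtoC (1 - al) *v Q (coord2 q) /\
  coord3 p = RtoC (Rpower 2 (- al)) *v Q (coord3 q).
Proof.
  intros Hal. set (Q := fpow (Rv A) (al / 2)). cbv zeta.
  destruct (Lambda_res HX HA Hsv) as (B & HB & HL).
  pose proof (positive_of_res _ _ HB HL) as HP.
  pose proof (banach_phase_space HX HA) as HE.
  rewrite (neg_power_iff HE HP al q p Hal).
  set (p' := fpow (Rv (Lambda A)) al q).
  pose proof (fpow_int HE (positive_resfam HP) al q Hal) as I. fold p' in I.
  set (f := coord1 q). set (g := coord2 q). set (h := coord3 q).
  assert (EQ : forall y, fpow (fun lam => hres (Psi := Rv A) (fst lam)) al y = Q y).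
  { intros y. apply (fpow_hres HX HR Hinj al Hal). }
  assert (IQ : forall y, is_int (fun x => RtoC (fpow_coef al) *v
    (RtoC (exp ((1 - al) * x)) *v hres (Psi := Rv A) (exp x) y)) (Q y)).
  { intros y. rewrite <- EQ. eapply int_ext; [|exact (fpow_int HX HS al y Hal)].
    intros x. simpl. unfold mel. now rewrite ep_0, pol_0. }
  pose proof (fun y => fpow_square_int HX HS al y Hal) as IS. simpl in IS.
  pose proof (fpow_half_int HX HS al h Hal) as IH. simpl in IH.
  assert (EI : forall (c : phase_space A -> X) (r : R -> X), blin c 1 ->
    (forall s, 0 <= s -> c (lres HX HA s q) = r s) ->
    is_int (fun x => RtoC (fpow_coef al) *v (RtoC (exp ((1 - al) * x)) *v r (exp x))) (c p')).
  { intros c r Hc Hr. eapply int_ext; [|exact (int_blin Hc _ _ I)].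
    intros x. simpl. unfold mel. rewrite ep_0, pol_0, !(blin_scal Hc).
    pose proof (exp_pos x).
    rewrite (Rv_Lambda HX HA Hsv) by lra. now rewrite Hr by lra. }
  pose proof (fpow_blin HX HR (al / 2) ltac:(lra)) as (BQ & _ & HQ). fold Q in HQ.
  assert (F1 : coord1 p' = RtoC (1 + al) *v Q f +v RtoC al *v Q g).
  { eapply int_unique; [exact (EI coord1 (fun s => lres1 (A := A) s f g) coord1_blin (fun _ _ => eq_refl))|].
    replace (RtoC (1 + al) *v Q f +v RtoC al *v Q g) with
      (Q (f +v g) -v RtoC (1 - al) *v Q (f +v g) +v Q f) by (rewrite (blin_plus HQ); vec).
    specialize (IS (f +v g)). rewrite EQ in IS.
    eapply int_ext; [|exact (int_plus _ _ _ _ (int_minus _ _ _ _ (IQ (f +v g)) IS) (IQ f))].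
    intros x. simpl. unfold lres1. vec. }
  assert (F2 : coord2 p' = RtoC (- al) *v Q f +v RtoC (1 - al) *v Q g).
  { eapply int_unique; [exact (EI coord2 (fun s => lres2 (A := A) s f g) coord2_blin (fun _ _ => eq_refl))|].
    replace (RtoC (- al) *v Q f +v RtoC (1 - al) *v Q g) with
      (RtoC (1 - al) *v Q (f +v g) -v Q f) by (rewrite (blin_plus HQ); vec).
    specialize (IS (f +v g)). rewrite EQ in IS.
    eapply int_ext; [|exact (int_minus _ _ _ _ IS (IQ f))].
    intros x. simpl. unfold lres2. vec. }
  assert (F3 : coord3 p' = RtoC (Rpower 2 (- al)) *v Q h).
  { eapply int_unique; [exact (EI coord3 (fun s => lres3 (A := A) s h) coord3_blin (fun _ _ => eq_refl))|].
    rewrite EQ in IH. eapply int_ext; [|exact IH].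
    intros x. simpl. unfold lres3. vec. }
  split.
  - intros ->. auto.
  - intros (E1 & E2 & E3). apply (phase_ext HX HA); congruence.
Qed.
End LambdaPower.

Lemma neg_power_bounded {V : cspace} (A : linrel V V) M a : banach V -> positive_with A M ->
  0 < a < 1 -> bounded_op (neg_power A a).
Proof.
  intros HV HA Ha. destruct (fpow_blin HV (positive_resfam HA) a Ha) as (B & _ & HB).
  split; [|split].
  - intros y x x' H H'. apply (neg_power_iff HV HA a y _ Ha) in H, H'. congruence.
  - intros y. exists (fpow (Rv A) a y). now apply (neg_power_iff HV HA a y _ Ha).
  - exists B. intros y x H. apply (neg_power_iff HV HA a y x Ha) in H. subst. apply (blin_nrm HB).
Qed.
Lemma bounded_op_ext {V W : cspace} (T T' : linrel V W) : eq_op T T' -> bounded_op T -> bounded_op T'.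
Proof.
  intros E (H1 & H2 & B & H3). split; [|split].
  - intros x y y' Hy Hy'. apply E in Hy, Hy'. eauto.
  - intros x. destruct (H2 x) as [y Hy]. exists y. now apply E.
  - exists B. intros x y Hy. apply E in Hy. auto.
Qed.

(** * The operator matrices in coordinates *)

Section Matrices.
Context {X : cspace} {A : linrel X X} {M : R}.
Hypothesis HX : banach X.
Hypothesis HA : positive_with A M.
Hypothesis Hsv : single_valued A.
Variable al : R.
Hypothesis Hal : 0 < al < 1.

Let HR := positive_resfam HA.
Let Hinj := positive_inj HA Hsv.
Local Notation H := (fpow (Rv A) (1 / 2)).
Local Notation Q := (fpow (Rv A) (al / 2)).

Let neg_iff a y x : 0 < a < 1 -> neg_power A a y x <-> x = fpow (Rv A) a y.
Proof. apply (neg_power_iff HX HA). Qed.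
Let frac_iff a x y : 0 < a < 1 -> frac_power A a x y <-> x = fpow (Rv A) a y.
Proof. apply (neg_power_iff HX HA). Qed.

Let P_plus y : fpow (Rv A) ((1 + al) / 2) y = H (Q y).
Proof. rewrite (fpow_add HX HR Hinj) by lra. f_equal. lra. Qed.
Let Q_H y : Q (H y) = H (Q y).
Proof. rewrite !(fpow_add HX HR Hinj) by lra. f_equal. lra. Qed.
Let P_minus_Q y : fpow (Rv A) ((1 - al) / 2) (Q y) = H y.
Proof. rewrite (fpow_add HX HR Hinj) by lra. f_equal. lra. Qed.

(** The entry with the positive power is defined on all of X^(1/2): A^(-1/2) = A^(-(1 - al)/2) Q
    gives A^((1 - al)/2) A^(-1/2) = Q. Likewise H commutes with Q, so the first row takes values in
    X^(1/2). *)
Lemma neg_power_matrix q p :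
  let O := lr_zero X X in
  op_matrix A
    ((1 + al) *: neg_power A (al / 2)) (al *: neg_power A ((1 + al) / 2)) O
    ((- al) *: frac_power A ((1 - al) / 2)) ((1 - al) *: neg_power A (al / 2)) O
    O O (Rpower 2 (- al) *: neg_power A (al / 2)) q p <->
  coord1 p = RtoC (1 + al) *v Q (coord1 q) +v RtoC al *v Q (coord2 q) /\
  coord2 p = RtoC (- al) *v Q (coord1 q) +v RtoC (1 - al) *v Q (coord2 q) /\
  coord3 p = RtoC (Rpower 2 (- al)) *v Q (coord3 q).
Proof.
  intros O. unfold O. rewrite (op_matrix_iff HX HA Hsv).
  destruct (H_blin HX HR) as (B & _ & HB).
  split.
  - intros ((y1 & y2 & (x1 & R1 & S1) & (x2 & R2 & S2) & E1) &
      (? & ? & (x3 & R3 & ->) & (x4 & R4 & ->) & E2) & (x5 & R5 & E3)).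
    apply neg_iff in R1, R2, R4, R5; try lra. apply frac_iff in R3; [|lra].
    rewrite <- (P_minus_Q (coord1 q)) in R3. apply (fpow_inj HX HR Hinj) in R3; [|lra].
    rewrite R1, Q_H, <- (blin_scal HB) in S1. apply (halfpow_inj HX HA Hsv) in S1.
    rewrite R2, P_plus, <- (blin_scal HB) in S2. apply (halfpow_inj HX HA Hsv) in S2.
    rewrite E1, E2, E3, S1, S2, <- R3, R4, R5.
    split; [vec|split; [vec|reflexivity]].
  - intros (E1 & E2 & E3). split; [|split].
    + exists (RtoC (1 + al) *v Q (coord1 q)), (RtoC al *v Q (coord2 q)). split; [|split; [|exact E1]].
      * exists (Q (H (coord1 q))). split; [apply neg_iff; [lra|reflexivity]|].
        rewrite Q_H, (blin_scal HB). vec.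
      * exists (H (Q (coord2 q))). split; [apply neg_iff; [lra|now rewrite P_plus]|].
        now rewrite (blin_scal HB).
    + exists (RtoC (- al) *v Q (coord1 q)), (RtoC (1 - al) *v Q (coord2 q)). split; [|split; [|exact E2]].
      * exists (Q (coord1 q)). split; [apply frac_iff; [lra|now rewrite P_minus_Q]|]. vec.
      * exists (Q (coord2 q)). split; [apply neg_iff; [lra|reflexivity]|]. vec.
    + exists (Q (coord3 q)). split; [apply neg_iff; [lra|reflexivity]|]. exact E3.
Qed.

(** Here m = A^((1 + al)/2) u, n = A^(al/2) v and d = A^(al/2) w. The entry A^((1 + al)/2) decides
    the domain in u, since then A^(al/2) u = A^(-1/2) m lies in X^(1/2) as the first row demands. *)
Lemma frac_power_matrix p q :
  let O := lr_zero X X in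
  op_matrix A
    ((1 - al) *: frac_power A (al / 2)) ((- al) *: neg_power A ((1 - al) / 2)) O
    (al *: frac_power A ((1 + al) / 2)) ((1 + al) *: frac_power A (al / 2)) O
    O O (Rpower 2 al *: frac_power A (al / 2)) p q <->
  exists m n d, coord1 p = Q m /\ coord2 p = Q n /\ coord3 p = Q d /\
    coord1 q = RtoC (1 - al) *v m +v RtoC (- al) *v n /\
    coord2 q = RtoC al *v m +v RtoC (1 + al) *v n /\
    coord3 q = RtoC (Rpower 2 al) *v d.
Proof.
  intros O. unfold O. rewrite (op_matrix_iff HX HA Hsv).
  destruct (H_blin HX HR) as (B & _ & HB).
  split.
  - intros ((y1 & y2 & (x1 & R1 & S1) & (x2 & R2 & S2) & E1) &
      (? & ? & (m & R3 & ->) & (n & R4 & ->) & E2) & (d & R5 & E3)).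
    apply neg_iff in R2; [|lra]. apply frac_iff in R1, R3, R4, R5; try lra.
    rewrite R4, P_minus_Q in R2.
    rewrite P_plus in R3. pose proof R3 as R6. apply (halfpow_inj HX HA Hsv) in R6.
    rewrite R3, <- Q_H in R1. apply (fpow_inj HX HR Hinj) in R1; [|lra].
    rewrite <- R1, <- (blin_scal HB) in S1. apply (halfpow_inj HX HA Hsv) in S1.
    rewrite R2, <- (blin_scal HB) in S2. apply (halfpow_inj HX HA Hsv) in S2.
    exists m, n, d. do 3 (split; [assumption|]). split; [|split; [|exact E3]].
    + rewrite E1, S1, S2. vec.
    + rewrite E2. vec.
  - intros (m & n & d & R1 & R2 & R3 & E1 & E2 & E3). split; [|split].
    + exists (RtoC (1 - al) *v m), (RtoC (- al) *v n). split; [|split; [|exact E1]].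
      * exists (H m). split; [apply frac_iff; [lra|now rewrite R1, Q_H]|].
        rewrite (blin_scal HB). vec.
      * exists (H n). split; [apply neg_iff; [lra|now rewrite R2, P_minus_Q]|].
        rewrite (blin_scal HB). vec.
    + exists (RtoC al *v m), (RtoC (1 + al) *v n). split; [|split; [|exact E2]].
      * exists m. split; [apply frac_iff; [lra|now rewrite R1, P_plus]|]. reflexivity.
      * exists n. split; [apply frac_iff; [lra|exact R2]|]. vec.
    + exists d. split; [apply frac_iff; [lra|exact R3]|]. exact E3.
Qed.

(** The coefficient matrix of the negative power has determinant (1 + al) (1 - al) + al^2 = 1, so
    its inverse has the rows (1 - al, - al) and (al, 1 + al). *)
Lemma frac_power_Lambda p q : frac_power (Lambda A) al p q <->
  exists m n d, coord1 p = Q m /\ coord2 p = Q n /\ coord3 p = Q d /\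
    coord1 q = RtoC (1 - al) *v m +v RtoC (- al) *v n /\
    coord2 q = RtoC al *v m +v RtoC (1 + al) *v n /\
    coord3 q = RtoC (Rpower 2 al) *v d.
Proof.
  destruct (fpow_blin HX HR (al / 2) ltac:(lra)) as (B & _ & HB).
  assert (E2 : Rpower 2 (- al) * Rpower 2 al = 1).
  { rewrite <- Rpower_plus. replace (- al + al) with 0 by ring. apply Rpower_O; lra. }
  etransitivity; [apply (neg_power_Lambda HX HA Hsv al q p Hal)|]. cbv zeta. split.
  - intros (E & F & G).
    exists (RtoC (1 + al) *v coord1 q +v RtoC al *v coord2 q),
      (RtoC (- al) *v coord1 q +v RtoC (1 - al) *v coord2 q), (RtoC (Rpower 2 (- al)) *v coord3 q).
    rewrite !(blin_plus HB), !(blin_scal HB).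
    do 3 (split; [assumption|]). split; [vec|split; [vec|]].
    rewrite Rmult_comm in E2. apply (f_equal RtoC) in E2. rewrite RtoC_mult in E2.
    rewrite Cscal_assoc. change (coord3 q = (RtoC (Rpower 2 al) * RtoC (Rpower 2 (- al)))%C *v coord3 q).
    rewrite E2. vec.
  - intros (m & n & d & R1 & R2 & R3 & E & F & G). rewrite E, F, G, R1, R2, R3.
    rewrite !(blin_plus HB), !(blin_scal HB). split; [vec|split; [vec|]].
    apply (f_equal RtoC) in E2. rewrite RtoC_mult in E2.
    rewrite Cscal_assoc. change (Q d = (RtoC (Rpower 2 (- al)) * RtoC (Rpower 2 al))%C *v Q d).
    rewrite E2. vec.
Qed.

Lemma dom_frac_power_Lambda u v w :
  (exists p : phase_space A, dom (frac_power (Lambda A) al) p /\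
     incl _ (fst p) = u /\ fst (snd p) = v /\ snd (snd p) = w) <->
  dom (frac_power A ((1 + al) / 2)) u /\ dom (frac_power A (al / 2)) v /\
  dom (frac_power A (al / 2)) w.
Proof.
  split.
  - intros (p & (q & Hq) & <- & <- & <-). apply frac_power_Lambda in Hq.
    destruct Hq as (m & n & d & R1 & R2 & R3 & _). split; [|split].
    + exists m. apply frac_iff; [lra|]. rewrite P_plus, (incl_coord HX HA).
      change (H (coord1 p) = H (Q m)). now rewrite R1.
    + exists n. apply frac_iff; [lra|]. exact R2.
    + exists d. apply frac_iff; [lra|]. exact R3.
  - intros ((m & Hm) & (n & Hn) & (d & Hd)). apply frac_iff in Hm, Hn, Hd; try lra.
    exists (mkp HX HA (Q m) v w). split; [|split; [|split; reflexivity]].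
    + exists (mkp HX HA (RtoC (1 - al) *v m +v RtoC (- al) *v n)
        (RtoC al *v m +v RtoC (1 + al) *v n) (RtoC (Rpower 2 al) *v d)).
      apply frac_power_Lambda. exists m, n, d. repeat (split; [first [reflexivity|assumption]|]).
      reflexivity.
    + rewrite Hm, P_plus. reflexivity.
Qed.
End Matrices.

Theorem theorem3p7 (X : CompleteNormedModule C_AbsRing) (A : linrel X X)
  (HA : positive_op A) :
  positive_op (Lambda A) /\
  forall alpha : R, 0 < alpha < 1 ->
    let O := lr_zero X X in
    let N := op_matrix A
      ((1 + alpha) *: neg_power A (alpha / 2))
        (alpha *: neg_power A ((1 + alpha) / 2)) O
      ((- alpha) *: frac_power A ((1 - alpha) / 2))
        ((1 - alpha) *: neg_power A (alpha / 2)) O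
      O O (Rpower 2 (- alpha) *: neg_power A (alpha / 2)) in
    let P := op_matrix A
      ((1 - alpha) *: frac_power A (alpha / 2))
        ((- alpha) *: neg_power A ((1 - alpha) / 2)) O
      (alpha *: frac_power A ((1 + alpha) / 2))
        ((1 + alpha) *: frac_power A (alpha / 2)) O
      O O (Rpower 2 alpha *: frac_power A (alpha / 2)) in
    (eq_op (neg_power (Lambda A) alpha) N /\ bounded_op N) /\
    eq_op (frac_power (Lambda A) alpha) P /\
    (forall u v w : X,
       (exists p : phase_space A, dom (frac_power (Lambda A) alpha) p /\
          incl _ (fst p) = u /\ fst (snd p) = v /\ snd (snd p) = w) <->
       dom (frac_power A ((1 + alpha) / 2)) u /\
       dom (frac_power A (alpha / 2)) v /\
       dom (frac_power A (alpha / 2)) w).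

Proof.
  destruct HA as (Hsv & _ & Hd & M & HM).
  pose proof (banach_complete X) as HX.
  split; [exact (Lambda_positive HX HM Hsv Hd)|].
  intros alpha Hal O N P.
  assert (HN : eq_op (neg_power (Lambda A) alpha) N).
  { intros q p. rewrite (neg_power_Lambda HX HM Hsv alpha q p Hal).
    symmetry. apply (neg_power_matrix HX HM Hsv alpha Hal). }
  destruct (Lambda_res HX HM Hsv) as (B & HB & HL).
  split; [split; [exact HN|]|split].
  - apply (bounded_op_ext _ _ HN).
    exact (neg_power_bounded _ B alpha (banach_phase_space HX HM) (positive_of_res _ B HB HL) Hal).
  - intros p q. rewrite (frac_power_Lambda HX HM Hsv alpha Hal p q).
    symmetry. apply (frac_power_matrix HX HM Hsv alpha Hal).
  - exact (dom_frac_power_Lambda HX HM Hsv alpha Hal).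
Qed.
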